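(* Let $n\ge1$, $\alpha\in[0,n)$, and let $V$ be a finite positive measure on $\mathbb{R}^n$ absolutely continuous with respect to Lebesgue measure. Suppose $\Omega$ is a homogeneous function of degree zero on $\mathbb{R}^n\setminus\{0\}$ satisfying the $L^1_{\alpha}$-Dini condition, and, when $\alpha=0$, $\int_{\mathbb{S}^{n-1}}\Omega\,d\sigma=0$. If $T^{\alpha}_{\Omega}$ is bounded from $L^1(\mathbb{R}^n)$ to $L^{\frac{n}{n-\alpha},\infty}(\mathbb{R}^n)$, then: (1) $\frac{\Omega(x)}{|x|^{n-\alpha}}\in L^{\frac{n}{n-\alpha},\infty}$ and $\big\|\frac{\Omega(\cdot)}{|\cdot|^{n-\alpha}}\big\|_{L^{\frac{n}{n-\alpha},\infty}}\le C\|T^{\alpha}_{\Omega}\|_{L^1\to L^{\frac{n}{n-\alpha},\infty}}$; (2) $\Omega\in L^{\frac{n}{n-\alpha}}(\mathbb{S}^{n-1})$ and $\|\Omega\|_{L^{\frac{n}{n-\alpha}}(\mathbb{S}^{n-1})}\le C\|T^{\alpha}_{\Omega}\|_{L^1\to L^{\frac{n}{n-\alpha},\infty}}$; (3) for every $\lambda>0$, $$\lim_{t\to0^+}\Big|\Big\{x\in\mathbb{R}^n:\Big|T^{\alpha}_{\Omega}(V_t)(x)-\frac{\Omega(x)}{|x|^{n-\alpha}}V(\mathbb{R}^n)\Big|>\lambda\Big\}\Big|=0,$$ where $C$ depends only on $n,\alpha$.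
   Context: $\Omega$ homogeneous of degree zero: $\Omega(sx)=\Omega(x)$ for $s>0$, $x\ne0$. For $1\le q<\infty$, $0\le s<n$, the $L^q_s$-Dini condition means $\Omega\in L^q(\mathbb{S}^{n-1})$ and $\int_0^1\frac{\omega_q(t)}{t^{1+s}}dt<\infty$, with $\omega_q(t)=\big(\sup_{|h|\le t}\int_{\mathbb{S}^{n-1}}|\Omega(x'+h)-\Omega(x')|^q d\sigma(x')\big)^{1/q}$. For a measure (or function, via $d\mu=f\,dy$) $\mu$, $T^{\alpha}_{\Omega}\mu(x)=\int_{\mathbb{R}^n}\frac{\Omega(x-y)}{|x-y|^{n-\alpha}}d\mu(y)$, understood as a principal value when $\alpha=0$. $V_t(E)=V(E/t)$ with $E/t=\{x/t:x\in E\}$. $L^{p,\infty}$ is weak $L^p$. *)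

(* Defs.v *)
(* R^n is modelled as n.-tuple R. *)
From HB Require Import structures.
From mathcomp Require Import all_boot all_order all_algebra.
From mathcomp Require Import all_classical all_reals all_analysis.
Set Implicit Arguments. Unset Strict Implicit. Unset Printing Implicit Defensive.
Import Order.TTheory GRing.Theory Num.Theory.
Local Open Scope classical_set_scope.
Local Open Scope ring_scope.

(* n.-tuple R carries (via mathcomp-analysis) the product Borel sigma-algebra;
   we only add the (trivial) pointed structure needed for Caratheodory. *)
HB.instance Definition _ (R : realType) (n : nat) :=
  isPointed.Build (n.-tuple R) (nseq_tuple n 0).

Section euclidean.
Context {R : realType} {n : nat}.
Implicit Types (x y : n.-tuple R) (c : R).

Definition vzero : n.-tuple R := [tuple (0 : R) | i < n].
Definition vadd x y : n.-tuple R := [tuple tnth x i + tnth y i | i < n].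
Definition vsub x y : n.-tuple R := [tuple tnth x i - tnth y i | i < n].
Definition vscale c x : n.-tuple R := [tuple c * tnth x i | i < n].
(* Euclidean norm |x| *)
Definition vnorm x : R := Num.sqrt (\sum_(i < n) tnth x i ^+ 2).
(* half-open box ]a,b] *)
Definition box (a b : n.-tuple R) : set (n.-tuple R) :=
  [set x | forall i, tnth a i < tnth x i <= tnth b i].
End euclidean.

(* [leb] is the n-dimensional Lebesgue measure on Borel sets: a measure giving
   every box its volume (this determines it uniquely). *)
Definition is_lebesgue_borel (R : realType) (n : nat)
    (leb : {measure set (n.-tuple R) -> \bar R}) : Prop :=
  forall a b : n.-tuple R, (forall i, tnth a i <= tnth b i) ->
    leb (box a b) = (\prod_(i < n) (tnth b i - tnth a i))%:E.

Unset Implicit Arguments.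
Section lebesgue_objects.
Context {R : realType} {n : nat} (leb : {measure set (n.-tuple R) -> \bar R}).

(* R^n with the Lebesgue (Caratheodory-complete) sigma-algebra and the
   Lebesgue measure |.| on it (completion of leb). *)
Definition Rn : measurableType _ := caratheodory_type (leb^*)%mu.
Definition Leb : {measure set Rn -> \bar R} :=
  @completed_measure_extension _ _ _ leb.

Local Open Scope ereal_scope.

(* integral over the unit sphere w.r.t. surface measure sigma, via the cone
   definition sigma(E) = n |{r x' : x' in E, 0 < r <= 1}|, i.e.
   int_S g dsigma = n * int_{0<|x|<=1} g(x/|x|) dx *)
Definition sph_int (g : n.-tuple R -> \bar R) : \bar R :=
  n%:R%:E * \int[Leb]_(x in [set x : Rn | (0 < vnorm x <= 1)%R])
               g (vscale (vnorm x)^-1 x).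

(* L^1 modulus of continuity omega_1(t) *)
Definition omega1 (Om : n.-tuple R -> R) (t : R) : \bar R :=
  ereal_sup [set sph_int (fun x => (`|Om (vadd x h) - Om x|)%:E)
            | h in [set h : n.-tuple R | (vnorm h <= t)%R]].

(* L^1_s-Dini condition *)
Definition L1_Dini (s : R) (Om : n.-tuple R -> R) : Prop :=
  sph_int (fun x => (`|Om x|)%:E) < +oo /\
  \int[lebesgue_measure]_(t in `]0%R, 1%R]%classic)
     (omega1 Om t * ((t `^ (1 + s))^-1)%:E) < +oo.

(* kernel Om(x)/|x|^(n-alpha) *)
Definition kern (Om : n.-tuple R -> R) (a : R) (x : n.-tuple R) : R :=
  (Om x / vnorm x `^ (n%:R - a))%R.

(* truncated operators, for a measure mu and for a function f (d mu = f dy) *)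
Definition Ttr_meas (mu : set Rn -> \bar R) Om a (eps : R) (x : Rn) : \bar R :=
  \int[mu]_(y in [set y : Rn | (eps < vnorm (vsub x y))%R])
     (kern Om a (vsub x y))%:E.
Definition Ttr_fun (f : Rn -> R) Om a (eps : R) (x : Rn) : \bar R :=
  \int[Leb]_(y in [set y : Rn | (eps < vnorm (vsub x y))%R])
     (kern Om a (vsub x y) * f y)%:E.

(* T^alpha_Omega: principal value when alpha = 0, plain integral otherwise *)
Definition T_meas (mu : set Rn -> \bar R) Om a (x : Rn) : \bar R :=
  if a == 0%R then lim ((fun eps => Ttr_meas mu Om a eps x) @ 0^'+)
  else Ttr_meas mu Om a 0 x.
Definition T_fun (f : Rn -> R) Om a (x : Rn) : \bar R :=
  if a == 0%R then lim ((fun eps => Ttr_fun f Om a eps x) @ 0^'+)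
  else Ttr_fun f Om a 0 x.

(* weak L^p quasi-norm  sup_{lambda>0} lambda |{|g|>lambda}|^(1/p) *)
Definition wknorm (p : R) (g : Rn -> \bar R) : \bar R :=
  ereal_sup [set l%:E * (Leb [set x | l%:E < `|g x|]) `^ p^-1
            | l in [set l : R | (0 < l)%R]].

Definition L1norm (f : Rn -> R) : \bar R := \int[Leb]_x (`|f x|)%:E.

(* A is an admissible constant for T : L^1 -> L^{n/(n-alpha),oo} *)
Definition T_bound Om a (A : R) : Prop :=
  forall f : Rn -> R, measurable_fun setT f -> L1norm f < +oo ->
    wknorm (n%:R / (n%:R - a)) (T_fun f Om a) <= A%:E * L1norm f.

(* operator norm ||T||_{L^1 -> L^{n/(n-alpha),oo}} *)
Definition T_opnorm Om a : \bar R := ereal_inf [set A%:E | A in T_bound Om a].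

(* dilation V_t(E) = V(E/t) *)
Definition dil (V : set Rn -> \bar R) (t : R) : set Rn -> \bar R :=
  pushforward V (vscale t : Rn -> Rn).

End lebesgue_objects.

(* Main.v *)
Require Import Defs.
From HB Require Import structures.
From mathcomp Require Import all_boot all_order all_algebra.
From mathcomp Require Import all_classical all_reals all_analysis.
From mathcomp Require Import measurable_realfun.
From mathcomp Require Import ring lra zify.
Import Order.TTheory GRing.Theory Num.Theory.
Import numFieldTopology.Exports numFieldNormedType.Exports.
Set Implicit Arguments. Unset Strict Implicit. Unset Printing Implicit Defensive.
Local Open Scope classical_set_scope.
Local Open Scope ring_scope.

(* Write K(x) = Om(x)/|x|^(n-a), b = n - a and p = n/b. By homogeneity
   |{|K| > s}| = s^-p |{|K| > 1}|, so (1) amounts to bounding M = |{|K| > 1}|.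
   If h is integrable and supported in a ball, then far from that ball T h - K int h
   is the sum of a function whose integral is small (Dini condition) and of a small multiple
   of |K| int |h|. Multiplying the weak type bound for T h by s^p and letting s -> 0, with h the
   indicator of the unit ball, gives M <= (2A)^p.
   For (2), cut F = |Om|^p into dyadic levels; each level is a cone, hence a dilation turns its
   mass in the unit ball into the mass of a piece of {|x|^n < F} = {|K| > 1}, and the pieces are disjoint.
   For (3), V = f dx and T(V_t)(t z) = t^-b T f(z), so the measure in question is a multiple of
   s^p |{|T f - K int f| > s}| with s = lambda t^b; split f = h + w, h of bounded support and w small in L^1.
   When a = 0, additivity of T requires the almost everywhere existence of principal values. This follows
   from a maximal inequality for step functions constant on the cells of a grid (stopping cubes for the
   bad part, Cotlar's inequality and the given weak bound for the good part) and from their density in L^1. *)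

(* The stock [done] calls [discriminate], which head-normalises every equation of the context;
   on equations between integrals this does not terminate in practice. *)
Ltac done ::=
  trivial; hnf; intros;
  solve [ do ![ solve [ trivial | simple refine (@sym_equal _ _ _ _); trivial ]
              | match goal with
                | H : @eq bool true false |- _ => discriminate H
                | H : @eq bool false true |- _ => discriminate H
                | H : is_true false |- _ => discriminate H
                | H : is_true (~~ true) |- _ => discriminate H
                | H : is_true (leq (S _) O) |- _ => discriminate H
                end
              | contradiction | split ]
        | match goal with H : ~ _ |- _ => solve [ case H; trivial ] end ].

(** Three obstacles shape the proof. [Om] is only Lebesgue measurable, and its modulus leaves the
    sphere: by homogeneity [Om (x / |x| + h)] is [Om (x + |x| h)], a displacement that is affine in
    [h] but not in [x], while the behaviour of Lebesgue measure is established for affine maps. So a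
    Borel version [OB] is carried along, the modulus is compared with it for almost every [h], and
    an average over [h] recovers every translation. Next, [T] is not additive as defined: for
    [alpha = 0] it is a [lim], unspecified where the limit fails, otherwise an integral that may be
    infinite. (1) and (2) evaluate [T] only far from a support, where it is a plain integral; the
    splitting in (3) needs genuine values almost everywhere. Finally no L^2 bound is at hand. The
    Calderon-Zygmund scheme runs on the assumed weak bound alone, applied to functions constant on
    grid cells: the mean zero kernel makes their truncations eventually constant off the cell faces.
    Bounds are shown for every admissible [A], the infimum is taken last. The factor 2 in [2 * A]
    comes from comparing [T h] with half of [K int h]. *)

Lemma inv_nat_small (R : realType) (e : R) : 0 < e -> exists k, k.+1%:R^-1 <= e.
Proof.
move=> e0; exists (Num.bound e^-1).
rewrite -[leRHS]invrK lef_pV2 ?posrE ?invr_gt0//.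
by apply: le_trans (ltW (archi_boundP _)) _; rewrite ?invr_ge0 ?ltW// ltr_nat.
Qed.

(** * Euclidean vectors, the norm and affine maps *)

Section vectors.
Context {R : realType} {n : nat}.
Implicit Types (x y z v : n.-tuple R) (c d : R).

Lemma tnth_vadd x y i : tnth (vadd x y) i = tnth x i + tnth y i.
Proof. by rewrite tnth_mktuple. Qed.
Lemma tnth_vsub x y i : tnth (vsub x y) i = tnth x i - tnth y i.
Proof. by rewrite tnth_mktuple. Qed.
Lemma tnth_vscale c x i : tnth (vscale c x) i = c * tnth x i.
Proof. by rewrite tnth_mktuple. Qed.
Lemma tnth_vzero i : tnth (@vzero R n) i = 0.
Proof. by rewrite tnth_mktuple. Qed.
Definition tnthE := (tnth_vadd, tnth_vsub, tnth_vscale, tnth_vzero).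

Lemma vsubK x y : vadd (vsub x y) y = x.
Proof. by apply: eq_from_tnth => i; rewrite !tnthE; ring. Qed.
Lemma vaddK x y : vsub (vadd x y) y = x.
Proof. by apply: eq_from_tnth => i; rewrite !tnthE; ring. Qed.
Lemma vaddC x y : vadd x y = vadd y x.
Proof. by apply: eq_from_tnth => i; rewrite !tnthE; ring. Qed.
Lemma vaddA x y z : vadd x (vadd y z) = vadd (vadd x y) z.
Proof. by apply: eq_from_tnth => i; rewrite !tnthE; ring. Qed.
Lemma vsubE x y : vsub x y = vadd x (vscale (-1) y).
Proof. by apply: eq_from_tnth => i; rewrite !tnthE; ring. Qed.
Lemma vscaleA c d x : vscale c (vscale d x) = vscale (c * d) x.
Proof. by apply: eq_from_tnth => i; rewrite !tnthE; ring. Qed.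
Lemma vscale1 x : vscale 1 x = x.
Proof. by apply: eq_from_tnth => i; rewrite !tnthE; ring. Qed.
Lemma vscaleDr c x y : vscale c (vadd x y) = vadd (vscale c x) (vscale c y).
Proof. by apply: eq_from_tnth => i; rewrite !tnthE; ring. Qed.
Lemma vscaleBr c x y : vscale c (vsub x y) = vsub (vscale c x) (vscale c y).
Proof. by apply: eq_from_tnth => i; rewrite !tnthE; ring. Qed.

Lemma sqr_vnorm x : vnorm x ^+ 2 = \sum_(i < n) tnth x i ^+ 2.
Proof. by rewrite /vnorm sqr_sqrtr// sumr_ge0// => i _; exact: sqr_ge0. Qed.
Lemma vnorm_ge0 x : 0 <= vnorm x. Proof. exact: sqrtr_ge0. Qed.
Lemma vnorm_scale c x : vnorm (vscale c x) = `|c| * vnorm x.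
Proof.
rewrite /vnorm -sqrtr_sqr -sqrtrM ?sqr_ge0//; congr Num.sqrt.
by rewrite big_distrr/=; apply: eq_bigr => i _; rewrite !tnthE exprMn.
Qed.
Lemma vnorm0 : vnorm (@vzero R n) = 0.
Proof.
by rewrite /vnorm big1 ?sqrtr0// => i _; rewrite !tnthE expr0n.
Qed.
Lemma coord_le_vnorm x i : `|tnth x i| <= vnorm x.
Proof.
rewrite /vnorm -sqrtr_sqr ler_wsqrtr// (bigD1 i)//= lerDl sumr_ge0// => j _.
exact: sqr_ge0.
Qed.
Lemma vnorm_eq0 x : vnorm x = 0 -> x = vzero.
Proof.
move=> x0; apply: eq_from_tnth => i; rewrite tnthE; apply/eqP.
by rewrite -normr_eq0 eq_le normr_ge0 andbT -x0 coord_le_vnorm.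
Qed.

Lemma cauchy_schwarz x y :
  (\sum_i tnth x i * tnth y i) ^+ 2 <= vnorm x ^+ 2 * vnorm y ^+ 2.
Proof.
rewrite !sqr_vnorm -subr_ge0.
set a := fun i => tnth x i; set b := fun i => tnth y i.
(* Lagrange's identity: the defect in Cauchy-Schwarz is half the sum of the squared 2 by 2
   minors. *)
have -> : (\sum_i a i ^+ 2) * (\sum_i b i ^+ 2) - (\sum_i a i * b i) ^+ 2
    = 2^-1 * \sum_i \sum_j (a i * b j - a j * b i) ^+ 2.
  have -> : \sum_i \sum_j (a i * b j - a j * b i) ^+ 2 =
     \sum_i \sum_j (a i ^+ 2 * b j ^+ 2) + \sum_i \sum_j (a j ^+ 2 * b i ^+ 2)
     - 2 * \sum_i \sum_j ((a i * b i) * (a j * b j)).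
    rewrite big_distrr/= -big_split/= -sumrB; apply: eq_bigr => i _.
    rewrite big_distrr/= -big_split/= -sumrB; apply: eq_bigr => j _; ring.
  rewrite [X in _ + X - _]exchange_big/= expr2.
  by rewrite 2!big_distrlr/=; field.
by rewrite mulr_ge0// ?invr_ge0// sumr_ge0// => i _; rewrite sumr_ge0// => j _; exact: sqr_ge0.
Qed.

Lemma vnormD x y : vnorm (vadd x y) <= vnorm x + vnorm y.
Proof.
rewrite -(@ler_pXn2r _ 2)// ?nnegrE ?addr_ge0 ?vnorm_ge0//.
rewrite sqrrD !sqr_vnorm.
have -> : \sum_(i < n) tnth (vadd x y) i ^+ 2 = \sum_i tnth x i ^+ 2 +
    (\sum_i tnth x i * tnth y i) *+ 2 + \sum_i tnth y i ^+ 2.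
  by rewrite -sumrMnl -!big_split/=; apply: eq_bigr => i _; rewrite tnthE sqrrD.
rewrite lerD2r lerD2l ler_wMn2r//.
apply: (le_trans (ler_norm _)).
have := @ler_wsqrtr _ _ _ (cauchy_schwarz x y).
rewrite -exprMn !sqrtr_sqr => h; apply: le_trans h _.
by rewrite ger0_norm// mulr_ge0// vnorm_ge0.
Qed.
Lemma vnormN x : vnorm (vscale (-1) x) = vnorm x.
Proof. by rewrite vnorm_scale normrN1 mul1r. Qed.
Lemma vnormB x y : vnorm (vsub x y) <= vnorm x + vnorm y.
Proof. by rewrite vsubE; apply: le_trans (vnormD _ _) _; rewrite vnormN. Qed.
Lemma vnorm_subC x y : vnorm (vsub x y) = vnorm (vsub y x).
Proof.
rewrite -vnormN; congr vnorm.
by apply: eq_from_tnth => i; rewrite !tnthE; ring.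
Qed.
Lemma vnorm_le_sub x y : vnorm x <= vnorm (vsub x y) + vnorm y.
Proof. by rewrite -{1}(vsubK x y) vnormD. Qed.
Lemma vnorm_ge_add x y : vnorm x - vnorm y <= vnorm (vadd x y).
Proof.
by rewrite lerBlDr -{1}(vaddK x y); apply: le_trans (vnormB _ _) _.
Qed.
Lemma vnorm_le_sum x : vnorm x <= \sum_i `|tnth x i|.
Proof.
rewrite -(@ler_pXn2r _ 2)// ?nnegrE ?vnorm_ge0 ?sumr_ge0// sqr_vnorm expr2.
rewrite big_distrl/=; apply: ler_sum => i _; rewrite -real_normK ?num_real// expr2.
by rewrite ler_wpM2l// (bigD1 i)//= lerDl sumr_ge0.
Qed.
Lemma vnorm_le_coord x c : (forall i, `|tnth x i| <= c) -> vnorm x <= n%:R * c.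
Proof.
move=> h; apply: le_trans (vnorm_le_sum _) _.
apply: le_trans (ler_sum _ (fun i _ => h i)) _.
by rewrite sumr_const card_ord mulr_natl.
Qed.

(** Dilations ([v = 0]), translations ([c = 1]) and reflections ([c = -1]) are all of this form, so
    each property of the measure is proved once for the three of them. *)
Definition vaff c v x : n.-tuple R := vadd (vscale c x) v.

Lemma vaffK c v x : c != 0 -> vaff c^-1 (vscale (- c^-1) v) (vaff c v x) = x.
Proof.
move=> c0; apply: eq_from_tnth => i; rewrite !tnthE.
by field.
Qed.
Lemma vaffK' c v x : c != 0 -> vaff c v (vaff c^-1 (vscale (- c^-1) v) x) = x.
Proof.
move=> c0; apply: eq_from_tnth => i; rewrite !tnthE.
by field.
Qed.
End vectors.

Section borel_vec.
Context {R : realType} {n : nat} {d} {T : measurableType d}.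
Local Notation V := (n.-tuple R).

Lemma measurable_coord (f : T -> V) i :
  measurable_fun setT f -> measurable_fun setT (fun x => tnth (f x) i).
Proof. by move=> /measurable_fun_tnthP; exact. Qed.
Lemma measurable_vec (f : T -> V) :
  (forall i, measurable_fun setT (fun x => tnth (f x) i)) -> measurable_fun setT f.
Proof. by move=> h; apply/measurable_fun_tnthP. Qed.
Lemma measurable_vadd (f g : T -> V) : measurable_fun setT f -> measurable_fun setT g ->
  measurable_fun setT (fun x => vadd (f x) (g x)).
Proof.
move=> mf mg; apply: measurable_vec => i; under eq_fun do rewrite tnthE.
by apply: measurable_funD; exact: measurable_coord.
Qed.
Lemma measurable_vsub (f g : T -> V) : measurable_fun setT f -> measurable_fun setT g ->
  measurable_fun setT (fun x => vsub (f x) (g x)).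
Proof.
move=> mf mg; apply: measurable_vec => i; under eq_fun do rewrite tnthE.
by apply: measurable_funB; exact: measurable_coord.
Qed.
Lemma measurable_vscale (f : T -> R) (g : T -> V) : measurable_fun setT f -> measurable_fun setT g ->
  measurable_fun setT (fun x => vscale (f x) (g x)).
Proof.
move=> mf mg; apply: measurable_vec => i; under eq_fun do rewrite tnthE.
by apply: measurable_funM => //; exact: measurable_coord.
Qed.
Lemma measurable_vnorm (f : T -> V) : measurable_fun setT f ->
  measurable_fun setT (fun x => vnorm (f x)).
Proof.
move=> mf.
rewrite (_ : (fun x => _) = (@Num.sqrt R) \o (fun x => \sum_i tnth (f x) i ^+ 2))//.
apply: measurableT_comp.
  by apply: continuous_measurable_fun; exact: sqrt_continuous.
apply: measurable_sum => i; apply: measurable_funX; exact: measurable_coord.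
Qed.
End borel_vec.

(** * Affine change of variables for the Borel measure *)

Section leb_invariance.
Context {R : realType} {n : nat} (leb : {measure set (n.-tuple R) -> \bar R}).
Hypothesis Hleb : is_lebesgue_borel leb.
Local Notation V := (n.-tuple R).
Implicit Types (a b v x : V).

Lemma measurable_box a b : measurable (box a b).
Proof.
have -> : box a b = \bigcap_(i : 'I_n) ((fun x : V => tnth x i) @^-1` `]tnth a i, tnth b i]).
  apply/seteqP; split => x /= h i; first by move=> _; rewrite /= in_itv/= h.
  by have := h i I; rewrite /= in_itv/=.
apply: fin_bigcap_measurable; first exact: finite_finset.
by move=> i _; rewrite -[X in measurable X]setTI; exact: (measurable_tnth i).
Qed.

Lemma measurable_halfspace i (A : set R) : measurable A -> measurable [set x : V | A (tnth x i)].
Proof. by move=> mA; rewrite -[X in measurable X]setTI; exact: (measurable_tnth i). Qed.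

Lemma box_eq0 a b : ~ (forall i, tnth a i <= tnth b i) -> box a b = set0.
Proof.
move=> h; apply/seteqP; split => // x /= xab; apply: h => i.
by have /andP[? ?] := xab i; apply: le_trans (ltW _) _; eassumption.
Qed.

Definition cube (k : R) : set V := box [tuple - k | i < n] [tuple k | i < n].
Lemma cubeE (k : R) x : cube k x = forall i, - k < tnth x i <= k.
Proof. by rewrite /cube /box/=; apply/propext; split => h i; have := h i; rewrite !tnth_mktuple. Qed.

Lemma cube_cover : \bigcup_k cube k%:R = setT.
Proof.
apply/seteqP; split => // x _.
exists (Num.bound (vnorm x)) => //=; rewrite cubeE => i.
have := archi_boundP (vnorm_ge0 x); have := coord_le_vnorm x i.
rewrite ler_norml => /andP[? ?] ?; lra.
Qed.

Definition boxes : set (set V) := [set box ab.1 ab.2 | ab in [set: V * V]].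

Lemma boxes_setI : setI_closed boxes.
Proof.
move=> _ _ [[a b] _ <-] [[a' b'] _ <-]/=.
exists ([tuple Num.max (tnth a i) (tnth a' i) | i < n],
        [tuple Num.min (tnth b i) (tnth b' i) | i < n]) => //=.
apply/seteqP; split => x /=.
  move=> h; split => i; have := h i; rewrite !tnth_mktuple gt_max le_min;
  by move=> /andP[/andP[h1 h2] /andP[h3 h4]]; apply/andP.
move=> [h h'] i; rewrite !tnth_mktuple gt_max le_min.
by have /andP[-> ->] := h i; have /andP[-> ->] := h' i.
Qed.

(** A half-space [x_i > c] is a countable union of boxes, and half-lines generate the Borel sets of
    each coordinate. This feeds the uniqueness theorem for measures that agree on the boxes. *)
Lemma measurable_boxesE : @measurable _ V = <<s boxes >>.
Proof.
apply/seteqP; split; last first.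
  apply: smallest_sub; first exact: sigma_algebra_measurable.
  by move=> _ [[a b] _ <-]; exact: measurable_box.
apply: smallest_sub; first exact: smallest_sigma_algebra.
rewrite -bigcup_seq/= => A [i _] [B mB <-]; rewrite setTI.
suff h : forall c : R, <<s boxes >> ((fun x : V => tnth x i) @^-1` `]c, +oo[).
  (* Good sets principle: the Borel sets of the line whose cylinder lies in the generated
     sigma-algebra form a sigma-algebra. *)
  pose C := [set B : set R | <<s boxes >> ((fun x : V => tnth x i) @^-1` B)].
  have sC : sigma_algebra setT C.
    split; rewrite /C/=.
    - by rewrite preimage_set0; exact: sigma_algebra0.
    - move=> D mD; rewrite setTD preimage_setC -setTD; exact: sigma_algebraCD.
    - by move=> F mF; rewrite preimage_bigcup; exact: sigma_algebra_bigcup.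
  have {}mB : (@RGenOInfty.G R).-sigma.-measurable B by rewrite -RGenOInfty.measurableE.
  apply: (smallest_sub sC _ mB) => _ [c ->]; exact: h.
move=> c.
pose A' k := box [tuple if j == i then c else - k%:R | j < n] [tuple (k%:R : R) | j < n].
have -> : (fun x : V => tnth x i) @^-1` `]c, +oo[ = \bigcup_k A' k.
  apply/seteqP; split => x /=; rewrite ?in_itv/= ?andbT.
    move=> cx; exists (Num.bound (vnorm x)) => //= j; rewrite !tnth_mktuple.
    have := archi_boundP (vnorm_ge0 x); have := coord_le_vnorm x j.
    rewrite ler_norml => /andP[h1 h2] h3; case: eqP => [->|_]; first by rewrite cx/=; have := coord_le_vnorm x i; rewrite ler_norml; lra.
    by apply/andP; split; lra.
  by move=> [k _ /(_ i)]; rewrite /= !tnth_mktuple eqxx => /andP[].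
apply: sigma_algebra_bigcup => k; apply: sub_sigma_algebra.
by exists ([tuple if j == i then c else - k%:R | j < n], [tuple (k%:R : R) | j < n]).
Qed.

Lemma leb_cube_fin k : (leb (cube k%:R) < +oo)%E.
Proof.
rewrite /cube Hleb ?ltry// => i; rewrite !tnth_mktuple.
by have := ler0n R k; lra.
Qed.

(** Inside the cube of half-side [k] the hyperplane lies in a slab of thickness [dl], of volume
    [dl * M] with [M] the product of the other sides; [M + 1] in the choice of [dl] avoids a
    division by zero. *)
Lemma leb_hyperplane i c : leb [set x : V | tnth x i = c] = 0%E.
Proof.
have mH : measurable [set x : V | tnth x i = c].
  exact: (measurable_halfspace i (measurable_set1 c)).
have mHk k : measurable ([set x : V | tnth x i = c] `&` cube k%:R).
  by apply: measurableI => //; exact: measurable_box.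
have -> : [set x : V | tnth x i = c] = \bigcup_k ([set x : V | tnth x i = c] `&` cube k%:R).
  by rewrite -setI_bigcupr cube_cover setIT.
apply/negligibleP; first by apply: bigcup_measurable.
apply: negligible_bigcup => k; apply/negligibleP => //.
apply/eqP; rewrite eq_le measure_ge0 andbT; apply/lee_addgt0Pr => e e0.
rewrite add0e.
pose M : R := \prod_(j < n | j != i) (k%:R + k%:R).
have M0 : 0 <= M by apply: prodr_ge0 => j _; rewrite addr_ge0.
pose dl := e / (M + 1).
have dl0 : 0 < dl by rewrite divr_gt0// ltr_wpDl.
apply: (@le_trans _ _ (leb (box [tuple if j == i then c - dl else - k%:R | j < n] [tuple if j == i then c else k%:R | j < n]))).
  apply: le_measure; rewrite ?inE//; first exact: measurable_box.
  move=> x [/= xc]; rewrite cubeE => xk j; rewrite !tnth_mktuple.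
  by case: eqP => [->|_]; [rewrite xc lexx andbT ltrBlDr ltrDl|exact: xk].
rewrite Hleb; last first.
  move=> j; rewrite !tnth_mktuple; case: eqP => _; first by rewrite gerBl ltW.
  by have := ler0n R k; lra.
rewrite lee_fin (bigD1 i)//= !tnth_mktuple eqxx opprB addrC subrK.
rewrite (eq_bigr (fun=> k%:R + k%:R)); last first.
  by move=> j ji; rewrite !tnth_mktuple (negbTE ji) opprK.
rewrite -/M /dl -mulrA -[leRHS]mulr1 ler_pM2l// mulrC ler_pdivrMr ?mul1r ?lerDl//.
by rewrite ltr_wpDl.
Qed.

Lemma negligible_hyperplane i c : leb.-negligible [set x : V | tnth x i = c].
Proof.
apply/negligibleP; last exact: leb_hyperplane.
exact: (measurable_halfspace i (measurable_set1 c)).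
Qed.

(** Boxes closed below and open above: the preimages of half-open boxes under a map of negative
    ratio. They differ from boxes by faces, which lie in null hyperplanes. *)
Definition obox (a b : V) : set V := [set x | forall i, tnth a i <= tnth x i < tnth b i].

Lemma leb_obox a b : (forall i, tnth a i <= tnth b i) ->
  measurable (obox a b) /\ leb (obox a b) = leb (box a b).
Proof.
move=> ab.
have mo : measurable (obox a b).
  have -> : obox a b = \bigcap_(i : 'I_n) ((fun x : V => tnth x i) @^-1` `[tnth a i, tnth b i[).
    apply/seteqP; split => x /= h i; first by move=> _; rewrite /= in_itv/= h.
    by have := h i I; rewrite /= in_itv/=.
  apply: fin_bigcap_measurable; first exact: finite_finset.
  by move=> i _; apply: measurable_halfspace.
split => //.
pose N := \big[setU/set0]_(i < n) ([set x : V | tnth x i = tnth a i] `|` [set x : V | tnth x i = tnth b i]).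
have mN : measurable N.
  apply: bigsetU_measurable => i _; apply: measurableU;
  exact: (measurable_halfspace i (measurable_set1 _)).
have N0 : leb N = 0%E.
  apply/negligibleP => //; rewrite /N; elim/big_ind : _.
  - exact: negligible_set0.
  - exact: negligibleU.
  - by move=> i _; apply: negligibleU; exact: negligible_hyperplane.
have NP x : (exists i, tnth x i = tnth a i \/ tnth x i = tnth b i) -> N x.
  by move=> [i h]; rewrite /N -bigcup_seq; exists i => //=; rewrite mem_index_enum.
have key (A B : set V) : measurable A -> measurable B -> A `<=` B `|` N -> (leb A <= leb B)%E.
  move=> mA mB AB; apply: le_trans (le_measure leb _ _ AB) _; rewrite ?inE//; first exact: measurableU.
  by apply: (@le_trans _ _ (leb B + leb N)%E); [exact: measureU2|rewrite N0 adde0].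
apply/eqP; rewrite eq_le; apply/andP; split; apply: key => //; try exact: measurable_box.
- move=> x xo; have [h|/existsNP[i /negP h]] := pselect (forall i, tnth a i != tnth x i).
    left => i; have /andP[h1 h2] := xo i; rewrite (ltW h2) andbT lt_neqAle h1 andbT.
    exact: h.
  by right; apply: NP; exists i; left; move: h; rewrite negbK => /eqP.
- move=> x xo; have [h|/existsNP[i /negP h]] := pselect (forall i, tnth x i != tnth b i).
    left => i; have /andP[h1 h2] := xo i; rewrite (ltW h1)/= lt_neqAle h2 andbT.
    exact: h.
  by right; apply: NP; exists i; right; move: h; rewrite negbK => /eqP.
Qed.

Lemma measurable_vaff c v : measurable_fun setT (vaff c v : V -> V).
Proof.
apply: measurable_vadd; last exact: measurable_cst.
by apply: measurable_vscale; [exact: measurable_cst|exact: measurable_id].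
Qed.

(** The pushforward and the rescaled measure agree on boxes, a pi-system that generates the Borel
    sets, so they agree everywhere. *)
Lemma leb_vaff c v (A : set V) : c != 0 -> measurable A ->
  leb (vaff c v @^-1` A) = ((`|c| ^+ n)^-1%:E * leb A)%E.
Proof.
move=> c0 mA.
have k0 : (0 <= (`|c| ^+ n)^-1)%R by rewrite invr_ge0 exprn_ge0.
have mv := measurable_vaff c v.
pose m1' : {measure set V -> \bar R} := pushforward leb (vaff c v).
pose m1 := m1' mv.
pose m2 : {measure set V -> \bar R} := mscale (NngNum k0) leb.
suff : m1 A = m2 A by [].
apply: (measure_unique boxes (fun k => cube k%:R)) => //.
- exact: measurable_boxesE.
- exact: boxes_setI.
- by move=> i; exists ([tuple - i%:R | _ < n], [tuple i%:R | _ < n]).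
- exact: cube_cover.
- move=> _ [[a b] _ <-]/=; rewrite /m1 /m2/= /mscale/= /pushforward/=.
  have [ab|/box_eq0->] := pselect (forall i, tnth a i <= tnth b i); last first.
    by rewrite preimage_set0 !measure0 mule0.
  rewrite Hleb//.
  pose p : V := [tuple (tnth a i - tnth v i) / c | i < n].
  pose q : V := [tuple (tnth b i - tnth v i) / c | i < n].
  have -> : leb (vaff c v @^-1` box a b) = (\prod_(i < n) ((tnth b i - tnth a i) / `|c|))%:E.
    have [cpos|cneg] : 0 < c \/ c < 0 by move: c0; rewrite neq_lt => /orP[]; [right|left].
      have -> : vaff c v @^-1` box a b = box p q.
        apply/seteqP; split => x /= h i; have := h i; rewrite !tnthE !tnth_mktuple.
          by rewrite ltr_pdivrMr// ler_pdivlMr// ltrBlDr lerBrDr ![c * _]mulrC.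
        by rewrite ltr_pdivrMr// ler_pdivlMr// ltrBlDr lerBrDr ![c * _]mulrC.
      rewrite Hleb => [|i]; last by rewrite !tnth_mktuple ler_pM2r ?invr_gt0// lerB.
      congr EFin; apply: eq_bigr => i _; rewrite !tnth_mktuple gtr0_norm//; ring.
    have -> : vaff c v @^-1` box a b = obox q p.
      apply/seteqP; split => x /= h i; have := h i; rewrite !tnthE !tnth_mktuple.
        by rewrite ltr_ndivlMr// ler_ndivrMr// ltrBlDr lerBrDr ![c * _]mulrC andbC.
      by rewrite ltr_ndivlMr// ler_ndivrMr// ltrBlDr lerBrDr ![c * _]mulrC andbC.
    have qp i : tnth q i <= tnth p i by rewrite !tnth_mktuple ler_nM2r ?invr_lt0// lerB.
    rewrite (leb_obox qp).2 Hleb//.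
    congr EFin; apply: eq_bigr => i _; rewrite !tnth_mktuple ltr0_norm// invrN; ring.
  by rewrite big_split/= prodr_const card_ord exprVn EFinM muleC.
- move=> k; rewrite /m1/= /pushforward/=.
  (* Uniqueness asks for finite mass on the exhausting cubes. [B] contains the preimage of the cube;
     the [- 1] makes its lower inequalities strict. *)
  pose B := box [tuple - (k%:R + `|tnth v i|) / `|c| - 1 | i < n] [tuple ((k%:R + `|tnth v i|) / `|c|) : R | i < n].
  have cp : 0 < `|c| by rewrite normr_gt0.
  have hv i : 0 <= k%:R + `|tnth v i| by rewrite addr_ge0.
  apply: (@le_lt_trans _ _ (leb B)).
    apply: le_measure; rewrite ?inE; [|exact: measurable_box|].
      rewrite -[X in measurable X]setTI; apply: measurable_vaff => //.
      exact: measurable_box.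
    move=> x /=; rewrite cubeE => h i; have := h i; rewrite !tnth_mktuple.
    move=> /andP[h1 h2].
    have : `|tnth x i| <= (k%:R + `|tnth v i|) / `|c|.
      rewrite ler_pdivlMr// mulrC -normrM.
      have -> : c * tnth x i = (c * tnth x i + tnth v i) - tnth v i by ring.
      apply: le_trans (ler_normB _ _) _; rewrite lerD2r ler_norml; lra.
    rewrite ler_norml mulNr => /andP[h3 h4]; rewrite h4 andbT; lra.
  rewrite Hleb ?ltry// => i; rewrite !tnth_mktuple mulNr.
  have : 0 <= (k%:R + `|tnth v i|) / `|c| by rewrite divr_ge0.
  lra.
Qed.

End leb_invariance.

Section sigma_finite_pack.
Context d (T : measurableType d) (R : realType) (m : {measure set T -> \bar R}).
(** The proof [h] is a phantom argument: it names a copy of [m] to which the sigma-finite structure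
    can be attached. *)
Definition sfm (h : sigma_finite [set: T] m) : set T -> \bar R := m.
HB.instance Definition _ h := Measure.copy (sfm h) m.
HB.instance Definition _ h := @Measure_isSigmaFinite.Build _ _ _ (sfm h) h.
Definition sigma_finite_pack h : {sigma_finite_measure set T -> \bar R} := sfm h.
End sigma_finite_pack.

(* An opaque copy of the Lebesgue measure: conversion must not unfold its construction. *)
Fact lebm_key (R : realType) (n : nat) (leb : {measure set (n.-tuple R) -> \bar R}) :
  {m : {measure set (Rn leb) -> \bar R} | m = Leb leb}.
Proof. by exists (Leb leb). Qed.
Definition lebm (R : realType) (n : nat) (leb : {measure set (n.-tuple R) -> \bar R}) :
  {measure set (Rn leb) -> \bar R} := sval (lebm_key leb).
Lemma lebmE (R : realType) (n : nat) (leb : {measure set (n.-tuple R) -> \bar R}) :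
  lebm leb = Leb leb.
Proof. by rewrite /lebm; case: lebm_key. Qed.

(** * The completed measure: affine invariance, hulls, Borel versions *)

Section Leb_basic.
Context {R : realType} {n : nat} (leb : {measure set (n.-tuple R) -> \bar R}).
Hypothesis Hleb : is_lebesgue_borel leb.
Local Notation V := (n.-tuple R).
Local Notation E := (Rn leb).
Local Notation mu := (lebm leb).
Implicit Types (c : R) (v : V).
Local Open Scope ereal_scope.

Lemma Leb_ge0 (A : set E) : 0 <= mu A.
Proof. rewrite lebmE; exact: (mu_ext_ge0 (@measure_ge0 _ _ _ leb)). Qed.
Lemma le_Leb (A B : set E) : A `<=` B -> mu A <= mu B.
Proof. by move=> AB; rewrite lebmE; apply: (le_mu_ext leb). Qed.
Lemma LebE (A : set V) : measurable A -> mu A = leb A.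
Proof. by move=> mA; rewrite lebmE; exact: (measurable_mu_extE leb). Qed.
Lemma Leb_subadd (A : (set E)^nat) : mu (\bigcup_k A k) <= \sum_(k <oo) mu (A k).
Proof. rewrite lebmE; exact: (mu_ext_sigma_subadditive (@measure_ge0 _ _ _ leb)). Qed.
Lemma LebU (A B : set E) : mu (A `|` B) <= mu A + mu B.
Proof. rewrite lebmE; exact: (outer_measureU2 (mu_ext leb : {outer_measure set V -> \bar R})). Qed.

Lemma borel_measurable (A : set V) : measurable A -> measurable (A : set E).
Proof. by move=> mA; exact: (caratheodory_measurable_mu_ext leb mA). Qed.

Lemma measurable_toV : measurable_fun setT (id : E -> V).
Proof. by move=> _ A mA; rewrite setTI; exact: borel_measurable. Qed.

(** [mu] is an outer measure defined on every set, measurable or not. A Borel cover of [A] pulls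
    back to a Borel cover of the preimage, with all masses multiplied by the same factor. The
    reverse inequality is this one for the inverse map. *)
Lemma Leb_vaff_le c v (A : set E) : c != 0%R ->
  mu (vaff c v @^-1` A) <= (`|c| ^+ n)^-1%:E * mu A.
Proof.
move=> c0.
have k0 : (0 < `|c| ^+ n)%R by rewrite exprn_gt0// normr_gt0.
rewrite lebmE lee_pdivlMl// /Leb /completed_measure_extension /mu_ext.
apply/le_ereal_inf_tmp => _ [F [mF AF] <-].
rewrite -lee_pdivlMl//; apply: ereal_inf_lbound.
exists (fun k => vaff c v @^-1` F k).
  split=> [i|x /AF [i _ ?]]; last by exists i.
  by rewrite -[X in measurable X]setTI; apply: measurable_vaff.
rewrite -nneseriesZl ?invr_ge0 ?ltW//; apply: eq_eseriesr => i _; exact: leb_vaff.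
Qed.

Lemma Leb_vaff c v (A : set E) : c != 0%R ->
  mu (vaff c v @^-1` A) = (`|c| ^+ n)^-1%:E * mu A.
Proof.
move=> c0; apply/eqP; rewrite eq_le Leb_vaff_le//=.
have k0 : (0 < `|c| ^+ n)%R by rewrite exprn_gt0// normr_gt0.
rewrite lee_pdivrMl//.
have := @Leb_vaff_le c^-1 (vscale (- c^-1) v) (vaff c v @^-1` A).
rewrite invr_neq0// => /(_ isT); rewrite normrV ?unitfE// exprVn invrK; apply: le_trans.
apply: le_Leb => x Ax /=; rewrite /preimage/=.
have -> : vaff c v (vaff c^-1 (vscale (- c^-1) v) x) = x by exact: vaffK'.
exact: Ax.
Qed.

(** Borel measurability of the map says nothing about preimages of general Lebesgue sets. Here the
    Caratheodory criterion itself is transported, since outer measures of preimages are all scaled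
    by one constant. *)
Lemma measurable_vaff_E c v : c != 0%R -> measurable_fun setT (vaff c v : E -> E).
Proof.
move=> c0 _ A mA; rewrite setTI.
have k0 : (0 < (`|c| ^+ n)^-1)%R by rewrite invr_gt0 exprn_gt0// normr_gt0.
apply: le_caratheodory_measurable => X.
pose Y := vaff c^-1 (vscale (- c^-1) v) @^-1` X.
have XY : X = vaff c v @^-1` Y.
  by apply/seteqP; split => x; rewrite /Y /preimage/= vaffK.
have := mA Y; rewrite XY -!preimage_setI => h.
have hh B : (leb^*)%mu (vaff c v @^-1` B) = (`|c| ^+ n)^-1%:E * (leb^*)%mu B.
  by have := Leb_vaff v B c0; rewrite lebmE.
rewrite preimage_setC -preimage_setI /= !hh -ge0_muleDr; [|exact: mu_ext_ge0..].
by rewrite le_eqVlt; apply/orP; left; apply/eqP; congr (_ * _); rewrite -h.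
Qed.

Lemma ge0_integral_vaff c v (D : set E) (f : E -> \bar R) : c != 0%R ->
  measurable D -> measurable_fun D f -> (forall x, D x -> 0 <= f x) ->
  \int[mu]_(x in (vaff c v : E -> E) @^-1` D) f (vaff c v x) =
   (`|c| ^+ n)^-1%:E * \int[mu]_(x in D) f x.
Proof.
move=> c0 mD mf f0.
have k0 : (0 <= (`|c| ^+ n)^-1)%R by rewrite invr_ge0 exprn_ge0.
rewrite -(@ge0_integral_pushforward _ _ _ _ _ (vaff c v : E -> E) (measurable_vaff_E v c0) mu D f)//; last first.
  by move=> x; rewrite inE; exact: f0.
pose m2 : {measure set E -> \bar R} := mscale (NngNum k0) mu.
transitivity (\int[m2]_(x in D) f x); last by rewrite ge0_integral_mscale.
pose m1 : {measure set E -> \bar R} := pushforward mu (vaff c v : E -> E).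
apply: (@eq_measure_integral _ _ _ D m2 (m1 (measurable_vaff_E v c0))).
by move=> A mA _; exact: Leb_vaff.
Qed.

Lemma Leb_cube_fin k : mu (cube k%:R) < +oo.
Proof. rewrite LebE; [exact: leb_cube_fin|exact: measurable_box]. Qed.

Lemma Leb_sigma_finite : sigma_finite [set: E] mu.
Proof.
exists (fun k => cube k%:R); first by rewrite -cube_cover.
by move=> k; split; [apply: borel_measurable; exact: measurable_box|exact: Leb_cube_fin].
Qed.

Lemma ge0_tonelli (F : E * E -> \bar R) :
  measurable_fun setT F -> (forall z, 0 <= F z) ->
  [/\ measurable_fun setT (fun x => \int[mu]_y F (x, y)),
      measurable_fun setT (fun y => \int[mu]_x F (x, y)) &
     \int[mu]_x \int[mu]_y F (x, y) = \int[mu]_y \int[mu]_x F (x, y)].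
Proof.
move=> mF F0; pose m := sigma_finite_pack Leb_sigma_finite.
split.
- exact: (measurable_fun_fubini_tonelli_F (m2 := m)).
- exact: (measurable_fun_fubini_tonelli_G (m1 := m)).
- exact: (fubini_tonelli (m1 := m) (m2 := m)).
Qed.

(** The intersection of open-ended covers [G k] whose mass exceeds that of [X] by at most
    [1 / (k + 1)]. It replaces level sets that are not known to be measurable by Borel ones of the
    same mass. *)
Lemma Leb_hull (X : set E) : exists2 G : set V, measurable G & X `<=` G /\ mu G = mu X.
Proof.
have [Xoo|] := eqVneq (mu X) +oo.
  exists setT => //; split => //; rewrite Xoo; apply/eqP; rewrite -leye_eq -Xoo.
  exact: le_Leb.
move=> Xfin.
have Xf : mu X \is a fin_num by rewrite fin_numE Xfin andbT gt_eqF// (lt_le_trans _ (Leb_ge0 _)).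
have h k : exists G : set V, [/\ measurable G, X `<=` G & mu G <= mu X + k.+1%:R^-1%:E].
  have Xf' := Xf; rewrite lebmE in Xf'.
  have [|_ [F [mF XF] <-] Fk] := @lb_ereal_inf_adherent _ _ (k.+1%:R^-1) _ Xf'; first by rewrite invr_gt0.
  exists (\bigcup_i F i); split => //; first exact: bigcup_measurable.
  apply: le_trans (Leb_subadd _) _; apply: (@le_trans _ _ (Leb leb X + k.+1%:R^-1%:E)); last by rewrite lebmE.
  apply: le_trans _ (ltW Fk).
  by rewrite le_eqVlt; apply/orP; left; apply/eqP; apply: eq_eseriesr => i _; exact: LebE.
have [G GP] := choice h.
exists (\bigcap_k G k); first by apply: bigcapT_measurable => k; have [] := GP k.
have XG : X `<=` \bigcap_k G k by move=> x Xx k _; have [_ XGk _] := GP k; exact: XGk.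
split => //; apply/eqP; rewrite eq_le; apply/andP; split; last exact: le_Leb.
apply/lee_addgt0Pr => e e0.
have [k ke] := inv_nat_small e0.
have [_ _ Gk] := GP k.
apply: (@le_trans _ _ (mu (G k))); first by apply: le_Leb; exact: bigcap_inf.
by apply: le_trans Gk _; rewrite leeD2l// lee_fin.
Qed.

Lemma null_hull (X : set E) : mu X = 0 ->
  exists2 N : set V, measurable N & X `<=` N /\ mu N = 0.
Proof. by move=> X0; have [N mN [XN N0]] := Leb_hull X; exists N; rewrite ?N0. Qed.

Lemma null_measurable (X : set E) : mu X = 0 -> measurable X.
Proof.
move=> X0; have [N mN [XN N0]] := null_hull X0.
apply: (@measure_is_complete_caratheodory _ _ _) => /=.
by exists N; split => //; [exact: borel_measurable|rewrite -N0 lebmE].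
Qed.

(** In each cube the mass is finite, so a Borel hull exceeds the set by a null set; a Borel null set
    containing this excess is removed, and the cubes are glued. *)
Lemma measurable_borel_null (A : set E) : measurable A ->
  exists2 N : set V, measurable N /\ mu N = 0 & measurable (A `\` N : set V).
Proof.
move=> mA.
have h k : exists N : set V, [/\ measurable N, mu N = 0 & measurable ((A `&` cube k%:R) `\` N : set V)].
  have mC : measurable (cube k%:R : set E) by apply: borel_measurable; exact: measurable_box.
  have [G mG [AG GA]] := Leb_hull (A `&` cube k%:R).
  have Afin : mu (A `&` cube k%:R) < +oo by apply: le_lt_trans (Leb_cube_fin k); exact: le_Leb.
  have mGE : measurable (G : set E) by exact: borel_measurable.
  have mAE : measurable (A `&` cube k%:R : set E) by exact: measurableI.
  have D0 : mu (G `\` (A `&` cube k%:R)) = 0.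
    have /(_ (eq_ind _ (fun t => t < +oo) Afin _ (esym GA))) := @measureD _ _ _ mu _ _ mGE mAE.
    move=> ->; rewrite setIidr//; rewrite -[X in X - _]/(mu G) GA subee//.
    by rewrite ge0_fin_numE ?Leb_ge0.
  have [N mN [XN N0]] := null_hull D0.
  exists N; split => //.
  have -> : (A `&` cube k%:R) `\` N = G `\` N.
    apply/seteqP; split => x [h1 h2]; split => //; first exact: AG.
    by apply: contrapT => hh; apply: h2; apply: XN.
  exact: measurableD.
have [N NP] := choice h.
exists (\bigcup_k N k).
  split; first by apply: bigcup_measurable => k _; have [] := NP k.
  apply/eqP; rewrite eq_le Leb_ge0 andbT; apply: le_trans (Leb_subadd _) _.
  by rewrite eseries0// => k _ _; have [] := NP k.
have -> : A `\` \bigcup_k N k = \bigcup_k (((A `&` cube k%:R) `\` N k) `\` \bigcup_k N k).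
  apply/seteqP; split => x.
    move=> [Ax Nx]; have [k _ xk] : (\bigcup_k cube k%:R) x by rewrite cube_cover.
    by exists k => //; split => //; split => // ?; apply: Nx; exists k.
  by move=> [k _ [[[Ax _] _] ?]].
apply: bigcup_measurable => k _; apply: measurableD; first by have [] := NP k.
by apply: bigcup_measurable => j _; have [] := NP j.
Qed.

(** Sums and differences on [E * E] are shown measurable into the Borel sigma-algebra, so composing
    a function with them calls for a Borel function. The superlevel sets at rational heights become
    Borel once a single null set [M] is removed; the new function is 0 on [M]. *)
Lemma borel_version (g : E -> R) : measurable_fun setT g ->
  exists2 g' : V -> R, measurable_fun setT g' & mu [set x : E | g x <> g' x] = 0.
Proof.
move=> mg.
have h (q : rat) : exists N : set V, [/\ measurable N, mu N = 0 & measurable ([set x | (g x > ratr q)%R] `\` N : set V)].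
  have [|N [? ?] ?] := @measurable_borel_null [set x | (g x > ratr q)%R]; last by exists N.
  have -> : [set x | (g x > ratr q)%R] = g @^-1` `]ratr q, +oo[%classic.
    by apply/seteqP; split => x /=; rewrite in_itv/= andbT.
  by rewrite -[X in measurable X]setTI; apply: mg => //; exact: measurable_itv.
have [N NP] := choice h.
pose M := \bigcup_(q : rat) N q.
have mM : measurable (M : set V) by apply: bigcupT_measurable_rat => q; have [] := NP q.
have M0 : mu M = 0.
  rewrite /M; have /card_esym/ppcard_eqP[f] := card_rat.
  have -> : \bigcup_q N q = \bigcup_k N (f k).
    apply/seteqP; split => x [q _ xq]; last by exists (f q).
    by exists (f^-1%FUN q) => //; rewrite invK ?inE.
  apply/eqP; rewrite eq_le Leb_ge0 andbT; apply: le_trans (Leb_subadd _) _.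
  by rewrite eseries0// => k _ _; have [] := NP (f k).
exists (fun x => if x \in M then 0%R else g x); last first.
  apply/eqP; rewrite eq_le Leb_ge0 andbT -M0; apply: le_Leb => x /=.
  by case: ifPn; rewrite ?inE.
set f := (f in measurable_fun _ f).
have mfq (q : rat) : measurable ([set x | (f x > ratr q)%R] : set V).
  have -> : [set x | (f x > ratr q)%R] =
      (([set x | (g x > ratr q)%R] `\` N q) `\` M) `|` (if (0 > ratr q :> R)%R then M else set0).
    apply/seteqP; split => x /=; rewrite /f.
      case: ifPn => [xM h1|xM h1]; first by right; rewrite h1; rewrite inE in xM.
      have nM : ~ M x by move=> xM'; rewrite mem_set in xM.
      by left; split; [split=> // ?; apply: nM; exists q|].
    move=> [[[h1 h2] h3]|]; first by rewrite memNset.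
    by case: ifPn => // h1 xM; rewrite mem_set.
  apply: measurableU; last by case: ifP.
  by apply: measurableD => //; have [] := NP q.
apply: (measurability _ (RGenOInfty.measurableE R)) => // _ [_ [r ->] <-].
rewrite setTI.
have -> : f @^-1` `]r, +oo[ = \bigcup_(q in [set q : rat | (r < ratr q)%R]) [set x | (f x > ratr q)%R].
  apply/seteqP; split => x /=; rewrite in_itv/= andbT.
    by move=> /rat_in_itvoo[q]; rewrite in_itv/= => /andP[? ?]; exists q.
  by move=> [q /= rq]; apply: lt_trans.
rewrite bigcup_mkcond; apply: bigcupT_measurable_rat => q.
by case: ifPn.
Qed.

End Leb_basic.

(** * Lebesgue measure on balls and annuli *)

Section balls.
Context {R : realType} {n : nat} (leb : {measure set (n.-tuple R) -> \bar R}).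
Hypothesis Hleb : is_lebesgue_borel leb.
Local Notation V := (n.-tuple R).
Local Notation E := (Rn leb).
Local Notation mu := (lebm leb).
Implicit Types (c : R) (v : V).
Local Open Scope ereal_scope.

Lemma Leb_complete : measure_is_complete mu.
Proof.
move=> B [A [mA A0 BA]]; apply: null_measurable => //; apply/eqP.
by rewrite eq_le Leb_ge0 andbT -A0; exact: le_Leb.
Qed.

Lemma measurable_vnormE : measurable_fun setT (vnorm : E -> R).
Proof. by apply: measurable_vnorm; exact: measurable_toV. Qed.

Definition vball (r : R) : set E := [set x : E | (vnorm x <= r)%R].
Definition ann (a b : R) : set E := [set x : E | (a < vnorm x <= b)%R].

Lemma measurable_vball r : measurable (vball r).
Proof.
have -> : vball r = (vnorm : E -> R) @^-1` `]-oo, r]%classic.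
  by apply/seteqP; split => x /=; rewrite in_itv.
by rewrite -[X in measurable X]setTI; apply: measurable_vnormE => //; exact: measurable_itv.
Qed.
Lemma measurable_ann a b : measurable (ann a b).
Proof.
have -> : ann a b = (vnorm : E -> R) @^-1` `]a, b]%classic.
  by apply/seteqP; split => x /=; rewrite in_itv.
by rewrite -[X in measurable X]setTI; apply: measurable_vnormE => //; exact: measurable_itv.
Qed.
Lemma measurable_far a : measurable [set x : E | (a < vnorm x)%R].
Proof.
have -> : [set x : E | (a < vnorm x)%R] = (vnorm : E -> R) @^-1` `]a, +oo[%classic.
  by apply/seteqP; split => x /=; rewrite in_itv/= andbT.
by rewrite -[X in measurable X]setTI; apply: measurable_vnormE => //; exact: measurable_itv.
Qed.

Lemma vaff0 c : vaff c (@vzero R n) = vscale c.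
Proof. by apply/funext => x; apply: eq_from_tnth => i; rewrite !tnthE addr0. Qed.
Lemma vaff1 v : vaff 1 v = fun x => vadd x v.
Proof. by apply/funext => x; apply: eq_from_tnth => i; rewrite !tnthE mul1r. Qed.
Lemma vaffN1 v : vaff (-1) v = vsub v.
Proof. by apply/funext => x; apply: eq_from_tnth => i; rewrite !tnthE; ring. Qed.

Lemma Leb_vscale c (A : set E) : c != 0%R ->
  mu (vscale c @^-1` A) = (`|c| ^+ n)^-1%:E * mu A.
Proof. by rewrite -vaff0; exact: Leb_vaff. Qed.
Lemma Leb_shift v (A : set E) : mu ((fun x => vadd x v) @^-1` A) = mu A.
Proof. by rewrite -vaff1 Leb_vaff ?oner_neq0// normr1 expr1n invr1 mul1e. Qed.
Lemma Leb_reflect v (A : set E) : mu (vsub v @^-1` A) = mu A.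
Proof. by rewrite -vaffN1 Leb_vaff ?oppr_eq0 ?oner_neq0// normrN1 expr1n invr1 mul1e. Qed.

Lemma measurable_vscale_E c : c != 0%R -> measurable_fun setT (vscale c : E -> E).
Proof. by rewrite -vaff0; exact: measurable_vaff_E. Qed.
Lemma measurable_shift v : measurable_fun setT ((fun x => vadd x v) : E -> E).
Proof. by rewrite -vaff1; apply: measurable_vaff_E => //; exact: oner_neq0. Qed.
Lemma measurable_reflect v : measurable_fun setT (vsub v : E -> E).
Proof. by rewrite -vaffN1; apply: measurable_vaff_E => //; rewrite oppr_eq0 oner_neq0. Qed.

Lemma measurable_preim_vaff c v (A : set E) : c != 0%R -> measurable A ->
  measurable ((vaff c v : E -> E) @^-1` A).
Proof.
by move=> c0 mA; rewrite -[X in measurable X]setTI; exact: (measurable_vaff_E Hleb).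
Qed.

Section change_var.
Variables (D : set E) (f : E -> \bar R).
Hypotheses (mD : measurable D) (mf : measurable_fun setT f) (f0 : forall x, 0 <= f x).
Let mfD : measurable_fun D f. Proof. exact: measurable_funTS. Qed.

Lemma ge0_integral_vscale c : c != 0%R ->
  \int[mu]_(x in (vscale c : E -> E) @^-1` D) f (vscale c x) = (`|c| ^+ n)^-1%:E * \int[mu]_(x in D) f x.
Proof. by move=> c0; rewrite -(ge0_integral_vaff Hleb (vzero) c0)// vaff0. Qed.
Lemma ge0_integral_shift v :
  \int[mu]_(x in ((fun x => vadd x v) : E -> E) @^-1` D) f (vadd x v) = \int[mu]_(x in D) f x.
Proof.
transitivity ((`|1 : R| ^+ n)^-1%:E * \int[mu]_(x in D) f x); last first.
  by rewrite normr1 expr1n invr1 mul1e.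
by rewrite -(ge0_integral_vaff Hleb v (oner_neq0 R))// vaff1.
Qed.
Lemma ge0_integral_reflect v :
  \int[mu]_(x in (vsub v : E -> E) @^-1` D) f (vsub v x) = \int[mu]_(x in D) f x.
Proof.
have n10 : (-1 != 0 :> R)%R by rewrite oppr_eq0 oner_neq0.
transitivity ((`|-1 : R| ^+ n)^-1%:E * \int[mu]_(x in D) f x); last first.
  by rewrite normrN1 expr1n invr1 mul1e.
by rewrite -(ge0_integral_vaff Hleb v n10)// vaffN1.
Qed.
End change_var.

Lemma vballE_scale r s : (0 < s)%R -> (vscale s : E -> E) @^-1` vball r = vball (r / s).
Proof.
move=> s0; apply/seteqP; split => x /=; rewrite /vball/= vnorm_scale gtr0_norm//;
by rewrite ler_pdivlMr// mulrC.
Qed.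
Lemma annE_scale a b s : (0 < s)%R -> (vscale s : E -> E) @^-1` ann a b = ann (a / s) (b / s).
Proof.
move=> s0; apply/seteqP; split => x /=; rewrite /ann/= vnorm_scale gtr0_norm//;
by rewrite ler_pdivlMr// ltr_pdivrMr// ![(s * _)%R]mulrC.
Qed.

Lemma Leb_ball_scale r s : (0 < s)%R -> mu (vball (s * r)) = (s ^+ n)%:E * mu (vball r).
Proof.
move=> s0; have si0 : (0 < s^-1)%R by rewrite invr_gt0.
have := @Leb_vscale s^-1 (vball r); rewrite gt_eqF// => /(_ isT).
rewrite vballE_scale// invrK mulrC => ->.
by rewrite gtr0_norm// exprVn invrK.
Qed.

Lemma Leb_ball_fin r : mu (vball r) < +oo.
Proof.
apply: le_lt_trans (Leb_cube_fin Hleb (Num.bound `|r|)).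
apply: le_Leb => x /= xr; rewrite cubeE => i.
have := coord_le_vnorm x i; have := archi_boundP (normr_ge0 r).
have := ler_norm r; rewrite /vball/= in xr; rewrite ler_norml => h1 h2 /andP[h3 h4].
by apply/andP; split; lra.
Qed.

Lemma Leb_ball_gt0 r : (0 < r)%R -> 0 < mu (vball r).
Proof.
move=> r0; set d := (r / (n%:R + 1))%R.
have d0 : (0 < d)%R by rewrite divr_gt0// ltr_wpDl.
apply: (@lt_le_trans _ _ (mu (cube d))); last first.
  apply: le_Leb => x; rewrite cubeE => h.
  rewrite /vball/=; apply: (@le_trans _ _ (n%:R * d)%R).
    apply: vnorm_le_coord => i; have := h i; rewrite ler_norml => /andP[/ltW-> ->//].
  rewrite /d mulrCA -[leRHS]mulr1 ler_pM2l// ler_pdivrMr ?mul1r ?lerDl//.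
rewrite LebE; last exact: measurable_box.
rewrite /cube Hleb => [|i]; last by rewrite !tnth_mktuple; lra.
rewrite lte_fin; apply: prodr_gt0 => i _; rewrite !tnth_mktuple; lra.
Qed.

Lemma measurable_vadd_EE : measurable_fun setT (fun z : E * E => vadd z.1 z.2 : V).
Proof.
apply: measurable_vadd.
- exact: (measurableT_comp (@measurable_toV _ _ leb) measurable_fst).
- exact: (measurableT_comp (@measurable_toV _ _ leb) measurable_snd).
Qed.

Lemma Leb_point x : (0 < n)%N -> mu [set x] = 0.
Proof.
case: n leb Hleb x => // m l hl x _.
apply/eqP; rewrite eq_le Leb_ge0 andbT.
apply: (@le_trans _ _ (lebm l [set y : (m.+1).-tuple R | tnth y ord0 = tnth x ord0])).
  by apply: le_Leb => y /= ->.
rewrite LebE ?leb_hyperplane//.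
exact: (measurable_halfspace ord0 (measurable_set1 _)).
Qed.

Lemma ae_eq_measurable (f g : E -> \bar R) : {ae mu, forall x, f x = g x} ->
  measurable_fun setT f -> measurable_fun setT g.
Proof.
move=> fg mf.
have fg' : ae_eq mu setT f g by apply: filterS fg => x h _.
exact: (ae_measurable_fun Leb_complete fg' mf).
Qed.

Lemma ge0_tonelli_on (D1 D2 : set E) (F : E * E -> \bar R) :
  measurable D1 -> measurable D2 -> measurable_fun setT F -> (forall z, 0 <= F z) ->
  [/\ measurable_fun setT (fun x => \int[mu]_(y in D2) F (x, y)),
      measurable_fun setT (fun y => \int[mu]_(x in D1) F (x, y)) &
     \int[mu]_(x in D1) \int[mu]_(y in D2) F (x, y) =
     \int[mu]_(y in D2) \int[mu]_(x in D1) F (x, y)].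
Proof.
move=> m1 m2 mF F0.
have mr (D D' : set E) : measurable D -> measurable D' -> measurable_fun setT (F \_ (D `*` D')).
  move=> mD mD'; apply/(measurable_restrictT _ _).1; first exact: measurableX.
  exact: measurable_funTS.
have r0 (D : set (E * E)) z : 0 <= (F \_ D) z by rewrite patchE; case: ifP.
have rE1 (D : set E) x : \int[mu]_y (F \_ (setT `*` D)) (x, y) = \int[mu]_(y in D) F (x, y).
  rewrite [RHS]integral_mkcond; apply: eq_integral => y _.
  by rewrite !patchE in_setX in_setT.
have rE2 (D : set E) y : \int[mu]_x (F \_ (D `*` setT)) (x, y) = \int[mu]_(x in D) F (x, y).
  rewrite [RHS]integral_mkcond; apply: eq_integral => x _.
  by rewrite !patchE in_setX in_setT andbT.
split.
- by under eq_fun do rewrite -rE1; have [] := ge0_tonelli Hleb (mr _ _ measurableT m2) (r0 _).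
- by under eq_fun do rewrite -rE2; have [] := ge0_tonelli Hleb (mr _ _ m1 measurableT) (r0 _).
have [_ _ H] := ge0_tonelli Hleb (mr _ _ m1 m2) (r0 _).
rewrite integral_mkcond [RHS]integral_mkcond.
transitivity (\int[mu]_x \int[mu]_y (F \_ (D1 `*` D2)) (x, y)).
  apply: eq_integral => x _; rewrite patchE; case: ifPn => xD.
    rewrite integral_mkcond; apply: eq_integral => y _.
    by rewrite !patchE in_setX xD.
  by rewrite integral0_eq// => y _; rewrite patchE in_setX (negbTE xD).
rewrite H; apply: eq_integral => y _; rewrite patchE; case: ifPn => yD.
  rewrite [RHS]integral_mkcond; apply: eq_integral => x _.
  by rewrite !patchE in_setX yD andbT.
by rewrite integral0_eq// => x _; rewrite patchE in_setX (negbTE yD) andbF.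
Qed.

Lemma ae_eq_null (f g : E -> \bar R) : mu [set x | f x <> g x] = 0 ->
  {ae mu, forall x, f x = g x}.
Proof. 
move=> h; exists [set x | f x <> g x]; split => //; exact: null_measurable.
Qed.
Lemma ae_null (P : E -> Prop) : mu [set x | ~ P x] = 0 <-> {ae mu, forall x, P x}.
Proof.
split => [h|[A [mA A0 PA]]].
  by exists [set x | ~ P x]; split => //; exact: null_measurable.
by apply/eqP; rewrite eq_le Leb_ge0 andbT -A0; exact: le_Leb.
Qed.
End balls.
Arguments vball {R n} leb r.
Arguments ann {R n} leb a b.

Section nonneg_integrals.
Local Open Scope ereal_scope.
Context d (T : measurableType d) (R : realType) (mu : {measure set T -> \bar R}).

Lemma measurable_absB (f g : T -> R) : measurable_fun setT f -> measurable_fun setT g ->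
  measurable_fun setT (fun x => `|f x - g x|%:E).
Proof.
move=> mf mg; apply/measurable_EFinP.
exact: (measurableT_comp (@normr_measurable R setT) (measurable_funB mf mg)).
Qed.

Lemma measurable_absE (f : T -> R) : measurable_fun setT f ->
  measurable_fun setT (fun x => `|f x|%:E).
Proof.
by move=> mf; apply/measurable_EFinP; exact: (measurableT_comp (@normr_measurable R setT) mf).
Qed.

Lemma ge0_integral_eq0_ae (f : T -> \bar R) : measurable_fun setT f -> (forall x, 0 <= f x) ->
  \int[mu]_x f x = 0 -> {ae mu, forall x, f x = 0}.
Proof.
move=> mf f0 h; have /(ae_eq_integral_abs mu measurableT mf) : \int[mu]_x `|f x| = 0.
  by rewrite -h; apply: eq_integral => x _; rewrite gee0_abs.
by apply: filterS => x /(_ I).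
Qed.

Lemma ae_eq_ge0_integral (D : set T) (f g : T -> \bar R) : measurable D ->
  measurable_fun setT f -> measurable_fun setT g -> (forall x, 0 <= f x) -> (forall x, 0 <= g x) ->
  {ae mu, forall x, f x = g x} -> \int[mu]_(x in D) f x = \int[mu]_(x in D) g x.
Proof.
move=> mD mf mg f0 g0 fg; apply: ge0_ae_eq_integral => //; try exact: measurable_funTS.
by apply: filterS fg => x h _.
Qed.

Lemma ge0_ae0_integral (D : set T) (f : T -> \bar R) : measurable D ->
  measurable_fun setT f -> (forall x, 0 <= f x) ->
  {ae mu, forall x, f x = 0} -> \int[mu]_(x in D) f x = 0.
Proof.
move=> mD mf f0 h; rewrite -(@integral0 _ _ _ mu D).
by apply: ae_eq_ge0_integral => //; exact: measurable_cst.
Qed.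

Lemma ge0_le_integralT (D : set T) (f g : T -> \bar R) : measurable D ->
  measurable_fun setT f -> measurable_fun setT g -> (forall x, 0 <= f x) ->
  (forall x, D x -> f x <= g x) -> \int[mu]_(x in D) f x <= \int[mu]_(x in D) g x.
Proof.
move=> mD mf mg f0 fg; apply: ge0_le_integral => //; try exact: measurable_funTS.
Qed.
End nonneg_integrals.

(** * The Dini condition *)

Section dini.
Context {R : realType} {n : nat} (leb : {measure set (n.-tuple R) -> \bar R}).
Hypothesis Hleb : is_lebesgue_borel leb.
Hypothesis n0 : (0 < n)%N.
Local Notation V := (n.-tuple R).
Local Notation E := (Rn leb).
Local Notation mu := (lebm leb).
Variable Om : V -> R.
Hypothesis Om_hom : forall (s : R) (x : V), 0 < s -> x != vzero -> Om (vscale s x) = Om x.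
Hypothesis mOm : measurable_fun [set: E] (Om : E -> R).
Local Open Scope ereal_scope.

Lemma Om_homT s x : (0 < s)%R -> Om (vscale s x) = Om x.
Proof.
move=> s0; have [->|x0] := eqVneq x (vzero); last exact: Om_hom.
by congr Om; apply: eq_from_tnth => i; rewrite !tnthE mulr0.
Qed.

Lemma vnorm_eq0P (x : V) : (vnorm x == 0%R) = (x == vzero).
Proof. by apply/eqP/eqP => [/vnorm_eq0//|->]; exact: vnorm0. Qed.

Lemma vnorm_gt0 (x : V) : (0 < vnorm x)%R = (x != vzero).
Proof. by rewrite lt_neqAle vnorm_ge0 andbT eq_sym vnorm_eq0P. Qed.

Section homogeneous.
Variable g : V -> \bar R.
Hypotheses (mg : measurable_fun [set: E] (g : E -> \bar R)) (g0 : forall x, 0 <= g x).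
Hypothesis g_hom : forall s x, (0 < s)%R -> g (vscale s x) = g x.

Lemma sph_int_hom : sph_int leb g = n%:R%:E * \int[mu]_(x in ann leb 0 1) g x.
Proof.
rewrite /sph_int -lebmE; congr (_ * _); apply: eq_integral => x; rewrite inE => /andP[x0 _].
by rewrite g_hom// invr_gt0.
Qed.

Lemma hom_int_scale r : (0 < r)%R ->
  \int[mu]_(x in ann leb 0 r) g x = (r ^+ n)%:E * \int[mu]_(x in ann leb 0 1) g x.
Proof.
move=> r0; have ri0 : (0 < r^-1)%R by rewrite invr_gt0.
have := @ge0_integral_vscale _ _ _ Hleb (ann leb 0 1) g (measurable_ann _ _ _) mg g0 _ (lt0r_neq0 ri0).
rewrite annE_scale// mul0r invrK mul1r gtr0_norm// exprVn invrK => <-.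
by apply: eq_integral => x _; rewrite g_hom.
Qed.
End homogeneous.

Lemma int_le_sph (g : V -> \bar R) : (forall x, 0 <= g x) -> 
  \int[mu]_(x in ann leb 0 1) g (vscale (vnorm x)^-1 x) <= sph_int leb g.
Proof.
move=> g0; rewrite /sph_int -lebmE -[leLHS]mul1e; apply: lee_wpmul2r; first exact: integral_ge0.
by rewrite lee_fin ler1n.
Qed.

Let dOm (h x : V) : \bar R := `|Om (vadd x h) - Om x|%:E.

(** Multiplying the argument by [|x|] leaves [Om] unchanged. The spherical difference thus becomes a
    shift of length [|x| |h|], defined on the whole cone over the sphere. *)
Lemma Om_shift_cone h (x : V) : (0 < vnorm x)%R ->
  Om (vadd (vscale (vnorm x)^-1 x) h) = Om (vadd x (vscale (vnorm x) h)).
Proof.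
move=> x0; rewrite -(@Om_homT (vnorm x))//; congr Om.
rewrite vscaleDr vscaleA divff ?gt_eqF// vscale1//.
Qed.

Variables (OB : V -> R) (NB : set V).
Hypothesis mOB : measurable_fun [set: V] OB.
Hypothesis mNB : measurable NB.
Hypothesis NB0 : mu NB = 0.
Hypothesis NBP : forall x, ~ NB x -> Om x = OB x.

Lemma OBE : mu [set x : E | Om x <> OB x] = 0.
Proof.
apply/eqP; rewrite eq_le Leb_ge0 andbT -NB0; apply: le_Leb => x /= h.
by apply: contrapT => /NBP.
Qed.

Lemma mOB_E d (T : measurableType d) (f : T -> V) : measurable_fun setT f ->
  measurable_fun setT (fun x => OB (f x)).
Proof. by move=> mf; exact: (measurableT_comp mOB mf). Qed.

Lemma OB_shift v : {ae mu, forall x : E, Om (vadd x v) = OB (vadd x v)}.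
Proof.
apply/ae_null.
by rewrite -[RHS]OBE; exact: (Leb_shift Hleb v [set x | Om x <> OB x]).
Qed.
Lemma OB_ae : {ae mu, forall x : E, Om x = OB x}.
Proof. by apply/ae_null; exact: OBE. Qed.

(* for almost every [h], the dilated difference can be computed with the Borel version *)
Lemma OB_cone : {ae mu, forall h : E,
  mu [set x : E | Om (vadd x (vscale (vnorm x) h)) <> OB (vadd x (vscale (vnorm x) h))] = 0}.
Proof.
pose F (z : E * E) : \bar R := (\1_NB (vadd z.1 (vscale (vnorm z.1) z.2)))%:E.
have m1 : measurable_fun setT (fun z : E * E => z.1 : V).
  exact: (measurableT_comp (@measurable_toV _ _ leb) measurable_fst).
have m2 : measurable_fun setT (fun z : E * E => z.2 : V).
  exact: (measurableT_comp (@measurable_toV _ _ leb) measurable_snd).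
have mF : measurable_fun setT F.
  apply/measurable_EFinP.
  have m3 : measurable_fun setT (\1_NB : V -> R) by exact: measurable_indic.
  have m4 : measurable_fun setT (fun z : E * E => vadd z.1 (vscale (vnorm z.1) z.2) : V).
    by apply: measurable_vadd => //; apply: measurable_vscale => //; exact: measurable_vnorm.
  exact: (measurableT_comp m3 m4).
have F0 z : 0 <= F z by rewrite lee_fin.
have [mF1 mF2 FF] := ge0_tonelli Hleb mF F0.
(* For fixed [x != 0] the map [h |-> x + |x| h] is affine of ratio [|x|], so the preimage of the
   null set [NB] is null. Tonelli turns this into a statement on almost every [h]. *)
have h1 : \int[mu]_x \int[mu]_y F (x, y) = 0.
  apply: ge0_ae0_integral; [exact: measurableT|exact: mF1|by move=> x; exact: integral_ge0|].
  apply/ae_null; apply/eqP; rewrite eq_le Leb_ge0 andbT.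
  apply: (@le_trans _ _ (mu [set vzero])); last by rewrite Leb_point.
  apply: le_Leb => x /= h; apply: contrapT => x0; apply: h.
  have {}x0 : (0 < vnorm x)%R by rewrite vnorm_gt0; apply/eqP.
  rewrite /F /=.
  rewrite (_ : (fun y => _) = EFin \o \1_((vaff (vnorm x) x : E -> E) @^-1` NB)); last first.
    by apply/funext => y; rewrite /= !indicE vaddC.
  have xn0 : vnorm x != 0%R := lt0r_neq0 x0.
  have mA : measurable ((vaff (vnorm x) x : E -> E) @^-1` NB).
    exact: (measurable_preim_vaff Hleb x xn0 (@borel_measurable _ _ leb _ mNB)).
  rewrite (@integral_indic _ E R mu setT measurableT _ mA) setIT.
  by rewrite (Leb_vaff Hleb x NB xn0) NB0 mule0.
have h2 := ge0_integral_eq0_ae mF2 (fun y => integral_ge0 _ (fun x _ => F0 (x, y))) (etrans (esym FF) h1).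
apply: filterS h2 => h /= hh.
have mFh : measurable_fun setT (fun x => F (x, h)) by exact: (measurableT_comp mF (pair2_measurable h)).
have /ae_null h0 := ge0_integral_eq0_ae mFh (fun x => F0 (x, h)) hh.
apply/eqP; rewrite eq_le Leb_ge0 andbT -h0; apply: le_Leb => x /= hn.
move=> hx; apply: hn; apply: NBP => Nx; move: hx; rewrite /F/= indicE (mem_set Nx).
by move=> /eqP; rewrite eqe oner_eq0.
Qed.

Let B (r : R) : set E := vball leb r.
(** The annulus is larger than [1 < |x| <= 2], so that it still contains that one after a shift of
    length at most 1/2. *)
Let psi (h : E) : \bar R := \int[mu]_(x in ann leb 2^-1 4) `|OB (vadd x h) - OB x|%:E.
Let W := omega1 leb Om.

Lemma mdiff_pair : measurable_fun setT (fun z : E * E => `|OB (vadd z.1 z.2) - OB z.1|%:E).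
Proof.
have m1 : measurable_fun setT (fun z : E * E => z.1 : V).
  exact: (measurableT_comp (@measurable_toV _ _ leb) measurable_fst).
apply: measurable_absB; apply: mOB_E => //.
exact: measurable_vadd_EE.
Qed.

Lemma mdiff_cone : measurable_fun setT
  (fun z : E * E => `|OB (vadd z.1 (vscale (vnorm z.1) z.2)) - OB z.1|%:E).
Proof.
have m1 : measurable_fun setT (fun z : E * E => z.1 : V).
  exact: (measurableT_comp (@measurable_toV _ _ leb) measurable_fst).
have m2 : measurable_fun setT (fun z : E * E => z.2 : V).
  exact: (measurableT_comp (@measurable_toV _ _ leb) measurable_snd).
apply: measurable_absB; apply: mOB_E => //.
by apply: measurable_vadd => //; apply: measurable_vscale => //; exact: measurable_vnorm.
Qed.

Lemma mpsi : measurable_fun setT psi.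
Proof.
by have [] := ge0_tonelli_on Hleb (measurable_ann leb 2^-1 4) measurableT mdiff_pair (fun z => ltac:(by rewrite lee_fin)).
Qed.

Lemma W_ge0 t : (0 <= t)%R -> 0 <= W t.
Proof.
move=> t0; apply: (@le_trans _ _ (sph_int leb (fun x => `|Om (vadd x vzero) - Om x|%:E))).
  by apply: mule_ge0; [rewrite lee_fin|apply: integral_ge0 => x _; rewrite lee_fin].
by apply: ereal_sup_ubound; exists vzero => //=; rewrite vnorm0.
Qed.

(** Up to a null set the integrand is homogeneous of degree zero, so the ball of radius 4 gives
    [4 ^ n] times the unit ball, and the latter is at most the spherical integral defining the
    modulus. *)
Lemma cone_bound (h : V) t : (vnorm h <= t)%R ->
  mu [set x : E | Om (vadd x (vscale (vnorm x) h)) <> OB (vadd x (vscale (vnorm x) h))] = 0 ->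
  \int[mu]_(x in ann leb 2^-1 4) `|OB (vadd x (vscale (vnorm x) h)) - OB x|%:E <=
   (4 ^+ n)%:E * W t.
Proof.
move=> ht hN.
pose g (x : V) : \bar R := `|Om (vadd x (vscale (vnorm x) h)) - Om x|%:E.
have m1 : measurable_fun setT (fun x : E => `|OB (vadd x (vscale (vnorm x) h)) - OB x|%:E).
  exact: (measurableT_comp mdiff_cone (pair2_measurable (h : E))).
have gae : {ae mu, forall x : E, `|OB (vadd x (vscale (vnorm x) h)) - OB x|%:E = g x}.
  by move/ae_null : hN; apply: filterS2 OB_ae => x h1 h2; rewrite /g h1 h2.
have mg : measurable_fun [set: E] (g : E -> \bar R).
  exact: (ae_eq_measurable gae m1).
have g0 x : 0 <= g x by rewrite lee_fin.
have g_hom s x : (0 < s)%R -> g (vscale s x) = g x.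
  move=> s0; rewrite /g vnorm_scale (gtr0_norm s0) (Om_homT x s0).
  have -> : Om (vadd (vscale s x) (vscale (s * vnorm x) h)) = Om (vadd x (vscale (vnorm x) h)).
    by rewrite -[RHS](Om_homT _ s0) vscaleDr vscaleA.
  by [].
rewrite (ae_eq_ge0_integral (measurable_ann leb 2^-1 4) m1 mg _ g0 gae)//.
apply: (@le_trans _ _ (\int[mu]_(x in ann leb 0 4) g x)).
  apply: ge0_subset_integral => //; try exact: measurable_ann; first exact: measurable_funTS.
  by move=> x /andP[h1 h2]; rewrite /ann/= h2 andbT (lt_trans _ h1)// invr_gt0.
rewrite (hom_int_scale mg g0 g_hom)//; apply: lee_wpmul2l; first by rewrite lee_fin exprn_ge0.
apply: (@le_trans _ _ (sph_int leb (fun x => `|Om (vadd x h) - Om x|%:E))).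
  apply: le_trans (int_le_sph _); last by move=> x; rewrite lee_fin.
  rewrite le_eqVlt; apply/orP; left; apply/eqP; apply: eq_integral => x; rewrite inE => /andP[x0 _].
  by rewrite /g Om_shift_cone// Om_homT ?invr_gt0.
by apply: ereal_sup_ubound; exists h.
Qed.

(** For each [x] the substitution [h |-> |x| h] turns the plain shift into the cone shift. The
    Jacobian [|x| ^ n] is at most [4 ^ n], and [|x| > 1/2] sends the ball of radius [2 dl] into the
    one of radius [4 dl]. After Tonelli, [cone_bound] applies for almost every [h]. *)
Lemma dini_avg (dl : R) : (0 < dl)%R ->
  \int[mu]_(h in vball leb (2 * dl)) psi h <=
   (4 ^+ n)%:E * (mu (vball leb (4 * dl)) * ((4 ^+ n)%:E * W (4 * dl))).
Proof.
move=> dl0.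
have F10 z : 0 <= `|OB (vadd z.1 z.2) - OB z.1|%:E by rewrite lee_fin.
have F20 z : 0 <= `|OB (vadd z.1 (vscale (vnorm z.1) z.2)) - OB z.1|%:E by rewrite lee_fin.
have mA := measurable_ann leb 2^-1 4.
have [_ _ <-] := ge0_tonelli_on Hleb mA (measurable_vball leb (2 * dl)) mdiff_pair F10.
have [_ mc hc] := ge0_tonelli_on Hleb mA (measurable_vball leb (4 * dl)) mdiff_cone F20.
have [mb _ _] := ge0_tonelli_on Hleb mA (measurable_vball leb (2 * dl)) mdiff_pair F10.
have [md _ _] := ge0_tonelli_on Hleb mA (measurable_vball leb (4 * dl)) mdiff_cone F20.
apply: (@le_trans _ _ (\int[mu]_(x in ann leb 2^-1 4) ((4 ^+ n)%:E *
   \int[mu]_(h in vball leb (4 * dl)) `|OB (vadd x (vscale (vnorm x) h)) - OB x|%:E))).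
  apply: ge0_le_integralT; [exact: mA|exact: mb| | by move=> x; exact: integral_ge0|].
    by apply: emeasurable_funM; [exact: measurable_cst|exact: md].
  move=> x /andP[x1 x2]; have x0 : (0 < vnorm x)%R by apply: lt_trans x1; rewrite invr_gt0.
  pose f (y : E) : \bar R := `|OB (vadd x y) - OB x|%:E.
  have mf : measurable_fun setT f.
    exact: (measurableT_comp mdiff_pair (pair1_measurable x)).
  have f0 y : 0 <= f y by rewrite lee_fin.
  have := ge0_integral_vscale Hleb (measurable_vball leb (2 * dl)) mf f0 (lt0r_neq0 x0).
  rewrite vballE_scale// gtr0_norm// => H.
  have -> : \int[mu]_(y in vball leb (2 * dl)) `|OB (vadd (x, y).1 (x, y).2) - OB (x, y).1|%:E =
     (vnorm x ^+ n)%:E * \int[mu]_(h in vball leb (2 * dl / vnorm x)) f (vscale (vnorm x) h).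
    by rewrite H muleA -EFinM divff ?mul1e// expf_neq0// gt_eqF.
  apply: lee_pmul; [by rewrite lee_fin exprn_ge0// ltW|exact: integral_ge0| |].
    by rewrite lee_fin; apply: lerXn2r => //; rewrite nnegrE ltW.
  apply: ge0_subset_integral; [exact: measurable_vball|exact: measurable_vball| | |].
  - by apply: measurable_funTS; exact: (measurableT_comp mdiff_cone (pair1_measurable x)).
  - by [].
  - move=> h; rewrite /vball/= => /le_trans; apply; rewrite ler_pdivrMr// -mulrA mulrCA.
    by have := ltW dl0; nra.
rewrite ge0_integralZl; [|exact: mA|exact: (measurable_funTS md)|by move=> x _; exact: integral_ge0|by rewrite lee_fin].
apply: lee_wpmul2l; [by rewrite lee_fin|rewrite hc].
apply: (@le_trans _ _ (\int[mu]_(h in vball leb (4 * dl)) ((4 ^+ n)%:E * W (4 * dl)))).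
  apply: ae_ge0_le_integral.
  - exact: measurable_vball.
  - by move=> h _; exact: integral_ge0.
  - exact: (measurable_funTS mc).
  - by move=> h _; rewrite mule_ge0 ?W_ge0// ?lee_fin ?mulr_ge0// ltW.
  - exact: measurable_cst.
  - by apply: filterS OB_cone => h hN hb; exact: cone_bound.
rewrite integral_cst; last exact: measurable_vball.
by rewrite muleC.
Qed.

Lemma psi_ge0 h : 0 <= psi h.
Proof. by apply: integral_ge0 => x _; rewrite lee_fin. Qed.

(** The 2 counts the two terms of a triangle inequality. The three factors [4 ^ n] are the Jacobian
    in [dini_avg], the dilation in [cone_bound] and the ratio of the balls of radii [4 dl] and
    [dl]. *)
Definition dini_cst : R := (2 * (4 ^+ n * 4 ^+ n * 4 ^+ n))%R.

Lemma mdOm h : measurable_fun [set: E] ((fun x => dOm h x) : E -> \bar R).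
Proof.
exact: (measurable_absB (measurableT_comp mOm (measurable_shift Hleb h)) mOm).
Qed.

(** A fixed shift [h0] is compared with shifts by [h'] and [h' + h0], and [h'] is averaged over the
    ball of radius [dl]. Only averages of [psi] remain, to which the estimate for almost every shift
    applies; the result holds for every [h0]. *)
Lemma dini_shell (dl : R) h0 : (0 < dl)%R -> (dl <= 2^-1)%R -> (vnorm h0 <= dl)%R ->
  \int[mu]_(x in ann leb 1 2) `|Om (vadd x h0) - Om x|%:E <= dini_cst%:E * W (4 * dl).
Proof.
move=> dl0 dl2 h0dl.
pose f h (x : E) : \bar R := `|OB (vadd x h) - OB x|%:E.
have mf h : measurable_fun setT (f h).
  exact: (measurableT_comp mdiff_pair (pair2_measurable (h : E))).
have f0 h x : 0 <= f h x by rewrite lee_fin.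
pose S h : \bar R := \int[mu]_(x in ann leb 1 2) f h x.
have mA := measurable_ann leb 2^-1 4.
have mA1 := measurable_ann leb 1 2.
have -> : \int[mu]_(x in ann leb 1 2) `|Om (vadd x h0) - Om x|%:E = S h0.
  apply: (ae_eq_ge0_integral mA1 (mdOm h0) (mf h0)) => //; first by move=> x; rewrite lee_fin.
  by apply: filterS2 OB_ae (OB_shift h0) => x e1 e2; rewrite /f /dOm e1 e2.
have key h' : (vnorm h' <= dl)%R -> S h0 <= psi h' + psi (vadd h' h0).
  move=> h'dl.
  have ms : measurable_fun setT (fun x : E => f h' (vadd x h0)).
    exact: (measurableT_comp (mf h') (measurable_shift Hleb h0)).
  have mfv := mf (vadd h' h0).
  apply: (@le_trans _ _ (\int[mu]_(x in ann leb 1 2) (f h' (vadd x h0) + f (vadd h' h0) x))).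
    rewrite /S; apply: ge0_le_integralT; [exact: mA1|exact: (mf h0)|exact: (emeasurable_funD ms mfv)|exact: (f0 h0)|].
    move=> x _; rewrite /f -EFinD lee_fin.
    have -> : vadd (vadd x h0) h' = vadd x (vadd h' h0) by rewrite (vaddC h') vaddA.
    rewrite (distrC (OB (vadd x (vadd h' h0)))).
    exact: ler_distD.
  rewrite (ge0_integralD mu mA1 (fun x _ => f0 h' (vadd x h0)) (measurable_funTS ms) (fun x _ => f0 (vadd h' h0) x) (measurable_funTS mfv)).
  apply: leeD.
    rewrite /psi -(ge0_integral_shift Hleb mA (mf h') (f0 h') h0).
    apply: ge0_subset_integral; [exact: mA1| |exact: (measurable_funTS ms)|by move=> *; exact: f0|].
      by rewrite -[X in measurable X]setTI; exact: (measurable_shift Hleb h0 measurableT mA).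
    move=> x /andP[x1 x2]; rewrite /ann/=.
    have := vnormD x h0; have := vnorm_ge_add x h0; move: h0dl dl2 => a1 a2 a3 a4.
    by apply/andP; split; lra.
  apply: ge0_subset_integral; [exact: mA1|exact: mA|exact: (measurable_funTS mfv)|by move=> *; exact: f0|].
  by move=> x /andP[x1 x2]; rewrite /ann/=; apply/andP; split; lra.
have mB1 := measurable_vball leb dl.
have mp := mpsi.
have mps : measurable_fun setT (fun h : E => psi (vadd h h0)).
  exact: (measurableT_comp mp (measurable_shift Hleb h0)).
have I1 : S h0 * mu (vball leb dl) <= 2%:E * \int[mu]_(h in vball leb (2 * dl)) psi h.
  rewrite -(integral_cst mu mB1).
  apply: (@le_trans _ _ (\int[mu]_(h in vball leb dl) (psi h + psi (vadd h h0)))).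
    apply: ge0_le_integralT; [exact: mB1|exact: measurable_cst|exact: (emeasurable_funD mp mps)| |].
      by move=> hh /=; apply: integral_ge0 => x _; exact: f0.
    by move=> h hb; exact: key.
  rewrite (ge0_integralD mu mB1 (fun x _ => psi_ge0 x) (measurable_funTS mp) (fun x _ => psi_ge0 (vadd x h0)) (measurable_funTS mps)).
  have -> : 2%:E = 1 + 1 :> \bar R by rewrite -EFinD.
  have mB2 := measurable_vball leb (2 * dl).
  rewrite ge0_muleDl ?lee_fin// !mul1e.
  apply: leeD.
    apply: ge0_subset_integral; [exact: mB1|exact: mB2|exact: (measurable_funTS mp)|by move=> *; exact: psi_ge0|].
    by move=> h; rewrite /vball/=; lra.
  rewrite -(ge0_integral_shift Hleb mB2 mp psi_ge0 h0).
  apply: ge0_subset_integral; [exact: mB1| |exact: (measurable_funTS mps)|by move=> *; exact: psi_ge0|].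
    by rewrite -[X in measurable X]setTI; exact: (measurable_shift Hleb h0 measurableT mB2).
  by move=> h; rewrite /vball/= => h1; apply: le_trans (vnormD _ _) _; lra.
have B0 := Leb_ball_gt0 Hleb dl0.
have Bf : mu (vball leb dl) \is a fin_num by rewrite ge0_fin_numE ?Leb_ge0 ?Leb_ball_fin.
have I2 : S h0 * mu (vball leb dl) <= (dini_cst%:E * W (4 * dl)) * mu (vball leb dl).
  apply: le_trans I1 _.
  apply: (@le_trans _ _ (2%:E * ((4 ^+ n)%:E * (mu (vball leb (4 * dl)) * ((4 ^+ n)%:E * W (4 * dl)))))).
    by apply: lee_wpmul2l => //; exact: dini_avg.
  rewrite (Leb_ball_scale Hleb dl)// /dini_cst -(fineK Bf).
  have W0 := W_ge0 (mulr_ge0 (ler0n R 4) (ltW dl0)).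
  rewrite le_eqVlt; apply/orP; left; apply/eqP.
  rewrite !muleA -!EFinM; rewrite muleAC; congr (_ * _); rewrite -EFinM; congr EFin; ring.
by move: I2; rewrite lee_pmul2r// ?lt0e_neq0// => /(_ B0).
Qed.

End dini.

(** * Kernel estimates *)

Section powers.
Context {R : realType}.
Implicit Types (r b x y : R) (n : nat).

Lemma one_sub_exprn_le n r : 0 <= r -> r <= 1 -> 1 - r ^+ n <= n%:R * (1 - r).
Proof.
move=> r0 r1; elim: n => [|n IH]; first by rewrite expr0 subrr mul0r.
rewrite exprS; have : r ^+ n <= 1 by rewrite exprn_ile1.
have : 0 <= r ^+ n by rewrite exprn_ge0.
move: (r ^+ n) IH => t; rewrite -[n.+1]addn1 natrD; nra.
Qed.

(** As [0 < b <= n], the power [r ^ b] lies between 1 and [r ^ n], and Bernoulli's inequality makes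
    the bound linear in [r - 1]. The factor [2 ^ n] bounds [r ^ - n] for [r >= 1/2]. *)
Lemma powR_ratio_sub1 n b r : 0 < b -> b <= n%:R -> 2^-1 <= r ->
  `|r `^ (- b) - 1| <= n%:R * 2 ^+ n * `|r - 1|.
Proof.
move=> b0 bn r2; have r0 : 0 < r by apply: lt_le_trans r2; rewrite invr_gt0.
have rb0 : 0 < r `^ b by exact: powR_gt0.
have two1 : 1 <= (2 : R) ^+ n by rewrite exprn_ege1// ler1n.
have r0' := ltW r0.
have r01 : r <= 1 -> 0 < r <= 1 by move=> ->; rewrite r0.
rewrite powRN; have [r1|r1] := leP r 1.
  have rb1 : r `^ b <= 1 by rewrite -(powRr0 r) ger_powR ?r01// ltW.
  rewrite ger0_norm ?subr_ge0 ?invf_ge1//.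
  rewrite ler0_norm ?subr_le0// opprB.
  have h1 : r ^+ n <= r `^ b by rewrite -(powR_mulrn n r0') ger_powR ?r01.
  have rn0 : 0 < r ^+ n by exact: exprn_gt0.
  apply: (@le_trans _ _ ((r ^+ n)^-1 - 1)); first by rewrite lerB// lef_pV2.
  have -> : (r ^+ n)^-1 - 1 = (1 - r ^+ n) / r ^+ n by field; rewrite gt_eqF.
  have h2 : (r ^+ n)^-1 <= 2 ^+ n.
    rewrite -exprVn; apply: lerXn2r; rewrite ?nnegrE ?invr_ge0//.
    by rewrite -(invrK 2) lef_pV2 ?posrE ?invr_gt0.
  have h3 := one_sub_exprn_le n r0' r1.
  rewrite -mulrA [2 ^+ n * _]mulrC mulrA.
  by apply: ler_pM => //; rewrite ?subr_ge0 ?exprn_ile1// invr_ge0 ltW.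
have r1' := ltW r1.
have r10 : 0 <= r^-1 by rewrite invr_ge0.
have r11 : r^-1 <= 1 by rewrite invf_le1.
have rb1 : 1 <= r `^ b by rewrite -(powRr0 r) ler_powR// ltW.
rewrite ler0_norm ?subr_le0 ?invf_le1//.
rewrite gtr0_norm ?subr_gt0// opprB.
have h1 : r `^ b <= r ^+ n by rewrite -(powR_mulrn n r0') ler_powR.
apply: (@le_trans _ _ (1 - (r^-1) ^+ n)).
  by rewrite lerB// exprVn lef_pV2// posrE// exprn_gt0.
apply: le_trans (one_sub_exprn_le n r10 r11) _.
rewrite -mulrA ler_wpM2l//.
have : 1 - r^-1 <= r - 1.
  rewrite -subr_ge0 (_ : r - 1 - (1 - r^-1) = (r - 1) ^+ 2 / r).
    by rewrite divr_ge0 ?sqr_ge0.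
  by field; rewrite gt_eqF.
by move=> /le_trans; apply; rewrite ler_peMl// subr_ge0.
Qed.

Lemma powR_sub_le n b x y : 0 < b -> b <= n%:R -> 0 < x -> x / 2 <= y ->
  `|y `^ (- b) - x `^ (- b)| <= n%:R * 2 ^+ n * (`|y - x| / x) * x `^ (- b).
Proof.
move=> b0 bn x0 xy.
have y0 : 0 < y by apply: lt_le_trans xy; rewrite divr_gt0.
have -> : y `^ (- b) - x `^ (- b) = x `^ (- b) * ((y / x) `^ (- b) - 1).
  by rewrite mulrBr mulr1 -powRM ?divr_ge0 ?ltW// mulrC divfK// gt_eqF.
rewrite normrM (ger0_norm (powR_ge0 _ _)) mulrC ler_wpM2r ?powR_ge0//.
apply: le_trans (powR_ratio_sub1 b0 bn _) _; first by rewrite ler_pdivlMr// mulrC.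
rewrite (_ : y / x - 1 = (y - x) / x); last by field; rewrite gt_eqF.
by rewrite normrM normfV (gtr0_norm x0).
Qed.
End powers.

Section kernel.
Context {R : realType} {n : nat} (leb : {measure set (n.-tuple R) -> \bar R}).
Hypothesis Hleb : is_lebesgue_borel leb.
Hypothesis n0 : (0 < n)%N.
Local Notation V := (n.-tuple R).
Local Notation E := (Rn leb).
Local Notation mu := (lebm leb).
Variable a : R.
Hypotheses (a0 : 0 <= a) (an : a < n%:R).
Let b := n%:R - a.
Let b0 : 0 < b. Proof. by rewrite subr_gt0. Qed.
Let bn : b <= n%:R. Proof. by rewrite gerBl. Qed.

Lemma kernE (Om : V -> R) x : kern Om a x = Om x * vnorm x `^ (- b).
Proof. by rewrite /kern powRN. Qed.

Lemma kern_scale (Om : V -> R) s x :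
  (forall s x, 0 < s -> Om (vscale s x) = Om x) -> 0 < s ->
  kern Om a (vscale s x) = s `^ (- b) * kern Om a x.
Proof.
move=> hom s0; rewrite !kernE hom// vnorm_scale gtr0_norm// powRM ?vnorm_ge0 ?ltW//; ring.
Qed.

Lemma measurable_kern d (T : measurableType d) (Om : V -> R) (f : T -> V) :
  measurable_fun setT (fun x => Om (f x)) -> measurable_fun setT f ->
  measurable_fun setT (fun x => kern Om a (f x)).
Proof.
move=> mO mf; under eq_fun do rewrite kernE.
apply: measurable_funM => //.
exact: (measurableT_comp (@measurable_powR R (- b)) (measurable_vnorm mf)).
Qed.

(** The increment splits into an angular one, with weight at most [2 ^ n |x| ^ - b] because
    [|x + h| >= |x| / 2], and a radial one, which is [|K x|] times a multiple of [|h| / |x|]. *)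
Lemma kern_diff (Om : V -> R) x h : 0 < vnorm x -> 2 * vnorm h <= vnorm x ->
  `|kern Om a (vadd x h) - kern Om a x| <=
  2 ^+ n * (`|Om (vadd x h) - Om x| * vnorm x `^ (- b)) +
  n%:R * 2 ^+ n * (vnorm h / vnorm x) * `|kern Om a x|.
Proof.
move=> x0 hx; rewrite !kernE.
set N := vnorm x; set M := vnorm (vadd x h).
have MN : N / 2 <= M.
  have := vnorm_ge_add x h; rewrite -/M -/N; move: hx; rewrite -/N => h1 h2.
  lra.
have M0 : 0 < M by apply: lt_le_trans MN; rewrite divr_gt0.
have -> : Om (vadd x h) * M `^ (- b) - Om x * N `^ (- b) =
    (Om (vadd x h) - Om x) * M `^ (- b) + Om x * (M `^ (- b) - N `^ (- b)) by ring.
apply: le_trans (ler_normD _ _) _; apply: lerD.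
  rewrite normrM (ger0_norm (powR_ge0 _ _)) mulrCA ler_wpM2l//.
  rewrite !powRN.
  have -> : 2 ^+ n / N `^ b = (N `^ b / 2 ^+ n)^-1 by rewrite invfM invrK mulrC.
  rewrite lef_pV2 ?posrE ?divr_gt0 ?powR_gt0 ?exprn_gt0//.
  apply: (@le_trans _ _ ((N / 2) `^ b)); last first.
    by apply: ge0_ler_powR; rewrite ?nnegrE ?divr_ge0// ltW.
  rewrite powRM ?vnorm_ge0 ?invr_ge0// ler_wpM2l ?powR_ge0//.
  rewrite -exprVn -powR_mulrn ?invr_ge0//.
  by rewrite ger_powR// invr_gt0 ltr0n/= invf_le1// ler1n.
rewrite normrM; have := powR_sub_le b0 bn x0 MN => h1.
apply: (@le_trans _ _ (`|Om x| * (n%:R * 2 ^+ n * (`|M - N| / N) * N `^ (- b)))).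
  by rewrite ler_wpM2l.
rewrite normrM (ger0_norm (powR_ge0 _ _)).
have -> : `|Om x| * (n%:R * 2 ^+ n * (`|M - N| / N) * N `^ (- b)) =
  n%:R * 2 ^+ n * (`|M - N| / N) * (`|Om x| * N `^ (- b)) by ring.
rewrite ler_wpM2r ?mulr_ge0 ?powR_ge0// ler_wpM2l ?mulr_ge0 ?exprn_ge0//.
rewrite ler_wpM2r ?invr_ge0 ?vnorm_ge0//.
have h2 := vnormD x h; have h3 := vnorm_le_sub (vadd x h) h.
have h4 := vnorm_ge_add x h.
by rewrite ler_norml -/M -/N in h2 h4 *; lra.
Qed.

Variable Om : V -> R.
Hypothesis Om_hom : forall (s : R) (x : V), 0 < s -> x != vzero -> Om (vscale s x) = Om x.
Hypothesis mOm : measurable_fun [set: E] (Om : E -> R).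
Hypothesis Om_dini : L1_Dini leb a Om.
Let W := omega1 leb Om.
Local Open Scope ereal_scope.

(** The contribution of the scale [t = 2 ^ - i] to the Dini integral, up to a constant. *)
Definition dini_term (i : nat) : \bar R := (((2 ^+ i) `^ a)%R)%:E * W ((2 ^+ i)^-1)%R.

Lemma W_homo s t : (s <= t)%R -> W s <= W t.
Proof.
move=> st; apply: le_ereal_sup => _ [h hs <-]; exists h => //=.
exact: le_trans hs st.
Qed.

Lemma dini_term_ge0 i : 0 <= dini_term i.
Proof.
by apply: mule_ge0; [rewrite lee_fin powR_ge0|apply: W_ge0; rewrite invr_ge0 exprn_ge0].
Qed.

Lemma measurable_W : measurable_fun setT (W : R -> \bar R).
Proof.
apply: (measurability _ (ErealGenOInfty.measurableE R)) => // _ [_ [y ->] <-].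
rewrite setTI; apply: is_interval_measurable => s t /= hs ht u /andP[su ut].
move: hs; rewrite !in_itv/= !andbT => /lt_le_trans; apply; exact: W_homo.
Qed.

Let itv k : set R := `](2 ^- k.+1)%R, (2 ^- k)%R]%classic.

Lemma itv_cover : \bigcup_k itv k = `]0%R, 1%R]%classic.
Proof.
apply/seteqP; split => [t [k _]|t]; rewrite /itv /= !in_itv/=.
  move=> /andP[h1 h2]; apply/andP; split.
    by apply: le_lt_trans h1; rewrite invr_ge0 exprn_ge0.
  by apply: le_trans h2 _; rewrite -exprVn exprn_ile1// invf_le1// ler1n.
move=> /andP[t0 t1].
have ex : exists k, (2 ^- k.+1 < t)%R.
  exists (Num.bound t^-1); rewrite -[ltRHS]invrK ltf_pV2 ?posrE ?exprn_gt0 ?invr_gt0//.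
  apply: lt_trans (archi_boundP _) _; first by rewrite invr_ge0 ltW.
  by rewrite -natrX ltr_nat; apply: leq_trans (ltn_expl _ _) (leq_pexp2l _ _).
case: (ex_minnP ex) => k hk kmin.
exists k => //=; rewrite in_itv/= hk/=.
case: k {hk} kmin => [|k'] kmin; first by rewrite expr0 invr1.
by rewrite leNgt; apply/negP => /kmin; rewrite ltnn.
Qed.

Lemma itv_disj : trivIset setT itv.
Proof.
have key i j t : (i < j)%N -> itv i t -> itv j t -> False.
  rewrite /itv /= !in_itv/= => ij /andP[h1 _] /andP[_ h2].
  have := lt_le_trans h1 h2; rewrite ltf_pV2 ?posrE ?exprn_gt0//.
  by rewrite ltNge => /negP; apply; rewrite ler_weXn2l// ler1n.
apply/trivIsetP => i j _ _ ij; apply/seteqP; split => // t [ti tj].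
by move: ij; rewrite neq_ltn => /orP[h|h]; [exact: (key i j t)|exact: (key j i t)].
Qed.

(** On []2 ^ - (k + 1), 2 ^ - k]] the modulus is at least its value at the lower end and the weight
    at least its value at the upper end; the length [2 ^ - (k + 1)] then gives [c = 2 * 2 ^ a].
    Monotonicity controls the modulus only at lower ends, hence the sum starts at index 1. *)
Lemma dini_series : \sum_(k <oo) dini_term k.+1 < +oo.
Proof.
pose g (t : R) : \bar R := W t * ((t `^ (1 + a))^-1)%:E.
have [_ gfin] := Om_dini; rewrite -/g in gfin.
have mg : measurable_fun setT g.
  apply: emeasurable_funM; first exact: measurable_W.
  apply/measurable_EFinP; under eq_fun do rewrite -powRN.
  exact: measurable_powR.
have g0 t : `]0%R, 1%R]%classic t -> 0 <= g t.
  rewrite /= in_itv/= => /andP[t0 _]; apply: mule_ge0; first by apply: W_ge0; exact: ltW.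
  by rewrite lee_fin invr_ge0 powR_ge0.
have mi k : measurable (itv k) by exact: measurable_itv.
pose c : R := (2 * 2 `^ a)%R.
have c0 : (0 <= c)%R by rewrite mulr_ge0// powR_ge0.
have sub k : itv k `<=` `]0%R, 1%R]%classic by rewrite -itv_cover; exact: bigcup_sup.
have step k : dini_term k.+1 <= c%:E * \int[lebesgue_measure]_(t in itv k) g t.
  pose w : \bar R := W (2 ^- k.+1)%R * (((2 ^- k) `^ (1 + a))^-1)%:E.
  have w0 : 0 <= w by apply: mule_ge0; [apply: W_ge0; rewrite invr_ge0 exprn_ge0|rewrite lee_fin invr_ge0 powR_ge0].
  apply: (@le_trans _ _ (c%:E * \int[lebesgue_measure]_(t in itv k) w)); last first.
    apply: lee_wpmul2l; first by rewrite lee_fin.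
    apply: ge0_le_integralT; [exact: mi|exact: measurable_cst|exact: mg|by move=> ?; exact: w0|].
    move=> t tk; have := sub k t tk; move: tk; rewrite /itv /= !in_itv/= => /andP[h1 h2] /andP[h3 h4].
    apply: lee_pmul.
    - by apply: W_ge0; rewrite invr_ge0 exprn_ge0.
    - by rewrite lee_fin invr_ge0 powR_ge0.
    - by apply: W_homo; exact: ltW.
    - have k0 : (0 < 2 ^- k :> R)%R by rewrite invr_gt0 exprn_gt0.
      have hh : (t `^ (1 + a) <= (2 ^- k) `^ (1 + a))%R.
        by apply: ge0_ler_powR; rewrite ?nnegrE ?addr_ge0//; exact: ltW.
      by rewrite lee_fin lef_pV2 ?posrE ?powR_gt0.
  have h2 : (0 < 2 ^+ k :> R)%R by rewrite exprn_gt0.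
  have lk : lebesgue_measure (itv k) = (2 ^- k - 2 ^- k.+1)%:E.
    rewrite /itv lebesgue_measure_itv/= lte_fin ifT -?EFinB//.
    by rewrite ltf_pV2 ?posrE ?exprn_gt0// exprS ltr_pMl// ltr1n.
  have -> : \int[lebesgue_measure]_(_ in itv k) w = w * (2 ^- k - 2 ^- k.+1)%:E.
    by rewrite -lk; exact: (@integral_cst _ (measurableTypeR R) R lebesgue_measure (itv k) (mi k) w).
  rewrite /w /dini_term -/W -[X in c%:E * X]muleA -EFinM muleCA -EFinM muleC.
  rewrite le_eqVlt; apply/orP; left; apply/eqP; congr (_ * _%:E).
  have e1 : (((2 ^- k) `^ (1 + a))^-1 = 2 ^+ k * (2 ^+ k) `^ a :> R)%R.
    rewrite powRD; last by rewrite invr_eq0 expf_eq0 pnatr_eq0 andbF implybT.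
    rewrite powRr1 ?invr_ge0 ?ltW// invfM invrK; congr (_ * _)%R.
    by rewrite -[in LHS]powR_inv1 ?ltW// -powRrM mulN1r powRN invrK.
  rewrite e1 /c exprS powRM ?ltW//.
  by field; rewrite ?gt_eqF// ?exprn_gt0.
have := @ge0_integral_bigcup _ (measurableTypeR R) R lebesgue_measure itv g mi.
rewrite itv_cover => /(_ (measurable_funTS mg) g0 itv_disj) e.
rewrite e in gfin.
apply: (@le_lt_trans _ _ (\sum_(k <oo) c%:E * \int[lebesgue_measure]_(t in itv k) g t)).
  by apply: lee_nneseries => k _; [move=> _; exact: dini_term_ge0|exact: step].
rewrite nneseriesZl//; last by move=> k _; apply: integral_ge0 => t tk; apply: g0; exact: sub tk.
by rewrite lte_mul_pinfty.
Qed.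

Variables (OB : V -> R) (NB : set V).
Hypothesis mOB : measurable_fun [set: V] OB.
Hypothesis mNB : measurable NB.
Hypothesis NB0 : mu NB = 0.
Hypothesis NBP : forall x, ~ NB x -> Om x = OB x.

Let dOm (h x : V) : \bar R := `|Om (vadd x h) - Om x|%:E.
Let mdOm h : measurable_fun [set: E] ((dOm h) : E -> \bar R).
Proof. exact: (measurable_absB (measurableT_comp mOm (measurable_shift Hleb h)) mOm). Qed.
Let dOm0 h x : 0 <= dOm h x. Proof. by rewrite lee_fin. Qed.
Let C1 : R := @dini_cst R n.
Lemma dini_cst_ge0 : (0 <= C1)%R.
Proof. by rewrite /C1 /dini_cst !mulr_ge0. Qed.

(** A dilation reduces to the shell of radius 1, where [dini_shell] is used with
    [dl = 2 ^ - (i + 2)], so that [4 * dl] is [2 ^ - i]. *)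
Lemma dOm_shell s h i : (0 < s)%R -> (vnorm h <= s * 2 ^- i.+2)%R ->
  \int[mu]_(x in ann leb s (2 * s)) dOm h x <= (s ^+ n * C1)%:E * W (2 ^- i)%R.
Proof.
move=> s0 hs; have si0 : (0 < s^-1)%R by rewrite invr_gt0.
pose h' := vscale s^-1 h.
have := ge0_integral_vscale Hleb (measurable_ann leb 1 2) (mdOm h') (dOm0 h') (lt0r_neq0 si0).
rewrite annE_scale// invrK mul1r gtr0_norm// exprVn invrK => H.
have -> : \int[mu]_(x in ann leb s (2 * s)) dOm h x = (s ^+ n)%:E * \int[mu]_(x in ann leb 1 2) dOm h' x.
  rewrite -H; apply: eq_integral => x _; rewrite /dOm /h' -vscaleDr.
  by rewrite !(Om_homT Om_hom _ si0).
rewrite EFinM -muleA; apply: lee_wpmul2l; first by rewrite lee_fin exprn_ge0// ltW.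
have dl0 : (0 < 2 ^- i.+2 :> R)%R by rewrite invr_gt0 exprn_gt0.
have -> : (2 ^- i = 4 * 2 ^- i.+2 :> R)%R.
  by rewrite !exprS; field; rewrite gt_eqF// exprn_gt0.
apply: (dini_shell Hleb n0 Om_hom mOm mOB mNB NB0 NBP dl0).
  by rewrite lef_pV2 ?posrE ?exprn_gt0// -[leLHS]expr1 ler_weXn2l// ler1n.
by rewrite /h' vnorm_scale gtr0_norm// mulrC ler_pdivrMr// mulrC.
Qed.

Definition dini_tail i : \bar R := \sum_(k <oo) dini_term (i + k).

Lemma dini_tail_ge0 i : 0 <= dini_tail i.
Proof. by apply: nneseries_ge0 => k _ _; exact: dini_term_ge0. Qed.

Lemma far_cover (s : R) : (0 < s)%R ->
  [set x : E | (s < vnorm x)%R] = \bigcup_k ann leb (2 ^+ k * s)%R (2 * (2 ^+ k * s))%R.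
Proof.
move=> s0; apply/seteqP; split => [x /= sx|x [k _ /andP[h _]]/=]; last first.
  by apply: le_lt_trans h; rewrite ler_peMl ?exprn_ege1 ?ler1n// ltW.
have ex : exists k, (vnorm x <= 2 * (2 ^+ k * s))%R.
  exists (Num.bound (vnorm x / s)); rewrite mulrA -exprS -ler_pdivrMr//.
  apply: le_trans (ltW (archi_boundP _)) _; first by rewrite divr_ge0 ?vnorm_ge0// ltW.
  by rewrite -natrX ler_nat; apply: leq_trans (ltnW (ltn_expl _ _)) (leq_pexp2l _ _).
case: (ex_minnP ex) => k hk kmin; exists k => //; rewrite /ann/= hk andbT.
case: k {hk} kmin => [|k] kmin; first by rewrite expr0 mul1r.
by rewrite ltNge; apply/negP => h; move: (kmin k); rewrite mulrA -exprS => /(_ h); rewrite ltnn.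
Qed.

Lemma far_disj (s : R) : (0 < s)%R -> trivIset setT (fun k => ann leb (2 ^+ k * s)%R (2 * (2 ^+ k * s))%R).
Proof.
move=> s0; have key i j x : (i < j)%N -> ann leb (2 ^+ i * s)%R (2 * (2 ^+ i * s))%R x ->
    ann leb (2 ^+ j * s)%R (2 * (2 ^+ j * s))%R x -> False.
  move=> ij /andP[_ h1] /andP[h2 _]; have := lt_le_trans h2 h1.
  by rewrite mulrA -exprS ltr_pM2r// ltNge ler_weXn2l// ler1n.
apply/trivIsetP => i j _ _ ij; apply/seteqP; split => // t [ti tj].
by move: ij; rewrite neq_ltn => /orP[h|h]; [exact: (key i j t)|exact: (key j i t)].
Qed.

Lemma measurable_vnorm_powR r : measurable_fun setT (fun x : E => (vnorm x `^ r)%:E).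
Proof.
apply/measurable_EFinP.
exact: (measurableT_comp (@measurable_powR R r) (@measurable_vnormE R n leb)).
Qed.

(** On the shell of radius [t = 2 ^ k * 2 ^ (i + 2) * r] the shift is relatively of size
    [2 ^ - (i + k + 2)]. The powers combine to [t ^ n * t ^ - b = t ^ a = (4 * r) ^ a * 2 ^ ((i + k)
    a)], which is exactly the weight of [dini_term (i + k)]. *)
Lemma far_dOm (r : R) h i : (0 < r)%R -> (vnorm h <= r)%R ->
  \int[mu]_(x in [set x : E | (2 ^+ i.+2 * r < vnorm x)%R])
     (dOm h x * (vnorm x `^ (- b))%:E) <=
  (C1 * 4 `^ a * r `^ a)%:E * dini_tail i.
Proof.
move=> r0 hr; set s := (2 ^+ i.+2 * r)%R.
have s0 : (0 < s)%R by rewrite mulr_gt0// exprn_gt0.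
have mg : measurable_fun setT (fun x : E => dOm h x * (vnorm x `^ (- b))%:E).
  by apply: emeasurable_funM; [exact: mdOm|exact: measurable_vnorm_powR].
have g0 x : 0 <= dOm h x * (vnorm x `^ (- b))%:E by rewrite mule_ge0// lee_fin powR_ge0.
have ma k := measurable_ann leb (2 ^+ k * s)%R (2 * (2 ^+ k * s))%R.
rewrite (far_cover s0).
rewrite (@ge0_integral_bigcup _ E R mu _ _ ma (measurable_funTS mg) (fun x _ => g0 x) (far_disj s0)).
have c0 : (0 <= C1 * 4 `^ a * r `^ a)%R by rewrite !mulr_ge0 ?powR_ge0 ?dini_cst_ge0.
rewrite /dini_tail -nneseriesZl//; last by move=> k _; exact: dini_term_ge0.
apply: lee_nneseries => k _; first by move=> _; apply: integral_ge0.
set t := (2 ^+ k * s)%R; have t0 : (0 < t)%R by rewrite mulr_gt0// exprn_gt0.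
apply: (@le_trans _ _ (\int[mu]_(x in ann leb t (2 * t)) ((t `^ (- b))%:E * dOm h x))).
  apply: ge0_le_integralT; [exact: ma|exact: mg| |exact: g0|].
    by apply: emeasurable_funM; [exact: measurable_cst|exact: mdOm].
  move=> x /andP[x1 _]; rewrite muleC; apply: lee_wpmul2r => //.
  rewrite lee_fin !powRN lef_pV2 ?posrE ?powR_gt0//; last exact: lt_trans x1.
  by apply: ge0_ler_powR; rewrite ?nnegrE ?vnorm_ge0//; exact: ltW.
rewrite ge0_integralZl; [|exact: ma|exact: (measurable_funTS (mdOm h))|by move=> *; exact: dOm0|by rewrite lee_fin powR_ge0].
apply: (@le_trans _ _ ((t `^ (- b))%:E * ((t ^+ n * C1)%:E * W (2 ^- (i + k))%R))).
  apply: lee_wpmul2l; first by rewrite lee_fin powR_ge0.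
  apply: dOm_shell => //; apply: le_trans hr _.
  have p2 j : (2 ^+ j != 0 :> R)%R by rewrite expf_neq0.
  have -> : (t / 2 ^+ (i + k).+2 = r)%R by rewrite /t /s !exprS exprD; field; rewrite !p2.
  exact: lexx.
rewrite /dini_term !muleA -!EFinM le_eqVlt; apply/orP; left; apply/eqP; congr (_%:E * _).
have e1 : (t `^ (- b) * t ^+ n = t `^ a)%R.
  rewrite -(powR_mulrn n (ltW t0)) -powRD; last by apply/implyP => _; rewrite gt_eqF.
  by congr (_ `^ _)%R; rewrite /b; ring.
rewrite mulrA e1 mulrC.
have -> : t = (4 * r * 2 ^+ (i + k))%R.
  by rewrite /t /s exprD !exprS; ring.
rewrite powRM ?exprn_ge0 ?mulr_ge0// ?(ltW r0)//; rewrite powRM// ?(ltW r0)//; ring.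
Qed.

End kernel.

(** * Zero mean of the kernel on annuli when the order is zero *)

Section zero_mean.
Context {R : realType} {n : nat} (leb : {measure set (n.-tuple R) -> \bar R}).
Hypothesis Hleb : is_lebesgue_borel leb.
Hypothesis n0 : (0 < n)%N.
Local Notation V := (n.-tuple R).
Local Notation E := (Rn leb).
Local Notation mu := (lebm leb).
Local Open Scope ereal_scope.

Lemma ann_split (s t u : R) : (s <= t)%R -> (t <= u)%R ->
  ann leb s u = ann leb s t `|` ann leb t u /\ [disjoint ann leb s t & ann leb t u].
Proof.
move=> st tu; split.
  apply/seteqP; split => x; rewrite /ann/=.
    by move=> /andP[h1 h2]; have [h|h] := leP (vnorm x) t; [left|right]; rewrite ?h1 ?h2 ?h.
  by move=> [|] /andP[h1 h2]; apply/andP; split => //; [exact: le_trans tu|exact: le_lt_trans h1].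
by apply/disj_setPS => x [/andP[_ h1] /andP[h2 _]]; have := lt_le_trans h2 h1; rewrite ltxx.
Qed.

Section radial.
Variable G : V -> R.
Hypotheses (mG : measurable_fun [set: E] (G : E -> R)) (G0 : forall x, (0 <= G x)%R).
Hypothesis G_hom : forall s x, (0 < s)%R -> G (vscale s x) = G x.
Variable g : R.
Hypothesis Gg : \int[mu]_(x in ann leb 0 1) (G x)%:E = g%:E.

Let mGE : measurable_fun [set: E] ((fun x => (G x)%:E) : E -> \bar R).
Proof. exact/measurable_EFinP. Qed.
Let P s t : \bar R := \int[mu]_(x in ann leb s t) (G x * vnorm x `^ (- n%:R))%:E.
Let mP : measurable_fun [set: E] ((fun x => (G x * vnorm x `^ (- n%:R))%:E) : E -> \bar R).
Proof.
apply/measurable_EFinP.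
exact: (measurable_funM mG (measurableT_comp (@measurable_powR R (- n%:R)) (@measurable_vnormE R n leb))).
Qed.
Let P0 x : 0 <= (G x * vnorm x `^ (- n%:R))%:E.
Proof. by rewrite lee_fin mulr_ge0// powR_ge0. Qed.

Lemma g_ge0 : (0 <= g)%R.
Proof. by rewrite -lee_fin -Gg; apply: integral_ge0 => x _; rewrite lee_fin. Qed.

Lemma radial_ball r : (0 < r)%R -> \int[mu]_(x in ann leb 0 r) (G x)%:E = (r ^+ n * g)%:E.
Proof.
move=> r0; rewrite (hom_int_scale (g := fun x => (G x)%:E) Hleb mGE)//; first by rewrite Gg -EFinM.
by move=> s x s0; rewrite G_hom.
Qed.

Lemma radial_ann s t : (0 < s)%R -> (s <= t)%R ->
  \int[mu]_(x in ann leb s t) (G x)%:E = ((t ^+ n - s ^+ n) * g)%:E.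
Proof.
move=> s0 st; have t0 : (0 < t)%R by exact: lt_le_trans st.
have [e dj] := ann_split (ltW s0) st.
have := radial_ball t0; rewrite e ge0_integral_setU; last first.
- exact: dj.
- by move=> x _; rewrite lee_fin.
- exact: (measurable_funTS mGE).
- exact: measurable_ann.
- exact: measurable_ann.
rewrite radial_ball//; set I := (X in _ + X = _ -> _) => h.
have If : I \is a fin_num.
  by have : (s ^+ n * g)%:E + I \is a fin_num; [rewrite h|rewrite fin_numD => /andP[]].
move: h; rewrite -/I -{1}(fineK If) -EFinD => -[h].
by rewrite -[LHS](fineK If) mulrBl -h; congr (_%:E); ring.
Qed.

Lemma radial_pow_bound s t : (0 < s)%R -> (s <= t)%R ->
  (t ^- n * ((t ^+ n - s ^+ n) * g))%:E <= P s t <= (s ^- n * ((t ^+ n - s ^+ n) * g))%:E.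
Proof.
move=> s0 st; have t0 : (0 < t)%R by exact: lt_le_trans st.
have mA := measurable_ann leb s t.
have aux c : (0 <= c)%R -> \int[mu]_(x in ann leb s t) (c%:E * (G x)%:E) = (c * ((t ^+ n - s ^+ n) * g))%:E.
  move=> c0; rewrite ge0_integralZl; [by rewrite radial_ann|exact: mA|exact: (measurable_funTS mGE)|by move=> *; rewrite lee_fin|by rewrite lee_fin].
have ti : (0 <= t ^- n)%R by rewrite invr_ge0 exprn_ge0// ltW.
have si : (0 <= s ^- n)%R by rewrite invr_ge0 exprn_ge0// ltW.
have mc c : measurable_fun [set: E] ((fun x => c%:E * (G x)%:E) : E -> \bar R).
  by apply: emeasurable_funM; [exact: measurable_cst|exact: mGE].
have pow x : (vnorm x `^ (- n%:R) = vnorm x ^- n)%R.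
  by rewrite powRN powR_mulrn// vnorm_ge0.
apply/andP; split; rewrite -aux//.
  apply: ge0_le_integralT; [exact: mA|exact: mc|exact: mP|by move=> x; rewrite -EFinM lee_fin mulr_ge0|].
  move=> x /andP[x1 x2]; rewrite -EFinM lee_fin mulrC ler_wpM2l// pow.
  have x0 : (0 < vnorm x)%R by exact: lt_trans x1.
  by rewrite lef_pV2 ?posrE ?exprn_gt0// lerXn2r// ?nnegrE ?vnorm_ge0// ltW.
apply: ge0_le_integralT; [exact: mA|exact: mP|exact: mc|exact: P0|].
move=> x /andP[x1 x2]; rewrite -EFinM lee_fin [leRHS]mulrC ler_wpM2l// pow.
have x0 : (0 < vnorm x)%R by exact: lt_trans x1.
by rewrite lef_pV2 ?posrE ?exprn_gt0// lerXn2r// ?nnegrE ?vnorm_ge0//; exact: ltW.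
Qed.

(** [|x| ^ - n dx] is invariant under dilations and [G] is homogeneous of degree zero. *)
Lemma radial_pow_scale s t c : (0 < c)%R -> P (c * s) (c * t) = P s t.
Proof.
move=> c0; have ci0 : (0 < c^-1)%R by rewrite invr_gt0.
have := ge0_integral_vscale Hleb (measurable_ann leb s t) mP P0 (lt0r_neq0 ci0).
rewrite annE_scale// invrK gtr0_norm// exprVn invrK ![(_ * c)%R]mulrC => H.
have cn0 : (0 < c ^+ n)%R by rewrite exprn_gt0.
have : \int[mu]_(x in ann leb (c * s) (c * t)) (G (vscale c^-1 x) * vnorm (vscale c^-1 x) `^ (- n%:R))%:E =
   (c ^+ n)%:E * P (c * s) (c * t).
  rewrite /P -ge0_integralZl; [|exact: measurable_ann|exact: (measurable_funTS mP)|by move=> *; exact: P0|by rewrite lee_fin ltW].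
  apply: eq_integral => x _; rewrite -EFinM G_hom// vnorm_scale gtr0_norm//.
  rewrite powRM ?vnorm_ge0 ?(ltW ci0)//; congr EFin.
  have -> : (c^-1 `^ (- n%:R) = c ^+ n)%R by rewrite powRN powR_mulrn ?(ltW ci0)// exprVn invrK.
  ring.
rewrite H => /(congr1 (fun z => (c ^- n)%:E * z)).
by rewrite !muleA -EFinM mulVf ?mul1e// gt_eqF.
Qed.

Lemma radial_pow_add s t u : (s <= t)%R -> (t <= u)%R -> P s u = P s t + P t u.
Proof.
move=> st tu; have [e dj] := ann_split st tu.
rewrite /P e ge0_integral_setU; [by []|exact: measurable_ann|exact: measurable_ann|exact: (measurable_funTS mP)|by move=> *; exact: P0|exact: dj].
Qed.

Lemma radial_pow_fin s t : (0 < s)%R -> (s <= t)%R -> P s t \is a fin_num.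
Proof.
move=> s0 st; have /andP[_ h] := radial_pow_bound s0 st.
by rewrite ge0_fin_numE ?(le_lt_trans h) ?ltry//; apply: integral_ge0.
Qed.
End radial.

Variable Om : V -> R.
Hypothesis Om_hom : forall (s : R) (x : V), (0 < s)%R -> Om (vscale s x) = Om x.
Hypothesis mOm : measurable_fun [set: E] (Om : E -> R).
Variable A : R.
Hypothesis OmA : \int[mu]_(x in ann leb 0 1) `|Om x|%:E = A%:E.
Hypothesis Om0 : \int[mu]_(x in ann leb 0 1) (Om x)%:E = 0.

Let Gp (x : V) : R := Num.max (Om x) 0%R.
Let Gm (x : V) : R := Num.max (- Om x)%R 0%R.
Let mGp : measurable_fun [set: E] (Gp : E -> R).
Proof. exact: (measurable_funrpos mOm). Qed.
Let mGm : measurable_fun [set: E] (Gm : E -> R).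
Proof. exact: (measurable_funrneg mOm). Qed.
Let Gp0 x : (0 <= Gp x)%R. Proof. by rewrite /Gp le_max lexx orbT. Qed.
Let Gm0 x : (0 <= Gm x)%R. Proof. by rewrite /Gm le_max lexx orbT. Qed.
Let Gp_hom s x : (0 < s)%R -> Gp (vscale s x) = Gp x. Proof. by move=> s0; rewrite /Gp Om_hom. Qed.
Let Gm_hom s x : (0 < s)%R -> Gm (vscale s x) = Gm x. Proof. by move=> s0; rewrite /Gm Om_hom. Qed.
Let GpGm x : (Gp x - Gm x = Om x)%R.
Proof. by rewrite /Gp /Gm; case: (leP (Om x) 0%R); case: (leP (- Om x)%R 0%R); lra. Qed.
Let GpOm x : (Gp x <= `|Om x|)%R.
Proof. by rewrite /Gp ge_max ler_norm normr_ge0. Qed.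
Let GmOm x : (Gm x <= `|Om x|)%R.
Proof. by rewrite /Gm ge_max -normrN ler_norm normr_ge0. Qed.

Let part_fin (G : V -> R) : measurable_fun [set: E] (G : E -> R) -> (forall x, (0 <= G x)%R) ->
  (forall x, (G x <= `|Om x|)%R) ->
  exists g, \int[mu]_(x in ann leb 0 1) (G x)%:E = g%:E.
Proof.
move=> mG G0 GO.
have h : \int[mu]_(x in ann leb 0 1) (G x)%:E \is a fin_num.
  rewrite ge0_fin_numE; last by apply: integral_ge0 => x _; rewrite lee_fin.
  apply: le_lt_trans (ltry A); rewrite -OmA.
  apply: ge0_le_integralT; [exact: measurable_ann|exact/measurable_EFinP| |by move=> x; rewrite lee_fin|by move=> x _; rewrite lee_fin].
  exact: measurable_absE.
by exists (fine (\int[mu]_(x in ann leb 0 1) (G x)%:E)); rewrite fineK.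
Qed.

Let part_integrable (G : V -> R) s t : measurable_fun [set: E] (G : E -> R) ->
  (forall x, (0 <= G x)%R) -> \int[mu]_(x in ann leb s t) (G x)%:E \is a fin_num ->
  mu.-integrable (ann leb s t) (EFin \o G).
Proof.
move=> mG G0 h; apply/integrableP; split; first by apply: measurable_funTS; exact/measurable_EFinP.
have -> : \int[mu]_(x in ann leb s t) `|(EFin \o G) x| = \int[mu]_(x in ann leb s t) (G x)%:E.
  by apply: eq_integral => x _ /=; rewrite ger0_norm.
by move: h; rewrite fin_numElt => /andP[].
Qed.

(** A substitute for polar coordinates. The positive and negative parts of [Om] have equal mass on
    every annulus without the weight; with the weight, two bounds that differ by a factor
    [(t / s) ^ n] enclose both masses, and scale invariance improves this to equality. *)
Lemma kern_ann_mean0 s t : (0 < s)%R -> (s <= t)%R ->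
  \int[mu]_(x in ann leb s t) (Om x * vnorm x `^ (- n%:R))%:E = 0.
Proof.
have [gp hgp] := part_fin mGp Gp0 GpOm.
have [gm hgm] := part_fin mGm Gm0 GmOm.
have gpm : gp = gm.
  have : \int[mu]_(x in ann leb 0 1) ((EFin \o Gp) x - (EFin \o Gm) x) = 0.
    by rewrite -Om0; apply: eq_integral => x _; rewrite /= -EFinB GpGm.
  rewrite integralB//; [|exact: measurable_ann|by apply: part_integrable => //; rewrite hgp|by apply: part_integrable => //; rewrite hgm].
  by rewrite /= hgp hgm -EFinB => -[] /eqP; rewrite subr_eq0 => /eqP.
subst gm.
have g0 := g_ge0 Gp0 hgp.
pose wt (x : V) : R := (vnorm x `^ (- n%:R))%R.
have wt0 x : (0 <= wt x)%R by exact: powR_ge0.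
have mwt : measurable_fun [set: E] (wt : E -> R).
  exact: (measurableT_comp (@measurable_powR R (- n%:R)) (@measurable_vnormE R n leb)).
pose Pp s t := \int[mu]_(x in ann leb s t) (Gp x * wt x)%:E.
pose Pm s t := \int[mu]_(x in ann leb s t) (Gm x * wt x)%:E.
have Ppf u v : (0 < u)%R -> (u <= v)%R -> Pp u v \is a fin_num by exact: (radial_pow_fin mGp Gp0 Gp_hom hgp).
have Pmf u v : (0 < u)%R -> (u <= v)%R -> Pm u v \is a fin_num by exact: (radial_pow_fin mGm Gm0 Gm_hom hgm).
(* halving: the defect on [1 < |x| <= q^2] is twice the defect on [1 < |x| <= q], and it is quadratically small in [q - 1] *)
pose D q := (fine (Pp 1%R q) - fine (Pm 1%R q))%R.
have Dsq q : (1 <= q)%R -> D (q * q)%R = (2 * D q)%R.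
  move=> q1; have q0 : (0 < q)%R by exact: lt_le_trans q1.
  have qq : (q <= q * q)%R by rewrite ler_peMl// ltW.
  have e1 : Pp 1%R (q * q)%R = Pp 1%R q + Pp 1%R q.
    rewrite {1}/Pp (radial_pow_add mGp Gp0 q1 qq); congr (_ + _).
    by have := radial_pow_scale mGp Gp0 Gp_hom 1%R q q0; rewrite mulr1.
  have e2 : Pm 1%R (q * q)%R = Pm 1%R q + Pm 1%R q.
    rewrite {1}/Pm (radial_pow_add mGm Gm0 q1 qq); congr (_ + _).
    by have := radial_pow_scale mGm Gm0 Gm_hom 1%R q q0; rewrite mulr1.
  have f1 := Ppf 1%R q ltr01 q1; have f2 := Pmf 1%R q ltr01 q1.
  rewrite /D e1 e2 (fineD f1 f1) (fineD f2 f2).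
  by move: (fine (Pp _ _)) (fine (Pm _ _)) => u v; lra.
have Dbound q : (1 <= q)%R -> (`|D q| <= gp * (q ^+ n - 1) ^+ 2)%R.
  move=> q1; have q0 : (0 < q)%R by exact: lt_le_trans q1.
  have qn : (1 <= q ^+ n)%R by exact: exprn_ege1.
  have := radial_pow_bound mGp Gp0 Gp_hom hgp ltr01 q1.
  have := radial_pow_bound mGm Gm0 Gm_hom hgm ltr01 q1.
  rewrite -/(Pp 1%R q) -/(Pm 1%R q) -(fineK (Ppf _ _ ltr01 q1)) -(fineK (Pmf _ _ ltr01 q1)).
  rewrite !lee_fin !expr1n invr1 !mul1r => /andP[m1 m2] /andP[p1 p2].
  have h : ((q ^+ n - 1) * gp - q ^- n * ((q ^+ n - 1) * gp) <= gp * (q ^+ n - 1) ^+ 2)%R.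
    have qi : (0 < q ^- n)%R by rewrite invr_gt0 exprn_gt0.
    have qi2 : (q ^- n * q ^+ n = 1)%R by rewrite mulVf// gt_eqF// exprn_gt0.
    have -> : ((q ^+ n - 1) * gp - q ^- n * ((q ^+ n - 1) * gp) = gp * (q ^+ n - 1) * (1 - q ^- n))%R by ring.
    rewrite expr2 mulrA ler_wpM2l// ?mulr_ge0 ?subr_ge0//.
    rewrite -subr_ge0 (_ : _ - _ = q ^- n * (q ^+ n - 1) ^+ 2)%R; last first.
      by field; rewrite gt_eqF// exprn_gt0.
    by rewrite mulr_ge0 ?sqr_ge0// ltW.
  by rewrite /D ler_norml; apply/andP; split; lra.
(* Iterated square roots: with [r ^ 2 = q] the defect at [q] is twice the one at [r], while
   [(r ^ n - 1) ^ 2] is at most a quarter of [(q ^ n - 1) ^ 2]. Each step gains a factor 1/2. *)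
have Dpow j : forall q, (1 <= q)%R -> (`|D q| <= gp * (q ^+ n - 1) ^+ 2 / 2 ^+ j)%R.
  elim: j => [|j IH] q q1; first by rewrite expr0 divr1; exact: Dbound.
  have q0 : (0 <= q)%R by exact: le_trans q1.
  pose r := Num.sqrt q.
  have r1 : (1 <= r)%R by rewrite -sqrtr1 ler_wsqrtr.
  have qr : q = (r * r)%R by rewrite -expr2 sqr_sqrtr.
  rewrite qr Dsq// normrM (ger0_norm (ler0n _ 2)) exprMn.
  have h := IH r r1.
  have rn : (1 <= r ^+ n)%R by exact: exprn_ege1.
  have XY : (4 * (r ^+ n - 1) ^+ 2 <= (r ^+ n * r ^+ n - 1) ^+ 2)%R.
    have -> : (r ^+ n * r ^+ n - 1 = (r ^+ n - 1) * (r ^+ n + 1))%R by ring.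
    rewrite exprMn mulrC ler_wpM2l ?sqr_ge0// -[4%R](_ : 2 ^+ 2 = _)%R; last by rewrite expr2; ring.
    by rewrite lerXn2r ?nnegrE ?addr_ge0//; lra.
  have t0 : (0 <= (2 ^+ j)^-1 :> R)%R by rewrite invr_ge0 exprn_ge0.
  have := ler_wpM2l (mulr_ge0 g0 t0) XY.
  have -> : ((2 ^+ j.+1)^-1 = (2 ^+ j)^-1 / 2 :> R)%R by rewrite exprS invfM mulrC.
  move: h; move: ((2 ^+ j)^-1)%R (_ ^+ 2)%R (_ ^+ 2)%R => w X Y h1 h2; lra.
have D0 q : (1 <= q)%R -> D q = 0%R.
  move=> q1; apply/eqP; rewrite -normr_le0; apply/ler_addgt0Pl => e e0; rewrite addr0.
  set c := (gp * (q ^+ n - 1) ^+ 2)%R.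
  have c0 : (0 <= c)%R by rewrite mulr_ge0// sqr_ge0.
  have := Dpow (Num.bound (c / e)) q q1; move/le_trans; apply.
  rewrite -/c ler_pdivrMr ?exprn_gt0// -ler_pdivrMl// mulrC.
  apply: le_trans (ltW (archi_boundP _)) _; first by rewrite divr_ge0// ltW.
  by rewrite -natrX ler_nat ltnW// ltn_expl.
move=> s0 st; have t1 : (1 <= t / s)%R by rewrite ler_pdivlMr// mul1r.
have sc (G : V -> R) : measurable_fun [set: E] (G : E -> R) -> (forall x, (0 <= G x)%R) ->
   (forall s x, (0 < s)%R -> G (vscale s x) = G x) ->
   \int[mu]_(x in ann leb s t) (G x * wt x)%:E = \int[mu]_(x in ann leb 1 (t / s)) (G x * wt x)%:E.
  move=> mG G0 Gh; have := radial_pow_scale mG G0 Gh 1%R (t / s)%R s0.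
  by rewrite mulr1 mulrCA divff ?mulr1// gt_eqF.
transitivity (\int[mu]_(x in ann leb s t) ((EFin \o (fun x => Gp x * wt x)%R) x - (EFin \o (fun x => Gm x * wt x)%R) x)).
  by apply: eq_integral => x _; rewrite /= -EFinB -mulrBl GpGm.
have mpp : measurable_fun [set: E] ((fun x => Gp x * wt x)%R : E -> R) by exact: (measurable_funM mGp mwt).
have mmm : measurable_fun [set: E] ((fun x => Gm x * wt x)%R : E -> R) by exact: (measurable_funM mGm mwt).
rewrite integralB; last 3 first.
- exact: measurable_ann.
- by apply: part_integrable => //; [move=> x; rewrite mulr_ge0|exact: Ppf].
- by apply: part_integrable => //; [move=> x; rewrite mulr_ge0|exact: Pmf].
rewrite /= (sc Gp mGp Gp0 Gp_hom) (sc Gm mGm Gm0 Gm_hom) -/(Pp 1%R _) -/(Pm 1%R _).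
rewrite -(fineK (Ppf _ _ ltr01 t1)) -(fineK (Pmf _ _ ltr01 t1)) -EFinB.
by have := D0 _ t1; rewrite /D => ->.
Qed.
End zero_mean.

(** * The operator away from the support *)

Section operator.
Context {R : realType} {n : nat} (leb : {measure set (n.-tuple R) -> \bar R}).
Hypothesis Hleb : is_lebesgue_borel leb.
Hypothesis n0 : (0 < n)%N.
Local Notation V := (n.-tuple R).
Local Notation E := (Rn leb).
Local Notation mu := (lebm leb).
Variable a : R.
Hypotheses (a0 : 0 <= a) (an : a < n%:R).
Let b := n%:R - a.
Let b0 : 0 < b. Proof. by rewrite subr_gt0. Qed.
Variables (O : V -> R).
Hypothesis mO : measurable_fun [set: V] O.
Local Notation K := (kern O a).
Local Open Scope ereal_scope.

Lemma m_fstE : measurable_fun setT (fun z : E * E => z.1 : V).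
Proof. exact: (measurableT_comp (@measurable_toV _ _ leb) measurable_fst). Qed.
Lemma m_sndE : measurable_fun setT (fun z : E * E => z.2 : V).
Proof. exact: (measurableT_comp (@measurable_toV _ _ leb) measurable_snd). Qed.

Lemma mO_comp d (T : measurableType d) (f : T -> V) : measurable_fun setT f ->
  measurable_fun setT (fun x => O (f x)).
Proof. by move=> mf; exact: (measurableT_comp mO mf). Qed.
Lemma mK_comp d (T : measurableType d) (f : T -> V) : measurable_fun setT f ->
  measurable_fun setT (fun x => K (f x)).
Proof. by move=> mf; apply: measurable_kern => //; exact: mO_comp. Qed.
Lemma mvsub x : measurable_fun [set: E] ((fun y => vsub x y) : E -> V).
Proof. by apply: measurable_vsub; [exact: measurable_cst|exact: measurable_toV]. Qed.
Lemma mKE : measurable_fun [set: E] (K : E -> R).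
Proof. by apply: mK_comp; exact: measurable_toV. Qed.
Lemma mKx x : measurable_fun [set: E] ((fun y => K (vsub x y)) : E -> R).
Proof. by apply: mK_comp; exact: mvsub. Qed.

(** The part of [T h - K int h] caused by the angular variation of the kernel. It is controlled in
    mean by the Dini condition, unlike the radial part, which is controlled pointwise by [|K|]. *)
Definition osc (h : E -> R) (x : E) : \bar R :=
  \int[mu]_y (`|O (vsub x y) - O x| * vnorm x `^ (- b) * `|h y|)%:E.

Let mosc_pair (h : E -> R) : measurable_fun setT h ->
  measurable_fun setT (fun z : E * E => (`|O (vsub z.1 z.2) - O z.1| * vnorm z.1 `^ (- b) * `|h z.2|)%:E).
Proof.
move=> mh; apply/measurable_EFinP.
have m1 : measurable_fun setT (fun z : E * E => (O (vsub z.1 z.2) - O z.1)%R).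
  apply: measurable_funB; apply: mO_comp; last exact: m_fstE.
  by apply: measurable_vsub; [exact: m_fstE|exact: m_sndE].
have m2 : measurable_fun setT (fun z : E * E => (vnorm z.1 `^ (- b))%R).
  exact: (measurableT_comp (@measurable_powR R (- b)) (measurable_vnorm m_fstE)).
have m3 : measurable_fun setT (fun z : E * E => h z.2) by exact: (measurableT_comp mh measurable_snd).
have mn := @normr_measurable R setT.
exact: (measurable_funM (measurable_funM (measurableT_comp mn m1) m2) (measurableT_comp mn m3)).
Qed.
Let osc0 (h : E -> R) x y : 0 <= (`|O (vsub x y) - O x| * vnorm x `^ (- b) * `|h y|)%:E.
Proof. by rewrite lee_fin !mulr_ge0// powR_ge0. Qed.

Lemma measurable_osc h : measurable_fun setT h -> measurable_fun setT (osc h).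
Proof.
move=> mh; have [m1 _ _] := ge0_tonelli Hleb (mosc_pair mh) (fun z => osc0 h z.1 z.2).
exact: m1.
Qed.
Lemma osc_ge0 h x : 0 <= osc h x.
Proof. by apply: integral_ge0 => y _; exact: osc0. Qed.

Variables (C : R) (e : nat -> R).
Hypothesis C0 : (0 <= C)%R.
Hypothesis e0 : forall i, (0 <= e i)%R.
(** The exponent [i.+3] gives [|x| > 8 r] already for [i = 0] and matches the region of [far_dOm] at
    index [i.+1]. *)
Definition far (i : nat) (r : R) : set E := [set x : E | (2 ^+ i.+3 * r < vnorm x)%R].
Hypothesis hfar : forall r h i, (0 < r)%R -> (vnorm h <= r)%R ->
  \int[mu]_(x in far i r) (`|O (vadd x h) - O x|%:E * (vnorm x `^ (- b))%:E) <= (C * r `^ a * e i)%:E.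

Lemma measurable_farE i r : measurable (far i r).
Proof. exact: measurable_far. Qed.

(** By Tonelli each [y] in the support is treated apart, as a shift by [- y] of length at most
    [r]. *)
Lemma osc_far (h : E -> R) r i : (0 < r)%R -> measurable_fun setT h ->
  (forall y, (r < vnorm y)%R -> h y = 0%R) ->
  \int[mu]_(x in far i r) osc h x <= (C * r `^ a * e i)%:E * \int[mu]_y `|h y|%:E.
Proof.
move=> r0 mh hsupp.
have [_ m2 ->] := ge0_tonelli_on Hleb (measurable_farE i r) measurableT (mosc_pair mh) (fun z => osc0 h z.1 z.2).
have c0 : (0 <= C * r `^ a * e i)%R by rewrite !mulr_ge0// powR_ge0.
have mh' : measurable_fun setT (fun y => `|h y|%:E) by exact: measurable_absE.
rewrite -(ge0_integralZl mu measurableT mh') => [|y _|]; [|by rewrite lee_fin|by rewrite lee_fin].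
apply: ge0_le_integralT; [exact: measurableT|exact: m2| |by move=> y; apply: integral_ge0 => x _; exact: osc0|].
  by apply: emeasurable_funM; [exact: measurable_cst|exact: mh'].
move=> y _ /=.
have [hy|hy] := leP (vnorm y) r; last first.
  by rewrite (hsupp y hy) normr0 mule0 integral0_eq// => x _; rewrite mulr0.
have ms : measurable_fun setT (fun x : E => `|O (vadd x (vscale (-1) y)) - O x|%:E * (vnorm x `^ (- b))%:E).
  apply: emeasurable_funM.
    apply: measurable_absB; apply: mO_comp; last exact: measurable_toV.
    by apply: measurable_vadd; [exact: measurable_toV|exact: measurable_cst].
  by apply: measurable_vnorm_powR.
apply: (@le_trans _ _ (\int[mu]_(x in far i r) (`|h y|%:E * (`|O (vadd x (vscale (-1) y)) - O x|%:E * (vnorm x `^ (- b))%:E)))).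
  rewrite le_eqVlt; apply/orP; left; apply/eqP; apply: eq_integral => x _.
  by rewrite -!EFinM vsubE mulrC.
rewrite ge0_integralZl; [|exact: measurable_farE|exact: (measurable_funTS ms)|by move=> x _; rewrite mule_ge0// lee_fin// powR_ge0|by rewrite lee_fin].
rewrite muleC; apply: lee_wpmul2r; first by rewrite lee_fin.
by apply: hfar => //; rewrite vnormN.
Qed.

(** If [|x| > 2 r], every [y] in the support has [|x - y| > r], so truncation below [r] removes
    nothing. The principal value is then the limit of an eventually constant function. *)
Lemma T_fun_far (h : E -> R) r x : (0 < r)%R -> (forall y, (r < vnorm y)%R -> h y = 0%R) ->
  (2 * r < vnorm x)%R -> T_fun leb h O a x = \int[mu]_y (K (vsub x y) * h y)%:E.
Proof.
move=> r0 hsupp xr.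
have key eps : (eps < r)%R -> Ttr_fun leb h O a eps x = \int[mu]_y (K (vsub x y) * h y)%:E.
  move=> er; rewrite /Ttr_fun -lebmE integral_mkcond; apply: eq_integral => y _.
  rewrite patchE; case: ifPn => // /negP; rewrite inE /= => /negP; rewrite -leNgt => hy.
  rewrite hsupp ?mulr0//.
  have := vnorm_le_sub x y; lra.
rewrite /T_fun; case: eqP => [_|_]; last exact: key.
apply: lim_near_cst => //.
by near=> eps; apply: key; near: eps; exact: nbhs_right_lt.
Unshelve. all: by end_near. Qed.

(** [K (x - y) - K x] is integrated against [h] by means of [kern_diff]; on [far i r] the radial
    factor [|y| / |x|] is at most [2 ^ - (i + 3)]. *)
Lemma bracket (h : E -> R) r x i : (0 < r)%R -> measurable_fun setT h ->
  (forall y, (r < vnorm y)%R -> h y = 0%R) -> \int[mu]_y `|h y|%:E < +oo -> far i r x ->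
  `| T_fun leb h O a x - (K x)%:E * \int[mu]_y (h y)%:E | <=
  (2 ^+ n)%:E * osc h x + (n%:R * 2 ^+ n / 2 ^+ i.+3 * `|K x|)%:E * \int[mu]_y `|h y|%:E.
Proof.
move=> r0 mh hsupp hfin xfar.
have i8 : (8 <= 2 ^+ i.+3 :> R)%R.
  have h1 : (1 <= 2 ^+ i :> R)%R by rewrite exprn_ege1// ler1n.
  by rewrite !exprS; lra.
have x8 : (8 * r < vnorm x)%R by apply: le_lt_trans xfar; rewrite ler_wpM2r// ltW.
rewrite (T_fun_far r0 hsupp); last by lra.
have hi : mu.-integrable setT (EFin \o h).
  by apply/integrableP; split; [exact/measurable_EFinP|].
have Hf : \int[mu]_y `|h y|%:E \is a fin_num.
  by rewrite ge0_fin_numE//; apply: integral_ge0 => y _; rewrite lee_fin.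
set H := \int[mu]_y `|h y|%:E in Hf *.
have H0 : 0 <= H by apply: integral_ge0 => y _; rewrite lee_fin.
set c := (n%:R * 2 ^+ n / 2 ^+ i.+3 * `|K x|)%R.
have c0 : (0 <= c)%R by rewrite !mulr_ge0.
(* An infinite oscillation makes the bound trivial; a finite one provides the integrability that the
   splitting below relies on. *)
have [oo|ofin] := eqVneq (osc h x) +oo.
  by rewrite oo gt0_muley ?lte_fin ?exprn_gt0// -(fineK Hf) -EFinM addye ?leey.
have osc_fin : osc h x < +oo by rewrite ltey.
have x0 : (0 < vnorm x)%R by lra.
have pw y : (`|(K (vsub x y) - K x) * h y| <=
   2 ^+ n * (`|O (vsub x y) - O x| * vnorm x `^ (- b) * `|h y|) + c * `|h y|)%R.
  have [hy|hy] := leP (vnorm y) r; last by rewrite (hsupp y hy) normr0 !mulr0 normr0 addr0.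
  rewrite normrM vsubE.
  have := kern_diff a0 an O (h := vscale (-1) y) x0; rewrite vnormN => /(_ _).
  have hyx : (2 * vnorm y <= vnorm x)%R by lra.
  move=> /(_ hyx) kd.
  apply: (@le_trans _ _ ((2 ^+ n * (`|O (vadd x (vscale (-1) y)) - O x| * vnorm x `^ (- b)) + c) * `|h y|)%R).
    rewrite ler_wpM2r//; apply: le_trans kd _; rewrite lerD2l /c ler_wpM2r//.
    rewrite ler_wpM2l ?mulr_ge0 ?exprn_ge0// ler_pdivrMr// ler_pdivlMl ?exprn_gt0//.
    apply: le_trans (ltW xfar); rewrite ler_wpM2l// exprn_ge0//.
  by rewrite mulrDl !mulrA.
have mKh : measurable_fun [set: E] (fun y : E => (K (vsub x y) - K x) * h y)%R.
  exact: (measurable_funM (measurable_funB (mKx x) (measurable_cst (K x))) mh).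
have mo : measurable_fun setT (fun y : E => (`|O (vsub x y) - O x| * vnorm x `^ (- b) * `|h y|)%:E).
  exact: (measurableT_comp (mosc_pair mh) (pair1_measurable x)).
have mh' : measurable_fun setT (fun y => `|h y|%:E) by exact: measurable_absE.
have two0 : (0 <= 2 ^+ n :> R)%R by rewrite exprn_ge0.
have bnd : \int[mu]_y `|(K (vsub x y) - K x) * h y|%:E <= (2 ^+ n)%:E * osc h x + c%:E * H.
  rewrite /osc -(ge0_integralZl mu measurableT mo) => [|y _|]; [|exact: osc0|by rewrite lee_fin].
  rewrite /H -(ge0_integralZl mu measurableT mh') => [|y _|]; [|by rewrite lee_fin|by rewrite lee_fin].
  have mo2 : measurable_fun setT (fun y : E => (2 ^+ n)%:E * (`|O (vsub x y) - O x| * vnorm x `^ (- b) * `|h y|)%:E).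
    by apply: emeasurable_funM; [exact: measurable_cst|exact: mo].
  have mh2 : measurable_fun setT (fun y : E => c%:E * `|h y|%:E).
    by apply: emeasurable_funM; [exact: measurable_cst|exact: mh'].
  rewrite -(ge0_integralD mu measurableT _ mo2 _ mh2) => [|y _|y _]; [|by rewrite mule_ge0// lee_fin|by rewrite mule_ge0// lee_fin].
  apply: ge0_le_integralT; [exact: measurableT|exact: measurable_absE| |by move=> y; rewrite lee_fin|].
    exact: (emeasurable_funD mo2 mh2).
  by move=> y _; rewrite -!EFinM -EFinD lee_fin; exact: pw.
have i1 : mu.-integrable setT (EFin \o (fun y : E => (K (vsub x y) - K x) * h y)%R).
  apply/integrableP; split; first exact/measurable_EFinP.
  apply: (le_lt_trans bnd); rewrite lte_add_pinfty//; last by rewrite -(fineK Hf) -EFinM ltry.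
  by rewrite lte_mul_pinfty.
have i2 : mu.-integrable setT (fun y : E => (K x)%:E * (EFin \o h) y).
  exact: integrableZl.
have -> : \int[mu]_y (K (vsub x y) * h y)%:E =
   \int[mu]_y ((EFin \o (fun y : E => (K (vsub x y) - K x) * h y)%R) y + (K x)%:E * (EFin \o h) y).
  by apply: eq_integral => y _; rewrite /= -EFinM -EFinD; congr EFin; ring.
rewrite (integralD measurableT i1 i2) (integralZl measurableT hi).
have if2 : \int[mu]_y (EFin \o h) y \is a fin_num by exact: (integrable_fin_num measurableT hi).
rewrite -[X in _ - X]/((K x)%:E * \int[mu]_y (EFin \o h) y).
rewrite addeK; last by rewrite fin_numM.
apply: le_trans (le_abse_integral mu measurableT _) _; first exact/measurable_EFinP.
exact: bnd.
Qed.

End operator.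

(** * Grid cells and stopping cubes *)

Section corners.
Context {R : realType} {n : nat}.
Local Notation V := (n.-tuple R).
Implicit Types (x y : V).

(* [crn d x] is the upper corner of the half-open grid cell of side [d] containing [x]. *)
Definition crn (d : R) x : V := [tuple d * (Num.ceil (tnth x i / d))%:~R | i < n].

Lemma tnth_crn d x i : tnth (crn d x) i = d * (Num.ceil (tnth x i / d))%:~R.
Proof. by rewrite tnth_mktuple. Qed.

Lemma crn_ge d x i : 0 < d -> tnth x i <= tnth (crn d x) i.
Proof. by move=> d0; rewrite tnth_crn -ler_pdivrMl// mulrC; exact: ceil_ge. Qed.

Lemma crn_lt d x i : 0 < d -> tnth (crn d x) i < tnth x i + d.
Proof.
move=> d0; rewrite tnth_crn -ltr_pdivlMl// mulrDr mulVf ?gt_eqF// [_ * tnth _ _]mulrC.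
have := ceilB1_lt (tnth x i / d); rewrite rmorphB/=; lra.
Qed.

Lemma crn_eqP d x y : 0 < d -> crn d x = crn d y <->
  forall i, tnth (crn d x) i - d < tnth y i <= tnth (crn d x) i.
Proof.
move=> d0; split=> [-> i|h].
  by rewrite crn_ge// ltrBlDr crn_lt.
apply: eq_from_tnth => i; rewrite [RHS]tnth_crn tnth_crn; congr (_ * _%:~R).
apply/esym/eqP; rewrite ceil_eq rmorphB/=.
have := h i; rewrite tnth_crn => /andP[h1 h2].
by rewrite ltr_pdivlMr// ler_pdivrMr// mulrBl mul1r ![_%:~R * d]mulrC h1 h2.
Qed.

(** The integer upper bounds of a number are those of its ceiling, so rounding up to the fine grid
    first does not change the coarse cell. *)
Lemma crn_nest d m x : 0 < d -> (0 < m)%N -> crn (d * m%:R) (crn d x) = crn (d * m%:R) x.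
Proof.
move=> d0 m0; apply/esym/crn_eqP => [|i]; first by rewrite mulr_gt0// ltr0n.
rewrite (tnth_crn d) (tnth_crn (d * _)).
set t := tnth x i; set p := Num.ceil (t / (d * m%:R)).
have mR : 0 < m%:R :> R by rewrite ltr0n.
have := ceil_itv (t / (d * m%:R)); rewrite -/p rmorphB/= invfM mulrA => /andP[].
rewrite ltr_pdivlMr// ler_pdivrMr// => h1 h2.
apply/andP; split.
  rewrite -[X in _ - X]mulr1 -mulrBr -mulrA ltr_pM2l// mulrBr mulr1 mulrC.
  have : (p - 1) * m%:Z < Num.ceil (t / d) by rewrite ceil_gt_int rmorphM rmorphB/=.
  by rewrite -(ltr_int R) rmorphM rmorphB/= mulrBl mul1r.
rewrite -mulrA ler_pM2l// [m%:R * _]mulrC.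
have : Num.ceil (t / d) <= p * m%:Z by rewrite ceil_le_int rmorphM.
by rewrite -(ler_int R) rmorphM.
Qed.

Lemma crn_idem d x : 0 < d -> crn d (crn d x) = crn d x.
Proof. by move=> d0; have := @crn_nest d 1 x d0 isT; rewrite mulr1. Qed.

Lemma crn_same d x y i : 0 < d -> crn d x = crn d y -> `|tnth x i - tnth y i| <= d.
Proof.
move=> d0 e; have := crn_ge x i d0; have := crn_lt x i d0.
have := crn_ge y i d0; have := crn_lt y i d0; rewrite -e.
by move=> h1 h2 h3 h4; rewrite ler_norml; apply/andP; split; lra.
Qed.

Lemma crn_near d x y : 0 < d -> crn d x = crn d y -> vnorm (vsub x y) <= n%:R * d.
Proof. by move=> d0 e; apply: vnorm_le_coord => i; rewrite tnthE; exact: crn_same. Qed.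

Lemma crn_dist d x : 0 < d -> vnorm (vsub x (crn d x)) <= n%:R * d.
Proof. by move=> d0; apply: crn_near => //; rewrite crn_idem. Qed.

Lemma measurable_crn d0 (T : measurableType d0) (d : R) (f : T -> V) : measurable_fun setT f ->
  measurable_fun setT (fun z => crn d (f z)).
Proof.
move=> mf; apply: measurable_vec => i.
have -> : (fun z => tnth (crn d (f z)) i) = (fun t => d * (Num.ceil t)%:~R) \o (fun z => tnth (f z) i / d).
  by apply/funext => z /=; rewrite tnth_crn.
apply: measurableT_comp.
  apply: measurable_funM => //; apply: nondecreasing_measurable => // s t st.
  by rewrite ler_int; exact: le_ceil.
by apply: measurable_funM => //; exact: measurable_coord.
Qed.

Definition same (d : R) x y : R := (crn d x == crn d y)%:R.

Lemma same_ge0 d x y : 0 <= same d x y. Proof. by rewrite /same; case: eqP. Qed.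
Lemma same_sym d x y : same d x y = same d y x. Proof. by rewrite /same eq_sym. Qed.

Lemma measurable_same d0 (T : measurableType d0) (d : R) (f g : T -> V) :
  measurable_fun setT f -> measurable_fun setT g ->
  measurable_fun setT (fun z => same d (f z) (g z)).
Proof.
move=> mf mg.
have -> : (fun z => same d (f z) (g z)) = \1_[set 0] \o (fun z => vnorm (vsub (crn d (f z)) (crn d (g z)))).
  apply/funext => z /=; rewrite /same indicE; congr (_ : bool)%:R.
  apply/eqP/idP => [->|].
    apply/mem_set => /=; rewrite (_ : vsub _ _ = vzero) ?vnorm0//.
    by apply: eq_from_tnth => i; rewrite !tnthE subrr.
  move/set_mem => /= /vnorm_eq0 h; apply: eq_from_tnth => i.
  by have := congr1 (fun v => tnth v i) h; rewrite !tnthE => /eqP; rewrite subr_eq0 => /eqP.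
apply: measurableT_comp; first by apply: measurable_indic.
by apply: measurable_vnorm; apply: measurable_vsub; exact: measurable_crn.
Qed.

End corners.

Section averages.
Context {R : realType} {n : nat} (leb : {measure set (n.-tuple R) -> \bar R}).
Hypothesis Hleb : is_lebesgue_borel leb.
Hypothesis n0 : (0 < n)%N.
Local Notation V := (n.-tuple R).
Local Notation E := (Rn leb).
Local Notation mu := (lebm leb).
Local Open Scope ereal_scope.
Variable d : R.
Hypothesis d0 : (0 < d)%R.

Let mtoV := @measurable_toV R n leb.
Lemma measurable_same1 x : measurable_fun [set: E] ((fun y => same d x y) : E -> R).
Proof. by apply: measurable_same; [exact: measurable_cst|exact: mtoV]. Qed.

Lemma int_same x : \int[mu]_y (same d x y)%:E = (d ^+ n)%:E.
Proof.
pose q (i : 'I_n) := (tnth (crn d x) i - d)%R.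
pose A : set V := box (mktuple q) (crn d x).
have mA : measurable A by exact: measurable_box.
have -> : \int[mu]_y (same d x y)%:E = \int[mu]_y (\1_(A : set E) y)%:E.
  apply: eq_integral => y _; rewrite indicE /same; congr ((_ : bool)%:R%:E).
  apply/eqP/idP => [e|/set_mem h].
    apply/mem_set => i; rewrite (tnth_mktuple q); exact: ((crn_eqP x y d0).1 e i).
  by apply/crn_eqP => // i; have := h i; rewrite (tnth_mktuple q).
have mA' : measurable (A : set E) by exact: borel_measurable.
rewrite (integral_indic mu measurableT mA').
rewrite setIT (@LebE _ _ leb _ mA) /A Hleb.
  under eq_bigr do rewrite (tnth_mktuple q) /q opprB addrCA subrr addr0.
  by rewrite prodr_const card_ord.
by move=> i; rewrite (tnth_mktuple q) /q lerBlDr lerDl ltW.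
Qed.

(** The conditional expectation on the grid of side [d], since a cell has volume [d ^ n]
    ([int_same]). It is extended real because [f] need not be integrable. *)
Definition avg (f : E -> R) (x : E) : \bar R := (d ^- n)%:E * \int[mu]_y (same d x y * f y)%:E.

Variable f : E -> R.
Hypothesis mf : measurable_fun setT f.
Hypothesis f0 : forall x, (0 <= f x)%R.

Let dn0 : (0 <= d ^- n)%R. Proof. by rewrite invr_ge0 exprn_ge0// ltW. Qed.
Let msf_pair : measurable_fun setT (fun z : E * E => (same d z.1 z.2 * f z.2)%:E).
Proof.
apply/measurable_EFinP/measurable_funM; last exact: (measurableT_comp mf measurable_snd).
by apply: measurable_same; [exact: m_fstE|exact: m_sndE].
Qed.
Let sf0 x y : 0 <= (same d x y * f y)%:E.
Proof. by rewrite lee_fin mulr_ge0// same_ge0. Qed.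

Lemma avg_ge0 x : 0 <= avg f x.
Proof. by rewrite mule_ge0 ?lee_fin//; apply: integral_ge0 => y _; exact: sf0. Qed.

Lemma measurable_avg : measurable_fun setT (avg f).
Proof.
have [m1 _ _] := ge0_tonelli Hleb msf_pair (fun z => sf0 z.1 z.2).
by apply: emeasurable_funM; [exact: measurable_cst|exact: m1].
Qed.

Lemma avg_inv x y : crn d x = crn d y -> avg f x = avg f y.
Proof. by move=> e; rewrite /avg /same e. Qed.

(** The kernel [same] is symmetric, so averaging is self-adjoint by Tonelli, and it fixes functions
    that are constant on cells. *)
Lemma avg_adj (X : E -> R) : measurable_fun setT X -> (forall x, 0 <= X x)%R ->
  (forall x y, crn d x = crn d y -> X x = X y) ->
  \int[mu]_x ((X x)%:E * avg f x) = \int[mu]_x (X x * f x)%:E.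
Proof.
move=> mX X0 Xinv.
have mF : measurable_fun setT (fun z : E * E => (X z.1 * d ^- n * (same d z.1 z.2 * f z.2))%:E).
  apply/measurable_EFinP/measurable_funM; last by apply/measurable_EFinP; exact: msf_pair.
  by apply: measurable_funM => //; exact: (measurableT_comp mX measurable_fst).
have F0 (z : E * E) : 0 <= (X z.1 * d ^- n * (same d z.1 z.2 * f z.2))%:E.
  by rewrite lee_fin !mulr_ge0// same_ge0.
have [_ _ ton] := ge0_tonelli Hleb mF F0.
transitivity (\int[mu]_x \int[mu]_y (X x * d ^- n * (same d x y * f y))%:E).
  apply: eq_integral => x _; rewrite /avg muleA -EFinM.
  rewrite -(ge0_integralZl mu measurableT (measurableT_comp msf_pair (pair1_measurable x))).
  - by [].
  - by move=> y _; exact: sf0.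
  - by rewrite lee_fin mulr_ge0.
rewrite ton; apply: eq_integral => y _ /=.
transitivity (\int[mu]_x ((X y * d ^- n * f y)%:E * (same d y x)%:E)).
  apply: eq_integral => x _; rewrite -EFinM; congr EFin; rewrite same_sym /same.
  by case: (eqVneq (crn d y) (crn d x)) => [e|_]; rewrite ?(Xinv _ _ e) /= ?mul1r ?mulr1 ?mul0r ?mulr0.
rewrite (ge0_integralZl mu measurableT); last 3 first.
- by apply/measurable_EFinP; exact: measurable_same1.
- by move=> x _; rewrite lee_fin same_ge0.
- by rewrite lee_fin !mulr_ge0.
rewrite int_same -EFinM; congr EFin.
by rewrite mulrAC -[(X y * _ * _)%R]mulrA mulVf ?mulr1// expf_neq0// gt_eqF.
Qed.

Lemma avg_le x : avg f x <= (d ^- n)%:E * \int[mu]_y (f y)%:E.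
Proof.
apply: lee_wpmul2l; first by rewrite lee_fin.
apply: ge0_le_integralT.
- exact: measurableT.
- exact: (measurableT_comp msf_pair (pair1_measurable x)).
- exact/measurable_EFinP.
- exact: sf0.
- by move=> y _; rewrite lee_fin /same; case: eqP => _; rewrite ?mul1r// mul0r.
Qed.

Lemma avg_id x : (forall y, crn d x = crn d y -> f x = f y) -> avg f x = (f x)%:E.
Proof.
move=> finv; rewrite /avg.
have -> : \int[mu]_y (same d x y * f y)%:E = \int[mu]_y ((f x)%:E * (same d x y)%:E).
  apply: eq_integral => y _; rewrite -EFinM; congr EFin; rewrite /same.
  by case: (eqVneq (crn d x) (crn d y)) => [e|_]; rewrite ?(finv _ e) /= ?mul1r ?mulr1 ?mul0r ?mulr0.
rewrite (ge0_integralZl mu measurableT); last 3 first.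
- by apply/measurable_EFinP; exact: measurable_same1.
- by move=> y _; rewrite lee_fin same_ge0.
- by rewrite lee_fin.
by rewrite int_same -!EFinM mulrCA mulVf ?mulr1// expf_neq0// gt_eqF.
Qed.

End averages.

Section averages2.
Context {R : realType} {n : nat} (leb : {measure set (n.-tuple R) -> \bar R}).
Hypothesis Hleb : is_lebesgue_borel leb.
Local Notation E := (Rn leb).
Local Open Scope ereal_scope.

(** A cell lies in its parent, whose volume is [2 ^ n] times larger. *)
Lemma avg_double (d : R) (f : E -> R) x : (0 < d)%R -> measurable_fun setT f -> (forall x, 0 <= f x)%R ->
  avg d f x <= (2 ^+ n)%:E * avg (d * 2) f x.
Proof.
move=> d0 mf f0; rewrite /avg muleA -EFinM exprMn invfM mulrCA mulfV ?mulr1 ?expf_neq0//.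
apply: lee_wpmul2l; first by rewrite lee_fin invr_ge0 exprn_ge0// ltW.
apply: ge0_le_integralT.
- exact: measurableT.
- apply/measurable_EFinP; exact: (measurable_funM (measurable_same1 d x) mf).
- apply/measurable_EFinP; exact: (measurable_funM (measurable_same1 (d * 2) x) mf).
- by move=> y; rewrite lee_fin mulr_ge0// same_ge0.
move=> y _; rewrite lee_fin ler_wpM2r// /same; case: eqP => // e.
have := @crn_nest _ _ d 2 x d0 isT; rewrite e crn_nest// => ->.
by rewrite eqxx.
Qed.

End averages2.

(** * Maximal truncations *)

Section real_integrals.
Context d (T : measurableType d) (R : realType) (mu : {measure set T -> \bar R}).
Local Open Scope ereal_scope.
Implicit Types f g : T -> R.

Lemma int_ge0R f : (forall x, 0 <= f x)%R -> 0 <= \int[mu]_x (f x)%:E.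
Proof. by move=> f0; apply: integral_ge0 => x _; rewrite lee_fin. Qed.

Lemma int_leR f g : measurable_fun setT f -> measurable_fun setT g ->
  (forall x, 0 <= f x)%R -> (forall x, f x <= g x)%R ->
  \int[mu]_x (f x)%:E <= \int[mu]_x (g x)%:E.
Proof.
move=> mf mg f0 fg; apply: ge0_le_integralT.
- exact: measurableT.
- exact/measurable_EFinP.
- exact/measurable_EFinP.
- by move=> x; rewrite lee_fin.
- by move=> x _; rewrite lee_fin.
Qed.

Lemma int_addR f g : measurable_fun setT f -> measurable_fun setT g ->
  (forall x, 0 <= f x)%R -> (forall x, 0 <= g x)%R ->
  \int[mu]_x (f x + g x)%:E = \int[mu]_x (f x)%:E + \int[mu]_x (g x)%:E.
Proof.
move=> /measurable_EFinP mf /measurable_EFinP mg f0 g0.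
rewrite -(ge0_integralD mu measurableT _ mf _ mg).
- by [].
- by move=> x _; rewrite lee_fin.
- by move=> x _; rewrite lee_fin.
Qed.

Lemma int_scaleR c f : measurable_fun setT f -> (0 <= c)%R -> (forall x, 0 <= f x)%R ->
  \int[mu]_x (c * f x)%:E = c%:E * \int[mu]_x (f x)%:E.
Proof.
move=> /measurable_EFinP mf c0 f0; rewrite -(ge0_integralZl mu measurableT mf).
- by [].
- by move=> x _; rewrite lee_fin.
- by rewrite lee_fin.
Qed.

Lemma integrableR f : measurable_fun setT f -> \int[mu]_x `|f x|%:E < +oo ->
  mu.-integrable setT (EFin \o f).
Proof. by move=> mf h; apply/integrableP; split; [exact/measurable_EFinP|]. Qed.

Lemma abs_intR f : measurable_fun setT f ->
  `|\int[mu]_x (f x)%:E| <= \int[mu]_x `|f x|%:E.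
Proof. by move=> /measurable_EFinP mf; exact: (le_abse_integral mu measurableT mf). Qed.

Lemma int_condR (D : set T) f : \int[mu]_(x in D) (f x)%:E = \int[mu]_x (\1_D x * f x)%:E.
Proof.
rewrite integral_mkcond; apply: eq_integral => x _; rewrite patchE indicE.
by case: (x \in D); rewrite ?mul1r ?mul0r.
Qed.

Lemma measurable_bool (A : set T) (b : T -> bool) :
  measurable A -> (forall x, A x <-> b x) -> measurable_fun setT (fun x => (b x)%:R : R).
Proof.
move=> mA h; have -> : (fun x => (b x)%:R : R) = \1_A.
  by apply/funext => x; rewrite indicE; congr (_ : bool)%:R; apply/idP/idP => [/h/mem_set|/set_mem/h].
exact: measurable_indic.
Qed.

Lemma measurable_ltb f g : measurable_fun setT f -> measurable_fun setT g ->
  measurable_fun setT (fun x => (f x < g x)%R%:R : R).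
Proof.
move=> mg mh; apply: (@measurable_bool [set x | (f x < g x)%R]) => //.
rewrite -[X in measurable X]setTI.
exact: (measurable_fun_ltr mg mh measurableT (Y := [set true])).
Qed.

Lemma measurable_absR f : measurable_fun setT f -> measurable_fun setT (fun x => `|f x|%R).
Proof. by move=> mf; exact: (measurableT_comp (@normr_measurable R setT) mf). Qed.
End real_integrals.

Section adjoint.
Context {R : realType} {n : nat} (leb : {measure set (n.-tuple R) -> \bar R}).
Hypothesis Hleb : is_lebesgue_borel leb.
Hypothesis n0 : (0 < n)%N.
Local Notation V := (n.-tuple R).
Local Notation E := (Rn leb).
Local Notation mu := (lebm leb).
Local Open Scope ereal_scope.
Variables (d : R) (f : E -> R).
Hypothesis d0 : (0 < d)%R.
Hypothesis mf : measurable_fun setT f.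
Hypothesis f0 : forall x, (0 <= f x)%R.

(** [fine] turns an infinite average into 0, so the identities below require [avg] to be finite
    wherever the weight [X] is nonzero. *)
Definition ravg (x : E) : R := fine (avg d f x).

Lemma ravg_ge0 x : (0 <= ravg x)%R.
Proof. by rewrite fine_ge0// avg_ge0. Qed.

Lemma measurable_ravg : measurable_fun setT ravg.
Proof.
exact: (measurableT_comp (@fine_measurable R setT measurableT) (measurable_avg Hleb d mf f0)).
Qed.

Lemma ravg_inv x y : crn d x = crn d y -> ravg x = ravg y.
Proof. by move=> e; rewrite /ravg (avg_inv _ e). Qed.

Lemma ravg_le x t : avg d f x <= t%:E -> (ravg x <= t)%R.
Proof.
move=> h; rewrite -lee_fin fineK// ge0_fin_numE ?avg_ge0//.
exact: le_lt_trans h (ltry _).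
Qed.

Section invariant.
Variable X : E -> R.
Hypothesis mX : measurable_fun setT X.
Hypothesis Xinv : forall x y, crn d x = crn d y -> X x = X y.
Hypothesis Xfin : forall x, X x != 0%R -> avg d f x < +oo.

Lemma ravg_adj0 : (forall x, (0 <= X x)%R) -> \int[mu]_x (X x * ravg x)%:E = \int[mu]_x (X x * f x)%:E.
Proof.
move=> X0; rewrite -(avg_adj Hleb d0 mf f0 mX X0 Xinv); apply: eq_integral => x _.
have [->|x0] := eqVneq (X x) 0%R; first by rewrite mul0r mul0e.
by rewrite EFinM fineK// ge0_fin_numE ?avg_ge0//; exact: Xfin.
Qed.
End invariant.

(** The positive and negative parts of [X] are treated separately, so the identity also covers
    infinite integrals. It expresses that [f] minus its average has mean zero on each cell. *)
Lemma ravg_adj (X : E -> R) : measurable_fun setT X ->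
  (forall x y, crn d x = crn d y -> X x = X y) ->
  (forall x, X x != 0%R -> avg d f x < +oo) ->
  \int[mu]_x (X x * ravg x)%:E = \int[mu]_x (X x * f x)%:E.
Proof.
move=> mX Xinv Xfin.
pose Xp := (fun x => Num.max (X x) 0)%R; pose Xn := (fun x => Num.max (- X x) 0)%R.
have p (g : E -> R) : (forall x, 0 <= g x)%R ->
    (EFin \o (fun x => X x * g x))%R ^\+ = (fun x => (Xp x * g x)%:E).
  move=> g0; apply/funext => x; rewrite funeposE /Xp /= -EFin_max; congr EFin.
  by rewrite maxr_pMl// mul0r.
have q (g : E -> R) : (forall x, 0 <= g x)%R ->
    (EFin \o (fun x => X x * g x))%R ^\- = (fun x => (Xn x * g x)%:E).
  move=> g0; apply/funext => x; rewrite funenegE /Xn /= -EFin_max; congr EFin.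
  by rewrite maxr_pMl// mul0r mulNr.
rewrite -[LHS]/(\int[mu]_x (EFin \o (fun x => X x * ravg x))%R x) integralE.
rewrite -[RHS]/(\int[mu]_x (EFin \o (fun x => X x * f x))%R x) [RHS]integralE.
have ra0 := ravg_ge0.
rewrite !p ?q//.
congr (_ - _); apply: ravg_adj0.
- by apply: measurable_maxr => //; exact: measurable_cst.
- by move=> x y e; rewrite /Xp (Xinv _ _ e).
- move=> x h; apply: Xfin; apply: contra h => /eqP h; by rewrite /Xp h maxxx.
- by move=> x; rewrite /Xp le_max lexx orbT.
- by apply: measurable_maxr; [exact: measurableT_comp|exact: measurable_cst].
- by move=> x y e; rewrite /Xn (Xinv _ _ e).
- move=> x h; apply: Xfin; apply: contra h => /eqP h; by rewrite /Xn h oppr0 maxxx.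
- by move=> x; rewrite /Xn le_max lexx orbT.
Qed.
End adjoint.

Lemma mul4_le (R : realDomainType) (w q k a t : R) : 0 <= q -> 0 <= k -> w * a <= w * t ->
  w * q * k * a <= t * (w * q * k).
Proof.
move=> q0 k0 h; have -> : w * q * k * a = w * a * (q * k) by ring.
have -> : t * (w * q * k) = w * t * (q * k) by ring.
by rewrite ler_wpM2r// mulr_ge0.
Qed.

(** Here and in the next three facts [a] is the distance from [x] to a point, [b] the distance from
    [x] to the corner of the cell of this point, and [e] bounds the diameter of the cell. The
    hypothesis [8 * e < b] keeps [a] and [b] comparable. *)
Lemma half_bound (R : realFieldType) (ep a b e : R) : 0 < ep -> 8 * e < b -> b <= a + e -> ep < b -> ep / 2 < a.
Proof. by move=> *; lra. Qed.

Lemma cross1 (R : realFieldType) (ep a b e : R) : 0 < ep -> 8 * e < b -> a <= b + e -> ep < a -> b <= ep ->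
  ep / 2 < b /\ b < 2 * ep.
Proof. by move=> *; split; lra. Qed.

Lemma cross2 (R : realFieldType) (ep a b e : R) : 0 < ep -> 8 * e < b -> b <= a + e -> a <= ep -> ep < b ->
  ep / 2 < b /\ b < 2 * ep.
Proof. by move=> *; split; lra. Qed.

Lemma ring_bound (R : realFieldType) (ep a b e : R) : 0 < ep -> 8 * e < b -> a <= b + e -> b <= a + e ->
  ep / 2 < b -> b < 2 * ep -> ep / 4 < a <= 4 * ep.
Proof. by move=> *; apply/andP; split; lra. Qed.

(** * Singular kernels with Hormander's condition: cancellation on the cells of one grid *)

Section singular.
Context {R : realType} {n : nat} (leb : {measure set (n.-tuple R) -> \bar R}).
Hypothesis Hleb : is_lebesgue_borel leb.
Hypothesis n0 : (0 < n)%N.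
Local Notation V := (n.-tuple R).
Local Notation E := (Rn leb).
Local Notation mu := (lebm leb).
Local Open Scope ereal_scope.
Variables (K : V -> R) (k0 CH : R).
Hypothesis mK : measurable_fun [set: V] K.
Hypothesis Kring : forall s, (0 < s)%R -> \int[mu]_(x in ann leb s (2 * s)) `|K x|%:E <= k0%:E.
Hypothesis Khor : forall r h, (0 < r)%R -> (vnorm h <= r)%R ->
  \int[mu]_(x in [set x : E | (8 * r < vnorm x)%R]) `|K (vadd x h) - K x|%:E <= CH%:E.

Let mtoV := @measurable_toV R n leb.
Lemma mKf d (T : measurableType d) (f : T -> V) : measurable_fun setT f ->
  measurable_fun setT (fun x => K (f x)).
Proof. by move=> mf; exact: (measurableT_comp mK mf). Qed.
Lemma mvsubE x : measurable_fun setT ((fun y => vsub x y) : E -> V).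
Proof. exact: measurable_vsub (measurable_cst x) mtoV. Qed.
Lemma mKabs : measurable_fun setT (fun x : E => `|K x|%:E).
Proof. exact: measurable_absE (mKf mtoV). Qed.

Lemma ring_ge0 : (0 <= k0)%R.
Proof.
rewrite -lee_fin; apply: le_trans (Kring (ltr01)).
by apply: integral_ge0 => x _; rewrite lee_fin.
Qed.

Lemma ann_add s t u : (s <= t)%R -> (t <= u)%R ->
  \int[mu]_(x in ann leb s u) `|K x|%:E =
  \int[mu]_(x in ann leb s t) `|K x|%:E + \int[mu]_(x in ann leb t u) `|K x|%:E.
Proof.
move=> st tu; have [-> dj] := ann_split leb st tu.
apply: ge0_integral_setU.
- exact: measurable_ann.
- exact: measurable_ann.
- exact: (measurable_funTS mKabs).
- by move=> x _; rewrite lee_fin.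
- exact: dj.
Qed.

Lemma Kring_pow s j : (0 < s)%R -> \int[mu]_(x in ann leb s (2 ^+ j * s)%R) `|K x|%:E <= (j%:R * k0)%:E.
Proof.
move=> s0; elim: j => [|j IH].
  rewrite expr0 !mul1r mul0r (_ : ann leb s s = set0) ?integral_set0//.
  by apply/seteqP; split => x //; rewrite /ann/= => /andP[h1 h2]; have := lt_le_trans h1 h2; rewrite ltxx.
have j1 : (1 <= 2 ^+ j :> R)%R by rewrite exprn_ege1// ler1n.
have p1 : (s <= 2 ^+ j * s)%R by rewrite ler_peMl// ltW.
have p2 : (2 ^+ j * s <= 2 ^+ j.+1 * s)%R.
  by rewrite exprS -mulrA ler_peMl ?ler1n// mulr_ge0// ltW.
rewrite (ann_add p1 p2) -[X in (X * k0)%R]natr1 mulrDl mul1r EFinD; apply: leeD => //.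
by rewrite exprS -mulrA; apply: Kring; rewrite mulr_gt0// exprn_gt0.
Qed.

Lemma le_Kring s t j : (0 < s)%R -> (t <= 2 ^+ j * s)%R ->
  \int[mu]_(x in ann leb s t) `|K x|%:E <= (j%:R * k0)%:E.
Proof.
move=> s0 tj; apply: le_trans (Kring_pow j s0); apply: ge0_subset_integral.
- exact: measurable_ann.
- exact: measurable_ann.
- exact: (measurable_funTS mKabs).
- by move=> x _; rewrite lee_fin.
- by move=> x /andP[h1 h2]; apply/andP; split => //; exact: le_trans h2 tj.
Qed.

Lemma Kring_fin s t : (0 < s)%R -> \int[mu]_(x in ann leb s t) `|K x|%:E < +oo.
Proof.
move=> s0; have [j hj] : exists j, (t <= 2 ^+ j * s)%R.
  exists (Num.bound (`|t| / s)); rewrite -ler_pdivrMr//.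
  apply: (@le_trans _ _ (`|t| / s)%R); first by rewrite ler_pM2r ?invr_gt0// ler_norm.
  apply: le_trans (ltW (archi_boundP _)) _; first by rewrite divr_ge0// ltW.
  by rewrite -natrX ler_nat; exact: (ltnW (ltn_expl _ _)).
by apply: le_lt_trans (le_Kring s0 hj) (ltry _).
Qed.

Lemma measurable_ring_at x s t : measurable [set y : E | (s < vnorm (vsub x y) <= t)%R].
Proof.
rewrite -[X in measurable X]setTI.
exact: (measurable_reflect Hleb x measurableT (measurable_ann leb s t)).
Qed.

Lemma Kring_at x s t : \int[mu]_(y in [set y : E | (s < vnorm (vsub x y) <= t)%R]) `|K (vsub x y)|%:E =
  \int[mu]_(y in ann leb s t) `|K y|%:E.
Proof.
have K0 (y : E) : 0 <= `|K y|%:E by rewrite lee_fin.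
by rewrite -(ge0_integral_reflect Hleb (measurable_ann _ s t) mKabs K0 x).
Qed.

Section level.
Variables (d : R) (f : E -> R) (W : set E) (t rho : R).
Hypothesis d0 : (0 < d)%R.
Hypothesis mf : measurable_fun setT f.
Hypothesis f0 : forall x, (0 <= f x)%R.
Hypothesis t0 : (0 < t)%R.
Hypothesis mW : measurable W.
Hypothesis Winv : forall x y, crn d x = crn d y -> W x -> W y.
Hypothesis Wavg : forall x, W x -> avg d f x <= t%:E.
Hypothesis Wbd : forall x, W x -> (vnorm x <= rho)%R.
Local Notation w := (\1_W : E -> R).
Local Notation fa := (ravg d f).

(** The cost of moving the argument of the kernel from [y] to the corner of its cell. In the weight,
    [f + t] bounds [|f - fa|], and the other [2 * t] comes from the cells cut by the truncation
    sphere. *)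
Definition Hlev (x : E) : \bar R :=
  \int[mu]_y ((8 * (n%:R * d) < vnorm (vsub x (crn d y)))%R%:R * w y * `|K (vsub x y) - K (vsub x (crn d y))| * (f y + 3 * t))%:E.

Let mw : measurable_fun setT w. Proof. by apply: measurable_indic. Qed.
Let w0 y : (0 <= w y)%R. Proof. by rewrite indicE. Qed.
Let mcr : measurable_fun setT ((crn d) : E -> V). Proof. exact: (measurable_crn d mtoV). Qed.

Let Hpair (z : E * E) : R := ((8 * (n%:R * d) < vnorm (vsub z.1 (crn d z.2)))%R%:R *
    w z.2 * `|K (vsub z.1 z.2) - K (vsub z.1 (crn d z.2))| * (f z.2 + 3 * t))%R.

Let ft0 y : (0 <= f y + 3 * t)%R.
Proof. by rewrite addr_ge0// mulr_ge0// ltW. Qed.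

Let Hpair0 z : 0 <= (Hpair z)%:E.
Proof. by rewrite lee_fin /Hpair !mulr_ge0. Qed.

Let measurable_Hpair : measurable_fun setT (EFin \o Hpair).
Proof.
have mxc : measurable_fun setT (fun z : E * E => vsub z.1 (crn d z.2)).
  by apply: measurable_vsub; [exact: m_fstE|exact: (measurable_crn d (@m_sndE _ _ leb))].
have mxy : measurable_fun setT (fun z : E * E => vsub z.1 z.2 : V).
  by apply: measurable_vsub; [exact: m_fstE|exact: m_sndE].
have m2 (g : E -> R) : measurable_fun setT g -> measurable_fun setT (fun z : E * E => g z.2).
  by move=> mg; exact: (measurableT_comp mg measurable_snd).
have mft : measurable_fun setT (fun y : E => f y + 3 * t)%R.
  exact: (measurable_funD mf (measurable_cst _)).
apply/measurable_EFinP.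
have h1 := measurable_ltb (measurable_cst (8 * (n%:R * d))%R) (measurable_vnorm mxc).
have h2 := measurable_absR (measurable_funB (mKf mxy) (mKf mxc)).
exact: (measurable_funM (measurable_funM (measurable_funM h1 (m2 _ mw)) h2) (m2 _ mft)).
Qed.

Lemma measurable_Hlev : measurable_fun setT Hlev.
Proof. by have [m1 _ _] := ge0_tonelli Hleb measurable_Hpair Hpair0; exact: m1. Qed.

Lemma Hlev_ge0 x : 0 <= Hlev x.
Proof. by apply: integral_ge0 => y _; exact: (Hpair0 (x, y)). Qed.

(** After Tonelli, Hormander's condition applies for each [y] to the displacement from [y] to its
    corner, of length at most [n * d]. *)
Lemma level_far : \int[mu]_x Hlev x <= CH%:E * \int[mu]_y (w y * (f y + 3 * t))%:E.
Proof.
have nd0 : (0 < n%:R * d)%R by rewrite mulr_gt0// ltr0n.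
have mwf : measurable_fun setT (fun y : E => w y * (f y + 3 * t))%R.
  exact: (measurable_funM mw (measurable_funD mf (measurable_cst _))).
have [_ mG e] := ge0_tonelli Hleb measurable_Hpair Hpair0.
rewrite [leLHS]e.
have CH0 : (0 <= CH)%R.
  rewrite -lee_fin; apply: le_trans (Khor nd0 (h := vzero) _); last by rewrite vnorm0 ltW.
  by apply: integral_ge0 => x _; rewrite lee_fin.
rewrite -(int_scaleR mu mwf CH0); last by move=> y; rewrite mulr_ge0.
apply: ge0_le_integralT.
- exact: measurableT.
- exact: mG.
- by apply/measurable_EFinP; exact: measurable_funM (measurable_cst _) mwf.
- by move=> y; apply: integral_ge0 => x _; exact: Hpair0.
move=> y _; rewrite /= /Hpair /=; pose h := vsub (crn d y) y.
have hnd : (vnorm h <= n%:R * d)%R by rewrite /h vnorm_subC; exact: crn_dist.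
have mh' : measurable_fun setT (fun x : E => `|K (vadd x h) - K x|%:E).
  exact: measurable_absB (mKf (measurable_vadd mtoV (measurable_cst h))) (mKf mtoV).
have h0 (x : E) : 0 <= `|K (vadd x h) - K x|%:E by rewrite lee_fin.
have := Khor nd0 hnd.
rewrite -(ge0_integral_shift Hleb (measurable_far leb (8 * (n%:R * d))%R) mh' h0 (vscale (-1) (crn d y))).
move=> Kh; rewrite (mulrC CH) EFinM.
apply: le_trans (lee_wpmul2l _ Kh); last by rewrite lee_fin mulr_ge0.
have mx1 : measurable_fun setT (fun x : E => vsub x (crn d y)).
  exact: measurable_vsub mtoV (measurable_cst _).
have mx2 : measurable_fun setT (fun x : E => vsub x y).
  exact: measurable_vsub mtoV (measurable_cst _).
have mg : measurable_fun setT (fun x : E => (8 * (n%:R * d) < vnorm (vsub x (crn d y)))%R%:R *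
    `|K (vsub x y) - K (vsub x (crn d y))|)%R.
  have h1 := measurable_ltb (measurable_cst (8 * (n%:R * d))%R) (measurable_vnorm mx1).
  exact: (measurable_funM h1 (measurable_absR (measurable_funB (mKf mx2) (mKf mx1)))).
rewrite le_eqVlt; apply/orP; left; apply/eqP.
have wf0 : (0 <= w y * (f y + 3 * t))%R by rewrite mulr_ge0.
transitivity ((w y * (f y + 3 * t))%:E * \int[mu]_x ((8 * (n%:R * d) < vnorm (vsub x (crn d y)))%R%:R *
    `|K (vsub x y) - K (vsub x (crn d y))|)%:E).
  rewrite -(int_scaleR mu mg wf0); last by move=> x; rewrite mulr_ge0.
  by apply: eq_integral => x _; congr EFin; ring.
congr (_ * _); rewrite [RHS]int_condR; apply: eq_integral => x _; congr EFin; congr (_ * _)%R.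
  by rewrite indicE; congr (_ : bool)%:R; apply/idP/idP => [hh|/set_mem /=];
    [apply/mem_set => /=|]; rewrite -vsubE.
congr (`|K _ - K _|)%R; last by rewrite vsubE.
by apply: eq_from_tnth => i; rewrite /h !tnthE; ring.
Qed.

(** [w * (f - fa)] has mean zero on every cell, so it is orthogonal to the kernel truncated and
    evaluated at the corners. What remains is the displacement of the kernel, and the cells on which
    truncating at [y] and at the corner disagree; these lie in the shell between [ep / 4] and
    [4 * ep]. *)
Lemma level_near x ep : (0 < ep)%R -> (forall y, W y -> 8 * (n%:R * d) < vnorm (vsub x (crn d y)))%R ->
  `| \int[mu]_y (K (vsub x y) * (ep < vnorm (vsub x y))%R%:R * (w y * (f y - fa y)))%:E | <=
  Hlev x + (2 * t)%:E * \int[mu]_y ((ep / 4 < vnorm (vsub x y) <= 4 * ep)%R%:R * (w y * `|K (vsub x y)|))%:E.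
Proof.
move=> ep0 xfar.
have nd0 : (0 < n%:R * d)%R by rewrite mulr_gt0// ltr0n.
set B2 := (X in _ <= _ + _ * X).
have mxy : measurable_fun setT ((fun y => vsub x y) : E -> V) by exact: mvsubE.
have mxc : measurable_fun setT ((fun y => vsub x (crn d y)) : E -> V).
  exact: measurable_vsub (measurable_cst x) mcr.
have mnxy := measurable_vnorm mxy; have mnxc := measurable_vnorm mxc.
pose P (y : E) : R := (ep < vnorm (vsub x y))%R%:R.
pose Q (y : E) : R := (ep < vnorm (vsub x (crn d y)))%R%:R.
pose S (y : E) : R := ((ep / 2 < vnorm (vsub x (crn d y)))%R%:R * (vnorm (vsub x (crn d y)) < 2 * ep)%R%:R)%R.
pose T (y : E) : R := (ep / 4 < vnorm (vsub x y) <= 4 * ep)%R%:R.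
have mP : measurable_fun setT P by exact: measurable_ltb (measurable_cst ep) mnxy.
have mQ : measurable_fun setT Q by exact: measurable_ltb (measurable_cst ep) mnxc.
have mS : measurable_fun setT S.
  exact: (measurable_funM (measurable_ltb (measurable_cst (ep / 2)%R) mnxc) (measurable_ltb mnxc (measurable_cst (2 * ep)%R))).
have mT : measurable_fun setT T.
  by apply: (measurable_bool (measurable_ring_at x (ep / 4)%R (4 * ep)%R)).
pose Kx (y : E) := K (vsub x y); pose Kc (y : E) := K (vsub x (crn d y)).
have mKx : measurable_fun setT Kx by exact: mKf mxy.
have mKc : measurable_fun setT Kc by exact: mKf mxc.
pose D (y : E) := `|Kx y - Kc y|%R.
have mD : measurable_fun setT D by exact: measurable_absR (measurable_funB mKx mKc).
have maKx := measurable_absR mKx; have maKc := measurable_absR mKc.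
have mfa : measurable_fun setT fa by exact: measurable_ravg.
have fa0 y : (0 <= fa y)%R by exact: ravg_ge0.
have b01 (b : bool) : (0 <= b%:R :> R)%R by case: b.
have P0 y : (0 <= P y)%R by []. have Q0 y : (0 <= Q y)%R by [].
have S0 y : (0 <= S y)%R by rewrite mulr_ge0. have T0 y : (0 <= T y)%R by [].
have D0 y : (0 <= D y)%R by rewrite /D normr_ge0.
have B20 : 0 <= B2 by apply: int_ge0R => y; rewrite !mulr_ge0.
have wfa y : (w y * fa y <= w y * t)%R.
  rewrite indicE; case: (boolP (y \in W)) => [/set_mem yW|_]; last by rewrite !mul0r.
  by rewrite !mul1r; apply: ravg_le => //; exact: Wavg.
have geo y : W y -> [/\ (vnorm (vsub x y) <= vnorm (vsub x (crn d y)) + n%:R * d)%R,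
    (vnorm (vsub x (crn d y)) <= vnorm (vsub x y) + n%:R * d)%R &
    (8 * (n%:R * d) < vnorm (vsub x (crn d y)))%R].
  move=> yW; have h3 := crn_dist y d0; split; last exact: xfar.
    have h1 := vnorm_le_sub (vsub x y) (vsub x (crn d y)).
    have e : vnorm (vsub (vsub x y) (vsub x (crn d y))) = vnorm (vsub y (crn d y)).
      by rewrite [RHS]vnorm_subC; congr vnorm; apply: eq_from_tnth => i; rewrite !tnthE; ring.
    by apply: le_trans h1 _; rewrite e addrC lerD2l.
  have h1 := vnorm_le_sub (vsub x (crn d y)) (vsub x y).
  have e : vnorm (vsub (vsub x (crn d y)) (vsub x y)) = vnorm (vsub y (crn d y)).
    by congr vnorm; apply: eq_from_tnth => i; rewrite !tnthE; ring.
  by apply: le_trans h1 _; rewrite e addrC lerD2l.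
have HE : Hlev x = \int[mu]_y (w y * D y * (f y + 3 * t))%:E.
  apply: eq_integral => y _; rewrite indicE; case: (boolP (y \in W)) => [/set_mem yW|_].
    by rewrite xfar// !mul1r.
  by rewrite mulr0 !mul0r.
have [Hoo|Hfin] := eqVneq (Hlev x) +oo.
  have h : 0 <= (2 * t)%:E * B2 by rewrite mule_ge0// lee_fin mulr_ge0// ltW.
  rewrite Hoo addye; first exact: leey.
  by rewrite gt_eqF//; exact: (lt_le_trans (ltNyr 0) h).
have {}Hfin : Hlev x < +oo by rewrite ltey.
have mwD : measurable_fun setT (fun y => w y * D y)%R by exact: measurable_funM mw mD.
have wD0 y : (0 <= w y * D y)%R by rewrite mulr_ge0.
have mft : measurable_fun setT (fun y : E => f y + 3 * t)%R by exact: measurable_funD mf (measurable_cst _).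
(* The constant [3 * t > 0] in the weight of [Hlev] makes the unweighted displacement integrable
   too. *)
have ID : \int[mu]_y (w y * D y)%:E < +oo.
  have t30 : (0 < 3 * t)%R by rewrite mulr_gt0.
  have : (3 * t)%:E * \int[mu]_y (w y * D y)%:E <= Hlev x.
    rewrite HE -(int_scaleR mu mwD (ltW t30) wD0).
    apply: int_leR; [exact: measurable_funM (measurable_cst _) mwD|exact: measurable_funM mwD mft| |].
      by move=> y; rewrite mulr_ge0// ltW.
    by move=> y; rewrite mulrC ler_wpM2l// lerDr.
  have [->|] := eqVneq (\int[mu]_y (w y * D y)%:E) +oo; last by rewrite ltey.
  by rewrite gt0_muley ?lte_fin// leye_eq => /eqP h; rewrite h in Hfin.
have IA : \int[mu]_y (w y * Q y * `|Kx y|)%:E < +oo.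
  apply: le_lt_trans (Kring_fin (s := (ep / 2)%R) (vnorm x + rho)%R _); last by rewrite divr_gt0.
  rewrite -(Kring_at x) [leRHS]int_condR; apply: int_leR.
  - exact: measurable_funM (measurable_funM mw mQ) maKx.
  - apply: measurable_funM maKx; apply: measurable_indic.
    exact: measurable_ring_at.
  - by move=> y; rewrite !mulr_ge0.
  move=> y; rewrite ler_wpM2r// indicE /Q; case: (boolP (y \in W)) => [/set_mem yW|_]; last by rewrite mul0r.
  rewrite mul1r; case: ltP => // xc; rewrite indicE mem_set//=; apply/andP; split.
    have [_ g2 g3] := geo y yW; exact: half_bound ep0 g3 g2 xc.
  by apply: le_trans (vnormB x y) _; rewrite lerD2l; exact: Wbd.
(* The kernel with argument and truncation moved to the corner: constant on cells, hence orthogonal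
   to [f - fa]. *)
pose X (y : E) := (Kc y * Q y * w y)%R.
have mX : measurable_fun setT X by exact: measurable_funM (measurable_funM mKc mQ) mw.
have winv u v : crn d u = crn d v -> w u = w v.
  move=> e; rewrite !indicE; congr (_ : bool)%:R; apply/idP/idP => /set_mem h; apply/mem_set.
    exact: Winv e h.
  exact: Winv (esym e) h.
have Xinv u v : crn d u = crn d v -> X u = X v by move=> e; rewrite /X /Kc /Q (winv _ _ e) e.
have wavg y : w y != 0%R -> avg d f y < +oo.
  rewrite indicE; case: (boolP (y \in W)) => [/set_mem yW _|_]; last by rewrite eqxx.
  by apply: le_lt_trans (Wavg yW) (ltry _).
have Xfin y : X y != 0%R -> avg d f y < +oo.
  by rewrite /X mulf_eq0 negb_or => /andP[_]; exact: wavg.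
have absX y : `|X y|%R = (w y * Q y * `|Kc y|)%R.
  by rewrite /X !normrM (ger0_norm (Q0 y)) (ger0_norm (w0 y)); ring.
have IX : \int[mu]_y (`|X y|)%:E < +oo.
  have mwQ : measurable_fun setT (fun y => w y * Q y * `|Kx y|)%R.
    exact: measurable_funM (measurable_funM mw mQ) maKx.
  apply: le_lt_trans (lte_add_pinfty ID IA).
  rewrite -(int_addR mu mwD mwQ wD0); last by move=> y; rewrite !mulr_ge0.
  apply: int_leR; [exact: (measurable_absR mX)|exact: measurable_funD mwD mwQ| |].
    by move=> y; rewrite normr_ge0.
  move=> y; rewrite absX -!mulrA -mulrDr ler_wpM2l//.
  rewrite /Q; case: ltP => _; rewrite ?mul1r ?mul0r ?addr0//.
  by rewrite /D distrC; have := ler_normD (Kc y - Kx y)%R (Kx y); rewrite subrK.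
have mXf : measurable_fun setT (fun y => X y * f y)%R by exact: measurable_funM mX mf.
have mXfa : measurable_fun setT (fun y => X y * fa y)%R by exact: measurable_funM mX mfa.
have IXfa : \int[mu]_y (`|X y| * fa y)%:E < +oo.
  apply: (@le_lt_trans _ _ (t%:E * \int[mu]_y (`|X y|)%:E)); last first.
    by rewrite lte_mul_pinfty// lee_fin ltW.
  rewrite -(int_scaleR mu (measurable_absR mX) (ltW t0)); last by move=> y; rewrite normr_ge0.
  apply: int_leR.
  - exact: measurable_funM (measurable_absR mX) mfa.
  - exact: measurable_funM (measurable_cst _) (measurable_absR mX).
  - by move=> y; rewrite mulr_ge0.
  by move=> y; rewrite absX; apply: mul4_le => //; exact: wfa.
have IXf : \int[mu]_y (`|X y| * f y)%:E < +oo.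
  rewrite -(ravg_adj0 Hleb d0 mf f0 (measurable_absR mX))//; first by move=> u v e; rewrite (Xinv _ _ e).
  by move=> y; rewrite normr_eq0; exact: Xfin.
have SP y : W y -> (S y != 0)%R = (ep / 2 < vnorm (vsub x (crn d y)) < 2 * ep)%R.
  by move=> _; rewrite /S mulf_eq0 negb_or !pnatr_eq0 !eqb0 !negbK.
(* Majorises the cells cut by the truncation sphere. Being constant on cells, [A] has the same
   integral against [f] as against [fa <= t], so the possibly large [f] is replaced by [t]. *)
pose A (y : E) := (w y * S y * `|Kc y|)%R.
have mA : measurable_fun setT A by exact: measurable_funM (measurable_funM mw mS) maKc.
have A0 y : (0 <= A y)%R by rewrite !mulr_ge0.
have Ainv u v : crn d u = crn d v -> A u = A v by move=> e; rewrite /A /Kc /S (winv _ _ e) e.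
have Afin y : A y != 0%R -> avg d f y < +oo.
  by rewrite /A !mulf_eq0 !negb_or => /andP[/andP[+ _] _]; exact: wavg.
have JA : \int[mu]_y (A y * fa y)%:E = \int[mu]_y (A y * f y)%:E.
  exact: (ravg_adj0 Hleb d0 mf f0 mA Ainv Afin A0).
have mAfa : measurable_fun setT (fun y => A y * fa y)%R by exact: measurable_funM mA mfa.
have mAf : measurable_fun setT (fun y => A y * f y)%R by exact: measurable_funM mA mf.
have mTK : measurable_fun setT (fun y => T y * (w y * `|Kx y|))%R.
  exact: measurable_funM mT (measurable_funM mw maKx).
have TK0 y : (0 <= T y * (w y * `|Kx y|))%R by rewrite !mulr_ge0.
have AT y : (A y <= w y * D y + T y * (w y * `|Kx y|))%R.
  rewrite /A indicE; case: (boolP (y \in W)) => [/set_mem yW|_]; last first.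
    by rewrite !(mulr0, mul0r) addr0.
  rewrite !mul1r; have [->|] := eqVneq (S y) 0%R.
    by rewrite mul0r addr_ge0// mulr_ge0.
  rewrite SP// => /andP[s1 s2]; have [g1 g2 g3] := geo y yW.
  have -> : S y = 1%R by rewrite /S s1 s2 mulr1.
  have -> : T y = 1%R by rewrite /T (ring_bound ep0 g3 g1 g2 s1 s2).
  rewrite !mul1r /D distrC.
  by have := ler_normD (Kc y - Kx y)%R (Kx y); rewrite subrK.
have JB : \int[mu]_y (A y * fa y)%:E <= t%:E * (\int[mu]_y (w y * D y)%:E + B2).
  rewrite -(int_addR mu mwD mTK wD0 TK0).
  rewrite -(int_scaleR mu (measurable_funD mwD mTK) (ltW t0)); last by move=> y; rewrite addr_ge0.
  apply: int_leR.
  - exact: mAfa.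
  - exact: measurable_funM (measurable_cst _) (measurable_funD mwD mTK).
  - by move=> y; rewrite mulr_ge0.
  move=> y; apply: le_trans (ler_wpM2l (ltW t0) (AT y)).
  by apply: mul4_le => //; exact: wfa.
(* The truncated kernel minus its corner version; the part with [X] integrates to zero against
   [f - fa]. *)
pose G (y : E) := ((Kx y * P y * w y - X y) * (f y - fa y))%R.
have mG : measurable_fun setT G.
  exact: measurable_funM (measurable_funB (measurable_funM (measurable_funM mKx mP) mw) mX) (measurable_funB mf mfa).
have mU : measurable_fun setT (fun y => w y * D y * (f y + t))%R.
  exact: measurable_funM mwD (measurable_funD mf (measurable_cst _)).
have U0 y : (0 <= w y * D y * (f y + t))%R by rewrite mulr_ge0// addr_ge0// ltW.
have mAA : measurable_fun setT (fun y => A y * f y + A y * fa y)%R by exact: measurable_funD mAf mAfa.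
have AA0 y : (0 <= A y * f y + A y * fa y)%R by rewrite addr_ge0// mulr_ge0.
have GU y : (`|G y| <= w y * D y * (f y + t) + (A y * f y + A y * fa y))%R.
  rewrite /G /X /A; have := wfa y; rewrite indicE; case: (boolP (y \in W)) => [/set_mem yW|_]; last first.
    by rewrite !(mulr0, mul0r) subrr mul0r normr0 !addr0.
  rewrite !(mul1r, mulr1) => fat; have [g1 g2 g3] := geo y yW.
  have ff : (`|f y - fa y| <= f y + fa y)%R.
    by apply: le_trans (ler_normB _ _) _; rewrite !ger0_norm.
  have SPQ : P y != Q y -> S y = 1%R.
    rewrite /P /Q /S; case: (ltP ep (vnorm (vsub x y))) => h1;
      case: (ltP ep (vnorm (vsub x (crn d y)))) => h2; rewrite ?eqxx// => _.
      by have [-> ->] := cross1 ep0 g3 g1 h1 h2; rewrite mulr1.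
    by have [-> ->] := cross2 ep0 g3 g2 h1 h2; rewrite mulr1.
  rewrite normrM; apply: le_trans (ler_wpM2l (normr_ge0 _) ff) _.
  apply: (@le_trans _ _ ((D y + S y * `|Kc y|) * (f y + fa y))%R).
    apply: ler_wpM2r; first by rewrite addr_ge0.
    have [pq|/SPQ ->] := eqVneq (P y) (Q y).
      rewrite pq -mulrBl normrM (ger0_norm (Q0 y)) -/(D y).
      apply: (@le_trans _ _ (D y)); last by rewrite lerDl mulr_ge0.
      by rewrite ler_piMr// /Q; case: ltP.
    rewrite mul1r; have := ler_normD (Kx y - Kc y)%R (Kc y); rewrite subrK -/(D y) => h.
    rewrite /P /Q; case: ltP => _; case: ltP => _; rewrite ?(mulr1, mulr0, subr0, sub0r, normrN) ?subrr ?normr0 ?addr_ge0//.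
      by rewrite lerDl.
    by rewrite lerDr.
  by rewrite mulrDl [(S y * _ * (_ + _))%R]mulrDr lerD2r ler_wpM2l// lerD2l.
have IG : \int[mu]_y `|G y|%:E <= Hlev x + (2 * t)%:E * B2.
  apply: (@le_trans _ _ (\int[mu]_y (w y * D y * (f y + t) + (A y * f y + A y * fa y))%:E)).
    by apply: int_leR; [exact: measurable_absR|exact: measurable_funD mU mAA|move=> y; rewrite normr_ge0|].
  rewrite (int_addR mu mU mAA U0 AA0) (int_addR mu mAf mAfa) => [|y|y]; try by rewrite mulr_ge0.
  rewrite -JA; apply: (@le_trans _ _ (\int[mu]_y (w y * D y * (f y + t))%:E +
     (2 * t)%:E * (\int[mu]_y (w y * D y)%:E + B2))).
    rewrite leeD2l// mulr_natl mulr2n EFinD ge0_muleDl ?lee_fin ?(ltW t0)//.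
    by apply: leeD; exact: JB.
  have ID0 : 0 <= \int[mu]_y (w y * D y)%:E by exact: int_ge0R.
  rewrite ge0_muleDr// addeA; apply: leeD => //.
  have mwD2 : measurable_fun setT (fun y => 2 * t * (w y * D y))%R.
    exact: measurable_funM (measurable_cst _) mwD.
  have t20 : (0 <= 2 * t)%R by rewrite mulr_ge0// ltW.
  rewrite -(int_scaleR mu mwD t20 wD0) -(int_addR mu mU mwD2 U0); last first.
    by move=> y; rewrite mulr_ge0.
  by rewrite HE le_eqVlt; apply/orP; left; apply/eqP; apply: eq_integral => y _; congr EFin; rewrite /=; ring.
have [B2oo|B2fin] := eqVneq B2 +oo.
  rewrite B2oo gt0_muley ?lte_fin ?mulr_gt0// addey ?leey//.
  by rewrite gt_eqF//; apply: (lt_le_trans (ltNyr 0)); apply: integral_ge0 => y _; rewrite lee_fin !mulr_ge0 ?addr_ge0 ?mulr_ge0// ltW.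
have {}B2fin : B2 < +oo by rewrite ltey.
have iG : mu.-integrable setT (EFin \o G).
  apply: (integrableR mG); apply: (le_lt_trans IG); rewrite lte_add_pinfty// lte_mul_pinfty//.
  by rewrite lee_fin mulr_ge0// ltW.
have iXf : mu.-integrable setT (EFin \o (fun y => X y * f y)%R).
  apply: (integrableR mXf); apply: le_lt_trans IXf.
  by rewrite le_eqVlt; apply/orP; left; apply/eqP; apply: eq_integral => y _; rewrite normrM (ger0_norm (f0 y)).
have iXfa : mu.-integrable setT (EFin \o (fun y => X y * fa y)%R).
  apply: (integrableR mXfa); apply: le_lt_trans IXfa.
  by rewrite le_eqVlt; apply/orP; left; apply/eqP; apply: eq_integral => y _; rewrite normrM (ger0_norm (fa0 y)).
have -> : \int[mu]_y (K (vsub x y) * (ep < vnorm (vsub x y))%R%:R * (w y * (f y - fa y)))%:E =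
   \int[mu]_y ((EFin \o G) y + ((EFin \o (fun y => X y * f y)%R) y - (EFin \o (fun y => X y * fa y)%R) y)).
  by apply: eq_integral => y _; rewrite /= -!EFinD; congr EFin; rewrite /G /Kx /P; ring.
rewrite (integralD measurableT iG (integrableB measurableT iXf iXfa)) (integralB measurableT iXf iXfa).
rewrite [X in _ + (X - _)](_ : _ = \int[mu]_y (X y * fa y)%:E); last first.
  by rewrite (ravg_adj Hleb d0 mf f0 mX Xinv Xfin).
rewrite subee ?adde0; last exact: (integrable_fin_num measurableT iXfa).
by apply: le_trans (abs_intR mu mG) IG.
Qed.
End level.
End singular.

(** * Stopping cells and the dyadic maximal inequality *)

Section stopping.
Context {R : realType} {n : nat} (leb : {measure set (n.-tuple R) -> \bar R}).
Hypothesis Hleb : is_lebesgue_borel leb.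
Hypothesis n0 : (0 < n)%N.
Local Notation V := (n.-tuple R).
Local Notation E := (Rn leb).
Local Notation mu := (lebm leb).
Local Open Scope ereal_scope.
Variables (l s : R) (f : E -> R).
Hypothesis l0 : (0 < l)%R.
Hypothesis s0 : (0 < s)%R.
Hypothesis mf : measurable_fun setT f.
Hypothesis f0 : forall x, (0 <= f x)%R.

Definition side k : R := (l / 2 ^+ k)%R.
Lemma side_gt0 k : (0 < side k)%R.
Proof. by rewrite divr_gt0// exprn_gt0. Qed.

Lemma side_nest i k (x y : V) : (i <= k)%N -> crn (side k) x = crn (side k) y -> crn (side i) x = crn (side i) y.
Proof.
move=> ik e; have -> : side i = (side k * (2 ^ (k - i))%:R)%R.
  have e2 : (2 ^+ k = 2 ^+ i * 2 ^+ (k - i) :> R)%R by rewrite -exprD subnKC.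
  by rewrite /side natrX e2; field; rewrite !expf_neq0.
have g0 : (0 < 2 ^ (k - i))%N by rewrite expn_gt0.
by rewrite -(crn_nest x (side_gt0 k) g0) e crn_nest// side_gt0.
Qed.

Definition above k : set E := [set x : E | s%:E < avg (side k) f x].
(** [seqDU] keeps in [stop k] the points whose average exceeds [s] for the first time at level [k]:
    the stopping cells of side [l / 2 ^ k]. *)
Definition stop := seqDU above.

Lemma measurable_above k : measurable (above k).
Proof.
have m := measurable_avg Hleb (side k) mf f0.
by rewrite -[X in measurable X]setTI; exact: emeasurable_fun_o_infty.
Qed.

Lemma measurable_stop k : measurable (stop k).
Proof. by apply: seqDU_measurable => j; exact: measurable_above. Qed.

Lemma above_inv k (x y : V) : crn (side k) x = crn (side k) y -> above k x -> above k y.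
Proof. by move=> e; rewrite /above/= (avg_inv _ e). Qed.

Lemma stopP k x : stop k x <-> above k x /\ forall i, (i < k)%N -> ~ above i x.
Proof.
rewrite /stop /seqDU -bigcup_mkord; split => [[h1 h2]|[h1 h2]]; split => //.
  by move=> i ik h; apply: h2; exists i.
by move=> [i /= ik h]; exact: (h2 i ik h).
Qed.

Lemma stop_inv k (x y : V) : crn (side k) x = crn (side k) y -> stop k x -> stop k y.
Proof.
move=> e /stopP[h1 h2]; apply/stopP; split; first exact: above_inv e h1.
by move=> i ik h; apply: (h2 i ik); exact: (above_inv (side_nest (ltnW ik) (esym e))) h.
Qed.

(** The parent of a stopping cell did not stop, so its average is at most [s], and [avg_double]
    costs [2 ^ n]. A cell of level 0 has no parent in the construction. *)
Lemma stop_le k x : stop k.+1 x -> avg (side k.+1) f x <= (2 ^+ n * s)%:E.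
Proof.
move=> /stopP[_ h]; apply: le_trans (avg_double x (side_gt0 k.+1) mf f0) _.
rewrite EFinM; apply: lee_wpmul2l; first by rewrite lee_fin exprn_ge0.
rewrite (_ : (side k.+1 * 2)%R = side k); last by rewrite /side exprS; field; rewrite expf_neq0.
by rewrite leNgt; apply/negP; exact: h.
Qed.

(** Chebyshev's inequality cell by cell: [stop k] is a union of cells of level [k], on each of which
    the average exceeds [s]. *)
Lemma stop_mass k : s%:E * mu (stop k) <= \int[mu]_(x in stop k) (f x)%:E.
Proof.
pose X : E -> R := \1_(stop k).
have mX : measurable_fun setT X by apply: measurable_indic; exact: measurable_stop.
have X0 x : (0 <= X x)%R by rewrite /X indicE.
have Xinv x y : crn (side k) x = crn (side k) y -> X x = X y.
  move=> e; rewrite /X !indicE; congr (_ : bool)%:R; apply/idP/idP => /set_mem h; apply/mem_set.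
    exact: stop_inv e h.
  exact: stop_inv (esym e) h.
rewrite int_condR -(avg_adj Hleb (side_gt0 k) mf f0 mX X0 Xinv).
rewrite -(setIT (stop k)) -(integral_indic mu measurableT (measurable_stop k)).
have mX' : measurable_fun setT (fun x => (X x)%:E) by apply/measurable_EFinP.
rewrite -(ge0_integralZl mu measurableT mX'); last 2 first.
- by move=> x _; rewrite lee_fin.
- by rewrite lee_fin ltW.
have ma := measurable_avg Hleb (side k) mf f0.
apply: ge0_le_integralT.
- exact: measurableT.
- exact: emeasurable_funM (measurable_cst _) mX'.
- exact: emeasurable_funM mX' ma.
- by move=> x; rewrite mule_ge0// lee_fin// ltW.
move=> x _; rewrite muleC; rewrite /X indicE; case: (boolP (x \in stop k)) => [/set_mem [h _]|_].
  by rewrite !mul1e ltW.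
by rewrite !mul0e.
Qed.

Lemma stop_series (w : E -> R) : measurable_fun setT w -> (forall x, 0 <= w x)%R ->
  \sum_(k <oo) \int[mu]_(x in stop k) (w x)%:E <= \int[mu]_x (w x)%:E.
Proof.
move=> /measurable_EFinP mw w0; rewrite -ge0_integral_bigcup.
- apply: ge0_subset_integral.
  + by apply: bigcup_measurable => k _; exact: measurable_stop.
  + exact: measurableT.
  + exact: mw.
  + by move=> x _; rewrite lee_fin.
  + by [].
- by move=> k; exact: measurable_stop.
- exact: measurable_funTS.
- by move=> x _; rewrite lee_fin.
- exact: trivIset_seqDU.
Qed.

Lemma stop_sum N (w : E -> R) : measurable_fun setT w -> (forall x, 0 <= w x)%R ->
  \sum_(0 <= k < N) \int[mu]_(x in stop k) (w x)%:E <= \int[mu]_x (w x)%:E.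
Proof.
move=> mw w0; apply: le_trans (stop_series mw w0); apply: nneseries_lim_ge => k _ _.
by apply: integral_ge0 => x _; rewrite lee_fin.
Qed.

Lemma stop_mass_series : \sum_(k <oo) s%:E * mu (stop k) <= \int[mu]_x (f x)%:E.
Proof.
apply: le_trans (stop_series mf f0).
by apply: lee_nneseries => k _; [move=> _; rewrite mule_ge0 ?Leb_ge0// lee_fin ltW|exact: stop_mass].
Qed.

(** The weak type bound of the dyadic maximal function over cells of side at most [l], obtained from
    the disjointness of the stopping sets. *)
Lemma stop_bigcup : s%:E * mu (\bigcup_k above k) <= \int[mu]_x (f x)%:E.
Proof.
rewrite seqDU_bigcup_eq (measure_bigcup mu setT); last 2 first.
- by move=> k _; exact: measurable_stop.
- exact: trivIset_seqDU.
apply: le_trans stop_mass_series.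
rewrite nneseriesZl => [|k _]; last exact: Leb_ge0.
apply: lee_wpmul2l; first by rewrite lee_fin ltW.
by rewrite le_eqVlt; apply/orP; left; apply/eqP; apply: eq_eseriesl => k; rewrite in_setT.
Qed.
End stopping.

(** * Cell faces are null *)

Section boundary.
Context {R : realType} {n : nat} (leb : {measure set (n.-tuple R) -> \bar R}).
Hypothesis Hleb : is_lebesgue_borel leb.
Hypothesis n0 : (0 < n)%N.
Local Notation V := (n.-tuple R).
Local Notation E := (Rn leb).
Local Notation mu := (lebm leb).
Local Open Scope ereal_scope.

Lemma null_bigcup (A : (set E)^nat) : (forall k, mu (A k) = 0) -> mu (\bigcup_k A k) = 0.
Proof.
move=> h; apply/eqP; rewrite eq_le Leb_ge0 andbT; apply: le_trans (Leb_subadd A) _.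
by rewrite eseries0.
Qed.

Lemma null_countable (T : countType) (A : T -> set E) : (forall t, mu (A t) = 0) -> mu (\bigcup_t A t) = 0.
Proof.
move=> h; pose B k : set E := if unpickle k is Some t then A t else set0.
apply/eqP; rewrite eq_le Leb_ge0 andbT -(@null_bigcup B).
  by apply: le_Leb => x [t _ xt]; exists (pickle t) => //; rewrite /B pickleK.
by move=> k; rewrite /B; case: unpickle => [t|]; rewrite ?h ?measure0.
Qed.

(** Cells are open below and closed above, so a point fails to be interior to its cell exactly when
    it lies on an upper face. *)
Definition bdry (d : R) : set E := [set z : E | exists i, tnth z i = tnth (crn d z) i].

Lemma null_bdry d : mu (bdry d) = 0.
Proof.
pose A (p : 'I_n * int) : set E := [set z : E | tnth z p.1 = (d * p.2%:~R)%R].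
apply/eqP; rewrite eq_le Leb_ge0 andbT -(@null_countable _ A).
  by apply: le_Leb => z [i h]; exists (i, Num.ceil (tnth z i / d)) => //; rewrite /A/= -tnth_crn.
move=> p; rewrite /A (@LebE _ _ leb [set z : V | tnth z p.1 = (d * p.2%:~R)%R]); first exact: leb_hyperplane.
exact: (measurable_halfspace p.1 (measurable_set1 (d * p.2%:~R)%R)).
Qed.

Lemma crn_locally_cst (d : R) z : (0 < d)%R -> ~ bdry d z ->
  exists2 r : R, (0 < r)%R & forall y, (vnorm (vsub z y) <= r)%R -> crn d z = crn d y.
Proof.
move=> d0 zb.
(* [p i] adds the reciprocals of the distances to the two faces in direction [i]. The reciprocal of
   [1 + \sum_i p i] is then positive and below all these distances. *)
pose p (i : 'I_n) : R := ((tnth (crn d z) i - tnth z i)^-1 + (tnth z i - (tnth (crn d z) i - d))^-1)%R.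
have c1 i : (0 < tnth (crn d z) i - tnth z i)%R.
  rewrite subr_gt0 lt_neqAle crn_ge// andbT; apply/eqP => h; apply: zb; by exists i.
have c2 i : (0 < tnth z i - (tnth (crn d z) i - d))%R.
  by have := crn_lt z i d0; lra.
have p0 i : (0 < p i)%R by rewrite addr_gt0// invr_gt0.
have S0 : (0 < 1 + \sum_i p i)%R by rewrite ltr_pwDl// sumr_ge0// => i _; exact: ltW.
have pS i : (p i < 1 + \sum_i p i)%R.
  by rewrite (bigD1 i)//= addrCA ltrDl ltr_pwDl// sumr_ge0// => j _; exact: ltW.
exists (1 + \sum_i p i)^-1%R; first by rewrite invr_gt0.
move=> y zy; apply/crn_eqP => // i.
have h := le_trans (coord_le_vnorm (vsub z y) i) zy; rewrite tnthE in h.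
have hS : ((1 + \sum_i p i)^-1 < (p i)^-1)%R by rewrite ltf_pV2 ?posrE.
have h1 : ((p i)^-1 <= tnth (crn d z) i - tnth z i)%R.
  by rewrite -[leRHS]invrK lef_pV2 ?posrE ?invr_gt0// lerDl invr_ge0 ltW.
have h2 : ((p i)^-1 <= tnth z i - (tnth (crn d z) i - d))%R.
  by rewrite -[leRHS]invrK lef_pV2 ?posrE ?invr_gt0// lerDr invr_ge0 ltW.
move: h; rewrite ler_norml => /andP[h3 h4].
by apply/andP; split; lra.
Qed.
End boundary.

(** * Truncations of grid steps and Cotlar's inequality *)

Section principal_value.
Context {R : realType} {n : nat} (leb : {measure set (n.-tuple R) -> \bar R}).
Hypothesis Hleb : is_lebesgue_borel leb.
Hypothesis n0 : (0 < n)%N.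
Local Notation V := (n.-tuple R).
Local Notation E := (Rn leb).
Local Notation mu := (lebm leb).
Local Open Scope ereal_scope.
Variables (K : V -> R) (k0 CH : R).
Hypothesis mK : measurable_fun [set: V] K.
Hypothesis Kring : forall s, (0 < s)%R -> \int[mu]_(x in ann leb s (2 * s)) `|K x|%:E <= k0%:E.
Hypothesis Khor : forall r h, (0 < r)%R -> (vnorm h <= r)%R ->
  \int[mu]_(x in [set x : E | (8 * r < vnorm x)%R]) `|K (vadd x h) - K x|%:E <= CH%:E.
Hypothesis Kmean : forall s t, (0 < s)%R -> (s <= t)%R -> \int[mu]_(x in ann leb s t) (K x)%:E = 0.

Let mtoV := @measurable_toV R n leb.
Let mxy x : measurable_fun setT ((fun y => vsub x y) : E -> V).
Proof. exact: mvsubE. Qed.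
Let mKxy x : measurable_fun setT ((fun y => K (vsub x y)) : E -> R).
Proof. by apply: (mKf mK); exact: mvsubE. Qed.

Definition Te (f : E -> R) (ep : R) (x : E) : \bar R :=
  \int[mu]_(y in [set y : E | (ep < vnorm (vsub x y))%R]) (K (vsub x y) * f y)%:E.
(** [lim] is unspecified where the truncations diverge. The weak bound is assumed for these raw
    values; explicit values are computed only where the function is locally constant, by
    [TT_loc]. *)
Definition TT (f : E -> R) (x : E) : \bar R := lim (Te f ep x @[ep --> 0^'+]).

Definition cutK (ep : R) (x y : V) : R := (K (vsub x y) * (ep < vnorm (vsub x y))%R%:R)%R.

Lemma TeE f ep x : Te f ep x = \int[mu]_y (cutK ep x y * f y)%:E.
Proof.
rewrite /Te int_condR; apply: eq_integral => y _; congr EFin; rewrite /cutK indicE.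
rewrite mulrCA mulrA; congr (_ * _ * _)%R; congr (_ : bool)%:R.
by apply/idP/idP => [/set_mem|h]; [|apply/mem_set].
Qed.

Lemma measurable_cutK ep x : measurable_fun setT (cutK ep x : E -> R).
Proof.
exact: measurable_funM (mKxy x) (measurable_ltb (measurable_cst ep) (measurable_vnorm (mxy x))).
Qed.

(** Bounded with bounded support: the truncated integrals then converge absolutely for every
    positive radius. *)
Definition bcs (h : E -> R) (B rho : R) :=
  [/\ measurable_fun setT h, forall y, (`|h y| <= B)%R & forall y, (rho < vnorm y)%R -> h y = 0%R].

Lemma bcs_ge0 h B rho : bcs h B rho -> (0 <= B)%R.
Proof. by case=> _ hB _; exact: le_trans (normr_ge0 (h vzero)) (hB _). Qed.

Lemma cutK_fin h (B rho ep : R) x : bcs h B rho -> (0 < ep)%R ->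
  \int[mu]_y `|cutK ep x y * h y|%:E < +oo.
Proof.
move=> hb ep0; have B0 := bcs_ge0 hb; case: hb => mh hB hs.
have mr := measurable_ring_at Hleb x ep (vnorm x + rho)%R.
have mi : measurable_fun setT ((\1_[set y : E | (ep < vnorm (vsub x y) <= vnorm x + rho)%R]) : E -> R).
  exact: measurable_indic.
have mB : measurable_fun setT (fun y : E => \1_[set y : E | (ep < vnorm (vsub x y) <= vnorm x + rho)%R] y * `|K (vsub x y)|)%R.
  exact: measurable_funM mi (measurable_absR (mKxy x)).
apply: (@le_lt_trans _ _ (B%:E * \int[mu]_(y in [set y : E | (ep < vnorm (vsub x y) <= vnorm x + rho)%R]) `|K (vsub x y)|%:E)); last first.
  by rewrite (Kring_at Hleb mK) lte_mul_pinfty// (Kring_fin mK Kring).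
rewrite [X in _ <= _ * X]int_condR -(int_scaleR mu mB B0); last by move=> y; rewrite mulr_ge0// indicE.
apply: int_leR.
- exact: measurable_absR (measurable_funM (measurable_cutK ep x) mh).
- exact: measurable_funM (measurable_cst _) mB.
- by move=> y; rewrite normr_ge0.
move=> y; rewrite indicE /cutK; have [hy|hy] := leP (vnorm y) rho; last first.
  by rewrite (hs y hy) mulr0 normr0 !mulr_ge0.
rewrite !normrM; case: ltP => xy; last by rewrite normr0 mulr0 mul0r !mulr_ge0.
rewrite normr1 mulr1 mulrC mem_set ?mul1r ?ler_wpM2r//=.
by rewrite xy; apply: le_trans (vnormB x y) _; rewrite lerD2l.
Qed.

Lemma cutK_integrable h (B rho ep : R) x : bcs h B rho -> (0 < ep)%R ->
  mu.-integrable setT (EFin \o (fun y => cutK ep x y * h y)%R).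
Proof.
move=> hb ep0; have [mh _ _] := hb.
by apply: integrableR; [exact: measurable_funM (measurable_cutK ep x) mh|exact: cutK_fin hb ep0].
Qed.

Lemma Te_fin h (B rho ep : R) x : bcs h B rho -> (0 < ep)%R -> Te h ep x \is a fin_num.
Proof.
by move=> hb ep0; rewrite TeE; exact: (integrable_fin_num measurableT (cutK_integrable x hb ep0)).
Qed.

Lemma Kmean_at (s t : R) z : (0 < s)%R -> (s <= t)%R ->
  \int[mu]_(y in [set y : E | (s < vnorm (vsub z y) <= t)%R]) (K (vsub z y))%:E = 0.
Proof.
move=> s0 st; rewrite -(Kmean s0 st).
rewrite integralE [RHS]integralE.
have mKE : measurable_fun setT (fun x : E => (K x)%:E) by apply/measurable_EFinP; exact: mKf.
have mp := measurable_funepos mKE; have mn := measurable_funeneg mKE.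
have p0 (x : E) : 0 <= (fun x : E => (K x)%:E)^\+ x by exact: funepos_ge0.
have q0 (x : E) : 0 <= (fun x : E => (K x)%:E)^\- x by exact: funeneg_ge0.
rewrite -(ge0_integral_reflect Hleb (measurable_ann _ s t) mp p0 z).
rewrite -(ge0_integral_reflect Hleb (measurable_ann _ s t) mn q0 z).
by congr (_ - _); apply: eq_integral => x _; rewrite ?funeposE ?funenegE.
Qed.

(** Between the radii [ep] and [r] the function is the constant [c], and the kernel has mean zero on
    the annulus. *)
Lemma Te_loc h (B rho : R) z (c r ep : R) : bcs h B rho -> (0 < ep)%R -> (ep <= r)%R ->
  (forall y, (vnorm (vsub z y) <= r)%R -> h y = c) -> Te h ep z = Te h r z.
Proof.
move=> hb ep0 er hc; have r0 : (0 < r)%R by exact: lt_le_trans er.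
rewrite !TeE.
pose D (y : E) := (c * (\1_[set y : E | (ep < vnorm (vsub z y) <= r)%R] y * K (vsub z y)))%R.
have mD1 : measurable_fun setT (fun y : E => \1_[set y : E | (ep < vnorm (vsub z y) <= r)%R] y * K (vsub z y))%R.
  by apply: measurable_funM (mKxy z); apply: measurable_indic; exact: measurable_ring_at.
have iD1 : mu.-integrable setT (EFin \o (fun y : E => \1_[set y : E | (ep < vnorm (vsub z y) <= r)%R] y * K (vsub z y))%R).
  apply: (integrableR mD1).
  have -> : \int[mu]_y `|\1_[set y : E | (ep < vnorm (vsub z y) <= r)%R] y * K (vsub z y)|%:E =
      \int[mu]_(y in [set y : E | (ep < vnorm (vsub z y) <= r)%R]) `|K (vsub z y)|%:E.
    rewrite [RHS]int_condR; apply: eq_integral => y _; congr EFin; rewrite normrM; congr (_ * _)%R.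
    by rewrite indicE; case: (_ \in _); rewrite ?normr1 ?normr0.
  by rewrite (Kring_at Hleb mK) (Kring_fin mK Kring).
have -> : \int[mu]_y (cutK ep z y * h y)%:E = \int[mu]_y ((EFin \o (fun y => cutK r z y * h y)%R) y + (EFin \o D) y).
  apply: eq_integral => y _; rewrite /= -EFinD; congr EFin; rewrite /cutK /D indicE.
  have [zr|zr] := leP (vnorm (vsub z y)) r.
    rewrite (hc y zr); have [ze|ze] := ltP ep (vnorm (vsub z y)).
      by rewrite mem_set/= ?ze ?zr//; ring.
    rewrite memNset/=; first by ring.
    by move=> /andP[h1 _]; have := lt_le_trans h1 ze; rewrite ltxx.
  rewrite (le_lt_trans er zr) memNset/=; first by ring.
  by move=> /andP[_ h1]; have := lt_le_trans zr h1; rewrite ltxx.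
rewrite (integralD measurableT (cutK_integrable z hb r0)); last first.
  by rewrite (_ : EFin \o D = (fun y => c%:E * (EFin \o (fun y : E => \1_[set y : E | (ep < vnorm (vsub z y) <= r)%R] y * K (vsub z y))%R) y)) ?integrableZl//.
have -> : \int[mu]_y (EFin \o D) y = 0; last by rewrite adde0.
rewrite (_ : \int[mu]_y (EFin \o D) y = \int[mu]_y (c%:E * (EFin \o (fun y : E => \1_[set y : E | (ep < vnorm (vsub z y) <= r)%R] y * K (vsub z y))%R) y))//.
rewrite (integralZl measurableT iD1).
by rewrite -[X in _ * X]/(\int[mu]_y (\1_[set y : E | (ep < vnorm (vsub z y) <= r)%R] y * K (vsub z y))%:E) -int_condR Kmean_at// mule0.
Qed.

Lemma TT_loc h (B rho : R) z (c r : R) : bcs h B rho -> (0 < r)%R ->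
  (forall y, (vnorm (vsub z y) <= r)%R -> h y = c) -> TT h z = Te h r z.
Proof.
move=> hb r0 hc; apply: lim_near_cst => //.
near=> ep; apply: (Te_loc hb _ _ hc) => //.
by near: ep; exact: nbhs_right_le.
Unshelve. all: by end_near. Qed.

Lemma bcs_restrict h (B rho : R) (D : set E) : measurable D -> bcs h B rho ->
  bcs (fun y => \1_D y * h y)%R B rho.
Proof.
move=> mD hb; have B0 := bcs_ge0 hb; case: hb => mh hB hs; split.
- by apply: measurable_funM => //; exact: measurable_indic.
- by move=> y; rewrite indicE; case: (_ \in _); rewrite ?mul1r// mul0r normr0.
- by move=> y /hs ->; rewrite mulr0.
Qed.

Lemma Te_bcsB h1 h2 (B1 B2 r1 r2 ep : R) x : bcs h1 B1 r1 -> bcs h2 B2 r2 -> (0 < ep)%R ->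
  Te h1 ep x - Te h2 ep x = \int[mu]_y (cutK ep x y * (h1 y - h2 y))%:E.
Proof.
move=> b1 b2 ep0; rewrite !TeE.
have := integralB measurableT (cutK_integrable x b1 ep0) (cutK_integrable x b2 ep0) => <-.
by apply: eq_integral => y _; rewrite /= -EFinB mulrBr.
Qed.

Definition inball x (ep : R) : set E := [set y : E | (vnorm (vsub x y) <= ep)%R].
Lemma measurable_inball x ep : measurable (inball x ep).
Proof.
rewrite -[X in measurable X]setTI.
exact: (measurable_reflect Hleb x measurableT (measurable_vball leb ep)).
Qed.

(** The truncation at [x] is compared with the integral over the same exterior region
    [|x - y| > ep], the kernel being centred at [z]. That integral is the value of [T g] at [z]
    minus the one of [T] applied to [g] cut to the ball, and Hormander's condition bounds the change
    of centre by [G * CH]. The point [z] avoids the cell faces so that both values are honest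
    truncations. *)
Lemma cotlar g d G rho x ep z : (0 < d)%R -> (forall x y, crn d x = crn d y -> g x = g y) ->
  bcs g G rho -> (0 < ep)%R -> (8 * vnorm (vsub z x) <= ep)%R -> ~ bdry (leb := leb) d z ->
  `|Te g ep x| <= `|TT g z| + `|TT (fun y => \1_(inball x ep) y * g y)%R z| + (G * CH)%:E.
Proof.
move=> d0 ginv gb ep0 zx zb.
have [r1 r10 hr1] := crn_locally_cst d0 zb.
(* Below [r1] the function [g] is constant around [z]; below [ep / 8] the ball around [z] stays
   inside [inball x ep], so the cut function is constant there as well. *)
pose r := Num.min r1 (ep / 8)%R.
have r0 : (0 < r)%R by rewrite lt_min r10 divr_gt0.
have rr1 : (r <= r1)%R by rewrite ge_min lexx.
have rep : (8 * r <= ep)%R.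
  by rewrite mulrC -ler_pdivlMr// ge_min lexx orbT.
have tri y : (vnorm (vsub x y) <= vnorm (vsub z y) + vnorm (vsub z x))%R.
  apply: le_trans (vnorm_le_sub (vsub x y) (vsub z y)) _.
  rewrite addrC lerD2l (_ : vsub (vsub x y) (vsub z y) = vsub x z) 1?vnorm_subC//.
  by apply: eq_from_tnth => i; rewrite !tnthE; ring.
have gbB := bcs_restrict (measurable_inball x ep) gb.
rewrite (TT_loc gb r0 (c := g z)); last by move=> y h; apply/esym/ginv/hr1; exact: le_trans h rr1.
rewrite (TT_loc gbB r0 (c := g z)); last first.
  move=> y h; rewrite indicE mem_set/=; last first.
    by rewrite /inball/=; apply: le_trans (tri y) _; lra.
  by rewrite mul1r; apply/esym/ginv/hr1; exact: le_trans h rr1.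
have e1 : Te g r z - Te (fun y => \1_(inball x ep) y * g y)%R r z =
   \int[mu]_y (K (vsub z y) * (ep < vnorm (vsub x y))%R%:R * g y)%:E.
  rewrite (Te_bcsB z gb gbB r0); apply: eq_integral => y _; congr EFin; rewrite /cutK indicE.
  have [xy|xy] := leP (vnorm (vsub x y)) ep.
    by rewrite mem_set/= ?mul1r ?subrr ?mulr0 ?mul0r.
  rewrite memNset/=; last by apply/negP; rewrite -ltNge.
  have -> : (r < vnorm (vsub z y))%R by have := tri y; lra.
  by rewrite mul0r subr0.
have fI : Te g r z - Te (fun y => \1_(inball x ep) y * g y)%R r z \is a fin_num.
  by rewrite fin_numB (Te_fin z gb r0) (Te_fin z gbB r0).
have i1 := cutK_integrable x gb ep0.
have i2 := cutK_integrable z gb r0.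
have i3 := cutK_integrable z gbB r0.
have [mg hG _] := gb; have G0 := bcs_ge0 gb.
have mP : measurable_fun setT (fun y : E => (ep < vnorm (vsub x y))%R%:R : R).
  exact: measurable_ltb (measurable_cst ep) (measurable_vnorm (mxy x)).
have e2 : Te g ep x - (Te g r z - Te (fun y => \1_(inball x ep) y * g y)%R r z) =
   \int[mu]_y ((ep < vnorm (vsub x y))%R%:R * (K (vsub x y) - K (vsub z y)) * g y)%:E.
  rewrite e1 TeE.
  have i4 : mu.-integrable setT (EFin \o (fun y => K (vsub z y) * (ep < vnorm (vsub x y))%R%:R * g y)%R).
    apply: eq_integrable (integrableB measurableT i2 i3) => // y _.
    rewrite /= -EFinB; congr EFin; rewrite /cutK indicE.
    have [xy|xy] := leP (vnorm (vsub x y)) ep.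
      by rewrite mem_set/= ?mul1r ?subrr ?mulr0 ?mul0r.
    rewrite memNset/=; last by apply/negP; rewrite -ltNge.
    have -> : (r < vnorm (vsub z y))%R by have := tri y; lra.
    by rewrite mul0r mulr0 subr0.
  have := integralB measurableT i1 i4 => <-.
  by apply: eq_integral => y _; rewrite /= -EFinB; congr EFin; rewrite /cutK; ring.
have e3 : `|Te g ep x - (Te g r z - Te (fun y => \1_(inball x ep) y * g y)%R r z)| <= (G * CH)%:E.
  rewrite e2; apply: le_trans (abs_intR mu _) _.
    exact: measurable_funM (measurable_funM mP (measurable_funB (mKxy x) (mKxy z))) mg.
  have h8 : (0 < ep / 8)%R by rewrite divr_gt0.
  have zx8 : (vnorm (vsub z x) <= ep / 8)%R by rewrite ler_pdivlMr// mulrC.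
  have mh' : measurable_fun setT (fun u : E => `|K (vadd u (vsub z x)) - K u|%:E).
    apply: measurable_absB; first by apply: (mKf mK); exact: measurable_vadd mtoV (measurable_cst _).
    exact: (measurableT_comp mK mtoV).
  have h0 (u : E) : 0 <= `|K (vadd u (vsub z x)) - K u|%:E by rewrite lee_fin.
  have := Khor h8 zx8; rewrite (_ : 8 * (ep / 8) = ep)%R; last by field.
  rewrite -(ge0_integral_reflect Hleb (measurable_far leb ep) mh' h0 x) => kh.
  rewrite EFinM; apply: le_trans (lee_wpmul2l _ kh); last by rewrite lee_fin.
  rewrite [X in _ <= _ * X]int_condR.
  have mb : measurable_fun setT (fun y : E => \1_((vsub x : E -> E) @^-1` [set u : E | (ep < vnorm u)%R]) y *
      `|K (vadd (vsub x y) (vsub z x)) - K (vsub x y)|)%R.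
    apply: measurable_funM.
      apply: measurable_indic; rewrite -[X in measurable X]setTI.
      exact: (measurable_reflect Hleb x measurableT (measurable_far leb ep)).
    apply: measurable_absR; apply: measurable_funB; last exact: mKxy.
    by apply: (mKf mK); exact: measurable_vadd (mxy x) (measurable_cst _).
  rewrite -(int_scaleR mu mb G0); last by move=> y; rewrite mulr_ge0// indicE.
  apply: int_leR.
  - apply: measurable_absR.
    exact: measurable_funM (measurable_funM mP (measurable_funB (mKxy x) (mKxy z))) mg.
  - exact: measurable_funM (measurable_cst _) mb.
  - by move=> y; rewrite normr_ge0.
  move=> y; rewrite !normrM mulrC; apply: ler_pM => //; rewrite ?mulr_ge0// indicE.
  rewrite (_ : vadd (vsub x y) (vsub z x) = vsub z y); last first.
    by apply: eq_from_tnth => i; rewrite !tnthE; ring.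
  rewrite [`|K (vsub z y) - _|%R]distrC; apply: ler_wpM2r => //.
  case: ltP => h; first by rewrite normr1 mem_set.
  by rewrite normr0.
set I := Te g r z - _ in fI e3 *.
have -> : Te g ep x = Te g ep x - I + I by rewrite subeK.
apply: le_trans (lee_abs_add _ _) _; rewrite addeC; apply: leeD => //.
exact: lee_abs_sub.
Qed.

End principal_value.

(** * The maximal inequality for nonnegative and signed grid steps *)

Section maximal.
Context {R : realType} {n : nat} (leb : {measure set (n.-tuple R) -> \bar R}).
Hypothesis Hleb : is_lebesgue_borel leb.
Hypothesis n0 : (0 < n)%N.
Local Notation V := (n.-tuple R).
Local Notation E := (Rn leb).
Local Notation mu := (lebm leb).
Local Open Scope ereal_scope.
Variables (K : V -> R) (k0 CH A : R).
Hypothesis mK : measurable_fun [set: V] K.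
Hypothesis Kring : forall s, (0 < s)%R -> \int[mu]_(x in ann leb s (2 * s)) `|K x|%:E <= k0%:E.
Hypothesis Khor : forall r h, (0 < r)%R -> (vnorm h <= r)%R ->
  \int[mu]_(x in [set x : E | (8 * r < vnorm x)%R]) `|K (vadd x h) - K x|%:E <= CH%:E.
Hypothesis Kmean : forall s t, (0 < s)%R -> (s <= t)%R -> \int[mu]_(x in ann leb s t) (K x)%:E = 0.
Hypothesis A0 : (0 <= A)%R.
Hypothesis Kweak : forall (f : E -> R) (s : R), measurable_fun setT f -> \int[mu]_x `|f x|%:E < +oo ->
  (0 < s)%R -> mu [set x : E | s%:E < `|TT K f x|] <= (A / s)%:E * \int[mu]_x `|f x|%:E.

Let mtoV := @measurable_toV R n leb.
Let nR : (1 <= n%:R :> R)%R. Proof. by rewrite ler1n. Qed.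

Lemma bcs_int h (B rho : R) : bcs (leb := leb) h B rho -> \int[mu]_x `|h x|%:E < +oo.
Proof.
move=> hb; have B0 := bcs_ge0 hb; case: hb => mh hB hs.
have mi : measurable_fun setT ((\1_(vball leb rho)) : E -> R).
  by apply: measurable_indic; exact: measurable_vball.
apply: (@le_lt_trans _ _ (B%:E * \int[mu]_x ((\1_(vball leb rho) : E -> R) x)%:E)); last first.
  rewrite (integral_indic mu measurableT (measurable_vball leb rho)) setIT.
  by rewrite lte_mul_pinfty// (Leb_ball_fin Hleb).
rewrite -(int_scaleR mu mi B0); last by move=> y; rewrite indicE.
apply: int_leR.
- exact: measurable_absR.
- exact: measurable_funM (measurable_cst _) mi.
- by move=> y; rewrite normr_ge0.
move=> y; rewrite indicE; have [hy|hy] := leP (vnorm y) rho.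
  by rewrite mem_set ?mulr1.
by rewrite hs// normr0 mulr_ge0.
Qed.

Lemma dyadic_scale (ep : R) : (0 < ep)%R -> (ep <= 1)%R ->
  exists2 k, (8 * (n%:R * side 1 k) <= ep)%R & (ep <= 16 * n%:R * side 1 k)%R.
Proof.
move=> ep0 ep1.
have ex : exists k, (8 * n%:R <= ep * 2 ^+ k)%R.
  exists (Num.bound (8 * n%:R / ep)); rewrite -ler_pdivrMl// mulrC.
  apply: le_trans (ltW (archi_boundP _)) _; first by rewrite divr_ge0 ?mulr_ge0// ltW.
  by rewrite -natrX ler_nat; exact: (ltnW (ltn_expl _ _)).
case: (ex_minnP ex) => k hk kmin; exists k.
  by rewrite /side mul1r mulrA ler_pdivrMr// exprn_gt0.
case: k hk kmin => [|k] hk kmin; first last.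
  have : ~~ (8 * n%:R <= ep * 2 ^+ k)%R by apply/negP => /kmin; rewrite ltnn.
  rewrite -ltNge /side mul1r => h; rewrite ler_pdivlMr ?exprn_gt0// exprS.
  by move: h; set N := (n%:R : R)%R; set p := (2 ^+ k : R)%R => h; nra.
(* The minimal exponent is not 0, as this would give [8 * n <= ep <= 1]. *)
move: hk; rewrite expr0 mulr1 => hk; have := le_trans hk ep1.
rewrite leNgt => /negP[]; apply: lt_le_trans (_ : (8 <= _)%R); first by lra.
by rewrite ler_peMr.
Qed.

Definition beta : R := fine (mu (vball leb 1)).
Lemma betaE : mu (vball leb 1) = beta%:E.
Proof. by rewrite /beta fineK// ge0_fin_numE ?Leb_ge0// (Leb_ball_fin Hleb). Qed.
Lemma beta_ge0 : (0 <= beta)%R.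
Proof. by rewrite fine_ge0// Leb_ge0. Qed.

Lemma mu_inball x ep : (0 < ep)%R -> mu (inball (leb := leb) x ep) = (ep ^+ n * beta)%:E.
Proof.
move=> ep0; rewrite EFinM -betaE -(Leb_ball_scale Hleb 1 ep0) mulr1.
exact: (Leb_reflect Hleb x (vball leb ep)).
Qed.

(** Chosen so that [A * 2 ^ n * beta * (16 * n) ^ n / Lam] is at most 1/4: the set where the
    localised operator exceeds [Lam * s] then fills at most a quarter of a cell. *)
Definition Lam : R := (1 + 4 * A * 2 ^+ n * beta * (16 * n%:R) ^+ n)%R.
Lemma Lam_ge1 : (1 <= Lam)%R.
Proof. by rewrite /Lam lerDl !mulr_ge0 ?beta_ge0. Qed.

(** Let [GF] contain the set where [T g] exceeds [s]. [D] consists of the points having a cell more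
    than half filled by [GF], and the dyadic maximal inequality bounds it. If a truncation at [x] is
    too large, Cotlar's inequality forces every [z] of a cell of size about [ep] around [x] into
    [GF], or into the set where the localised operator is large, or onto a face; so [GF] fills most
    of that cell and [x] lies in [D]. *)
Lemma good_max g d rho s : (0 < d)%R -> (forall x y, crn d x = crn d y -> g x = g y) -> (0 < s)%R ->
  bcs (leb := leb) g (2 ^+ n * s)%R rho ->
  exists2 D : set E, measurable D /\ mu D <= (2 * A / s)%:E * \int[mu]_x `|g x|%:E &
    forall x ep, ~ D x -> (0 < ep)%R -> (ep <= 1)%R ->
      `|Te (leb := leb) K g ep x| <= (s * (1 + Lam + 2 ^+ n * CH))%:E.
Proof.
move=> d0 ginv s0 gb; set G := (2 ^+ n * s)%R in gb.
have L1 := Lam_ge1; have L0 : (0 < Lam)%R by lra.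
have [mg hG gs] := gb.
(* The level set is not known to be measurable; a Borel hull of the same mass replaces it. *)
have [GF mGF [FG GFE]] := @Leb_hull _ _ leb [set x : E | s%:E < `|TT (leb := leb) K g x|].
have mGF' : measurable (GF : set E) by exact: borel_measurable.
pose f1 : E -> R := \1_(GF : set E).
have mf1 : measurable_fun setT f1 by exact: measurable_indic.
have f10 x : (0 <= f1 x)%R by rewrite /f1 indicE.
have h0 : (0 < 2^-1 :> R)%R by rewrite invr_gt0.
exists (\bigcup_k above 1 2^-1 f1 k).
  split; first by apply: bigcup_measurable => k _; exact: measurable_above.
  have := stop_bigcup Hleb ltr01 h0 mf1 f10.
  rewrite /f1 (integral_indic mu measurableT mGF') setIT GFE => H.
  have := Kweak mg (bcs_int gb) s0 => H2.
  have H3 := le_trans H H2.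
  have -> : (2 * A / s)%:E = 2%:E * (A / s)%:E :> \bar R by rewrite -EFinM mulrA.
  rewrite -muleA -lee_pdivrMl//.
move=> x ep xD ep0 ep1; rewrite leNgt; apply/negP => big.
have [k k1 k2] := dyadic_scale ep0 ep1; set q := side 1 k in k1 k2.
have q0 : (0 < q)%R by exact: side_gt0.
apply: xD; exists k => //; rewrite /above/= -/q.
pose Q : set E := [set z : E | crn q x = crn q z].
have Q1 : (same q x : E -> R) = \1_Q.
  by apply/funext => z; rewrite /same indicE; congr (_ : bool)%:R; apply/eqP/idP => [/mem_set|/set_mem].
have mQ : measurable Q.
  rewrite (_ : Q = (same q x : E -> R) @^-1` [set 1%R]).
    rewrite -[X in measurable X]setTI; exact: (measurable_same1 q x measurableT (measurable_set1 1%R)).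
  apply/seteqP; split => z; rewrite /= /same.
    by move=> ->; rewrite eqxx.
  by case: eqP => // _ /eqP; rewrite eq_sym oner_eq0.
have muQ : mu Q = (q ^+ n)%:E.
  by rewrite -(int_same Hleb q0 x) Q1 (integral_indic mu measurableT mQ) setIT.
pose F' : set E := [set z : E | (Lam * s)%:E < `|TT (leb := leb) K (fun y => \1_(inball x ep) y * g y)%R z|].
have sub : Q `<=` (Q `&` GF) `|` (F' `|` bdry d).
  move=> z Qz; have [zb|zb] := pselect (bdry (leb := leb) d z); first by right; right.
  have [zF|zF] := pselect (F' z); first by right; left.
  left; split => //; apply: FG => /=; rewrite ltNge; apply/negP => zs.
  have zx : (8 * vnorm (vsub z x) <= ep)%R.
    by apply: le_trans k1; rewrite ler_pM2l// vnorm_subC; exact: crn_near.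
  have := cotlar Hleb mK Kring Khor Kmean d0 ginv gb ep0 zx zb.
  move: zF => /negP; rewrite -leNgt => zF' cot.
  have := lt_le_trans big (le_trans cot (leeD (leeD zs zF') (lexx _))).
  by rewrite -!EFinD lte_fin /G => /lt_eqF/eqP; apply; ring.
have gbB := bcs_restrict (measurable_inball Hleb x ep) gb.
have [mgB hgB _] := gbB.
have muF' : mu F' <= (4^-1 * q ^+ n)%:E.
  have Ls : (0 < Lam * s)%R by rewrite mulr_gt0.
  apply: le_trans (Kweak mgB (bcs_int gbB) Ls) _.
  have mi : measurable_fun setT ((\1_(inball x ep)) : E -> R).
    by apply: measurable_indic; exact: measurable_inball.
  have G0 : (0 <= G)%R by exact: bcs_ge0 gb.
  apply: (@le_trans _ _ ((A / (Lam * s))%:E * (G * (ep ^+ n * beta))%:E)).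
    apply: lee_wpmul2l; first by rewrite lee_fin divr_ge0// ltW.
    rewrite [leRHS]EFinM -(mu_inball x ep0) -[inball x ep in X in _ <= X]setIT.
    rewrite -(integral_indic mu measurableT (measurable_inball Hleb x ep)).
    rewrite -(int_scaleR mu mi G0); last by move=> y; rewrite indicE.
    apply: int_leR.
    - exact: measurable_absR.
    - exact: measurable_funM (measurable_cst _) mi.
    - by move=> y; rewrite normr_ge0.
    move=> y; rewrite normrM indicE mulrC; case: (y \in _); rewrite ?normr1 ?mulr1//.
    by rewrite normr0 !mulr0.
  rewrite -EFinM lee_fin /G.
  have epn : (ep ^+ n <= (16 * n%:R * q) ^+ n)%R by rewrite lerXn2r ?nnegrE ?mulr_ge0//; exact: ltW.
  have -> : (A / (Lam * s) * (2 ^+ n * s * (ep ^+ n * beta)) = A * 2 ^+ n * beta / Lam * ep ^+ n)%R.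
    by field; rewrite !gt_eqF.
  apply: (@le_trans _ _ (A * 2 ^+ n * beta / Lam * (16 * n%:R * q) ^+ n)%R).
    by rewrite ler_wpM2l// divr_ge0 ?mulr_ge0 ?beta_ge0// ltW.
  rewrite [((16 * n%:R * q) ^+ n)%R]exprMn mulrA ler_wpM2r ?exprn_ge0 ?(ltW q0)//.
  by rewrite mulrAC ler_pdivrMr// /Lam; lra.
have muQ2 : (q ^+ n)%:E <= mu (Q `&` GF) + (4^-1 * q ^+ n)%:E.
  rewrite -muQ; apply: le_trans (le_Leb sub) _; apply: le_trans (LebU _ _) _; apply: leeD => //.
  apply: le_trans (LebU _ _) _; rewrite [X in _ + X](null_bdry Hleb) adde0; exact: muF'.
rewrite /avg.
have -> : \int[mu]_y (same q x y * f1 y)%:E = mu (Q `&` GF).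
  rewrite -[Q `&` GF]setIT -(integral_indic mu measurableT (measurableI _ _ mQ mGF')).
  by apply: eq_integral => y _; rewrite Q1 /f1 indicI.
have fQ : mu (Q `&` GF) \is a fin_num.
  rewrite ge0_fin_numE ?Leb_ge0//; apply: le_lt_trans (le_Leb (@subIsetl _ Q GF)) _.
  by rewrite muQ ltry.
(* At least three quarters of the cell lie in [GF], which beats the threshold 1/2 strictly. *)
move: muQ2; rewrite -(fineK fQ) -EFinD -EFinM lee_fin lte_fin => h.
have qn : (0 < q ^+ n)%R by rewrite exprn_gt0.
rewrite -(ltr_pM2l qn) mulrA mulfV ?gt_eqF// mul1r; lra.
Qed.

Lemma markov_lt (h : E -> \bar R) s : measurable_fun setT h -> (forall x, 0 <= h x) -> (0 < s)%R ->
  mu [set x | s%:E < h x] <= (s^-1)%:E * \int[mu]_x h x.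
Proof.
move=> mh h0 s0; rewrite lee_pdivlMl//.
have mS : measurable [set x | s%:E < h x].
  by rewrite -[X in measurable X]setTI; exact: emeasurable_fun_o_infty.
rewrite -[X in mu X]setIT -(integral_indic mu measurableT mS).
have mi : measurable_fun setT (\1_[set x | s%:E < h x] : E -> R) by exact: measurable_indic.
rewrite -(int_scaleR mu mi (ltW s0)); last by move=> x; rewrite indicE.
apply: ge0_le_integralT.
- exact: measurableT.
- by apply/measurable_EFinP; exact: measurable_funM (measurable_cst _) mi.
- exact: mh.
- by move=> x; rewrite lee_fin mulr_ge0// ?indicE// ltW.
move=> x _; rewrite indicE; case: (boolP (x \in _)) => [/set_mem/= h1|_]; last by rewrite mulr0.
by rewrite mulr1 ltW.
Qed.

Lemma CH_ge0 : (0 <= CH)%R.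
Proof.
rewrite -lee_fin; apply: le_trans (Khor ltr01 (h := vzero) _); last by rewrite vnorm0.
by apply: integral_ge0 => x _; rewrite lee_fin.
Qed.

(** The complement of this enlargement is where [level_near] applies: there the distance to every
    corner exceeds [8 * (n * d)]. *)
Definition star (d : R) (W : set E) : set E :=
  [set x : E | exists2 y, W y & (vnorm (vsub x (crn d y)) <= 8 * (n%:R * d))%R].

(** Cells are not enumerated. A point of [star] sees at least one full cell of [W], so the
    normalised integral of the proximity relation over [y] is at least 1; Tonelli and Markov's
    inequality give the bound. *)
Lemma mu_star d (W : set E) : (0 < d)%R -> measurable W -> (forall x y, crn d x = crn d y -> W x -> W y) ->
  mu (star d W) <= (2 * (beta * (8 * n%:R) ^+ n))%:E * mu W.
Proof.
move=> d0 mW Winv; pose r := (8 * (n%:R * d))%R.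
have r0 : (0 < r)%R by rewrite /r !mulr_gt0// ltr0n.
pose F (z : E * E) : R := (d ^- n * (\1_W z.2 * (1 - (r < vnorm (vsub z.1 (crn d z.2)))%R%:R)))%R.
have dn0 : (0 <= d ^- n)%R by rewrite invr_ge0 exprn_ge0// ltW.
have b1 (b : bool) : (0 <= 1 - b%:R :> R)%R by case: b; rewrite ?subrr ?subr0.
have F0 z : 0 <= (F z)%:E by rewrite lee_fin /F !mulr_ge0// indicE.
have mi : measurable_fun setT (\1_W : E -> R) by exact: measurable_indic.
have mF : measurable_fun setT (EFin \o F).
  apply/measurable_EFinP; apply: measurable_funM (measurable_cst _) _; apply: measurable_funM.
    exact: (measurableT_comp mi measurable_snd).
  apply: measurable_funB (measurable_cst _) _; apply: measurable_ltb (measurable_cst r) _.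
  apply: measurable_vnorm; apply: measurable_vsub; [exact: m_fstE|].
  exact: (measurable_crn d (@m_sndE _ _ leb)).
have [m1 _ ton] := ge0_tonelli Hleb mF F0.
(* Markov is used at level 1/2, strictly below the value 1 that is reached; this is the factor 2 in
   the constant. *)
have sub : star d W `<=` [set x | (2^-1)%:E < \int[mu]_y (F (x, y))%:E].
  move=> x [y0 Wy0 xy0] /=.
  apply: (@lt_le_trans _ _ (\int[mu]_y (d ^- n * same d y0 y)%:E)).
    rewrite (int_scaleR mu (measurable_same1 d y0) dn0) => [|y]; last exact: same_ge0.
    rewrite (int_same Hleb d0) -EFinM mulVf ?expf_neq0 ?gt_eqF// lte_fin.
    by rewrite invf_lt1// ltr1n.
  apply: int_leR.
  - exact: measurable_funM (measurable_cst _) (measurable_same1 d y0).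
  - by apply/measurable_EFinP; exact: (measurableT_comp mF (pair1_measurable x)).
  - by move=> y; rewrite mulr_ge0// same_ge0.
  move=> y; rewrite /F /=; apply: ler_wpM2l => //; rewrite /same.
  case: eqP => e; last by rewrite mulr_ge0// indicE.
  by rewrite indicE mem_set ?mul1r -?e ?[(r < _)%R]ltNge ?xy0 ?subr0//; exact: Winv e Wy0.
have h0 : (0 < 2^-1 :> R)%R by rewrite invr_gt0.
have Fx0 x : 0 <= \int[mu]_y (F (x, y))%:E by apply: integral_ge0 => y _; exact: F0.
apply: le_trans (le_Leb sub) _; apply: le_trans (markov_lt m1 Fx0 h0) _.
rewrite invrK [X in _ * X]ton.
have c0 : (0 <= beta * (8 * n%:R) ^+ n)%R by rewrite mulr_ge0 ?beta_ge0// exprn_ge0// mulr_ge0.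
rewrite EFinM -muleA; apply: lee_wpmul2l; first by rewrite lee_fin.
rewrite -[W in X in _ <= X]setIT -(integral_indic mu measurableT mW) -(int_scaleR mu mi c0); last first.
  by move=> y; rewrite indicE.
rewrite le_eqVlt; apply/orP; left; apply/eqP; apply: eq_integral => y _.
have mb : measurable_fun setT ((\1_(inball (crn d y) r)) : E -> R).
  by apply: measurable_indic; exact: measurable_inball.
have k0' : (0 <= d ^- n * \1_W y)%R by rewrite mulr_ge0// indicE.
transitivity (\int[mu]_x (d ^- n * \1_W y * \1_(inball (crn d y) r) x)%:E).
  apply: eq_integral => x _; rewrite /F /= -[RHS]/((_ * _)%:E) mulrA; congr (_ * _)%:E.
  rewrite [RHS]indicE /inball vnorm_subC; have [h|h] := leP (vnorm (vsub (crn d y) x)) r.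
    by rewrite mem_set// subr0.
  by rewrite memNset/= ?subrr//; apply/negP; rewrite -ltNge.
rewrite (int_scaleR mu mb k0') => [|x]; last by rewrite indicE.
rewrite (integral_indic mu measurableT (measurable_inball Hleb _ _)) setIT (mu_inball _ r0) -EFinM.
congr EFin; rewrite /r mulrA exprMn.
have dn : (d ^+ n != 0)%R by rewrite expf_neq0// gt_eqF.
by field.
Qed.

(** * Calderon-Zygmund decomposition of a nonnegative grid step *)

Section cz.
Variables (f : E -> R) (d B rho s : R) (N : nat).
Hypothesis d0 : (0 < d)%R.
Hypothesis finv : forall x y, crn d x = crn d y -> f x = f y.
Hypothesis fb : bcs (leb := leb) f B rho.
Hypothesis f0 : forall x, (0 <= f x)%R.
Hypothesis s0 : (0 < s)%R.
Let l : R := (d * 2 ^+ N)%R.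
Hypothesis ltop : forall x, avg (leb := leb) l f x <= s%:E.

Let mf : measurable_fun setT f. Proof. by case: fb. Qed.
Let l0 : (0 < l)%R. Proof. by rewrite mulr_gt0// exprn_gt0. Qed.
Let sd0 k : (0 < side l k)%R. Proof. exact: side_gt0. Qed.
Let sideN : side l N = d.
Proof. by rewrite /side /l mulfK// expf_neq0. Qed.
Let side0 : side l 0 = l. Proof. by rewrite /side expr0 divr1. Qed.
Let side_le k : (side l k <= l)%R.
Proof. by rewrite /side ler_piMr ?(ltW l0)// invf_le1 ?exprn_gt0// exprn_ege1// ler1n. Qed.

Let t : R := (2 ^+ n * s)%R.
Let t0 : (0 < t)%R. Proof. by rewrite mulr_gt0// exprn_gt0. Qed.
Let st : nat -> set E := stop l s f.
Let w k : E -> R := \1_(st k).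
Let fa k := ravg (leb := leb) (side l k) f.
Let b k x : R := (w k x * (f x - fa k x))%R.
(** The good part: the cell average on stopping cells and [f] elsewhere. Finitely many levels
    suffice because [f] is already constant on the cells of level [N], whose side is [d]. *)
Let g x : R := (f x - \sum_(k < N.+1) b k x)%R.
(** A cell meeting the ball of radius [rho] stays within its diameter, at most [n * l]. *)
Let rh : R := (rho + n%:R * l)%R.

Let mst k : measurable (st k). Proof. exact: measurable_stop. Qed.
Let mw k : measurable_fun setT (w k). Proof. exact: measurable_indic. Qed.
Let mfa k : measurable_fun setT (fa k). Proof. exact: measurable_ravg. Qed.
Let fa0 k x : (0 <= fa k x)%R. Proof. exact: ravg_ge0. Qed.
Let w0 k x : (0 <= w k x)%R. Proof. by rewrite /w indicE. Qed.
Let w1 k x : st k x -> w k x = 1%R.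
Proof. by move=> h; rewrite /w indicE mem_set. Qed.
Let wN k x : ~ st k x -> w k x = 0%R.
Proof. by move=> h; rewrite /w indicE memNset. Qed.

Let st0 x : ~ st 0 x.
Proof. by move=> /stopP[]; rewrite /above/= side0 ltNge ltop. Qed.

Let st_avg k x : st k x -> avg (side l k) f x <= t%:E.
Proof. by case: k => [/st0//|k]; exact: stop_le. Qed.

Let st_fa k x : st k x -> (fa k x <= t)%R.
Proof. by move=> h; apply: ravg_le => //; exact: st_avg. Qed.

Let st_uniq i j x : st i x -> st j x -> i = j.
Proof.
move=> /stopP[ai hi] /stopP[aj hj]; case: (ltngtP i j) => // ij.
  by have := hj _ ij ai.
by have := hi _ ij aj.
Qed.

Let st_supp k x : st k x -> (vnorm x <= rh)%R.
Proof.
move=> /stopP[h _]; rewrite leNgt; apply/negP => xr; move: h; rewrite /above/=.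
have -> : avg (side l k) f x = 0.
  rewrite /avg integral0_eq ?mule0// => y _; rewrite /same; case: eqP => [e|_]; last by rewrite mul0r.
  have [_ _ hs] := fb; rewrite hs ?mulr0//.
  have h1 := crn_near (sd0 k) e; have h2 := vnorm_le_sub x y.
  have h3 : (n%:R * side l k <= n%:R * l)%R by rewrite ler_wpM2l.
  by move: xr; rewrite /rh; lra.
by rewrite ltNge lee_fin (ltW s0).
Qed.

Let st_exists k x : above l s f k x -> exists2 j, (j <= k)%N & st j x.
Proof.
move=> h; have ex : exists j, `[< above l s f j x >] by exists k; apply/asboolP.
case: (ex_minnP ex) => j /asboolP hj jmin; exists j; first by apply: jmin; apply/asboolP.
apply/stopP; split => // i ij hi; have : (j <= i)%N by apply: jmin; apply/asboolP.
by rewrite leqNgt ij.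
Qed.

Let sum_st k x (v : nat -> R) : (k < N.+1)%N -> st k x ->
  (\sum_(j < N.+1) w j x * v j = v k)%R.
Proof.
move=> kN h; rewrite (bigD1 (Ordinal kN))//= w1// mul1r big1 ?addr0// => j jk.
rewrite wN ?mul0r// => h'; move: jk; rewrite -val_eqE /= => /eqP; apply.
exact: st_uniq h' h.
Qed.

Let sum_stN x (v : nat -> R) : (forall k, (k < N.+1)%N -> ~ st k x) ->
  (\sum_(j < N.+1) w j x * v j = 0)%R.
Proof. by move=> h; rewrite big1// => j _; rewrite wN ?mul0r//; exact: h. Qed.

Let st_cases x : (exists2 k, (k < N.+1)%N & st k x) \/ (forall k, (k < N.+1)%N -> ~ st k x).
Proof.
have [h|h] := pselect (exists2 k, (k < N.+1)%N & st k x); [by left|right => k kN hk].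
by apply: h; exists k.
Qed.

(** At level [N] the average of [f] is [f] itself, so a point that has not stopped by then satisfies
    [f x <= s]. *)
Let g_cases x : (exists k, [/\ (k < N.+1)%N, st k x & g x = fa k x]) \/
  [/\ forall k, (k < N.+1)%N -> ~ st k x, g x = f x & (f x <= s)%R].
Proof.
case: (st_cases x) => [[k kN h]|h]; [left; exists k|right]; split => //.
- by rewrite /g (sum_st (fun j => f x - fa j x)%R kN h) opprB addrC subrK.
- by rewrite /g (sum_stN (fun j => f x - fa j x)%R h) subr0.
rewrite -lee_fin -(avg_id Hleb d0 f0 (finv (x := x))) leNgt; apply/negP => h'.
have [|j jN hj] := @st_exists N x; first by rewrite /above/= sideN.
by apply: h hj.
Qed.

Let w_inv k x y : (k < N.+1)%N -> crn d x = crn d y -> w k x = w k y.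
Proof.
move=> kN e; rewrite /w !indicE; congr (_ : bool)%:R.
have e' : crn (side l k) x = crn (side l k) y by apply: (side_nest l0 (k := N)) => //; rewrite sideN.
by apply/idP/idP => /set_mem h; apply/mem_set; [exact: stop_inv e' h|exact: stop_inv (esym e') h].
Qed.

(** Levels [k <= N] are coarser than the grid of side [d], so [g] stays constant on its cells, as
    [good_max] requires. *)
Let g_inv x y : crn d x = crn d y -> g x = g y.
Proof.
move=> e; rewrite /g (finv e); congr (_ - _)%R; apply: eq_bigr => k _.
rewrite /b (w_inv (ltn_ord k) e) (finv e); congr (_ * (_ - _))%R.
by apply: ravg_inv; apply: (side_nest l0 (k := N)); rewrite ?sideN// -ltnS.
Qed.

Let g0 x : (0 <= g x)%R.
Proof. by case: (g_cases x) => [[k [_ _ ->]]|[_ -> _]]. Qed.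

Let mb k : measurable_fun setT (b k).
Proof. exact: measurable_funM (mw k) (measurable_funB mf (mfa k)). Qed.

Let mg : measurable_fun setT g.
Proof. by apply: measurable_funB mf _; apply: measurable_sum => k; exact: mb. Qed.

Let rh_ge : (rho <= rh)%R. Proof. by rewrite lerDl mulr_ge0// ltW. Qed.

Let g_bcs : bcs (leb := leb) g t rh.
Proof.
split; first exact: mg.
- move=> x; rewrite ger0_norm//; case: (g_cases x) => [[k [_ h ->]]|[_ -> h]]; first exact: st_fa.
  by apply: le_trans h _; rewrite /t ler_peMl ?(ltW s0)// exprn_ege1// ler1n.
move=> x xr; case: (g_cases x) => [[k [_ h _]]|[_ -> _]].
  by have := le_lt_trans (st_supp h) xr; rewrite ltxx.
by have [_ _ hs] := fb; apply: hs; exact: le_lt_trans xr.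
Qed.

Let b_bcs k : bcs (leb := leb) (b k) (B + t)%R rh.
Proof.
have B0 := bcs_ge0 fb; have [_ hB hs] := fb.
split; first exact: mb.
- move=> x; rewrite /b; have [h|h] := pselect (st k x); last first.
    by rewrite wN// mul0r normr0 addr_ge0// ltW.
  rewrite w1// mul1r; apply: le_trans (ler_normB _ _) _; apply: lerD => //.
  by rewrite ger0_norm//; exact: st_fa.
move=> x xr; rewrite /b wN ?mul0r// => h.
by have := le_lt_trans (st_supp h) xr; rewrite ltxx.
Qed.

Let mwfa k : measurable_fun setT (fun x => w k x * fa k x)%R.
Proof. exact: measurable_funM (mw k) (mfa k). Qed.
Let wfa0 k x : (0 <= w k x * fa k x)%R. Proof. by rewrite mulr_ge0. Qed.

Let int_st k (h : E -> R) : \int[mu]_(x in st k) (h x)%:E = \int[mu]_x (w k x * h x)%:E.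
Proof. by rewrite int_condR. Qed.

Let int_sumR (h : nat -> E -> R) M : (forall k, measurable_fun setT (h k)) ->
  (forall k x, 0 <= h k x)%R ->
  \int[mu]_x (\sum_(k < M) h k x)%:E = \sum_(k < M) \int[mu]_x (h k x)%:E.
Proof.
move=> mh h0; have mh' k := (measurable_EFinP _ _).2 (mh k).
transitivity (\int[mu]_x (\sum_(k < M) (h k x)%:E)).
  by apply: eq_integral => x _; rewrite sumEFin.
apply: (ge0_integral_sum mu measurableT (f := fun (k : 'I_M) x => (h k x)%:E)).
- by move=> k; exact: mh'.
- by move=> k x _; rewrite lee_fin.
Qed.

(** [g] is at most [f] plus its averages on the stopping cells, and averaging preserves the mass of
    disjoint cells: hence the factor 2. *)
Let g_int : \int[mu]_x `|g x|%:E <= 2%:E * \int[mu]_x (f x)%:E.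
Proof.
have h : \int[mu]_x `|g x|%:E <= \int[mu]_x (f x + \sum_(k < N.+1) w k x * fa k x)%:E.
  apply: int_leR.
  - exact: measurable_absR.
  - by apply: measurable_funD mf _; apply: measurable_sum => k; exact: mwfa.
  - by move=> x; rewrite normr_ge0.
  move=> x; rewrite ger0_norm//; case: (g_cases x) => [[k [kN hk ->]]|[_ -> _]].
    by rewrite (sum_st (fun j => fa j x) kN hk) lerDr.
  by rewrite lerDl sumr_ge0.
apply: le_trans h _; rewrite (int_addR mu mf) => [|||x]; last 3 first.
- by apply: measurable_sum => k; exact: mwfa.
- exact: f0.
- by rewrite sumr_ge0.
rewrite (@int_sumR _ N.+1 mwfa wfa0).
have -> : 2%:E * \int[mu]_x (f x)%:E = \int[mu]_x (f x)%:E + \int[mu]_x (f x)%:E.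
  have f00 : 0 <= \int[mu]_x (f x)%:E by exact: int_ge0R.
  by rewrite (_ : 2 = 1 + 1)%R// EFinD ge0_muleDl// mul1e.
apply: leeD => //; apply: le_trans (stop_sum Hleb l s mf f0 N.+1 mf f0).
rewrite big_mkord; apply: lee_sum => k _.
rewrite int_st (ravg_adj0 Hleb (sd0 k) mf f0 (mw k))//.
- by move=> x y e; rewrite /w !indicE; congr (_ : bool)%:R; apply/idP/idP => /set_mem h; apply/mem_set;
    [exact: stop_inv e h|exact: stop_inv (esym e) h].
- move=> x; rewrite /w indicE; case: (boolP (x \in st k)) => [/set_mem h _|_]; last by rewrite eqxx.
  by apply: le_lt_trans (st_avg h) (ltry _).
Qed.

Let mass : \sum_(k < N.+1) mu (st k) <= (s^-1)%:E * \int[mu]_x (f x)%:E.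
Proof.
rewrite lee_pdivlMl// ge0_sume_distrr => [|k _]; last exact: Leb_ge0.
apply: le_trans (stop_sum Hleb l s mf f0 N.+1 mf f0); rewrite big_mkord; apply: lee_sum => k _.
exact: stop_mass.
Qed.

Let Te_split ep x : (0 < ep)%R -> Te (leb := leb) K f ep x - Te K g ep x =
  \sum_(k < N.+1) \int[mu]_y (cutK K ep x y * b k y)%:E.
Proof.
move=> ep0; rewrite (Te_bcsB Hleb mK Kring x fb g_bcs ep0).
have ib k := cutK_integrable Hleb mK Kring x (b_bcs k) ep0.
rewrite -(integral_sum measurableT (fun k : 'I_N.+1 => ib k)).
by apply: eq_integral => y _; rewrite /g opprB addrC subrK mulr_sumr -sumEFin.
Qed.

Let Hs x : \bar R := \sum_(k < N.+1) Hlev K (side l k) f (st k) t x.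

(** [level_near] is summed over the levels. The shell terms are added before being estimated: the
    stopping sets are disjoint, so together they cost one integral over the shell from [ep / 4] to
    [4 * ep]. This is four dyadic shells, whence [2 * t * (4 * k0)]. *)
Let bad ep x : (0 < ep)%R -> (forall k, (k < N.+1)%N -> ~ star (side l k) (st k) x) ->
  `|Te (leb := leb) K f ep x - Te K g ep x| <= Hs x + (8 * t * k0)%:E.
Proof.
move=> ep0 xs; rewrite (Te_split x ep0).
have mT : measurable_fun setT (fun y : E => (ep / 4 < vnorm (vsub x y) <= 4 * ep)%R%:R : R).
  by apply: (measurable_bool (measurable_ring_at Hleb x (ep / 4)%R (4 * ep)%R)).
pose T (y : E) : R := (ep / 4 < vnorm (vsub x y) <= 4 * ep)%R%:R.
have mKx : measurable_fun setT (fun y : E => `|K (vsub x y)|%R).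
  by apply: measurable_absR; apply: (mKf mK); exact: mvsubE.
have T0 y : (0 <= T y)%R by rewrite /T.
have mTK k : measurable_fun setT (fun y => T y * (w k y * `|K (vsub x y)|))%R.
  exact: measurable_funM mT (measurable_funM (mw k) mKx).
have TK0 k y : (0 <= T y * (w k y * `|K (vsub x y)|))%R by rewrite !mulr_ge0.
have step (k : 'I_N.+1) : `|\int[mu]_y (cutK K ep x y * b k y)%:E| <=
    Hlev K (side l k) f (st k) t x + (2 * t)%:E * \int[mu]_y (T y * (w k y * `|K (vsub x y)|))%:E.
  apply: (level_near Hleb n0 mK Kring (rho := rh) (sd0 k) mf f0 t0 (mst k)) => //.
  - by move=> u v e; exact: stop_inv e.
  - by move=> u; exact: st_avg.
  - by move=> u; exact: st_supp.
  - move=> y hy; rewrite ltNge; apply/negP => h; apply: (xs k (ltn_ord k)); by exists y.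
apply: le_trans (lee_abs_sum _ _ _) _.
apply: le_trans (lee_sum _ (fun k _ => step k)) _.
rewrite big_split/= -ge0_sume_distrr => [|k _]; last exact: int_ge0R.
apply: leeD => //; rewrite -(@int_sumR _ N.+1 mTK TK0).
have t20 : (0 <= 2 * t)%R by rewrite mulr_ge0// ltW.
apply: (@le_trans _ _ ((2 * t)%:E * \int[mu]_y (T y * `|K (vsub x y)|)%:E)).
  apply: lee_wpmul2l; first by rewrite lee_fin.
  apply: int_leR.
  - by apply: measurable_sum => k; exact: mTK.
  - exact: measurable_funM mT mKx.
  - by move=> y; rewrite sumr_ge0.
  move=> y; rewrite -mulr_sumr; apply: ler_wpM2l => //.
  case: (st_cases y) => [[k kN h]|h].
    by rewrite (sum_st (fun=> `|K (vsub x y)|%R) kN h).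
  by rewrite (sum_stN (fun=> `|K (vsub x y)|%R) h).
have -> : (8 * t * k0 = 2 * t * (4 * k0))%R by ring.
rewrite [leRHS]EFinM; apply: lee_wpmul2l; first by rewrite lee_fin.
have e4 : (0 < ep / 4)%R by rewrite divr_gt0.
have h16 : (4 * ep <= 2 ^+ 4 * (ep / 4))%R by rewrite !exprS expr0; lra.
apply: le_trans (le_Kring mK Kring e4 h16).
rewrite -(Kring_at Hleb mK x) [leRHS]int_condR le_eqVlt; apply/orP; left; apply/eqP.
apply: eq_integral => y _; congr (_ * _)%:E; rewrite /T indicE; congr (_ : bool)%:R.
by apply/idP/idP => [h|/set_mem//]; apply/mem_set.
Qed.
(** The good part contributes [1 + Lam + 2 ^ n * CH], the displacement sum 1, and the truncation
    shell [8 * 2 ^ n * k0]. *)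
Definition max_height : R := (2 + Lam + 2 ^+ n * CH + 8 * 2 ^+ n * k0)%R.
(** One summand for each exceptional set: the enlarged stopping cells, the points with a large
    displacement sum, and the set [D] of the good part, where the 4 is 2 from [good_max] times 2
    from [g_int]. *)
Definition max_cst : R := (2 * (beta * (8 * n%:R) ^+ n) + CH * (1 + 3 * 2 ^+ n) + 4 * A)%R.

Let star_mass : mu (\bigcup_k star (side l k) (st k)) <= (2 * (beta * (8 * n%:R) ^+ n) / s)%:E * \int[mu]_x (f x)%:E.
Proof.
set c := (2 * (beta * (8 * n%:R) ^+ n))%R.
have c0 : (0 <= c)%R by rewrite !mulr_ge0 ?beta_ge0// exprn_ge0// mulr_ge0.
have cs0 : (0 <= c / s)%R by rewrite divr_ge0// ltW.
apply: le_trans (Leb_subadd _) _.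
apply: (@le_trans _ _ (\sum_(k <oo) (c / s)%:E * (s%:E * mu (st k)))).
  apply: lee_nneseries => k _; first by move=> _; exact: Leb_ge0.
  rewrite muleA -EFinM divfK ?gt_eqF//; apply: mu_star => //.
  by move=> x y e; exact: stop_inv e.
rewrite nneseriesZl => [|k _]; last by rewrite mule_ge0 ?Leb_ge0// lee_fin ltW.
apply: lee_wpmul2l; first by rewrite lee_fin.
exact: stop_mass_series.
Qed.

Let f_int_ge0 : 0 <= \int[mu]_x (f x)%:E. Proof. exact: int_ge0R. Qed.

Let mHs : measurable_fun setT Hs.
Proof.
apply: emeasurable_sum => k; apply: measurable_Hlev => //; exact: mst.
Qed.

Let Hs0 x : 0 <= Hs x.
Proof. by apply: sume_ge0 => k _; apply: Hlev_ge0. Qed.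

(** Markov and [level_far]: the integrals of [f] over the stopping sets add up to at most its total
    mass, and [3 * t] times the mass of these sets adds [3 * 2 ^ n] times it. *)
Let Hs_mass : mu [set x | s%:E < Hs x] <= (CH * (1 + 3 * 2 ^+ n) / s)%:E * \int[mu]_x (f x)%:E.
Proof.
apply: le_trans (markov_lt mHs Hs0 s0) _.
rewrite mulrC EFinM -muleA; apply: lee_wpmul2l; first by rewrite lee_fin invr_ge0 ltW.
have mH k : measurable_fun setT (Hlev K (side l k) f (st k) t) by apply: measurable_Hlev => //; exact: mst.
have H0 k x : 0 <= Hlev K (side l k) f (st k) t x by apply: Hlev_ge0.
rewrite /Hs (ge0_integral_sum mu measurableT (f := fun (k : 'I_N.+1) x => Hlev K (side l k) f (st k) t x)); last 2 first.
- by move=> k; exact: mH.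
- by move=> k x _; exact: H0.
have lf (k : 'I_N.+1) : \int[mu]_x Hlev K (side l k) f (st k) t x <=
   CH%:E * \int[mu]_y (w k y * (f y + 3 * t))%:E by apply: level_far.
apply: le_trans (lee_sum _ (fun k _ => lf k)) _.
rewrite -ge0_sume_distrr => [|k _]; last first.
  by apply: int_ge0R => y; rewrite mulr_ge0// addr_ge0// mulr_ge0// ltW.
rewrite EFinM -muleA; apply: lee_wpmul2l; first by rewrite lee_fin CH_ge0.
have t30 : (0 <= 3 * t)%R by rewrite mulr_ge0// ltW.
have e (k : 'I_N.+1) : \int[mu]_y (w k y * (f y + 3 * t))%:E =
    \int[mu]_(y in st k) (f y)%:E + (3 * t)%:E * mu (st k).
  rewrite int_st -[X in mu X]setIT -(integral_indic mu measurableT (mst k)) -(int_scaleR mu (mw k) t30 (w0 k)).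
  rewrite -(int_addR mu (measurable_funM (mw k) mf) (measurable_funM (measurable_cst _) (mw k))) => [|y|y].
  - by apply: eq_integral => y _; congr EFin; rewrite /= mulrDr (mulrC (w k y) (3 * t))%R.
  - by rewrite /= mulr_ge0.
  - by rewrite /= mulr_ge0.
under eq_bigr do rewrite e.
rewrite big_split/= EFinD ge0_muleDl ?lee_fin ?mulr_ge0 ?exprn_ge0// mul1e; apply: leeD.
  by apply: le_trans (stop_sum Hleb l s mf f0 N.+1 mf f0); rewrite big_mkord.
rewrite -ge0_sume_distrr => [|k _]; last exact: Leb_ge0.
apply: le_trans (lee_wpmul2l _ mass) _; first by rewrite lee_fin.
rewrite muleA -EFinM /t (_ : 3 * (2 ^+ n * s) / s = 3 * 2 ^+ n)%R//.
by field; rewrite gt_eqF.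
Qed.

(** The set [Z] does not depend on [ep], which makes this an inequality for the maximal truncation.
    The restriction [ep <= 1] comes from the cells of side at most 1 used in [good_max]. *)
Lemma cz_max : exists2 Z : set E, mu Z <= (max_cst / s)%:E * \int[mu]_x (f x)%:E &
  forall x ep, ~ Z x -> (0 < ep)%R -> (ep <= 1)%R -> `|Te (leb := leb) K f ep x| <= (max_height * s)%:E.
Proof.
have [D [mD muD] hD] := good_max d0 g_inv s0 g_bcs.
exists ((\bigcup_k star (side l k) (st k)) `|` ([set x | s%:E < Hs x] `|` D)).
  apply: le_trans (LebU _ _) _; apply: (le_trans (leeD (lexx _) (LebU _ _))).
  have h4 : mu D <= (4 * A / s)%:E * \int[mu]_x (f x)%:E.
    apply: le_trans muD _; apply: le_trans (lee_wpmul2l _ g_int) _.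
      by rewrite lee_fin divr_ge0 ?mulr_ge0// ltW.
    rewrite muleA -EFinM (_ : 2 * A / s * 2 = 4 * A / s)%R//; ring.
  apply: le_trans (leeD star_mass (leeD Hs_mass h4)) _.
  have c1 : (0 <= 2 * (beta * (8 * n%:R) ^+ n) / s)%R.
    by rewrite divr_ge0 ?(ltW s0)// !mulr_ge0 ?beta_ge0// exprn_ge0// mulr_ge0.
  have c2 : (0 <= CH * (1 + 3 * 2 ^+ n) / s)%R.
    by rewrite divr_ge0 ?(ltW s0)// mulr_ge0 ?CH_ge0// addr_ge0// mulr_ge0// exprn_ge0.
  have c3 : (0 <= 4 * A / s)%R by rewrite divr_ge0 ?(ltW s0)// mulr_ge0.
  by rewrite -!ge0_muleDl ?lee_fin ?addr_ge0// -!EFinD /max_cst -!mulrDl addrA.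
move=> x ep /not_orP[x1 /not_orP[x2 x3]] ep0 ep1.
have xs k : (k < N.+1)%N -> ~ star (side l k) (st k) x by move=> _ h; apply: x1; exists k.
have h1 := bad ep0 xs; have h2 := hD x ep x3 ep0 ep1.
have h3 : Hs x <= s%:E by rewrite leNgt; apply/negP.
have fg : Te K g ep x \is a fin_num by exact: (Te_fin Hleb mK Kring x g_bcs ep0).
rewrite -(subeK (Te K f ep x) fg); apply: le_trans (lee_abs_add _ _) _.
apply: le_trans (leeD (le_trans h1 (leeD h3 (lexx _))) h2) _.
rewrite -!EFinD lee_fin /max_height /t le_eqVlt; apply/orP; left; apply/eqP; ring.
Qed.
End cz.
Lemma max_cst_ge0 : (0 <= max_cst)%R.
Proof. by rewrite /max_cst !addr_ge0 ?mulr_ge0 ?addr_ge0 ?mulr_ge0 ?beta_ge0 ?exprn_ge0 ?CH_ge0. Qed.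

(** Averages are at most the total mass over [l ^ n]. The [1 +] in the choice of [N] ensures
    [l >= 1], so that [l ^ n >= l]. *)
Lemma top_scale f (d B rho s : R) : (0 < d)%R -> bcs (leb := leb) f B rho -> (forall x, 0 <= f x)%R -> (0 < s)%R ->
  exists N, forall x, avg (leb := leb) (d * 2 ^+ N)%R f x <= s%:E.
Proof.
move=> d0 fb f0 s0; have [mf _ _] := fb.
have If : \int[mu]_x (f x)%:E \is a fin_num.
  rewrite ge0_fin_numE; last exact: int_ge0R.
  by apply: le_lt_trans (bcs_int fb); apply: int_leR; [exact: mf|exact: (measurable_absR mf)|exact: f0|move=> x; exact: ler_norm].
set I := fine (\int[mu]_x (f x)%:E).
have I0 : (0 <= I)%R by rewrite fine_ge0// int_ge0R.
pose N := Num.bound ((1 + I / s) / d).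
have q0 : (0 <= I / s)%R by rewrite divr_ge0// ltW.
have hN : (1 + I / s <= d * 2 ^+ N)%R.
  rewrite -ler_pdivrMl// mulrC; apply: le_trans (ltW (archi_boundP _)) _.
    by rewrite divr_ge0 ?addr_ge0// ltW.
  by rewrite -natrX ler_nat; exact: (ltnW (ltn_expl _ _)).
exists N => x; have l0 : (0 < d * 2 ^+ N)%R by rewrite mulr_gt0// exprn_gt0.
apply: le_trans (avg_le l0 mf f0 x) _.
rewrite -(fineK If) -/I -EFinM lee_fin mulrC ler_pdivrMr ?exprn_gt0//.
rewrite mulrC -ler_pdivrMr//.
have l1 : (1 <= d * 2 ^+ N)%R by apply: le_trans hN; rewrite lerDl.
apply: (@le_trans _ _ (d * 2 ^+ N)%R); first by apply: le_trans hN; rewrite lerDr.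
by rewrite -[leLHS]expr1 ler_weXn2l.
Qed.

Lemma step_max (u : E -> R) (d B rho s : R) : (0 < d)%R -> (forall x y, crn d x = crn d y -> u x = u y) ->
  bcs (leb := leb) u B rho -> (0 < s)%R ->
  exists2 Z : set E, mu Z <= (2 * max_cst / s)%:E * \int[mu]_x `|u x|%:E &
  forall x ep, ~ Z x -> (0 < ep)%R -> (ep <= 1)%R -> `|Te (leb := leb) K u ep x| <= (2 * max_height * s)%:E.
Proof.
move=> d0 uinv ub s0; have [mu' uB us] := ub; have B0 := bcs_ge0 ub.
have pos (v : E -> R) : measurable_fun setT v -> (forall y, `|v y| <= B)%R ->
    (forall x y, crn d x = crn d y -> v x = v y) ->
    (forall y, (rho < vnorm y)%R -> v y = 0%R) ->
    bcs (leb := leb) (fun x => Num.max (v x) 0)%R B rho /\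
  exists2 Z : set E, mu Z <= (max_cst / s)%:E * \int[mu]_x `|v x|%:E &
  forall x ep, ~ Z x -> (0 < ep)%R -> (ep <= 1)%R ->
    `|Te (leb := leb) K (fun x => Num.max (v x) 0)%R ep x| <= (max_height * s)%:E.
  move=> mv vB vinv vs.
  have vle x : (Num.max (v x) 0 <= `|v x|)%R by rewrite ge_max ler_norm normr_ge0.
  have v0 x : (0 <= Num.max (v x) 0)%R by rewrite le_max lexx orbT.
  have mm : measurable_fun setT (fun x => Num.max (v x) 0)%R.
    by apply: measurable_maxr => //; exact: measurable_cst.
  have vb : bcs (leb := leb) (fun x => Num.max (v x) 0)%R B rho.
    split => // x; first by rewrite ger0_norm//; exact: le_trans (vB x).
    by move=> /vs ->; rewrite maxxx.
  split => //; have [N hN] := top_scale d0 vb v0 s0.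
  have vi x y : crn d x = crn d y -> Num.max (v x) 0%R = Num.max (v y) 0%R by move=> e; rewrite (vinv _ _ e).
  have [Z mZ hZ] := cz_max d0 vi vb v0 s0 hN.
  exists Z => //; apply: le_trans mZ _; apply: lee_wpmul2l.
    by rewrite lee_fin divr_ge0 ?(ltW s0)// max_cst_ge0.
  by apply: int_leR; [exact: mm|exact: (measurable_absR mv)|exact: v0|exact: vle].
have [b1 [Z1 m1 h1]] := pos u mu' uB uinv us.
have mN : measurable_fun setT (fun x => - u x)%R by exact: measurableT_comp.
have uBN y : (`|- u y| <= B)%R by rewrite normrN.
have uiN x y : crn d x = crn d y -> (- u x = - u y)%R by move=> e; rewrite (uinv _ _ e).
have usN y : (rho < vnorm y)%R -> (- u y = 0)%R by move=> h; rewrite us// oppr0.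
have [b2 [Z2 m2 h2]] := pos (fun x => - u x)%R mN uBN uiN usN.
exists (Z1 `|` Z2).
  apply: le_trans (LebU _ _) _; apply: le_trans (leeD m1 m2) _.
  rewrite (_ : \int[mu]_x `|- u x|%:E = \int[mu]_x `|u x|%:E); last first.
    by apply: eq_integral => x _; rewrite normrN.
  have I0 : 0 <= \int[mu]_x `|u x|%:E by apply: int_ge0R => x; rewrite normr_ge0.
  have c0 : (0 <= max_cst / s)%R.
    by rewrite divr_ge0 ?(ltW s0)// max_cst_ge0.
  by rewrite -ge0_muleDl ?lee_fin// -EFinD (_ : max_cst / s + max_cst / s = 2 * max_cst / s)%R//; ring.
move=> x ep /not_orP[x1 x2] ep0 ep1.
have e : Te (leb := leb) K u ep x = Te K (fun x => Num.max (u x) 0)%R ep x - Te K (fun x => Num.max (- u x) 0)%R ep x.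
  rewrite (Te_bcsB Hleb mK Kring x b1 b2 ep0) TeE; apply: eq_integral => y _; congr (_ * _)%:E.
  have [h|/ltW h] := leP 0%R (u y).
    by rewrite max_r ?subr0// oppr_le0.
  by rewrite max_l ?oppr_ge0// sub0r opprK.
rewrite e; apply: le_trans (lee_abs_sub _ _) _.
apply: le_trans (leeD (h1 x ep x1 ep0 ep1) (h2 x ep x2 ep0 ep1)) _.
by rewrite -EFinD lee_fin le_eqVlt; apply/orP; left; apply/eqP; ring.
Qed.

End maximal.

(** * Density of grid steps *)

Import HBSimple.

Section density.
Context {R : realType} {n : nat} (leb : {measure set (n.-tuple R) -> \bar R}).
Hypothesis Hleb : is_lebesgue_borel leb.
Hypothesis n0 : (0 < n)%N.
Local Notation V := (n.-tuple R).
Local Notation E := (Rn leb).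
Local Notation mu := (lebm leb).
Local Open Scope ereal_scope.

Definition grid_step (u : E -> R) := exists k B rho, bcs (leb := leb) u B rho /\
  forall x y, crn (side 1 k) x = crn (side 1 k) y -> u x = u y.

(** The L^1 closure of the grid steps. It is stable under linear combinations, L^1 limits and
    dominated limits, and density is proved by enlarging the known members. *)
Definition apx (f : E -> R) := measurable_fun setT f /\
  forall e : R, (0 < e)%R -> exists2 u, grid_step u & \int[mu]_x `|f x - u x|%:E <= e%:E.

Lemma grid_stepD u v : grid_step u -> grid_step v -> grid_step (fun x => u x + v x)%R.
Proof.
move=> [k1 [B1 [r1 [b1 i1]]]] [k2 [B2 [r2 [b2 i2]]]].
exists (maxn k1 k2), (B1 + B2)%R, (Num.max r1 r2); split.
  have [m1 h1 s1] := b1; have [m2 h2 s2] := b2; split.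
  - exact: measurable_funD m1 m2.
  - by move=> x; apply: le_trans (ler_normD _ _) _; exact: lerD.
  - by move=> x; rewrite gt_max => /andP[x1 x2]; rewrite s1// s2// addr0.
move=> x y e; congr (_ + _)%R; [apply: i1|apply: i2].
  by apply: (side_nest ltr01 _ e); exact: leq_maxl.
by apply: (side_nest ltr01 _ e); exact: leq_maxr.
Qed.

Lemma grid_stepZ c u : grid_step u -> grid_step (fun x => c * u x)%R.
Proof.
move=> [k [B [r [b i]]]]; have [m h s] := b.
exists k, (`|c| * B)%R, r; split; first split.
- exact: measurable_funM (measurable_cst _) m.
- by move=> x; rewrite normrM ler_wpM2l.
- by move=> x /s ->; rewrite mulr0.
by move=> x y e; rewrite (i x y e).
Qed.

Lemma grid_step_measurable u : grid_step u -> measurable_fun setT u.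
Proof. by move=> [k [B [r [[]]]]]. Qed.

Lemma grid_step0 : grid_step (fun=> 0%R).
Proof.
exists 0%N, 0%R, 0%R; split => //; split => //.
by move=> x; rewrite normr0.
Qed.

Lemma int_norm_triangle (f g h : E -> R) : measurable_fun setT f -> measurable_fun setT g -> measurable_fun setT h ->
  (forall x, `|h x| <= `|f x| + `|g x|)%R ->
  \int[mu]_x `|h x|%:E <= \int[mu]_x `|f x|%:E + \int[mu]_x `|g x|%:E.
Proof.
move=> mf mg mh fgh; have af := measurable_absR mf; have ag := measurable_absR mg.
rewrite -(int_addR mu af ag) => [|x|x]; [|by rewrite normr_ge0|by rewrite normr_ge0].
apply: int_leR; [exact: measurable_absR|exact: measurable_funD af ag|by move=> x; rewrite normr_ge0|exact: fgh].
Qed.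

Lemma apx_step u : grid_step u -> apx u.
Proof.
move=> su; split; first exact: grid_step_measurable.
move=> e e0; exists u => //; rewrite integral0_eq ?lee_fin ?(ltW e0)// => x _.
by rewrite subrr normr0.
Qed.

Lemma apxD f g : apx f -> apx g -> apx (fun x => f x + g x)%R.
Proof.
move=> [mf af] [mg ag]; split; first exact: measurable_funD mf mg.
move=> e e0; have e20 : (0 < e / 2)%R by rewrite divr_gt0.
have [u su ue] := af _ e20; have [v sv ve] := ag _ e20.
exists (fun x => u x + v x)%R; first exact: grid_stepD.
have mu' := grid_step_measurable su; have mv := grid_step_measurable sv.
rewrite [e]splitr EFinD; apply: le_trans (leeD ue ve).
apply: int_norm_triangle.
- exact: measurable_funB mf mu'.
- exact: measurable_funB mg mv.
- exact: measurable_funB (measurable_funD mf mg) (measurable_funD mu' mv).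
by move=> x; rewrite opprD addrACA; exact: ler_normD.
Qed.

Lemma apxZ c f : apx f -> apx (fun x => c * f x)%R.
Proof.
move=> [mf af]; split; first exact: measurable_funM (measurable_cst _) mf.
move=> e e0; have c1 : (0 < `|c| + 1)%R by rewrite ltr_wpDl.
have [u su ue] := af (e / (`|c| + 1))%R (divr_gt0 e0 c1).
exists (fun x => c * u x)%R; first exact: grid_stepZ.
have ma := measurable_absR (measurable_funB mf (grid_step_measurable su)).
rewrite (_ : \int[mu]_x `|c * f x - c * u x|%:E = `|c|%:E * \int[mu]_x `|f x - u x|%:E).
  apply: le_trans (lee_wpmul2l _ ue) _; first by rewrite lee_fin.
  by rewrite -EFinM lee_fin mulrCA ler_piMr ?(ltW e0)// ler_pdivrMr// mul1r lerDl.
rewrite -(int_scaleR mu ma (normr_ge0 c)) => [|x]; last by rewrite normr_ge0.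
by apply: eq_integral => x _; rewrite -mulrBr normrM.
Qed.

Lemma apx_limit (f : E -> R) : measurable_fun setT f ->
  (forall e : R, (0 < e)%R -> exists2 g, apx g & \int[mu]_x `|f x - g x|%:E <= e%:E) -> apx f.
Proof.
move=> mf h; split => // e e0; have e20 : (0 < e / 2)%R by rewrite divr_gt0.
have [g [mg ag] fg] := h _ e20; have [u su ue] := ag _ e20.
exists u => //; rewrite [e]splitr EFinD; apply: le_trans (leeD fg ue).
have mu' := grid_step_measurable su.
apply: int_norm_triangle.
- exact: measurable_funB mf mg.
- exact: measurable_funB mg mu'.
- exact: measurable_funB mf mu'.
by move=> x; have := ler_normD (f x - g x)%R (g x - u x)%R; rewrite addrA subrK.
Qed.

Lemma apx_dominated (u_ : nat -> E -> R) (f g : E -> R) : (forall k, apx (u_ k)) -> measurable_fun setT f ->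
  {ae mu, forall x, u_ ^~ x @ \oo --> f x} -> measurable_fun setT g -> \int[mu]_x `|g x|%:E < +oo ->
  (forall k x, `|u_ k x| <= g x)%R -> apx f.
Proof.
move=> au mf cv mg ig ug; apply: apx_limit => // e e0.
have [_ H _] : [/\ mu.-integrable setT (EFin \o f),
  [sequence \int[mu]_(x in setT) `|(EFin \o u_ k) x - (EFin \o f) x|]_k @ \oo --> 0 &
  [sequence \int[mu]_(x in setT) ((EFin \o u_ k) x)]_k @ \oo --> \int[mu]_(x in setT) ((EFin \o f) x)].
  apply: (@dominated_convergence _ _ _ mu setT measurableT (fun k => EFin \o u_ k) (EFin \o f) (EFin \o g)).
  - by move=> k; apply/measurable_EFinP; have [] := au k.
  - exact/measurable_EFinP.
  - by apply: filterS cv => x h _; apply: cvg_EFin => //; exact: nearW.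
  - exact: integrableR.
  - by apply: aeW => x k _; rewrite /= lee_fin.
have e0' : 0 < e%:E by rewrite lte_fin.
have [k _ /(_ k (leqnn k))/= hk] := H _ (open_ereal_lt' e0').
exists (u_ k) => //; apply: le_trans (ltW hk).
by rewrite le_eqVlt; apply/orP; left; apply/eqP; apply: eq_integral => x _; rewrite /= distrC.
Qed.
Lemma side_small (e : R) : (0 < e)%R -> \forall k \near \oo, (side 1 k < e)%R.
Proof.
move=> e0; exists (Num.bound e^-1) => // k /= hk.
rewrite /side mul1r invf_plt ?posrE ?exprn_gt0//.
apply: lt_le_trans (archi_boundP _) _; first by rewrite invr_ge0 ltW.
by rewrite -natrX ler_nat; apply: leq_trans hk (ltnW (ltn_expl _ _)).
Qed.

(** The indicator is evaluated at the corners of finer and finer grids. Corners tend to the point,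
    so the values are eventually right except on the hyperplanes carrying the faces of the box. *)
Lemma apx_box (a b : V) : apx (\1_(box a b : set E)).
Proof.
pose u_ k (x : E) : R := \1_(box a b : set E) (crn (side 1 k) x).
pose c : R := (\sum_i (`|tnth a i| + `|tnth b i|) + 1)%R.
have mbx : measurable (box a b : set E) by apply: borel_measurable; exact: measurable_box.
have c0 : (0 <= \sum_i (`|tnth a i| + `|tnth b i|))%R by apply: sumr_ge0 => i _; rewrite addr_ge0.
have cb (x : V) : box a b x -> (forall i, `|tnth x i| <= c - 1)%R.
  move=> h i; have /andP[h1 h2] := h i.
  rewrite /c addrK (bigD1 i)//=; apply: (@le_trans _ _ (`|tnth a i| + `|tnth b i|)%R).
    rewrite ler_norml; apply/andP; split.
      have := ler_norm (- tnth a i)%R; rewrite normrN; have := normr_ge0 (tnth b i); lra.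
    have := ler_norm (tnth b i); have := normr_ge0 (tnth a i); lra.
  by rewrite lerDl; apply: sumr_ge0 => j _; rewrite addr_ge0.
have side1 k : (side 1 k <= 1 :> R)%R.
  by rewrite /side mul1r invf_le1 ?exprn_gt0// exprn_ege1// ler1n.
have us k x : (n%:R * c < vnorm x)%R -> ~ box a b (crn (side 1 k) x).
  move=> xc h; have sk := @side_gt0 R 1 ltr01 k.
  have : (vnorm x <= n%:R * c)%R.
    apply: vnorm_le_coord => i; have := cb _ h i; have := crn_ge x i sk; have := crn_lt x i sk.
    have := side1 k; rewrite !ler_norml => h1 h2 h3 /andP[h4 h5]; apply/andP; split; lra.
  by rewrite leNgt xc.
have us0 x : (n%:R * c < vnorm x)%R -> ~ box a b x.
  move=> xc h; have : (vnorm x <= n%:R * c)%R.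
    apply: vnorm_le_coord => i; have := cb _ h i; lra.
  by rewrite leNgt xc.
have mu_ k : measurable_fun setT (u_ k).
  have m1 : measurable_fun setT (\1_(box a b : set V) : V -> R).
    by apply: measurable_indic; exact: measurable_box.
  exact: (measurableT_comp m1 (measurable_crn (side 1 k) (@measurable_toV _ _ leb))).
have mball : measurable_fun setT (\1_(vball leb (n%:R * c)%R) : E -> R).
  by apply: measurable_indic; exact: measurable_vball.
apply: (@apx_dominated u_ _ (\1_(vball leb (n%:R * c)%R))).
- move=> k; apply: apx_step; exists k, 1%R, (n%:R * c)%R; split; first split.
  + exact: mu_.
  + by move=> x; rewrite /u_ indicE; case: (_ \in _); rewrite ?normr1 ?normr0.
  + by move=> x xc; rewrite /u_ indicE memNset//; exact: us.
  by move=> x y e; rewrite /u_ e.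
- exact: measurable_indic.
- apply/ae_null; apply/eqP; rewrite eq_le Leb_ge0 andbT.
  pose A (p : 'I_n * bool) : set E := [set z : E | tnth z p.1 = if p.2 then tnth a p.1 else tnth b p.1].
  rewrite -(@null_countable _ _ leb _ A); last first.
    move=> p; rewrite (@LebE _ _ leb (A p : set V)); first exact: leb_hyperplane.
    exact: (measurable_halfspace p.1 (measurable_set1 _)).
  apply: le_Leb => x; apply: contra_notP => xA.
  have xa i : tnth x i != tnth a i by apply/eqP => h; apply: xA; exists (i, true).
  have xb i : tnth x i != tnth b i by apply/eqP => h; apply: xA; exists (i, false).
  rewrite [X in _ --> X]indicE /u_.
  have [bx|bx] := pselect (box a b x).
    apply: cvg_near_cst; rewrite mem_set//; near=> k.
    have sk i : (side 1 k < tnth b i - tnth x i)%R.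
      move: i; near: k; apply: filter_forall => i; apply: side_small.
      by rewrite subr_gt0 lt_neqAle xb; have /andP[_ ->] := bx i.
    rewrite indicE mem_set// => i; have k0 := @side_gt0 R 1 ltr01 k.
    have := crn_ge x i k0; have := crn_lt x i k0; have := sk i; have /andP[h1 h2] := bx i.
    by move=> h3 h4 h5; apply/andP; split; lra.
  have [i hi] : exists i, ~ (tnth a i < tnth x i <= tnth b i)%R by apply/existsNP.
  have {}hi : (tnth x i < tnth a i)%R \/ (tnth b i < tnth x i)%R.
    have [h|h] := ltP (tnth a i) (tnth x i); last by left; rewrite lt_neqAle xa.
    by right; rewrite ltNge; apply/negP => h'; apply: hi; rewrite h.
  apply: cvg_near_cst; near=> k; rewrite (memNset bx) indicE memNset// => /(_ i)/andP[h1 h2].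
  have k0 := @side_gt0 R 1 ltr01 k.
  have g1 := crn_ge x i k0; have g2 := crn_lt x i k0.
  case: hi => h3; last by have := lt_le_trans h3 (le_trans g1 h2); rewrite ltxx.
  have sk : (tnth x i < tnth a i -> side 1 k < tnth a i - tnth x i)%R.
    near: k; have [h|h] := ltP (tnth x i) (tnth a i); last by apply: nearW.
    by have := @side_small (tnth a i - tnth x i)%R; rewrite subr_gt0 => /(_ h); apply: filterS.
  by have := sk h3; lra.
- exact: mball.
- rewrite (_ : \int[mu]_x _ = mu (vball leb (n%:R * c)%R)); first exact: Leb_ball_fin.
  rewrite -[vball _ _ in RHS]setIT -(integral_indic mu measurableT (measurable_vball leb _)).
  by apply: eq_integral => x _; rewrite ger0_norm// indicE.
move=> k x; rewrite /u_ !indicE.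
have [h|h] := pselect (box a b (crn (side 1 k) x)); last by rewrite memNset// normr0.
rewrite mem_set// normr1 mem_set// /vball/= leNgt; apply/negP => xc; exact: us h.
Unshelve. all: by end_near. Qed.

Lemma apx_ae (f g : E -> R) : apx f -> {ae mu, forall x, f x = g x} -> apx g.
Proof.
move=> [mf af] fg.
have mg : measurable_fun setT g.
  apply/measurable_EFinP; apply: (@ae_eq_measurable _ _ leb (EFin \o f)); last exact/measurable_EFinP.
  by apply: filterS fg => x /= ->.
split => // e /af[u su ue]; exists u => //; apply: le_trans ue.
rewrite le_eqVlt; apply/orP; left; apply/eqP; have mu' := grid_step_measurable su.
apply: ae_eq_ge0_integral.
- exact: measurableT.
- by apply/measurable_EFinP; exact: measurable_absR (measurable_funB mg mu').
- by apply/measurable_EFinP; exact: measurable_absR (measurable_funB mf mu').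
- by move=> x; rewrite lee_fin normr_ge0.
- by move=> x; rewrite lee_fin normr_ge0.
by apply: filterS fg => x ->.
Qed.

Lemma int_cube k : \int[mu]_x `|(\1_(cube k%:R : set E) : E -> R) x|%:E < +oo.
Proof.
have mC : measurable (cube k%:R : set E) by apply: borel_measurable; exact: measurable_box.
rewrite (_ : \int[mu]_x _ = mu (cube k%:R : set E)); first exact: Leb_cube_fin.
rewrite -[(cube k%:R : set E) in RHS]setIT -(integral_indic mu measurableT mC).
by apply: eq_integral => x _; rewrite ger0_norm// indicE.
Qed.

(** Dynkin's theorem starting from the boxes; the intersection with a cube keeps every indicator
    integrable, in particular for complements. *)
Lemma apx_borel k (A : set V) : measurable A -> apx (\1_(A `&` cube k%:R : set E)).
Proof.
move=> mA; pose P (A : set V) := apx (\1_(A `&` cube k%:R : set E)).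
have mC : measurable (cube k%:R : set E) by apply: borel_measurable; exact: measurable_box.
have PT : P setT by rewrite /P setTI; exact: apx_box.
apply: (@dynkin_induction _ V boxes P).
- exact: measurable_boxesE.
- exact: boxes_setI.
- exact: PT.
- move=> _ [[a b] _ <-]/=; rewrite /P.
  have : boxes (box a b `&` cube k%:R).
    by apply: boxes_setI; [exists (a, b)|exists ([tuple (- k%:R)%R | i < n], [tuple k%:R | i < n])].
  by move=> [[a' b'] _ <-]; exact: apx_box.
- move=> S mS PS; rewrite /P.
  rewrite (_ : \1_(~` S `&` cube k%:R) = (fun x => \1_(setT `&` cube k%:R : set E) x + (-1) * \1_(S `&` cube k%:R : set E) x)%R :> (E -> R)).
    exact: apxD PT (apxZ _ PS).
  apply/funext => x; rewrite !indicE !in_setI in_setT in_setC.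
  by case: (_ \in S); case: (_ \in cube _); rewrite /=; lra.
- move=> F mF tF PF; rewrite /P.
  have mFE i : measurable (F i : set E) by exact: borel_measurable.
  have sumE m x : (\sum_(i < m) \1_(F i `&` cube k%:R : set E) x = \1_(\big[setU/set0]_(i < m) F i `&` cube k%:R : set E) x :> R)%R.
    elim: m => [|m IH]; first by rewrite !big_ord0 set0I indic0.
    rewrite !big_ord_recr/= IH !indicE !in_setI in_setU.
    case: (boolP (x \in F m)) => [/set_mem xm|_]; last by rewrite orbF addr0.
    rewrite (_ : (x \in \big[setU/set0]_(i < m) F i) = false) ?add0r//.
    apply/negbTE/negP => /set_mem; rewrite -bigcup_mkord => -[j /= jm xj].
    have := (trivIsetP.1 tF) j m I I; rewrite neq_ltn jm => /(_ isT)/seteqP[+ _].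
    by move=> /(_ x); apply.
  apply: (@apx_dominated (fun m x => \sum_(i < m) \1_(F i `&` cube k%:R : set E) x)%R _ (\1_(cube k%:R : set E))).
  + elim => [|m IH].
      by under eq_fun do rewrite big_ord0; apply: apx_step; exact: grid_step0.
    under eq_fun do rewrite big_ord_recr/=; exact: apxD IH (PF m).
  + by apply: measurable_indic; apply: measurableI; [exact: bigcup_measurable|exact: mC].
  + apply: aeW => x; apply: cvg_near_cst.
    have [[i _ xi]|h] := pselect ((\bigcup_i F i) x).
      exists i.+1 => // m /= im; rewrite sumE !indicE !in_setI; congr ((_ && _) : bool)%:R.
      apply/idP/idP => _; apply/mem_set; first by exists i.
      by rewrite -bigcup_mkord; exists i.
    exists 0%N => // m _; rewrite sumE !indicE !in_setI; congr ((_ && _) : bool)%:R.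
    apply/idP/idP => /set_mem h'; exfalso; apply: h => //.
    by move: h'; rewrite -bigcup_mkord => -[j _ xj]; exists j.
  + exact: measurable_indic.
  + exact: int_cube.
  move=> m x; rewrite sumE !indicE in_setI; case: (_ \in cube _); rewrite ?andbF ?andbT ?normr0//.
  by case: (_ \in _); rewrite ?normr1 ?normr0.
- by rewrite -measurable_boxesE.
Qed.

Lemma apx_indic k (A : set E) : measurable A -> apx (\1_(A `&` cube k%:R : set E)).
Proof.
move=> mA; have [N [mN N0] mAN] := measurable_borel_null Hleb mA.
apply: (apx_ae (apx_borel k mAN)); apply/ae_null; apply/eqP; rewrite eq_le Leb_ge0 andbT -N0.
apply: le_Leb => x /=; apply: contra_notP => xN; rewrite !indicE; congr (_ : bool)%:R.
by apply/idP/idP => /set_mem[h1 h2]; apply/mem_set; split => //; case: h1.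
Qed.

(** [f] is cut to growing cubes, and each cut is approximated by a simple function, a finite
    combination of indicators inside the cube. *)
Lemma apx_L1 (f : E -> R) : measurable_fun setT f -> \int[mu]_x `|f x|%:E < +oo -> apx f.
Proof.
move=> mf fi; have mC k : measurable (cube k%:R : set E) by apply: borel_measurable; exact: measurable_box.
have mab := measurable_absR mf.
have iab : \int[mu]_x `| `|f x| |%:E < +oo.
  by apply: le_lt_trans fi; rewrite le_eqVlt; apply/orP; left; apply/eqP; apply: eq_integral => x _; rewrite normr_id.
have cube_near (x : V) : \forall k \near \oo, cube k%:R x.
  exists (Num.bound (vnorm x)) => // k /= hk; rewrite cubeE => i.
  have h1 := archi_boundP (vnorm_ge0 x); have := coord_le_vnorm x i.
  have h2 : ((Num.bound (vnorm x))%:R <= k%:R :> R)%R by rewrite ler_nat.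
  by rewrite ler_norml => /andP[? ?]; apply/andP; split; lra.
have mcut k : measurable_fun setT (fun x => f x * \1_(cube k%:R : set E) x)%R.
  by apply: measurable_funM => //; exact: measurable_indic.
apply: (@apx_dominated (fun k x => f x * \1_(cube k%:R : set E) x)%R _ (fun x => `|f x|%R)).
- move=> k; apply: apx_limit => // e e0.
  have [g [ig _ cvg]] := @approximation_sfun_integrable _ _ _ mu setT measurableT _ (integrableR mf fi).
  have e0' : 0 < e%:E by rewrite lte_fin.
  have [m _ /(_ m (leqnn m))/= hm] := cvg _ (open_ereal_lt' e0').
  have mgm : measurable_fun setT (g m : E -> R) by exact: measurable_funPT.
  exists (fun x => g m x * \1_(cube k%:R : set E) x)%R.
    have [N [c gE0]] : exists N (c : nat -> R), forall x,
        g m x = (\sum_(i < N) c i * \1_(g m @^-1` [set c i]) x)%R.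
      eexists; eexists (fun i => nth 0%R _ i) => x; exact: fimfunEord.
    have gE x : (g m x * \1_(cube k%:R : set E) x =
        \sum_(i < N) c i * \1_((g m @^-1` [set c i]) `&` cube k%:R : set E) x)%R.
      rewrite gE0 mulr_suml; apply: eq_bigr => i _.
      by rewrite -mulrA indicI.
    under eq_fun do rewrite gE; elim: N {gE gE0} => [|j IH].
      by under eq_fun do rewrite big_ord0; apply: apx_step; exact: grid_step0.
    under eq_fun do rewrite big_ord_recr/=; apply: (apxD IH); apply: apxZ; apply: apx_indic.
    by rewrite -[X in measurable X]setTI; apply: mgm.
  apply: le_trans (ltW hm).
  apply: int_leR.
  + apply: measurable_absR; apply: measurable_funB; first exact: mcut.
    by apply: measurable_funM => //; exact: measurable_indic.
  + exact: measurable_absR (measurable_funB mf mgm).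
  + by move=> x; rewrite normr_ge0.
  by move=> x; rewrite -mulrBl normrM ler_piMr// indicE; case: (_ \in _); rewrite ?normr1 ?normr0.
- exact: mf.
- apply: aeW => x; apply: cvg_near_cst; near=> k; rewrite indicE mem_set ?mulr1//.
  by near: k; exact: cube_near.
- exact: mab.
- exact: iab.
by move=> k x; rewrite normrM ler_piMr// indicE; case: (_ \in _); rewrite ?normr1 ?normr0.
Unshelve. all: by end_near. Qed.
End density.

(** * Principal values *)

Section existence.
Context {R : realType} {n : nat} (leb : {measure set (n.-tuple R) -> \bar R}).
Hypothesis Hleb : is_lebesgue_borel leb.
Hypothesis n0 : (0 < n)%N.
Local Notation V := (n.-tuple R).
Local Notation E := (Rn leb).
Local Notation mu := (lebm leb).
Local Open Scope ereal_scope.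

(** Countable subadditivity of the outer measure suffices, so the sets [B k] may be arbitrary. *)
Lemma borel_cantelli (B : (set E)^nat) (C : R) : (forall k, mu (B k) <= (C / 2 ^+ k)%:E) ->
  mu [set x | ~ exists N, forall k, (N <= k)%N -> ~ B k x] = 0.
Proof.
move=> hB; set S := [set x | _].
have h N : mu S <= (2 * C / 2 ^+ N)%:E.
  apply: (@le_trans _ _ (mu (\bigcup_j B (N + j)%N))).
    apply: le_Leb => x /= h; apply: contrapT => h'; apply: h; exists N => k Nk hk.
    by apply: h'; exists (k - N)%N => //; rewrite subnKC.
  apply: le_trans (Leb_subadd _) _.
  have C0 : (0 <= C)%R by have := le_trans (Leb_ge0 _) (hB 0%N); rewrite lee_fin expr0 divr1.
  have e0 : (0 <= 2 * C / 2 ^+ N)%R by rewrite divr_ge0 ?mulr_ge0// exprn_ge0.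
  have eps0 : \sum_(j <oo) (2 * C / 2 ^+ N / (2 ^ j.+1)%:R)%:E <= (2 * C / 2 ^+ N)%:E.
    exact: epsilon_trick0.
  apply: le_trans eps0; apply: lee_nneseries => j _; first by move=> _; exact: Leb_ge0.
  apply: le_trans (hB _) _; rewrite lee_fin natrX exprD exprS le_eqVlt; apply/orP; left; apply/eqP.
  by field; rewrite !expf_neq0.
apply/eqP; rewrite eq_le Leb_ge0 andbT; apply/lee_addgt0Pr => e e0; rewrite add0e.
have C0 : (0 <= C)%R by have := le_trans (Leb_ge0 _) (hB 0%N); rewrite lee_fin expr0 divr1.
apply: le_trans (h (Num.bound (2 * C / e)%R)) _; rewrite lee_fin ler_pdivrMr ?exprn_gt0// [leRHS]mulrC -ler_pdivrMr//.
apply: le_trans (ltW (archi_boundP _)) _; first by rewrite divr_ge0 ?mulr_ge0// ltW.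
by rewrite -natrX ler_nat; exact: (ltnW (ltn_expl _ _)).
Qed.

Variables (K : V -> R) (k0 CH A : R).
Hypothesis mK : measurable_fun [set: V] K.
Hypothesis Kring : forall s, (0 < s)%R -> \int[mu]_(x in ann leb s (2 * s)) `|K x|%:E <= k0%:E.
Hypothesis Khor : forall r h, (0 < r)%R -> (vnorm h <= r)%R ->
  \int[mu]_(x in [set x : E | (8 * r < vnorm x)%R]) `|K (vadd x h) - K x|%:E <= CH%:E.
Hypothesis Kmean : forall s t, (0 < s)%R -> (s <= t)%R -> \int[mu]_(x in ann leb s t) (K x)%:E = 0.
Hypothesis A0 : (0 <= A)%R.
Hypothesis Kweak : forall (f : E -> R) (s : R), measurable_fun setT f -> \int[mu]_x `|f x|%:E < +oo ->
  (0 < s)%R -> mu [set x : E | s%:E < `|TT K f x|] <= (A / s)%:E * \int[mu]_x `|f x|%:E.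

(** The constant must be uniform in [y]. For [y] near the ball one fixed annulus contains all the
    differences; for [y] far away they stay within finitely many dyadic shells. *)
Lemma cutK_sup r dl : (0 < r)%R -> (0 < dl)%R ->
  exists2 c : R, (0 <= c)%R & forall y, \int[mu]_(x in vball leb r) `|cutK K dl x y|%:E <= c%:E.
Proof.
move=> r0 dl0; have Kr0 := ring_ge0 Kring.
have Kf : \int[mu]_(x in ann leb dl (3 * r)%R) `|K x|%:E \is a fin_num.
  rewrite ge0_fin_numE; first exact: (Kring_fin mK Kring).
  by apply: integral_ge0 => x _; rewrite lee_fin.
pose c1 := fine (\int[mu]_(x in ann leb dl (3 * r)%R) `|K x|%:E).
have c10 : (0 <= c1)%R by rewrite fine_ge0//; apply: integral_ge0 => x _; rewrite lee_fin.
exists (c1 + 3 * k0)%R; first by rewrite addr_ge0// mulr_ge0.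
move=> y.
have K0 (x : E) : 0 <= `|K x|%:E by rewrite lee_fin.
have bnd (s t : R) : (forall x, vball leb r x -> (dl < vnorm (vsub x y))%R -> (s < vnorm (vsub x y) <= t)%R) ->
    \int[mu]_(x in vball leb r) `|cutK K dl x y|%:E <= \int[mu]_(x in ann leb s t) `|K x|%:E.
  move=> h.
  rewrite -(ge0_integral_shift Hleb (measurable_ann leb s t) (mKabs mK) K0 (vscale (-1) y)).
  rewrite [leLHS]int_condR [leRHS]int_condR.
  have mx : measurable_fun setT ((fun x => vsub x y) : E -> V).
    exact: measurable_vsub (@measurable_toV _ _ leb) (measurable_cst _).
  apply: int_leR.
  - apply: measurable_funM; first by apply: measurable_indic; exact: measurable_vball.
    apply: measurable_absR; apply: measurable_funM; first exact: mKf.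
    exact: measurable_ltb (measurable_cst dl) (measurable_vnorm mx).
  - apply: measurable_funM.
      apply: measurable_indic; rewrite -[X in measurable X]setTI.
      exact: (measurable_shift Hleb (vscale (-1) y) measurableT (measurable_ann leb s t)).
    apply: measurable_absR; apply: (mKf mK).
    exact: measurable_vadd (@measurable_toV _ _ leb) (measurable_cst _).
  - by move=> x; rewrite mulr_ge0// indicE.
  move=> x; rewrite /cutK normrM -vsubE !indicE.
  case: (boolP (x \in vball leb r)) => [/set_mem xr|_]; last by rewrite mul0r mulr_ge0.
  case: ltP => xd; last by rewrite normr0 !mulr0 mulr_ge0.
  by rewrite normr1 mulr1 mem_set//= /ann/= -vsubE; exact: h.
have [yr|yr] := leP (vnorm y) (2 * r)%R.
  apply: le_trans (bnd dl (3 * r)%R _) _.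
    move=> x xr ->; apply: le_trans (vnormB x y) _.
    by rewrite (_ : 3 * r = r + 2 * r)%R ?lerD//; ring.
  by rewrite EFinD -(fineK Kf) -EFinD lee_fin lerDl mulr_ge0.
(* If [|y| > 2 r], then [|x - y|] lies between [2 * s] and [8 * s], so three dyadic shells are
   enough. *)
pose s : R := ((vnorm y - r) / 2)%R.
have s0 : (0 < s)%R by rewrite divr_gt0// subr_gt0; lra.
apply: le_trans (bnd s (2 ^+ 3 * s)%R _) _.
  move=> x; rewrite /vball/= => xr _; have := vnormB x y; have := vnorm_le_sub y x.
  by rewrite vnorm_subC /s !exprS expr0 => h1 h2; apply/andP; split; lra.
apply: le_trans (Kring_pow mK Kring 3 s0) _.
by rewrite lee_fin lerDr.
Qed.

Lemma cutK_mass (h : E -> R) r dl c : (0 < r)%R -> (0 < dl)%R -> measurable_fun setT h ->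
  (forall y, \int[mu]_(x in vball leb r) `|cutK K dl x y|%:E <= c%:E) -> (0 <= c)%R ->
  measurable_fun setT (fun x : E => \int[mu]_y `|cutK K dl x y * h y|%:E) /\
  \int[mu]_(x in vball leb r) \int[mu]_y `|cutK K dl x y * h y|%:E <= c%:E * \int[mu]_y `|h y|%:E.
Proof.
move=> r0 dl0 mh hc c0.
have mcut : measurable_fun setT (fun z : E * E => cutK K dl z.1 z.2).
  have m12 : measurable_fun setT (fun z : E * E => vsub z.1 z.2 : V).
    by apply: measurable_vsub; [exact: m_fstE|exact: m_sndE].
  apply: measurable_funM; first exact: mKf.
  exact: measurable_ltb (measurable_cst dl) (measurable_vnorm m12).
have mF : measurable_fun setT (fun z : E * E => `|cutK K dl z.1 z.2 * h z.2|%:E).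
  apply: measurable_absE; apply: measurable_funM => //.
  exact: (measurableT_comp mh measurable_snd).
have F0 (z : E * E) : 0 <= `|cutK K dl z.1 z.2 * h z.2|%:E by rewrite lee_fin.
have [m1 _ _] := ge0_tonelli Hleb mF F0; split; first exact: m1.
have [_ m2 ton] := ge0_tonelli_on Hleb (measurable_vball leb r) measurableT mF F0.
rewrite [leLHS]ton; have mab := measurable_absR mh.
rewrite -(int_scaleR mu mab c0) => [|y]; last by rewrite normr_ge0.
apply: ge0_le_integralT.
- exact: measurableT.
- exact: m2.
- by apply/measurable_EFinP; exact: measurable_funM (measurable_cst _) mab.
- by move=> y; apply: integral_ge0 => x _; rewrite lee_fin.
move=> y _ /=.
have mcy : measurable_fun setT (fun x : E => `|cutK K dl x y|%:E).
  by apply: measurable_absE; exact: (measurableT_comp mcut (pair2_measurable y)).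
rewrite (_ : \int[mu]_(x in vball leb r) `|cutK K dl x y * h y|%:E =
    \int[mu]_(x in vball leb r) (`|h y|%:E * `|cutK K dl x y|%:E)); last first.
  by apply: eq_integral => x _; rewrite -EFinM normrM mulrC.
rewrite (ge0_integralZl mu (measurable_vball leb r) (measurable_funTS mcy)); last 2 first.
- by move=> x _; rewrite lee_fin.
- by rewrite lee_fin.
by rewrite mulrC EFinM; apply: lee_wpmul2l; [rewrite lee_fin|exact: hc].
Qed.
Let H : R := (2 * max_height leb k0 CH A)%R.

Let H0 : (0 <= H)%R.
Proof.
rewrite /H /max_height mulr_ge0// !addr_ge0 ?mulr_ge0 ?exprn_ge0//.
- exact: beta_ge0.
- exact: (CH_ge0 Khor).
- exact: (ring_ge0 Kring).
Qed.

Lemma grid_step_max u s : grid_step (leb := leb) u -> (0 < s)%R ->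
  exists2 Z : set E, mu Z <= (2 * max_cst leb CH A / s)%:E * \int[mu]_x `|u x|%:E &
  forall x ep, ~ Z x -> (0 < ep)%R -> (ep <= 1)%R -> `|Te (leb := leb) K u ep x| <= (H * s)%:E.
Proof.
move=> [k [B [rho [ub ui]]]] s0.
exact: (step_max Hleb n0 mK Kring Khor Kmean A0 Kweak (side_gt0 ltr01 k) ui ub s0).
Qed.

Lemma grid_step_loc u : grid_step (leb := leb) u -> exists2 N : set E, mu N = 0 &
  forall x, ~ N x -> exists2 r : R, (0 < r)%R & forall ep, (0 < ep)%R -> (ep <= r)%R -> Te (leb := leb) K u ep x = Te K u r x.
Proof.
move=> [k [B [rho [ub ui]]]]; exists (bdry (side 1 k)); first exact: null_bdry.
move=> x xb; have [r r0 hr] := crn_locally_cst (side_gt0 ltr01 k) xb.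
exists r => // ep ep0 er; apply: (Te_loc Hleb mK Kring Kmean ub ep0 er (c := u x)).
by move=> y h; apply/esym/ui/hr.
Qed.

(** A finite absolute integral at the smaller radius [dl] dominates the remainder for all [ep >= dl]
    at once. *)
Lemma TeD_step (f : E -> R) u ep dl x : measurable_fun setT f -> grid_step (leb := leb) u ->
  (0 < dl)%R -> (dl <= ep)%R -> \int[mu]_y `|cutK K dl x y * (f y - u y)|%:E < +oo ->
  exists2 w : \bar R, Te (leb := leb) K f ep x = w + Te K u ep x &
    `|w| <= \int[mu]_y `|cutK K dl x y * (f y - u y)|%:E.
Proof.
move=> mf su dl0 de fin; have mu' := grid_step_measurable su.
have [k [B [rho [ub _]]]] := su; have ep0 : (0 < ep)%R by exact: lt_le_trans de.
have mfu := measurable_funB mf mu'.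
have mc e := measurable_cutK (leb := leb) mK e x.
have le : \int[mu]_y `|cutK K ep x y * (f y - u y)|%:E <= \int[mu]_y `|cutK K dl x y * (f y - u y)|%:E.
  apply: int_leR.
  - exact: measurable_absR (measurable_funM (mc ep) mfu).
  - exact: measurable_absR (measurable_funM (mc dl) mfu).
  - by move=> y; rewrite normr_ge0.
  move=> y; rewrite !normrM ler_wpM2r//; rewrite ler_wpM2l//.
  by case: ltP => h; [rewrite (le_lt_trans de h)|rewrite normr0].
have iw : mu.-integrable setT (EFin \o (fun y => cutK K ep x y * (f y - u y))%R).
  apply: integrableR; [exact: measurable_funM (mc ep) mfu|exact: le_lt_trans le fin].
exists (\int[mu]_y (cutK K ep x y * (f y - u y))%:E); last first.
  by apply: le_trans (abs_intR mu (measurable_funM (mc ep) mfu)) le.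
rewrite !TeE -(integralD measurableT iw (cutK_integrable Hleb mK Kring x ub ep0)).
by apply: eq_integral => y _; rewrite /= -EFinD; congr EFin; ring.
Qed.

(** Grid steps [u k] converge fast to [f]. Off a summable sequence of sets the maximal inequality
    makes their truncations uniformly close in [ep], and each of them is constant in [ep] near 0 off
    a null set. Hence the truncations of [f] are Cauchy almost everywhere. *)
Lemma pv_ae (f : E -> R) : measurable_fun setT f -> \int[mu]_x `|f x|%:E < +oo ->
  {ae mu, forall x, exists l : R, Te (leb := leb) K f ep x @[ep --> 0^'+] --> l%:E}.
Proof.
move=> mf fi; have [_ af] := apx_L1 Hleb mf fi.
have hc k : exists c : R, (0 <= c)%R /\ forall y,
    \int[mu]_(x in vball leb k.+1%:R) `|cutK K (k.+1%:R^-1) x y|%:E <= c%:E.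
  have k10 : (0 < k.+1%:R^-1 :> R)%R by rewrite invr_gt0.
  by have [c c0 hc] := cutK_sup (ltr0Sn _ k) k10; exists c.
have [c hc'] := choice hc.
have p4 k : (0 < 4 ^+ k :> R)%R by rewrite exprn_gt0.
have p2 k : (0 < 2 ^+ k :> R)%R by rewrite exprn_gt0.
have c1 k : (0 < 1 + c k)%R by have [h _] := hc' k; rewrite ltr_pwDl.
(* The factor [4 ^ k] leaves [2 ^ - k] after the weak bound at height [2 ^ - k]; the factor
   [1 + c k] absorbs the size of the kernel cut at radius [1 / (k + 1)] on the ball of radius
   [k + 1]. *)
have hu k : exists u, grid_step (leb := leb) u /\ \int[mu]_x `|f x - u x|%:E <= ((4 ^+ k * (1 + c k))^-1)%:E.
  have [|u su ue] := af ((4 ^+ k * (1 + c k))^-1)%R; first by rewrite invr_gt0 mulr_gt0.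
  by exists u.
have [u hu'] := choice hu.
have su k : grid_step (u k) by have [] := hu' k.
have mu' k := grid_step_measurable (su k).
pose v k x : R := (u k.+1 x + (-1) * u k x)%R.
have sv k : grid_step (v k) by apply: grid_stepD => //; exact: grid_stepZ.
have fu4 k : \int[mu]_x `|f x - u k x|%:E <= ((4 ^+ k)^-1)%:E.
  have [_ h] := hu' k; apply: le_trans h _; rewrite lee_fin lef_pV2 ?posrE ?mulr_gt0//.
  by rewrite ler_peMr ?(ltW (p4 k))// lerDl; have [] := hc' k.
have iv k : \int[mu]_x `|v k x|%:E <= (2 / 4 ^+ k)%:E.
  apply: (@le_trans _ _ (\int[mu]_x `|f x - u k.+1 x|%:E + \int[mu]_x `|f x - u k x|%:E)).
    apply: int_norm_triangle.
    - exact: measurable_funB mf (mu' _).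
    - exact: measurable_funB mf (mu' _).
    - exact: grid_step_measurable (sv k).
    move=> x; rewrite -[leRHS]addrC; apply: le_trans (ler_normB _ _).
    by rewrite /v le_eqVlt; apply/orP; left; apply/eqP; congr (`|_|)%R; ring.
  apply: le_trans (leeD (fu4 _) (fu4 _)) _; rewrite -EFinD lee_fin.
  rewrite (_ : 2 / 4 ^+ k = (4 ^+ k)^-1 + (4 ^+ k)^-1)%R; last by ring.
  by rewrite lerD2r lef_pV2 ?posrE// exprS ler_peMl ?ler1n// ltW.
have hZ k : exists Z : set E, mu Z <= (4 * max_cst leb CH A / 2 ^+ k)%:E /\
    forall x ep, ~ Z x -> (0 < ep)%R -> (ep <= 1)%R -> `|Te (leb := leb) K (v k) ep x| <= (H / 2 ^+ k)%:E.
  have [|Z mZ hZ] := grid_step_max (sv k) (s := (2 ^- k)%R); first by rewrite invr_gt0.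
  exists Z; split => //; apply: le_trans mZ _; apply: le_trans (lee_wpmul2l _ (iv k)) _.
    by rewrite lee_fin invrK !mulr_ge0 ?(@max_cst_ge0 R n leb K CH A Khor A0)// ltW.
  rewrite invrK -EFinM lee_fin le_eqVlt; apply/orP; left; apply/eqP.
  rewrite (_ : 4 = 2 * 2 :> R)%R; last by ring.
  by rewrite exprMn; field; rewrite gt_eqF.
have [Z hZ'] := choice hZ.
have mfu k : measurable_fun setT (fun y => f y - u k y)%R by exact: measurable_funB mf (mu' k).
pose dl k : R := (k.+1%:R^-1)%R.
have dl0 k : (0 < dl k)%R by rewrite invr_gt0.
pose G k x := \int[mu]_y `|cutK K (dl k) x y * (f y - u k y)|%:E.
(* The second part is where replacing [f] by [u k] in truncations of radius at least [dl k] is not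
   yet harmless. *)
pose Bd k : set E := Z k `|` [set x | (2 ^- k)%:E < (G k \_ (vball leb k.+1%:R)) x].
pose C : R := (4 * max_cst leb CH A + 1)%R.
have mB k : mu (Bd k) <= (C / 2 ^+ k)%:E.
  apply: le_trans (LebU _ _) _; rewrite /C mulrDl EFinD mul1r; apply: leeD; first by have [] := hZ' k.
  have [ck0 hck] := hc' k.
  have [mG IG] := cutK_mass (h := fun y => (f y - u k y)%R) (ltr0Sn _ k) (dl0 k) (mfu k) hck ck0.
  have mGr : measurable_fun setT (G k \_ (vball leb k.+1%:R)).
    apply/(measurable_restrictT _ _).1; first exact: measurable_vball.
    exact: measurable_funTS.
  have Gr0 x : 0 <= (G k \_ (vball leb k.+1%:R)) x.
    by rewrite patchE; case: ifP => // _; apply: int_ge0R => y; rewrite normr_ge0.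
  have k20 : (0 < 2 ^- k :> R)%R by rewrite invr_gt0.
  apply: le_trans (markov_lt mGr Gr0 k20) _; rewrite -integral_mkcond invrK.
  apply: le_trans (lee_wpmul2l _ IG) _; first by rewrite lee_fin ltW.
  have [_ h] := hu' k.
  apply: le_trans (lee_wpmul2l _ (lee_wpmul2l _ h)) _; [by rewrite lee_fin ltW|by rewrite lee_fin|].
  rewrite -!EFinM lee_fin (_ : 4 = 2 * 2 :> R)%R; last by ring.
  rewrite exprMn (_ : 2 ^+ k * (c k * (2 ^+ k * 2 ^+ k * (1 + c k))^-1) = c k / (1 + c k) / 2 ^+ k)%R; last first.
    by field; rewrite !gt_eqF.
  by rewrite ler_piMl ?invr_ge0 ?(ltW (p2 k))// ler_pdivrMr// mul1r lerDr.
have S0 := borel_cantelli mB.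
have hN k : exists N : set E, mu N = 0 /\ forall x, ~ N x -> exists2 r : R, (0 < r)%R &
    forall ep, (0 < ep)%R -> (ep <= r)%R -> Te (leb := leb) K (u k) ep x = Te K (u k) r x.
  by have [N N0 hN] := grid_step_loc (su k); exists N.
have [Nk hNk] := choice hN.
have NN0 : mu (\bigcup_k Nk k) = 0 by apply: null_bigcup => k; have [] := hNk k.
apply/ae_null; apply/eqP; rewrite eq_le Leb_ge0 andbT.
apply: le_trans (le_Leb (B := [set x | ~ exists N, forall k, (N <= k)%N -> ~ Bd k x] `|` \bigcup_k Nk k) _) _; last first.
  by apply: le_trans (LebU _ _) _; rewrite S0 NN0 adde0.
move=> x /=; apply: contra_notP => /not_orP[/contrapT[N hNx] xN].
have fin k ep : (0 < ep)%R -> Te (leb := leb) K (u k) ep x \is a fin_num.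
  by move=> ep0; have [k' [B [rho [ub _]]]] := su k; exact: (Te_fin Hleb mK Kring x ub ep0).
pose t k ep : R := fine (Te (leb := leb) K (u k) ep x).
have step k ep : (N <= k)%N -> (0 < ep)%R -> (ep <= 1)%R -> (`|t k.+1 ep - t k ep| <= H / 2 ^+ k)%R.
  move=> Nk' ep0 ep1; have /not_orP[xZ _] := hNx k Nk'.
  have [_ /(_ x ep xZ ep0 ep1)] := hZ' k.
  have [k1 [B1 [r1 [b1 _]]]] := su k.+1; have [k2 [B2 [r2 [b2 _]]]] := su k.
  have -> : Te (leb := leb) K (v k) ep x = Te K (u k.+1) ep x - Te K (u k) ep x.
    rewrite (Te_bcsB Hleb mK Kring x b1 b2 ep0) TeE; apply: eq_integral => y _; congr EFin; rewrite /v; ring.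
  by rewrite -(fineK (fin k.+1 ep ep0)) -(fineK (fin k ep ep0)) -EFinB /= lee_fin.
have tel J i ep : (N <= J)%N -> (0 < ep)%R -> (ep <= 1)%R ->
    (`|t (J + i)%N ep - t J ep| <= 2 * H / 2 ^+ J - 2 * H / 2 ^+ (J + i))%R.
  move=> NJ ep0 ep1; elim: i => [|i IH]; first by rewrite addn0 !subrr normr0.
  have NJi : (N <= J + i)%N by exact: leq_trans NJ (leq_addr _ _).
  rewrite addnS; apply: le_trans (_ : _ <= `|t (J + i).+1 ep - t (J + i)%N ep| + `|t (J + i)%N ep - t J ep|)%R _.
    by apply: le_trans (ler_normD _ _); rewrite addrA subrK.
  apply: le_trans (lerD (step _ _ NJi ep0 ep1) IH) _.
  rewrite le_eqVlt; apply/orP; left; apply/eqP; rewrite (exprS _ (J + i)%N).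
  by field; rewrite !gt_eqF.
have main J ep : (N <= J)%N -> (0 < ep)%R -> (ep <= 1)%R ->
    Te (leb := leb) K f ep x \is a fin_num /\ (`|fine (Te (leb := leb) K f ep x) - t J ep| <= (2 * H + 1) / 2 ^+ J)%R.
  move=> NJ ep0 ep1.
  (* The index [j] depends on [ep]: the cut [dl j] must be below [ep] and the ball must contain [x].
     Telescoping from [j] back to the fixed [J] costs a geometric tail, independent of [ep]. *)
  pose i := (Num.bound ep^-1 + Num.bound (vnorm x))%N; pose j := (J + i)%N.
  have NJj : (N <= j)%N by exact: leq_trans NJ (leq_addr _ _).
  have jep : (dl j <= ep)%R.
    rewrite /dl -[leRHS]invrK lef_pV2 ?posrE ?invr_gt0//.
    apply: le_trans (ltW (archi_boundP _)) _; first by rewrite invr_ge0 ltW.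
    by rewrite ler_nat /j /i; lia.
  have jx : vball leb j.+1%:R x.
    rewrite /vball/=; apply: le_trans (ltW (archi_boundP (vnorm_ge0 x))) _.
    by rewrite ler_nat /j /i; lia.
  have /not_orP[_] := hNx j NJj; rewrite /= => /negP; rewrite -leNgt patchE mem_set// => Gj.
  have [w e we] := TeD_step mf (su j) (dl0 j) jep (le_lt_trans Gj (ltry _)).
  have wj := le_trans we Gj.
  have wf : w \is a fin_num by rewrite fin_num_abs; exact: le_lt_trans wj (ltry _).
  rewrite e fin_numD wf fin//; split => //.
  rewrite fineD ?fin// -/(t j ep).
  have wj' : (`|fine w| <= 2 ^- j)%R by rewrite -lee_fin -[X in X%:E]fine_abse ?fineK ?abse_fin_num.
  apply: le_trans (_ : _ <= `|fine w| + `|t j ep - t J ep|)%R _.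
    by rewrite -addrA; exact: ler_normD.
  apply: le_trans (lerD wj' (tel J i ep NJ ep0 ep1)) _; rewrite -/j.
  have jJ : (2 ^- j <= 2 ^- J :> R)%R by rewrite lef_pV2 ?posrE// ler_weXn2l ?ler1n// leq_addr.
  have Hj : (0 <= 2 * H / 2 ^+ j)%R by apply: divr_ge0; [exact: mulr_ge0|exact: ltW].
  by rewrite [leRHS]mulrDl mul1r; lra.
pose F ep : R := fine (Te (leb := leb) K f ep x).
have : cauchy (F ep @[ep --> 0^'+]).
  apply: cauchy_exP => e e0.
  pose J := (N + Num.bound ((2 * H + 1) / e))%N.
  have HJ : ((2 * H + 1) / 2 ^+ J < e)%R.
    have q0 : (0 <= (2 * H + 1) / e)%R by apply: divr_ge0; [rewrite addr_ge0// mulr_ge0|exact: ltW].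
    rewrite ltr_pdivrMr// [ltRHS]mulrC -ltr_pdivrMr//.
    apply: lt_le_trans (archi_boundP q0) _; rewrite -natrX ler_nat.
    by apply: leq_trans (ltnW (ltn_expl _ _)) (leq_pexp2l _ _); rewrite // leq_addl.
  have [r r0 hr] : exists2 r : R, (0 < r)%R &
      forall ep, (0 < ep)%R -> (ep <= r)%R -> Te (leb := leb) K (u J) ep x = Te K (u J) r x.
    by have [_ h] := hNk J; apply: h => h'; apply: xN; exists J.
  (* For [ep <= r] the truncation of [u J] no longer changes, so its value there can serve as the
     centre of the Cauchy ball. *)
  exists (t J r); rewrite /fmap/=; near=> ep.
  have ep0 : (0 < ep)%R by near: ep; exact: nbhs_right_gt.
  have ep1 : (ep <= 1)%R by near: ep; apply: nbhs_right_le.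
  have epr : (ep <= r)%R by near: ep; apply: nbhs_right_le.
  rewrite -ball_normE /ball_/= distrC /t -(hr ep ep0 epr) -/(t J ep).
  have [_ h] := main J ep (leq_addr _ _) ep0 ep1.
  exact: le_lt_trans h HJ.
move=> /cauchy_cvg/cvg_ex[l hl]; exists l.
have /cvg_EFin : \forall ep \near 0^'+, Te (leb := leb) K f ep x \is a fin_num.
  near=> ep; have ep0 : (0 < ep)%R by near: ep; exact: nbhs_right_gt.
  have ep1 : (ep <= 1)%R by near: ep; exact: nbhs_right_le.
  by have [] := main N ep (leqnn N) ep0 ep1.
by apply.
Unshelve. all: by end_near. Qed.

End existence.

(** * The kernel of the theorem as an instance *)

Section instance.
Context {R : realType} {n : nat} (leb : {measure set (n.-tuple R) -> \bar R}).
Hypothesis Hleb : is_lebesgue_borel leb.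
Hypothesis n0 : (0 < n)%N.
Local Notation V := (n.-tuple R).
Local Notation E := (Rn leb).
Local Notation mu := (lebm leb).
Variable a : R.
Hypotheses (a0 : 0 <= a) (an : a < n%:R).
Variable Om : V -> R.
Hypothesis Om_hom : forall (s : R) (x : V), 0 < s -> x != vzero -> Om (vscale s x) = Om x.
Hypothesis mOm : measurable_fun [set: E] (Om : E -> R).
Hypothesis Om_dini : L1_Dini leb a Om.
Variables (OB : V -> R) (NB : set V).
Hypothesis mOB : measurable_fun [set: V] OB.
Hypothesis mNB : measurable NB.
Hypothesis NB0 : mu NB = 0%E.
Hypothesis NBP : forall x, ~ NB x -> Om x = OB x.
Local Open Scope ereal_scope.
Let b := (n%:R - a)%R.
Let p := (n%:R / b)%R.
Local Notation K := (kern OB a).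

Lemma kern_ae : mu [set x : E | kern Om a x <> K x] = 0.
Proof.
apply/eqP; rewrite eq_le Leb_ge0 andbT -NB0; apply: le_Leb => x /=.
by apply: contra_notP => /NBP h; rewrite /kern h.
Qed.

Let mKOm : measurable_fun [set: E] (kern Om a : E -> R).
Proof.
apply/measurable_EFinP; apply: (@ae_eq_measurable _ _ leb (fun x => (K x)%:E)).
  by apply: ae_eq_null; apply/eqP; rewrite eq_le Leb_ge0 andbT -kern_ae; apply: le_Leb => x /= h h'; apply: h; rewrite h'.
by apply/measurable_EFinP; exact: mKE.
Qed.

(** For each fixed [x] the two kernels agree for almost every [y], by invariance of null sets under
    reflection. Thus the operators coincide at every point, not merely almost everywhere. *)
Lemma Ttr_fun_version (f : E -> R) eps x : measurable_fun setT f ->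
  Ttr_fun leb f Om a eps x = Ttr_fun leb f OB a eps x.
Proof.
move=> mf; rewrite /Ttr_fun -lebmE.
have mD : measurable [set y : E | (eps < vnorm (vsub x y))%R].
  rewrite -[X in measurable X]setTI.
  exact: (measurable_reflect Hleb x measurableT (measurable_far leb eps)).
apply: ae_eq_integral.
- exact: mD.
- apply: measurable_funTS; apply/measurable_EFinP; apply: measurable_funM mf.
  exact: (measurableT_comp mKOm (measurable_reflect Hleb x)).
- by apply: measurable_funTS; apply/measurable_EFinP; apply: measurable_funM mf; exact: mKx.
have : {ae mu, forall y : E, kern Om a (vsub x y) = K (vsub x y)}.
  by apply/ae_null; rewrite -kern_ae -(Leb_reflect Hleb x [set y : E | kern Om a y <> K y]).
by apply: filterS => y h _; rewrite h.
Qed.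

Lemma T_fun_version (f : E -> R) x : measurable_fun setT f -> T_fun leb f Om a x = T_fun leb f OB a x.
Proof.
move=> mf; rewrite /T_fun; case: ifP => _; last exact: Ttr_fun_version.
rewrite (_ : (fun eps => Ttr_fun leb f Om a eps x) = (fun eps => Ttr_fun leb f OB a eps x))//.
by apply/funext => eps; exact: Ttr_fun_version.
Qed.

(** Starts at [i.+1] because finiteness of the dyadic Dini series is known from index 1 on. *)
Definition tail_coef i : R := fine (dini_tail leb a Om i.+1).

Lemma dini_tail_small (e : R) : (0 < e)%R -> exists N, forall i, (N <= i)%N -> (tail_coef i <= e)%R.
Proof.
move=> e0; have tl := nneseries_tail_cvg (dini_series a0 Om_dini) (fun k _ => dini_term_ge0 leb a Om k.+1).
have e0' : 0 < e%:E by rewrite lte_fin.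
have [M _ hM] := tl _ (open_ereal_lt' e0').
exists M => N /hM/= h; rewrite /tail_coef /dini_tail.
have -> : \sum_(k <oo) dini_term leb a Om (N.+1 + k) = \sum_(N <= k <oo) dini_term leb a Om k.+1.
  rewrite -(@nneseries_addn _ (fun k => dini_term leb a Om k.+1) N) => [|k]; last exact: dini_term_ge0.
  by apply: eq_eseriesr => k _; rewrite addSn addnC.
have h0 : 0 <= \sum_(N <= k <oo) dini_term leb a Om k.+1.
  by apply: nneseries_ge0 => k _ _; exact: dini_term_ge0.
rewrite -lee_fin fineK ?(ltW h)// ge0_fin_numE//; exact: lt_trans h (ltry _).
Qed.

Lemma dini_tail_fin i : dini_tail leb a Om i.+1 \is a fin_num.
Proof.
rewrite ge0_fin_numE; last exact: dini_tail_ge0.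
apply: le_lt_trans (dini_series a0 Om_dini); rewrite /dini_tail.
rewrite [leRHS](@nneseries_split _ (fun k => dini_term leb a Om k.+1) 0 i) => [|k _]; last exact: dini_term_ge0.
rewrite add0n (_ : \sum_(k <oo) _ = \sum_(i <= k <oo) dini_term leb a Om k.+1).
  by rewrite leeDr// sume_ge0// => k _; exact: dini_term_ge0.
rewrite -(@nneseries_addn _ (fun k => dini_term leb a Om k.+1) i) => [|k]; last exact: dini_term_ge0.
by apply: eq_eseriesr => k _; rewrite addSn addnC.
Qed.

Lemma tail_coef_ge0 i : (0 <= tail_coef i)%R.
Proof. by rewrite fine_ge0// dini_tail_ge0. Qed.

Definition far_cst : R := (@dini_cst R n * 4 `^ a)%R.
Lemma far_cst_ge0 : (0 <= far_cst)%R.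
Proof. by rewrite mulr_ge0 ?powR_ge0 ?dini_cst_ge0. Qed.

Lemma hfar_version r h i : (0 < r)%R -> (vnorm h <= r)%R ->
  \int[mu]_(x in far i r) (`|OB (vadd x h) - OB x|%:E * (vnorm x `^ (- b))%:E) <=
  (far_cst * r `^ a * tail_coef i)%:E.
Proof.
move=> r0 hr.
have := far_dOm Hleb n0 an Om_hom mOm mOB mNB NB0 NBP i.+1 r0 hr.
rewrite -(fineK (dini_tail_fin i)) -EFinM => H; apply: le_trans H.
rewrite le_eqVlt; apply/orP; left; apply/eqP.
have mP := @measurable_vnorm_powR R n leb (- b)%R.
have mOBh : measurable_fun setT (fun x : E => OB (vadd x h)).
  by apply: (mO_comp mOB); exact: measurable_vadd (@measurable_toV _ _ leb) (measurable_cst _).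
apply: ae_eq_ge0_integral.
- exact: measurable_farE.
- exact: emeasurable_funM (measurable_absB mOBh (mO_comp mOB (@measurable_toV _ _ leb))) mP.
- exact: emeasurable_funM (measurable_absB (measurableT_comp mOm (measurable_shift Hleb h)) mOm) mP.
- by move=> x; rewrite mule_ge0// lee_fin powR_ge0.
- by move=> x; rewrite mule_ge0// lee_fin powR_ge0.
have := OB_shift Hleb NB0 NBP h; have := OB_ae NB0 NBP; apply: filterS2 => x h1 h2.
by rewrite h1 h2.
Qed.

Lemma Om_ball_fin : \int[mu]_(x in ann leb 0 1) `|Om x|%:E < +oo.
Proof.
have [h _] := Om_dini; move: h.
rewrite (@sph_int_hom R n leb (fun x => `|Om x|%:E)) => [|s x s0]; last by rewrite (Om_homT Om_hom).
have [->|] := eqVneq (\int[mu]_(x in ann leb 0 1) `|Om x|%:E) +oo; last by move=> h _; rewrite ltey.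
by rewrite gt0_muley ?lte_fin ?ltr0n.
Qed.
(** The weak quasi-norm at the single height [s], raised to the power [p] and transferred to the
    Borel version. *)
Lemma T_weak (A J s : R) (f : E -> R) : T_bound leb Om a A -> (0 <= A)%R ->
  measurable_fun setT f -> \int[mu]_x `|f x|%:E = J%:E -> (0 < s)%R ->
  mu [set x | s%:E < `|T_fun leb f OB a x|] <= ((A * J / s) `^ p)%:E.
Proof.
move=> TA A0 mf fJ s0.
have b0 : (0 < b)%R by rewrite subr_gt0.
have p0 : (0 < p)%R by rewrite divr_gt0// ltr0n.
have L1 : L1norm leb f = J%:E by rewrite /L1norm -lebmE.
have J0 : (0 <= J)%R by rewrite -lee_fin -fJ; apply: int_ge0R => x; rewrite normr_ge0.
have := TA f mf; rewrite L1 => /(_ (ltry _)); rewrite -EFinM => wk.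
have {wk} : s%:E * (Leb leb [set x | s%:E < `|T_fun leb f Om a x|]) `^ p^-1 <= (A * J)%:E.
  by apply: le_trans wk; apply: ereal_sup_ubound; exists s.
rewrite -lebmE (_ : [set x | s%:E < `|T_fun leb f Om a x|] = [set x | s%:E < `|T_fun leb f OB a x|]); last first.
  by apply/seteqP; split => x /=; rewrite T_fun_version.
set m := mu _; have m0 : 0 <= m by exact: Leb_ge0.
rewrite -lee_pdivlMl// -EFinM mulrC => h.
have q0 : (0 <= A * J / s)%R by rewrite divr_ge0 ?mulr_ge0// ltW.
rewrite -[m](@poweRe1)// -(@mulVf _ p) ?gt_eqF// poweRrM -poweR_EFin.
apply: gt0_ler_poweR => //; first exact: ltW.
- by rewrite in_itv/= leey poweR_ge0.
- by rewrite in_itv/= leey lee_fin q0.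
Qed.

Section order_zero.
Hypothesis a_eq0 : a = 0%R.
Let bn : b = n%:R. Proof. by rewrite /b a_eq0 subr0. Qed.

Definition sphere_mass : R := fine (\int[mu]_(x in ann leb 0 1) `|Om x|%:E).
Let sphere_massE : \int[mu]_(x in ann leb 0 1) `|Om x|%:E = sphere_mass%:E.
Proof.
rewrite /sphere_mass fineK// ge0_fin_numE; first exact: Om_ball_fin.
by apply: integral_ge0 => x _; rewrite lee_fin.
Qed.
Let sphere_mass_ge0 : (0 <= sphere_mass)%R.
Proof. by rewrite fine_ge0//; apply: integral_ge0 => x _; rewrite lee_fin. Qed.

Let mOBE : measurable_fun [set: E] (OB : E -> R).
Proof. exact: (mO_comp mOB (@measurable_toV _ _ leb)). Qed.

(** On the shell the weight is at most [s ^ - n], and the ball of radius [2 * s] carries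
    [(2 * s) ^ n] times the mass of the unit ball. *)
Lemma Kring_version s : (0 < s)%R -> \int[mu]_(x in ann leb s (2 * s)%R) `|K x|%:E <= (2 ^+ n * sphere_mass)%:E.
Proof.
move=> s0; have s20 : (0 < 2 * s)%R by rewrite mulr_gt0.
have mo := measurable_absE mOBE.
apply: (@le_trans _ _ (\int[mu]_(x in ann leb 0 (2 * s)%R) ((s ^- n)%:E * `|OB x|%:E))).
  apply: (@le_trans _ _ (\int[mu]_(x in ann leb s (2 * s)%R) ((s ^- n)%:E * `|OB x|%:E))).
    apply: ge0_le_integralT.
    - exact: measurable_ann.
    - by apply: measurable_absE; exact: mKE.
    - exact: emeasurable_funM (measurable_cst _) mo.
    - by move=> x; rewrite lee_fin.
    move=> x /andP[x1 _]; rewrite -EFinM lee_fin kernE -/b bn normrM mulrC ler_wpM2r//.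
    rewrite ger0_norm ?powR_ge0// powRN powR_mulrn ?vnorm_ge0//.
    have x0 : (0 < vnorm x)%R by exact: lt_trans x1.
    by rewrite lef_pV2 ?posrE ?exprn_gt0// lerXn2r ?nnegrE ?vnorm_ge0//; exact: ltW.
  apply: ge0_subset_integral.
  - exact: measurable_ann.
  - exact: measurable_ann.
  - exact: measurable_funTS (emeasurable_funM (measurable_cst _) mo).
  - by move=> x _; rewrite mule_ge0// lee_fin invr_ge0 exprn_ge0// ltW.
  - by move=> x /andP[x1 x2]; apply/andP; split => //; exact: lt_trans x1.
rewrite (ge0_integralZl mu (measurable_ann leb _ _) (measurable_funTS mo)); last 2 first.
- by move=> x _; rewrite lee_fin.
- by rewrite lee_fin invr_ge0 exprn_ge0// ltW.
rewrite (@ae_eq_ge0_integral _ _ _ mu _ _ (fun x => `|Om x|%:E) (measurable_ann leb _ _) mo); last 4 first.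
- exact: measurable_absE mOm.
- by move=> x; rewrite lee_fin.
- by move=> x; rewrite lee_fin.
- by have := OB_ae NB0 NBP; apply: filterS => x ->.
have Oh c (x : V) : (0 < c)%R -> `|Om (vscale c x)|%:E = `|Om x|%:E by move=> c0; rewrite (Om_homT Om_hom).
have O0 (x : V) : 0 <= `|Om x|%:E by rewrite lee_fin.
rewrite (hom_int_scale Hleb (measurable_absE mOm) O0 Oh s20) sphere_massE -!EFinM lee_fin.
by rewrite exprMn le_eqVlt; apply/orP; left; apply/eqP; field; rewrite expf_neq0// gt_eqF.
Qed.

Lemma Kmean_version s t : sph_int leb (fun x => (Om x)%:E) = 0 -> (0 < s)%R -> (s <= t)%R ->
  \int[mu]_(x in ann leb s t) (K x)%:E = 0.
Proof.
move=> sph0 s0 st.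
have Om0 : \int[mu]_(x in ann leb 0 1) (Om x)%:E = 0.
  move: sph0; rewrite (@sph_int_hom R n leb (fun x => (Om x)%:E)) => [|c x c0]; last by rewrite (Om_homT Om_hom).
  by move/eqP; rewrite mule_eq0 eqe pnatr_eq0 eqn0Ngt n0/= => /eqP.
rewrite -(kern_ann_mean0 Hleb (Om_homT Om_hom) mOm sphere_massE Om0 s0 st).
have mp : measurable_fun setT (fun x : E => (vnorm x `^ (- n%:R))%R).
  by apply/measurable_EFinP; exact: measurable_vnorm_powR.
apply: ae_eq_integral.
- exact: measurable_ann.
- by apply: measurable_funTS; apply/measurable_EFinP; exact: mKE.
- by apply: measurable_funTS; apply/measurable_EFinP; exact: measurable_funM mOm mp.
by have := OB_ae NB0 NBP; apply: filterS => x h _; rewrite kernE -/b bn h.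
Qed.

(** [kern_diff] gives an angular part, bounded by the Dini tail at [i = 0], and a radial part
    [r / |x|] times [|K|]. Over the shells of radius [2 ^ k * 8 * r] the latter is summed as
    [k0 * 2 ^ - k / 8], in total [k0 / 4]. *)
Lemma Khor_version : exists C : R, forall r h, (0 < r)%R -> (vnorm h <= r)%R ->
  \int[mu]_(x in [set x : E | (8 * r < vnorm x)%R]) `|K (vadd x h) - K x|%:E <= C%:E.
Proof.
pose k0 := (2 ^+ n * sphere_mass)%R.
have k00 : (0 <= k0)%R by rewrite mulr_ge0// exprn_ge0.
exists (2 ^+ n * (far_cst * tail_coef 0) + n%:R * 2 ^+ n * (k0 / 4))%R.
move=> r h r0 hr; set D := [set x : E | _].
have mD : measurable D by exact: measurable_far.
have e8 : (2 ^+ 3 = 8 :> R)%R by rewrite !exprS expr0; ring.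
have DE : D = far (leb := leb) 0 r by rewrite /far e8.
have hf := hfar_version 0 r0 hr; rewrite -DE a_eq0 powRr0 mulr1 in hf.
have mOBh : measurable_fun setT (fun x : E => OB (vadd x h)).
  by apply: (mO_comp mOB); exact: measurable_vadd (@measurable_toV _ _ leb) (measurable_cst _).
have mP := @measurable_vnorm_powR R n leb (- b)%R.
have m1 : measurable_fun setT (fun x : E => `|OB (vadd x h) - OB x|%:E * (vnorm x `^ (- b))%:E).
  exact: emeasurable_funM (measurable_absB mOBh mOBE) mP.
have mKE' : measurable_fun setT (K : E -> R) by exact: mKE.
have mKh : measurable_fun setT (fun x : E => K (vadd x h)).
  exact: (measurableT_comp mKE' (measurable_shift Hleb h)).
have m2 : measurable_fun setT (fun x : E => (r * (vnorm x `^ (-1)) * `|K x|)%:E).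
  apply/measurable_EFinP; apply: measurable_funM (measurable_absR mKE').
  apply: measurable_funM (measurable_cst _) _; apply/measurable_EFinP; exact: measurable_vnorm_powR.
have g1 (x : E) : 0 <= `|OB (vadd x h) - OB x|%:E * (vnorm x `^ (- b))%:E by rewrite mule_ge0// lee_fin powR_ge0.
have g2 (x : E) : 0 <= (r * (vnorm x `^ (-1)) * `|K x|)%:E.
  by rewrite lee_fin !mulr_ge0 ?powR_ge0// ltW.
have far_K : \int[mu]_(x in D) (r * (vnorm x `^ (-1)) * `|K x|)%:E <= (k0 / 4)%:E.
  have r80 : (0 < 8 * r)%R by rewrite mulr_gt0.
  rewrite /D (far_cover leb r80).
  have ma k := measurable_ann leb (2 ^+ k * (8 * r))%R (2 * (2 ^+ k * (8 * r)))%R.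
  rewrite (@ge0_integral_bigcup _ E R mu _ _ ma (measurable_funTS m2) (fun x _ => g2 x) (far_disj r80)).
  have k40 : (0 <= k0 / 4)%R by rewrite divr_ge0.
  have eps0 : \sum_(j <oo) (k0 / 4 / (2 ^ j.+1)%:R)%:E <= (k0 / 4)%:E by exact: epsilon_trick0.
  apply: le_trans eps0; apply: lee_nneseries => k _; first by move=> _; apply: integral_ge0.
  set t := (2 ^+ k * (8 * r))%R; have t0 : (0 < t)%R by rewrite mulr_gt0// exprn_gt0.
  have rt0 : (0 <= r / t)%R by rewrite divr_ge0// ltW.
  have mka := measurable_absE mKE'.
  apply: (@le_trans _ _ (\int[mu]_(x in ann leb t (2 * t)%R) ((r / t)%:E * `|K x|%:E))).
    apply: ge0_le_integralT; [exact: ma|exact: m2|exact: emeasurable_funM (measurable_cst _) mka|exact: g2|].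
    move=> x /andP[x1 _]; have x0 : (0 < vnorm x)%R by exact: lt_trans x1.
    rewrite -EFinM lee_fin ler_wpM2r// powR_inv1 ?vnorm_ge0// ler_wpM2l ?(ltW r0)//.
    by rewrite lef_pV2 ?posrE//; exact: ltW.
  rewrite (ge0_integralZl mu (ma k) (measurable_funTS mka)); [|by move=> x _; rewrite lee_fin|by rewrite lee_fin].
  apply: le_trans (lee_wpmul2l _ (Kring_version t0)) _; first by rewrite lee_fin.
  rewrite -/k0 -EFinM lee_fin le_eqVlt; apply/orP; left; apply/eqP; rewrite /t natrX exprS.
  by field; rewrite expf_neq0// gt_eqF.
apply: (@le_trans _ _ (\int[mu]_(x in D) ((2 ^+ n)%:E * (`|OB (vadd x h) - OB x|%:E * (vnorm x `^ (- b))%:E) +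
   (n%:R * 2 ^+ n)%:E * (r * (vnorm x `^ (-1)) * `|K x|)%:E))).
  apply: ge0_le_integralT.
  - exact: mD.
  - exact: measurable_absB mKh mKE'.
  - exact: emeasurable_funD (emeasurable_funM (measurable_cst _) m1) (emeasurable_funM (measurable_cst _) m2).
  - by move=> x; rewrite lee_fin.
  move=> x; rewrite /D/= => x8; have x0 : (0 < vnorm x)%R by apply: lt_trans x8; rewrite mulr_gt0.
  rewrite -!EFinM -EFinD lee_fin; have hx : (2 * vnorm h <= vnorm x)%R by lra.
  apply: le_trans (kern_diff a0 an OB x0 hx) _; rewrite lerD2l -/b !mulrA ler_wpM2r//.
  rewrite -!mulrA !ler_wpM2l// ?exprn_ge0//.
  by rewrite powR_inv1 ?vnorm_ge0// ler_wpM2r// invr_ge0 vnorm_ge0.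
have c1 : (0 <= 2 ^+ n :> R)%R by rewrite exprn_ge0.
have c2 : (0 <= n%:R * 2 ^+ n :> R)%R by rewrite mulr_ge0.
rewrite (ge0_integralD mu mD); last 4 first.
- by move=> x _; rewrite mule_ge0// lee_fin.
- exact: measurable_funTS (emeasurable_funM (measurable_cst _) m1).
- by move=> x _; rewrite mule_ge0// lee_fin.
- exact: measurable_funTS (emeasurable_funM (measurable_cst _) m2).
rewrite (ge0_integralZl mu mD (measurable_funTS m1)); [|by move=> x _; exact: g1|by rewrite lee_fin].
rewrite (ge0_integralZl mu mD (measurable_funTS m2)); [|by move=> x _; exact: g2|by rewrite lee_fin].
rewrite EFinD; apply: leeD.
  by rewrite (EFinM (2 ^+ n)); apply: lee_wpmul2l; rewrite ?lee_fin.
by rewrite (EFinM _ (k0 / 4)); apply: lee_wpmul2l; rewrite ?lee_fin.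
Qed.
End order_zero.
End instance.

(** * Weak and strong bounds for the kernel *)

Section weak_kernel.
Context {R : realType} {n : nat} (leb : {measure set (n.-tuple R) -> \bar R}).
Hypothesis Hleb : is_lebesgue_borel leb.
Hypothesis n0 : (0 < n)%N.
Local Notation V := (n.-tuple R).
Local Notation E := (Rn leb).
Local Notation mu := (lebm leb).
Variable a : R.
Hypotheses (a0 : 0 <= a) (an : a < n%:R).
Variable Om : V -> R.
Hypothesis Om_hom : forall (s : R) (x : V), 0 < s -> x != vzero -> Om (vscale s x) = Om x.
Hypothesis mOm : measurable_fun [set: E] (Om : E -> R).
Hypothesis Om_dini : L1_Dini leb a Om.
Variables (OB : V -> R) (NB : set V).
Hypothesis mOB : measurable_fun [set: V] OB.
Hypothesis mNB : measurable NB.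
Hypothesis NB0 : mu NB = 0%E.
Hypothesis NBP : forall x, ~ NB x -> Om x = OB x.
Variable A : R.
Hypothesis TA : T_bound leb Om a A.
Hypothesis A0 : 0 <= A.
Local Open Scope ereal_scope.
Let b := (n%:R - a)%R.
Let p := (n%:R / b)%R.
Local Notation K := (kern OB a).
Let b0 : (0 < b)%R. Proof. by rewrite subr_gt0. Qed.
Let p0 : (0 < p)%R. Proof. by rewrite divr_gt0// ltr0n. Qed.
Let p1 : (1 <= p)%R. Proof. by rewrite ler_pdivlMr// mul1r gerBl. Qed.

Lemma far_osc_weak (h : E -> R) r J s i : (0 < r)%R -> measurable_fun setT h ->
  (forall y, (r < vnorm y)%R -> h y = 0%R) -> \int[mu]_y `|h y|%:E = J%:E -> (0 < s)%R ->
  mu [set x | far i r x /\ s%:E < (2 ^+ n)%:E * osc a OB h x] <=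
    (2 ^+ n / s * (@far_cst R n a * r `^ a * tail_coef leb a Om i) * J)%:E.
Proof.
move=> r0 mh hs hJ s0.
have mf : measurable (far i r : set E) by exact: measurable_farE.
have mo : measurable_fun setT (osc a OB h) by exact: measurable_osc.
have og x : 0 <= osc (leb := leb) a OB h x by exact: osc_ge0.
have c0 : (0 <= 2 ^+ n :> R)%R by rewrite exprn_ge0.
pose g := (fun x => (2 ^+ n)%:E * osc a OB h x) \_ (far i r).
have mg : measurable_fun setT g.
  apply/(measurable_restrictT _ mf).1; apply: measurable_funTS.
  exact: emeasurable_funM (measurable_cst _) mo.
have g0 x : 0 <= g x by rewrite /g patchE; case: ifP => // _; rewrite mule_ge0// lee_fin.
apply: (@le_trans _ _ (mu [set x | s%:E < g x])).
  by apply: le_Leb => x [xf xs]; rewrite /= /g patchE mem_set.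
apply: le_trans (markov_lt mg g0 s0) _; rewrite /g -integral_mkcond.
rewrite (ge0_integralZl mu mf (measurable_funTS mo)); [|by move=> x _; exact: og|by rewrite lee_fin].
have H := osc_far Hleb mOB (far_cst_ge0 (n := n) a) (tail_coef_ge0 leb a Om)
  (hfar_version Hleb n0 a0 an Om_hom mOm Om_dini mOB mNB NB0 NBP) i r0 mh hs.
rewrite hJ in H; apply: le_trans (lee_wpmul2l _ (lee_wpmul2l _ H)) _.
- by rewrite lee_fin invr_ge0 ltW.
- by rewrite lee_fin.
by rewrite -!EFinM lee_fin le_eqVlt; apply/orP; left; apply/eqP; ring.
Qed.

Lemma mu_kern_scale (s : R) : (0 < s)%R ->
  mu [set x : E | (s < `|kern Om a x|)%R] = (s `^ (- p))%:E * mu [set x : E | (1 < `|kern Om a x|)%R].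
Proof.
move=> s0; pose c := (s `^ b^-1)%R; have c0 : (0 < c)%R by rewrite powR_gt0.
have cb : (c `^ (- b) = s^-1)%R.
  by rewrite /c -powRrM mulrN mulVf ?gt_eqF// powR_inv1// ltW.
have -> : [set x : E | (s < `|kern Om a x|)%R] = (vscale c : E -> E) @^-1` [set x : E | (1 < `|kern Om a x|)%R].
  apply/seteqP; split => x /=; by rewrite (kern_scale a x (Om_homT Om_hom) c0) -/b cb (normrM (s^-1)%R) (gtr0_norm (x := (s^-1)%R)) ?invr_gt0// ltr_pdivlMl// mulr1.
rewrite (Leb_vscale Hleb); last by rewrite gt_eqF.
congr (_%:E * _); rewrite gtr0_norm// -powR_mulrn ?(ltW c0)// -powRN -powRrM.
by congr (_ `^ _)%R; rewrite /p; field; rewrite gt_eqF.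
Qed.

Let M := mu [set x : E | (1 < `|kern Om a x|)%R].

Lemma mu_K_version (s : R) : mu [set x : E | (s < `|K x|)%R] = mu [set x : E | (s < `|kern Om a x|)%R].
Proof.
have k0 := kern_ae a NB0 NBP.
apply/eqP; rewrite eq_le; apply/andP; split.
  apply: le_trans (le_Leb (B := [set x : E | (s < `|kern Om a x|)%R] `|` [set x : E | kern Om a x <> K x]) _) _.
    by move=> x /= h; have [e|e] := pselect (kern Om a x = K x); [left; rewrite /= e|right].
  by apply: le_trans (LebU _ _) _; rewrite [X in _ + X]k0 adde0.
apply: le_trans (le_Leb (B := [set x : E | (s < `|K x|)%R] `|` [set x : E | kern Om a x <> K x]) _) _.
  by move=> x /= h; have [e|e] := pselect (kern Om a x = K x); [left; rewrite /= -e|right].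
by apply: le_trans (LebU _ _) _; rewrite [X in _ + X]k0 adde0.
Qed.

Lemma powR_le_id (s : R) : (0 <= s)%R -> (s <= 1)%R -> (s `^ p <= s)%R.
Proof.
move=> s0 s1; have [->|s_neq0] := eqVneq s 0%R; first by rewrite powR0 ?gt_eqF.
rewrite -[leRHS]powRr1//; apply: ger_powR => //.
by rewrite s1 lt_neqAle eq_sym s_neq0 s0.
Qed.

Definition brk i : R := (n%:R * 2 ^+ n / 2 ^+ i.+3)%R.
Lemma brk_ge0 i : (0 <= brk i)%R. Proof. by rewrite /brk divr_ge0// ?mulr_ge0// exprn_ge0. Qed.
Lemma brk_small (e : R) : (0 < e)%R -> exists N, forall i, (N <= i)%N -> (brk i <= e)%R.
Proof.
move=> e0; have q0 : (0 <= n%:R * 2 ^+ n / e)%R by rewrite divr_ge0 ?mulr_ge0 ?exprn_ge0// ltW.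
exists (Num.bound (n%:R * 2 ^+ n / e)%R) => i hi; rewrite /brk ler_pdivrMr ?exprn_gt0// [leRHS]mulrC -ler_pdivrMr//.
apply: le_trans (ltW (archi_boundP q0)) _; have h2 : (Num.bound (n%:R * 2 ^+ n / e)%R <= 2 ^ i.+3)%N.
  by apply: leq_trans hi (leq_trans (ltnW (ltn_expl _ _)) (leq_pexp2l _ _)); rewrite //; lia.
by move: h2; rewrite -(ler_nat R) natrX.
Qed.

(** Let [h] be the indicator of the unit ball, of mass [beta]. If [|T h| <= beta * s / 2], the
    oscillation is at most [beta * s / 4] and [brk i <= 1/4], then [|K| <= s / 2 + s / 4 + |K| / 4],
    which excludes [|K| > s]. The weak bound at height [beta * s / 2] yields [(2 * A) ^ p]; the
    oscillation term keeps the factor [s ^ p / s <= 1]. *)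
Lemma kern_mass_step i (s : R) : (0 < s)%R -> (s <= 1)%R -> (brk i <= 4^-1)%R ->
  M <= (s `^ p * fine (mu (vball leb (2 ^+ i.+3)%R)) + (2 * A) `^ p +
        4 * 2 ^+ n * @far_cst R n a * tail_coef leb a Om i)%:E.
Proof.
move=> s0 s1 bi; pose h : E -> R := \1_(vball leb 1).
have be0 : (0 < beta leb)%R by rewrite -lte_fin -(betaE Hleb); exact: Leb_ball_gt0.
have mh : measurable_fun setT h by apply: measurable_indic; exact: measurable_vball.
have hs y : (1 < vnorm y)%R -> h y = 0%R.
  by move=> y1; rewrite /h indicE memNset// /vball/=; apply/negP; rewrite -ltNge.
have Ih : \int[mu]_y (h y)%:E = (beta leb)%:E.
  by rewrite /h (integral_indic mu measurableT (measurable_vball leb 1)) setIT betaE.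
have Iah : \int[mu]_y `|h y|%:E = (beta leb)%:E.
  by rewrite -Ih; apply: eq_integral => y _; rewrite ger0_norm// /h indicE.
have bs2 : (0 < beta leb * s / 2)%R by rewrite divr_gt0// mulr_gt0.
have bs4 : (0 < beta leb * s / 4)%R by rewrite divr_gt0// mulr_gt0.
have W := T_weak Hleb n0 an mOB NB0 NBP TA A0 mh Iah bs2.
have O := far_osc_weak i (@ltr01 R) mh hs Iah bs4.
have sub : [set x : E | (s < `|K x|)%R] `<=` vball leb (2 ^+ i.+3)%R `|`
   ([set x | (beta leb * s / 2)%:E < `|T_fun leb h OB a x|] `|`
    [set x | far i 1 x /\ (beta leb * s / 4)%:E < (2 ^+ n)%:E * osc a OB h x]).
  move=> x /= xs; have [x1|x1] := leP (vnorm x) (2 ^+ i.+3)%R; [by left|right].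
  have xf : far (leb := leb) i 1 x by rewrite /far/= mulr1.
  have fin : \int[mu]_y `|h y|%:E < +oo by rewrite Iah ltry.
  have := bracket (leb := leb) a0 an mOB ltr01 mh hs fin xf; rewrite Ih Iah -/(brk i).
  have [xT|xT] := ltP (beta leb * s / 2)%:E `|T_fun leb h OB a x|; [by left|].
  have [xO|xO] := ltP (beta leb * s / 4)%:E ((2 ^+ n)%:E * osc a OB h x); [by right|].
  move=> br; exfalso.
  have tf : T_fun leb h OB a x \is a fin_num by rewrite fin_num_abs; exact: le_lt_trans xT (ltry _).
  have := le_trans br (leeD xO (lexx _)); move: xT.
  rewrite -(fineK tf) -!EFinM -EFinB -EFinD !abse_EFin !lee_fin => h1 h2.
  have := ler_normB (fine (T_fun leb h OB a x)) (fine (T_fun leb h OB a x) - K x * beta leb)%R.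
  rewrite opprB addrC subrK normrM (gtr0_norm be0) => h3.
  have h4 : (brk i * `|K x| * beta leb <= 4^-1 * (`|K x| * beta leb))%R.
    by rewrite -mulrA ler_wpM2r// mulr_ge0// ltW.
  have h5 : (s * beta leb < `|K x| * beta leb)%R by rewrite ltr_pM2r.
  move: h1 h2 h3 h4 h5; set u := (`|K x| * beta leb)%R; set q := (s * beta leb)%R.
  rewrite (mulrC (beta leb) s) -/q; lra.
have spN : (s `^ p * s `^ (- p) = 1)%R.
  rewrite -powRD ?subrr ?powRr0//; by apply/implyP => _; rewrite gt_eqF.
have -> : M = (s `^ p)%:E * mu [set x : E | (s < `|K x|)%R].
  by rewrite mu_K_version (mu_kern_scale s0) muleA -EFinM spN mul1e.
have bf : mu (vball leb (2 ^+ i.+3)%R) \is a fin_num by rewrite ge0_fin_numE ?Leb_ge0// (Leb_ball_fin Hleb).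
apply: le_trans (lee_wpmul2l _ (le_trans (le_Leb sub) (le_trans (LebU _ _) (leeD (lexx _) (le_trans (LebU _ _) (leeD W O)))))) _.
  by rewrite lee_fin powR_ge0.
rewrite -(fineK bf) -!EFinD -EFinM lee_fin mulrDr -[leRHS]addrA lerD2l mulrDr; apply: lerD.
  rewrite -powRM; [|exact: ltW|by rewrite divr_ge0 ?mulr_ge0// ltW].
  rewrite le_eqVlt; apply/orP; left; apply/eqP; congr (_ `^ _)%R; field.
  by rewrite !gt_eqF.
have fc := far_cst_ge0 (n := n) a; have tc := tail_coef_ge0 leb a Om i.
rewrite powR1 mulr1.
have -> : (s `^ p * (2 ^+ n / (beta leb * s / 4) * (@far_cst R n a * tail_coef leb a Om i) * beta leb) =
   (s `^ p / s) * (4 * 2 ^+ n * @far_cst R n a * tail_coef leb a Om i))%R.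
  by field; rewrite !gt_eqF.
rewrite ler_piMl ?mulr_ge0 ?exprn_ge0// ler_pdivrMr// mul1r.
by apply: powR_le_id => //; exact: ltW.
Qed.

(** The order of the choices matters: [i] first, making the Dini tail small, and then [s], small
    with respect to the measure of the ball of radius [2 ^ (i + 3)]. *)
Lemma kern_mass : M <= ((2 * A) `^ p)%:E.
Proof.
apply/lee_addgt0Pr => /= e e0.
pose c := (4 * 2 ^+ n * @far_cst R n a)%R.
have c0 : (0 <= c)%R by rewrite !mulr_ge0 ?exprn_ge0 ?far_cst_ge0.
have ec : (0 < e / 2 / (c + 1))%R by rewrite !divr_gt0// ltr_wpDl.
have [N1 h1] := dini_tail_small (leb := leb) a0 Om_dini ec.
have q4 : (0 < 4^-1 :> R)%R by rewrite invr_gt0.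
have [N2 h2] := brk_small q4.
pose i := (N1 + N2)%N.
pose m := fine (mu (vball leb (2 ^+ i.+3)%R)).
have m0 : (0 <= m)%R by rewrite fine_ge0// Leb_ge0.
pose s : R := Num.min 1%R (e / 2 / (m + 1))%R.
have m1 : (0 < m + 1)%R by rewrite ltr_wpDl.
have s0 : (0 < s)%R by rewrite lt_min ltr01 !divr_gt0.
have s1 : (s <= 1)%R by rewrite ge_min lexx.
apply: le_trans (kern_mass_step s0 s1 (h2 i (leq_addl _ _))) _.
rewrite -EFinD lee_fin -/m -/c.
have t1 : (s `^ p * m <= e / 2)%R.
  apply: (@le_trans _ _ (s * (m + 1)))%R.
    apply: ler_pM => //; [exact: powR_ge0|by apply: powR_le_id => //; exact: ltW|by rewrite lerDl].
  by rewrite -ler_pdivlMr// ge_min lexx orbT.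
have t2 : (c * tail_coef leb a Om i <= e / 2)%R.
  have := h1 i (leq_addr _ _); rewrite ler_pdivlMr ?ltr_wpDl//; apply: le_trans.
  by rewrite mulrC ler_wpM2l ?tail_coef_ge0// lerDl.
by rewrite [leRHS]addrC; move: t1 t2; set u := (s `^ p * m)%R; set v := (c * _)%R; lra.
Qed.
End weak_kernel.

(** * The two norm bounds on the kernel and on [Om] *)

Section strong_type.
Context {R : realType} {n : nat} (leb : {measure set (n.-tuple R) -> \bar R}).
Hypothesis Hleb : is_lebesgue_borel leb.
Hypothesis n0 : (0 < n)%N.
Local Notation V := (n.-tuple R).
Local Notation E := (Rn leb).
Local Notation mu := (lebm leb).
Variable a : R.
Hypotheses (a0 : 0 <= a) (an : a < n%:R).
Variable Om : V -> R.
Hypothesis Om_hom : forall (s : R) (x : V), 0 < s -> x != vzero -> Om (vscale s x) = Om x.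
Hypothesis mOm : measurable_fun [set: E] (Om : E -> R).
Hypothesis Om_dini : L1_Dini leb a Om.
Local Open Scope ereal_scope.
Let b := (n%:R - a)%R.
Let p := (n%:R / b)%R.
Let b0 : (0 < b)%R. Proof. by rewrite subr_gt0. Qed.
Let p0 : (0 < p)%R. Proof. by rewrite divr_gt0// ltr0n. Qed.
Let p1 : (1 <= p)%R. Proof. by rewrite ler_pdivlMr// mul1r gerBl. Qed.
Let M := mu [set x : E | (1 < `|kern Om a x|)%R].

Lemma borel_null_version : exists OB : V -> R, exists NB : set V,
  [/\ measurable_fun [set: V] OB, measurable NB, mu NB = 0 & forall x, ~ NB x -> Om x = OB x].
Proof.
have [OB mOB h] := borel_version Hleb mOm; have [NB mNB [sub NB0]] := null_hull h.
by exists OB, NB; split => // x xN; apply: contrapT => h'; apply: xN; exact: sub.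
Qed.

Lemma T_bound_ge0 (A : R) : T_bound leb Om a A -> (0 <= A)%R.
Proof.
move=> TA; pose f : E -> R := \1_(vball leb 1).
have mf : measurable_fun setT f by apply: measurable_indic; exact: measurable_vball.
have be0 : (0 < beta leb)%R by rewrite -lte_fin -(betaE Hleb); exact: Leb_ball_gt0.
have If : L1norm leb f = (beta leb)%:E.
  rewrite /L1norm -lebmE -(betaE Hleb) -[vball leb 1]setIT -(integral_indic mu measurableT (measurable_vball leb 1)).
  by apply: eq_integral => y _; rewrite ger0_norm// /f indicE.
have := TA f mf; rewrite If => /(_ (ltry _)) h.
have : 0 <= (A * beta leb)%:E.
  have h0 : 0 <= 1%:E * (Leb leb [set x | 1%:E < `|T_fun leb f Om a x|]) `^ (n%:R / (n%:R - a))^-1.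
    by rewrite mul1e poweR_ge0.
  by rewrite EFinM; apply: le_trans h0 (le_trans _ h); apply: ereal_sup_ubound; exists 1%R => //=; exact: ltr01.
by rewrite lee_fin pmulr_lge0.
Qed.

Section bounds.
Variable A : R.
Hypothesis TA : T_bound leb Om a A.
Let A0 : (0 <= A)%R. Proof. exact: T_bound_ge0. Qed.

Lemma kern_mass_le : M <= ((2 * A) `^ p)%:E.
Proof.
have [OB [NB [mOB mNB NB0 NBP]]] := borel_null_version.
exact: (kern_mass Hleb n0 a0 an Om_hom mOm Om_dini mOB mNB NB0 NBP TA A0).
Qed.

Lemma wknorm_kern : wknorm leb p (fun x => (kern Om a x)%:E) <= (2 * A)%:E.
Proof.
have A2 : (0 <= 2 * A)%R by rewrite mulr_ge0.
apply: ub_ereal_sup => _ [s s0' <-]; have s0 : (0 < s)%R := s0'; rewrite -lebmE.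
have -> : [set x : E | s%:E < `|(kern Om a x)%:E|] = [set x | (s < `|kern Om a x|)%R].
  by apply/seteqP; split => x; rewrite /= lte_fin.
rewrite (mu_kern_scale Hleb an Om_hom s0) -/p -/M -lee_pdivlMl// -EFinM.
have sp : (0 <= s `^ (- p))%R by exact: powR_ge0.
have h : (s `^ (- p))%:E * M <= (s `^ (- p) * (2 * A) `^ p)%:E.
  by rewrite EFinM; apply: lee_wpmul2l; [rewrite lee_fin|exact: kern_mass_le].
apply: (@le_trans _ _ ((s `^ (- p) * (2 * A) `^ p)%:E `^ p^-1)).
  apply: gt0_ler_poweR => //; first by rewrite invr_ge0 ltW.
  - by rewrite in_itv/= leey mule_ge0 ?Leb_ge0.
  - by rewrite in_itv/= leey lee_fin mulr_ge0 ?powR_ge0.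
rewrite poweR_EFin lee_fin powRM ?powR_ge0// -!powRrM mulNr mulfV ?gt_eqF// powR_inv1 ?(ltW s0)//.
by rewrite powRr1.
Qed.

Let F (x : V) : R := (`|Om x| `^ p)%R.
Let F0 x : (0 <= F x)%R. Proof. exact: powR_ge0. Qed.
Let F_scale (s : R) x : (0 < s)%R -> F (vscale s x) = F x.
Proof. by move=> s0; rewrite /F (Om_homT Om_hom). Qed.
Let mF : measurable_fun [set: E] (F : E -> R).
Proof. by apply: (measurableT_comp (measurable_powR p)); apply: measurable_absR. Qed.

Let lev (e : R) k : set E := [set x : E | (e * 2 ^+ k <= F x < e * 2 ^+ k.+1)%R].
Let mlev e k : measurable (lev e k).
Proof.
have -> : lev e k = F @^-1` `[(e * 2 ^+ k)%R, (e * 2 ^+ k.+1)%R[%classic.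
  by apply/seteqP; split => x; rewrite /lev /= in_itv.
by rewrite -[_ @^-1` _]setTI; exact: mF.
Qed.
(** Radius with [rad ^ n] equal to half the lower value of the level: inside this ball [F x]
    strictly exceeds [|x| ^ n], which means [|K x| > 1]. *)
Let rad (e : R) k : R := ((e * 2 ^+ k / 2) `^ n%:R^-1)%R.
Let rad_gt0 (e : R) k : (0 < e)%R -> (0 < rad e k)%R.
Proof. by move=> e0; rewrite powR_gt0// divr_gt0// mulr_gt0// exprn_gt0. Qed.
Let rad_pow (e : R) k : (0 < e)%R -> (rad e k ^+ n = e * 2 ^+ k / 2)%R.
Proof.
move=> e0; rewrite -powR_mulrn ?(ltW (rad_gt0 _ _))// -powRrM mulVf ?powRr1//.
  by rewrite divr_ge0// mulr_ge0 ?exprn_ge0// ltW.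
by rewrite pnatr_eq0 -lt0n.
Qed.

(** The level is a cone, so dilating by [rad] multiplies its mass by [e * 2 ^ k / 2]; the upper
    value [e * 2 ^ (k + 1)] is 4 times that. *)
Let lev_mass (e : R) k : (0 < e)%R ->
  (e * 2 ^+ k.+1)%:E * mu (ann leb 0 1 `&` lev e k) = 4%:E * mu (ann leb 0 (rad e k) `&` lev e k).
Proof.
move=> e0; have r0 := rad_gt0 k e0.
have h : (vscale (rad e k) : E -> E) @^-1` (ann leb 0 (rad e k) `&` lev e k) = ann leb 0 1 `&` lev e k.
  rewrite preimage_setI annE_scale// mul0r divff ?gt_eqF//; congr (_ `&` _).
  by apply/seteqP; split => x; rewrite /lev /= F_scale.
rewrite -h (Leb_vscale Hleb) ?gt_eqF// gtr0_norm// rad_pow// muleA -EFinM; congr (_%:E * _).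
by rewrite exprS; field; rewrite !gt_eqF// exprn_gt0.
Qed.

Let lev_triv (e : R) (S : nat -> set E) : (0 < e)%R -> trivIset setT (fun k => S k `&` lev e k).
Proof.
move=> e0; have lt i j x : lev e i x -> lev e j x -> ~~ (i < j)%N.
  move=> /andP[_ h1] /andP[h2 _]; apply/negP => ij.
  have := le_lt_trans h2 h1; rewrite ltr_pM2l// => /lt_geF; rewrite ler_weXn2l//.
  by rewrite ler1n.
move=> i j _ _ [x [[_ xi] [_ xj]]]; apply/eqP; rewrite eqn_leq leqNgt (lt _ _ _ xj xi) /=.
by rewrite leqNgt (lt _ _ _ xi xj).
Qed.

Let lev_sub (e : R) k : (0 < e)%R -> ann leb 0 (rad e k) `&` lev e k `<=` [set x : E | (1 < `|kern Om a x|)%R].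
Proof.
move=> e0 x [] /andP[x0 xr] /andP[xe _] /=.
have xb : (0 < vnorm x `^ b)%R by rewrite powR_gt0.
rewrite /kern -/b normrM normfV [X in (_ / X)%R]gtr0_norm// ltr_pdivlMr// mul1r.
rewrite ltNge; apply/negP => h.
have h1 : (F x <= vnorm x ^+ n)%R.
  rewrite -powR_mulrn ?(ltW x0)// -[X in (_ `^ X)%R](_ : (b * p = n%:R)%R).
    by rewrite powRrM; apply: ge0_ler_powR; rewrite ?nnegrE ?powR_ge0 ?(ltW p0).
  by rewrite /p mulrC divfK// gt_eqF.
have h2 : (vnorm x ^+ n <= e * 2 ^+ k / 2)%R.
  by rewrite -rad_pow// lerXn2r// ?nnegrE ?ltW// rad_gt0.
have := le_trans xe (le_trans h1 h2).
have : (0 < e * 2 ^+ k)%R by rewrite mulr_gt0 ?exprn_gt0.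
by set u := (e * _)%R; lra.
Qed.

Let lev_exists (e : R) x : (0 < e)%R -> (e <= F x)%R -> exists k, lev e k x.
Proof.
move=> e0 ex; have q0 : (0 <= F x / e)%R by rewrite divr_ge0// ltW.
have hex : exists m, (F x < e * 2 ^+ m)%R.
  exists (Num.bound (F x / e)); rewrite mulrC -ltr_pdivrMr//.
  apply: lt_le_trans (archi_boundP q0) _; rewrite -natrX ler_nat; apply: ltnW; exact: ltn_expl.
have [[|m] hm min] := ex_minnP hex.
  by move: hm; rewrite expr0 mulr1 ltNge ex.
exists m; rewrite /lev /= hm andbT leNgt; apply/negP => /min; by rewrite ltnn.
Qed.

(** The levels start at height [e > 0]; where [F] lies below, it contributes at most [e] times the
    measure of the ball, which is made smaller than any given [d]. *)
Lemma ball_Om_pow : \int[mu]_(x in ann leb 0 1) (F x)%:E <= 4%:E * M.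
Proof.
have mB := measurable_ann leb 0 1.
have Bfin : mu (ann leb 0 1) < +oo.
  by apply: le_lt_trans (Leb_ball_fin Hleb 1); apply: le_Leb => x /andP[].
have m0 : 0 <= mu (ann leb 0 1) by exact: Leb_ge0.
have fB : mu (ann leb 0 1) \is a fin_num by rewrite ge0_fin_numE.
apply/lee_addgt0Pr => /= d d0.
pose e : R := (d / (fine (mu (ann leb 0 1)) + 1))%R.
have fm : (0 <= fine (mu (ann leb 0 1)))%R by exact: fine_ge0.
have e0 : (0 < e)%R by rewrite divr_gt0// ltr_wpDl.
pose c k : R := (e * 2 ^+ k.+1)%R.
have c0 k : (0 <= c k)%R by rewrite /c mulr_ge0 ?exprn_ge0// ltW.
pose g k (x : E) : \bar R := (c k)%:E * (\1_(lev e k) x)%:E.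
have g0 k x : 0 <= g k x by rewrite /g mule_ge0 ?lee_fin// indicE.
have mgT k : measurable_fun setT (g k).
  apply: emeasurable_funM; first exact: measurable_cst.
  by apply/measurable_EFinP; apply: measurable_indic; exact: mlev.
have mg k : measurable_fun (ann leb 0 1) (g k) by exact: measurable_funTS.
have msT : measurable_fun setT (fun x : E => \sum_(k <oo) g k x).
  by apply: ge0_emeasurable_sum => [k x _ _|k _]; [exact: g0|exact: mgT].
have s0 x : 0 <= \sum_(k <oo) g k x by apply: nneseries_ge0 => k _ _; exact: g0.
have bnd x : (F x)%:E <= e%:E + \sum_(k <oo) g k x.
  have [xe|xe] := leP e (F x); last by rewrite -[leLHS]adde0 leeD// lee_fin ltW.
  have [k kx] := lev_exists e0 xe.
  rewrite -[leLHS]add0e leeD ?lee_fin ?(ltW e0)//.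
  apply: (le_trans _ (nneseries_lim_ge k.+1 (fun i _ _ => g0 i x))).
  rewrite big_mkord big_ord_recr /=.
  apply: (@le_trans _ _ (g k x)); last by rewrite leeDr// sume_ge0.
  rewrite /g indicE mem_set// mule1 lee_fin /c; by case/andP: kx => _ /ltW.
have mFE : measurable_fun setT (fun x : E => (F x)%:E) by apply/measurable_EFinP; exact: mF.
have me : measurable_fun setT (fun _ : E => e%:E) by exact: measurable_cst.
apply: (@le_trans _ _ (\int[mu]_(x in ann leb 0 1) (e%:E + \sum_(k <oo) g k x))).
  have mS : measurable_fun setT (fun x : E => e%:E + \sum_(k <oo) g k x) by exact: emeasurable_funD me msT.
  apply: ge0_le_integralT.
  - exact: mB.
  - exact: mFE.
  - exact: mS.
  - by move=> x; rewrite lee_fin.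
  - by move=> x _; exact: bnd.
rewrite (ge0_integralD mu mB _ (measurable_funTS me) _ (measurable_funTS msT)); last 2 first.
- by move=> x _; rewrite lee_fin ltW.
- by move=> x _; exact: s0.
rewrite (integral_cst mu mB) addeC; apply: leeD; last first.
  rewrite -(fineK fB) -EFinM lee_fin /e mulrAC ler_pdivrMr ?ltr_wpDl//.
  by rewrite ler_wpM2l// ?lerDl// ltW.
rewrite (integral_nneseries mu mB mg); last by move=> k x _; exact: g0.
have -> : \sum_(k <oo) \int[mu]_(x in ann leb 0 1) g k x =
    \sum_(k <oo) (4%:E * mu (ann leb 0 (rad e k) `&` lev e k)).
  have mi k : measurable_fun (ann leb 0 1) (fun x : E => (\1_(lev e k) x : R)%:E).
    by apply: measurable_funTS; apply/measurable_EFinP; apply: measurable_indic; exact: mlev.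
  apply: eq_eseriesr => k _; rewrite /g (ge0_integralZl mu mB (mi k)).
  - rewrite (integral_indic mu mB (mlev e k)) setIC; exact: lev_mass.
  - by move=> x _; rewrite lee_fin indicE.
  - by rewrite lee_fin.
rewrite nneseriesZl; last by move=> k _; exact: Leb_ge0.
apply: lee_wpmul2l; first by rewrite lee_fin.
pose S k := ann leb 0 (rad e k) `&` lev e k.
have mS k : measurable (S k) by apply: measurableI; [exact: measurable_ann|exact: mlev].
have tS : trivIset setT S by exact: lev_triv.
rewrite (_ : \sum_(i <oo) _ = mu (\bigcup_k S k)).
  by apply: le_Leb => x [k _ kx]; exact: (lev_sub e0 kx).
by rewrite (measure_semi_bigcup mu mS tS (bigcupT_measurable S mS)).
Qed.

(** The spherical integral is at most [4 * n * (2 * A) ^ p]. Taking the root of order [p] leaves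
    [4 * n] in place of its root, as [4 * n >= 1] and [p >= 1]; this is the origin of [8 * n]. *)
Lemma sph_Om_pow : poweR (sph_int leb (fun x => (`|Om x| `^ p)%:E)) p^-1 <= (8 * n%:R * A)%:E /\
  sph_int leb (fun x => (`|Om x| `^ p)%:E) < +oo.
Proof.
rewrite (@sph_int_hom _ _ leb (fun x => (F x)%:E)); last by move=> s x s0; rewrite F_scale.
have A2 : (0 <= 2 * A)%R by rewrite mulr_ge0.
have h : n%:R%:E * \int[mu]_(x in ann leb 0 1) (F x)%:E <= (4 * n%:R * (2 * A) `^ p)%:E.
  apply: (@le_trans _ _ (n%:R%:E * (4%:E * ((2 * A) `^ p)%:E))).
    apply: lee_wpmul2l; first by rewrite lee_fin.
    apply: le_trans ball_Om_pow _; apply: lee_wpmul2l; [by rewrite lee_fin|exact: kern_mass_le].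
  by rewrite -!EFinM lee_fin le_eqVlt; apply/orP; left; apply/eqP; ring.
have q0 : (0 <= 4 * n%:R * (2 * A) `^ p)%R by rewrite !mulr_ge0 ?powR_ge0.
have i0 : 0 <= n%:R%:E * \int[mu]_(x in ann leb 0 1) (F x)%:E.
  by rewrite mule_ge0 ?lee_fin// integral_ge0// => x _; rewrite lee_fin.
split; last by apply: le_lt_trans h (ltry _).
apply: (@le_trans _ _ ((4 * n%:R * (2 * A) `^ p)%:E `^ p^-1)).
  apply: gt0_ler_poweR => //; first by rewrite invr_ge0 ltW.
  - by rewrite in_itv/= leey andbT.
  - by rewrite in_itv/= leey lee_fin andbT.
rewrite poweR_EFin lee_fin powRM ?powR_ge0 ?mulr_ge0// -powRrM mulfV ?gt_eqF// powRr1//.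
have -> : (8 * n%:R * A = 4 * n%:R * (2 * A))%R by ring.
have n1 : (1 <= 4 * n%:R :> R)%R by rewrite -natrM ler1n muln_gt0 n0.
rewrite ler_wpM2r// -[leRHS]powRr1 ?mulr_ge0//; apply: ler_powR => //.
by rewrite invf_le1.
Qed.
End bounds.

Lemma T_opnorm_le (X : \bar R) (c : R) : (0 < c)%R -> T_opnorm leb Om a < +oo ->
  (forall A, T_bound leb Om a A -> X <= (c * A)%:E) -> X <= c%:E * T_opnorm leb Om a.
Proof.
move=> c0 fin h; rewrite -lee_pdivrMl//; apply: le_ereal_inf_tmp => _ [A TA <-].
by rewrite lee_pdivrMl// -EFinM; exact: h.
Qed.

Lemma T_bound_exists : T_opnorm leb Om a < +oo -> exists A, T_bound leb Om a A.
Proof.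
move=> h; apply: contrapT => h'; move: h; rewrite /T_opnorm.
rewrite (_ : T_bound leb Om a = set0); last by apply/seteqP; split => // A TA; apply: h'; exists A.
by rewrite image_set0 ereal_inf0 ltxx.
Qed.
End strong_type.

(** * Asymptotics of T f *)

(** The integral is by definition the difference of those of the two parts, and an extended
    difference is finite only if both terms are. *)
Lemma finite_integrable d (T : measurableType d) (R : realType) (mu : {measure set T -> \bar R})
    (D : set T) (f : T -> \bar R) : measurable D -> measurable_fun D f ->
  (\int[mu]_(x in D) f x)%E \is a fin_num -> mu.-integrable D f.
Proof.
move=> mD mf; rewrite integralE fin_numB => /andP[fp fn].
apply/integrableP; split => //.
have -> : (\int[mu]_(x in D) `|f x| = \int[mu]_(x in D) (f^\+ x + f^\- x))%E.
  by apply: eq_integral => x _; rewrite -[LHS]/((abse \o f) x) fune_abse.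
rewrite ge0_integralD//; [|exact: measurable_funepos|exact: measurable_funeneg].
by rewrite lte_add_pinfty// -ge0_fin_numE// integral_ge0.
Qed.

Lemma small_mul (R : realType) (c e : R) : 0 <= c -> 0 < e -> exists2 d, 0 < d <= 1 & c * d <= e.
Proof.
move=> c0 e0; have c1 : 0 < c + 1 by rewrite ltr_wpDl.
exists (Num.min 1 (e / (c + 1))); first by rewrite lt_min ltr01 divr_gt0//= ge_min lexx.
apply: (@le_trans _ _ ((c + 1) * Num.min 1 (e / (c + 1)))).
  by rewrite ler_wpM2r ?lerDl// le_min ler01 divr_ge0// ltW.
by rewrite mulrC -ler_pdivlMr// ge_min lexx orbT.
Qed.

Lemma powR_ratio (R : realType) (p s c : R) : 0 < s -> 0 < c -> s `^ p * (s / c) `^ (- p) = c `^ p.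
Proof.
move=> s0 c0; have sc : 0 < s / c by rewrite divr_gt0.
have -> : s `^ p = (s / c) `^ p * c `^ p by rewrite -powRM ?ltW// divfK// gt_eqF.
rewrite mulrAC -powRD ?subrr ?powRr0 ?mul1r//.
by apply/implyP => _; rewrite gt_eqF.
Qed.

Lemma split_contra (R : realFieldType) (s u1 u2 u3 u4 u5 u6 : R) : s < u1 -> u2 <= s / 6 + u6 -> u4 <= s / 3 ->
  u1 <= u2 + u3 -> u3 <= u4 + u5 -> u6 <= s / 6 -> u5 <= s / 3 -> False.
Proof. lra. Qed.

Lemma sum_fifths (R : realFieldType) (e u1 u2 u3 u4 u5 : R) : u1 <= e / 5 -> u2 <= e / 5 -> u3 <= e / 5 ->
  u4 <= e / 5 -> u5 <= e / 5 -> u1 + (u2 + (u3 + (u4 + u5))) <= e.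
Proof. lra. Qed.

Section approximation.
Context {R : realType} {n : nat} (leb : {measure set (n.-tuple R) -> \bar R}).
Hypothesis Hleb : is_lebesgue_borel leb.
Hypothesis n0 : (0 < n)%N.
Local Notation V := (n.-tuple R).
Local Notation E := (Rn leb).
Local Notation mu := (lebm leb).
Variable a : R.
Hypotheses (a0 : 0 <= a) (an : a < n%:R).
Variable Om : V -> R.
Hypothesis Om_hom : forall (s : R) (x : V), 0 < s -> x != vzero -> Om (vscale s x) = Om x.
Hypothesis mOm : measurable_fun [set: E] (Om : E -> R).
Hypothesis Om_dini : L1_Dini leb a Om.
Hypothesis Om_mean : a = 0%R -> sph_int leb (fun x => (Om x)%:E) = 0%E.
Variables (OB : V -> R) (NB : set V).
Hypothesis mOB : measurable_fun [set: V] OB.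
Hypothesis mNB : measurable NB.
Hypothesis NB0 : mu NB = 0%E.
Hypothesis NBP : forall x, ~ NB x -> Om x = OB x.
Variable A : R.
Hypothesis TA : T_bound leb Om a A.
Local Open Scope ereal_scope.
Let b := (n%:R - a)%R.
Let p := (n%:R / b)%R.
Local Notation K := (kern OB a).
Let b0 : (0 < b)%R. Proof. by rewrite subr_gt0. Qed.
Let p0 : (0 < p)%R. Proof. by rewrite divr_gt0// ltr0n. Qed.
Let p1 : (1 <= p)%R. Proof. by rewrite ler_pdivlMr// mul1r gerBl. Qed.
Let A0 : (0 <= A)%R. Proof. by apply: (T_bound_ge0 Hleb) TA. Qed.

Let dom (eps : R) (x : V) : set E := [set y : E | (eps < vnorm (vsub x y))%R].
Let mdom eps x : measurable (dom eps x).
Proof.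
have h := measurable_vnorm (mvsubE (leb := leb) x).
have -> : dom eps x = (fun y : E => vnorm (vsub x y)) @^-1` `]eps, +oo[%classic.
  by apply/seteqP; split => y; rewrite /dom /= in_itv /= andbT.
by rewrite -[_ @^-1` _]setTI; exact: h.
Qed.
Let mker x : measurable_fun setT (fun y : E => K (vsub x y)).
Proof. exact: mKx. Qed.

Lemma Ttr_add (f g : E -> R) eps x : measurable_fun setT f -> measurable_fun setT g ->
  Ttr_fun leb f OB a eps x \is a fin_num -> Ttr_fun leb g OB a eps x \is a fin_num ->
  Ttr_fun leb (fun y => f y + g y)%R OB a eps x = Ttr_fun leb f OB a eps x + Ttr_fun leb g OB a eps x.
Proof.
move=> mf mg; rewrite /Ttr_fun -lebmE => ff fg.
have m h : measurable_fun setT h -> measurable_fun (dom eps x) (fun y : E => (K (vsub x y) * h y)%:E).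
  move=> mh; apply: measurable_funTS; apply/measurable_EFinP; exact: measurable_funM (mker x) mh.
have i1 := finite_integrable (mdom eps x) (m _ mf) ff.
have i2 := finite_integrable (mdom eps x) (m _ mg) fg.
rewrite -(integralD (mdom eps x) i1 i2); apply: eq_integral => y _.
by rewrite -EFinD -mulrDr.
Qed.

(** Asserts a genuine finite value. An equation on [T_fun] would not exclude the unspecified value
    of a [lim] that fails to exist, and would not give additivity. *)
Definition T_at (f : E -> R) (x : V) (l : R) : Prop :=
  if a == 0%R then Ttr_fun leb f OB a eps x @[eps --> (0:R)^'+] --> l%:E
  else Ttr_fun leb f OB a 0 x = l%:E.

Lemma T_atE f x l : T_at f x l -> T_fun leb f OB a x = l%:E.
Proof.
rewrite /T_at /T_fun; case: ifP => // _ h; apply: cvg_lim => //.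
Qed.

Lemma T_at_add (f g : E -> R) x l m : measurable_fun setT f -> measurable_fun setT g ->
  T_at f x l -> T_at g x m -> T_at (fun y => f y + g y)%R x (l + m).
Proof.
move=> mf mg; rewrite /T_at; case: ifP => _ h1 h2; last first.
  by rewrite Ttr_add ?h1 ?h2.
have /fine_cvgP[f1 _] := h1; have /fine_cvgP[f2 _] := h2.
have c : Ttr_fun leb f OB a eps x + Ttr_fun leb g OB a eps x @[eps --> (0:R)^'+] --> (l + m)%:E.
  by rewrite EFinD; apply: cvgeD.
apply: cvg_trans c; apply: near_eq_cvg.
by near=> eps; rewrite Ttr_add//; near: eps.
Unshelve. all: by end_near.
Qed.

(** For positive order the weak bound itself suffices: where the integral is infinite its absolute
    value exceeds every height, so that set is null. For order zero, [p = 1] and [pv_ae] applies. *)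
Lemma T_at_ae (f : E -> R) : measurable_fun setT f -> \int[mu]_x `|f x|%:E < +oo ->
  {ae mu, forall x, exists l, T_at f x l}.
Proof.
move=> mf ff.
have [J J0 hJ] : exists2 J : R, (0 <= J)%R & \int[mu]_x `|f x|%:E = J%:E.
  have i0 : 0 <= \int[mu]_x `|f x|%:E by apply: int_ge0R => x; exact: normr_ge0.
  exists (fine (\int[mu]_x `|f x|%:E)); first exact: fine_ge0.
  by rewrite fineK// ge0_fin_numE.
have W s : (0 < s)%R -> mu [set x | s%:E < `|T_fun leb f OB a x|] <= ((A * J / s) `^ p)%:E.
  by move=> s0; exact: (T_weak Hleb n0 an mOB NB0 NBP TA A0 mf hJ s0).
have [az|az] := eqVneq a 0%R; last first.
  apply/ae_null; apply/eqP; rewrite eq_le Leb_ge0 andbT; apply/lee_addgt0Pr => e e0; rewrite add0e.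
  have q0 : (0 <= A * J)%R by rewrite mulr_ge0.
  have e0' : (0 < Num.min 1 e)%R by rewrite lt_min ltr01.
  have [d /andP[d0 d1] hd] := small_mul q0 e0'.
  have dV : (0 < d^-1)%R by rewrite invr_gt0.
  apply: le_trans (le_trans (le_Leb _) (W _ dV)) _.
    move=> x /= h; rewrite ltNge; apply/negP => h'; apply: h.
    have tf : T_fun leb f OB a x \is a fin_num by rewrite fin_num_abs; exact: le_lt_trans h' (ltry _).
    exists (fine (T_fun leb f OB a x)); rewrite /T_at (negbTE az) fineK//.
    by rewrite /T_fun (negbTE az).
  rewrite invrK lee_fin; apply: (@le_trans _ _ (A * J * d)%R).
    apply: (powR_le_id n0 a0 an); first by rewrite mulr_ge0// ltW.
    by apply: le_trans hd _; rewrite ge_min lexx.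
  by apply: le_trans hd _; rewrite ge_min lexx orbT.
have mK : measurable_fun [set: V] K by apply: mK_comp => //; exact: measurable_id.
have [C hor] := Khor_version Hleb n0 a0 an Om_hom mOm Om_dini mOB mNB NB0 NBP az.
have mean s t : (0 < s)%R -> (s <= t)%R -> \int[mu]_(x in ann leb s t) (K x)%:E = 0.
  move=> s0 st; exact: (Kmean_version Hleb n0 Om_hom mOm Om_dini mOB NB0 NBP az (Om_mean az) s0 st).
have ring := Kring_version Hleb n0 Om_hom mOm Om_dini mOB NB0 NBP az.
have pE : p = 1%R by rewrite /p /b az subr0 divff// pnatr_eq0 -lt0n.
have TTE (g : E -> R) x : TT (leb := leb) K g x = T_fun leb g OB a x.
  by rewrite /TT /T_fun az eqxx /Te /Ttr_fun lebmE.
have weak (g : E -> R) (s : R) : measurable_fun setT g -> \int[mu]_x `|g x|%:E < +oo -> (0 < s)%R ->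
    mu [set x | s%:E < `|TT (leb := leb) K g x|] <= (A / s)%:E * \int[mu]_x `|g x|%:E.
  move=> mg gf s0.
  have i0 : 0 <= \int[mu]_x `|g x|%:E by apply: int_ge0R => x; exact: normr_ge0.
  have hg : \int[mu]_x `|g x|%:E = (fine (\int[mu]_x `|g x|%:E))%:E by rewrite fineK// ge0_fin_numE.
  have j0 : (0 <= fine (\int[mu]_x `|g x|%:E))%R by exact: fine_ge0.
  have := T_weak Hleb n0 an mOB NB0 NBP TA A0 mg hg s0; rewrite -/b -/p pE powRr1; last first.
    by rewrite divr_ge0 ?mulr_ge0// ltW.
  rewrite (_ : [set x | s%:E < `|TT (leb := leb) K g x|] = [set x | s%:E < `|T_fun leb g OB a x|]).
    by rewrite hg -EFinM mulrAC.
  by apply/seteqP; split => x /=; rewrite TTE.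
have := pv_ae Hleb n0 mK ring hor mean A0 weak mf ff.
apply: filterS => x [l hl]; exists l; move: hl; rewrite /T_at.
have -> : (a == 0)%R = true by rewrite az eqxx.
by rewrite /Te /Ttr_fun lebmE.
Qed.

Let M := mu [set x : E | (1 < `|kern Om a x|)%R].
Let mass : exists2 m : R, (0 <= m)%R & M = m%:E.
Proof.
have M0 : 0 <= M by exact: Leb_ge0.
have Mf : M \is a fin_num.
  rewrite ge0_fin_numE//; apply: le_lt_trans (ltry ((2 * A) `^ p)).
  exact: (kern_mass Hleb n0 a0 an Om_hom mOm Om_dini mOB mNB NB0 NBP TA A0).
by exists (fine M); [exact: fine_ge0|rewrite fineK].
Qed.

(** [h] is [f] cut to a ball outside which some grid step [u], within [d] of [f] in L^1, vanishes.
    Off that ball [w = f - u], on it [w = 0], so [w] has mass at most [d]. *)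
Lemma localize (f : E -> R) (J : R) : measurable_fun setT f -> \int[mu]_x `|f x|%:E = J%:E ->
  forall d : R, (0 < d)%R -> exists (h w : E -> R) (r I1 I2 J1 J2 : R),
  [/\ measurable_fun setT h, measurable_fun setT w, forall y, f y = (h y + w y)%R,
      (0 < r)%R /\ (forall y, (r < vnorm y)%R -> h y = 0%R) &
  [/\ \int[mu]_x `|h x|%:E = J1%:E /\ (0 <= J1 <= J)%R, \int[mu]_x `|w x|%:E = J2%:E /\ (0 <= J2 <= d)%R,
      \int[mu]_x (h x)%:E = I1%:E, \int[mu]_x (f x)%:E = (I1 + I2)%:E & (`|I2| <= d)%R]].
Proof.
move=> mf hJ d d0; have ff : \int[mu]_x `|f x|%:E < +oo by rewrite hJ ltry.
have [_ /(_ d d0)[u [k [B [r0 [[mu' _ us] _]]]] fu]] := apx_L1 Hleb mf ff.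
pose r : R := Num.max 1%R r0; have r1 : (0 < r)%R by rewrite lt_max ltr01.
have mB := measurable_vball leb r.
pose h (y : E) : R := (\1_(vball leb r) y * f y)%R; pose w (y : E) : R := (f y - h y)%R.
have mh : measurable_fun setT h by apply: measurable_funM => //; exact: measurable_indic.
have mw : measurable_fun setT w by exact: measurable_funB.
have hle y : (`|h y| <= `|f y|)%R.
  by rewrite /h indicE; case: (_ \in _); rewrite ?mul1r// mul0r normr0.
have wle y : (`|w y| <= `|f y - u y|)%R.
  rewrite /w /h indicE; case: (boolP (y \in vball leb r)) => [_|].
    by rewrite mul1r subrr normr0.
  rewrite notin_setE => yB; rewrite us ?mul0r//.
  by apply: le_lt_trans (_ : r < _)%R; [rewrite le_max lexx orbT|rewrite ltNge; apply/negP].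
have fin (g : E -> R) (c : R) : \int[mu]_x `|g x|%:E <= c%:E ->
    exists J', \int[mu]_x `|g x|%:E = J'%:E /\ (0 <= J' <= c)%R.
  move=> gc; have i0 : 0 <= \int[mu]_x `|g x|%:E by apply: int_ge0R => x; exact: normr_ge0.
  exists (fine (\int[mu]_x `|g x|%:E)).
  have e : \int[mu]_x `|g x|%:E = (fine (\int[mu]_x `|g x|%:E))%:E.
    by rewrite fineK// ge0_fin_numE// (le_lt_trans gc (ltry _)).
  by split => //; rewrite fine_ge0//= -lee_fin -e.
have [J1 [hJ1 J1b]] : exists J1, \int[mu]_x `|h x|%:E = J1%:E /\ (0 <= J1 <= J)%R.
  apply: fin; rewrite -hJ.
  apply: int_leR.
  - exact: measurable_absR mh.
  - exact: measurable_absR mf.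
  - by move=> x; exact: normr_ge0.
  - exact: hle.
have [J2 [hJ2 J2b]] : exists J2, \int[mu]_x `|w x|%:E = J2%:E /\ (0 <= J2 <= d)%R.
  apply: fin; apply: le_trans fu; have mfu : measurable_fun setT (fun x => f x - u x)%R by exact: measurable_funB.
  apply: int_leR.
  - exact: measurable_absR mw.
  - exact: measurable_absR mfu.
  - by move=> x; exact: normr_ge0.
  - exact: wle.
have ih : mu.-integrable setT (EFin \o h) by apply: integrableR => //; rewrite hJ1 ltry.
have iw : mu.-integrable setT (EFin \o w) by apply: integrableR => //; rewrite hJ2 ltry.
have hf y : f y = (h y + w y)%R by rewrite /w addrC subrK.
exists h, w, r, (fine (\int[mu]_x (h x)%:E)), (fine (\int[mu]_x (w x)%:E)), J1, J2.
have fh : \int[mu]_x (h x)%:E \is a fin_num by exact: (integrable_fin_num measurableT ih).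
have fw : \int[mu]_x (w x)%:E \is a fin_num by exact: (integrable_fin_num measurableT iw).
split => //; first split => //.
  move=> y ry; rewrite /h indicE memNset ?mul0r// /vball/=; apply/negP; by rewrite -ltNge.
split => //.
- by rewrite fineK.
- rewrite EFinD !fineK// -(integralD measurableT ih iw).
  by apply: eq_integral => y _; rewrite /= -EFinD -hf.
have /andP[_ J2d] := J2b.
apply: le_trans J2d; rewrite -lee_fin -hJ2.
apply: le_trans (abs_intR mu mw); by rewrite -abse_EFin fineK.
Qed.

Lemma mu_K_scale (m s c : R) : M = m%:E -> (0 < s)%R -> (0 < c)%R ->
  mu [set x : E | (s / c < `|K x|)%R] = ((s / c) `^ (- p) * m)%:E.
Proof.
move=> hm s0 c0; have sc : (0 < s / c)%R by rewrite divr_gt0.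
rewrite (mu_K_version a NB0 NBP) (mu_kern_scale Hleb an Om_hom sc) -/b -/p.
by rewrite -[X in _ * X]/M hm.
Qed.

(** The height [s] is distributed as [s / 6] to the oscillation, [s / 6] to the radial error of
    [bracket], [s / 3] to [T w] and [s / 3] to [K] times the integral of [w]. Each of the five
    exceptional sets, the ball included, then costs at most [eta / 5] after multiplication by
    [s ^ p]. *)
Lemma T_asymptotics (f : E -> R) (J I : R) : measurable_fun setT f -> \int[mu]_x `|f x|%:E = J%:E ->
  \int[mu]_x (f x)%:E = I%:E -> forall eta : R, (0 < eta)%R -> exists2 s0 : R, (0 < s0)%R &
  forall s : R, (0 < s)%R -> (s <= s0)%R ->
  (s `^ p)%:E * mu [set x | s%:E < `|T_fun leb f OB a x - (K x * I)%:E|] <= eta%:E.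
Proof.
move=> mf hJ hI eta eta0; have [m m0 hm] := mass.
have J0 : (0 <= J)%R by rewrite -lee_fin -hJ; apply: int_ge0R => x; exact: normr_ge0.
(* With [e <= 1] and [p >= 1], a quantity below [e] stays below [e] when raised to the power [p]. *)
pose e : R := Num.min 1%R (eta / 5)%R.
have e0 : (0 < e)%R by rewrite lt_min ltr01 divr_gt0.
have e1 : (e <= 1)%R by rewrite ge_min lexx.
have e5 : (e <= eta / 5)%R by rewrite ge_min lexx orbT.
have m1 : (0 < m + 1)%R by rewrite ltr_wpDl.
have A1 : (0 < A + 1)%R by rewrite ltr_wpDl.
have c1 : (0 <= 3 * (A + 1) * (m + 1))%R by rewrite !mulr_ge0// ltW.
(* One choice of [d] serves both terms in [w]: [3 * A * J2] from the weak bound and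
   [3 * d * (m + 1)] from the level set of [K]. *)
have [d /andP[d0 d1] hd] := small_mul c1 e0.
have [h [w [r [I1 [I2 [J1 [J2 [mh mw fE [r0 hs] [[hJ1 /andP[J10 J1J]] [hJ2 /andP[J20 J2d]] hI1 hI2 I2d]]]]]]]]] := localize mf hJ d0.
have IE : I = (I1 + I2)%R by apply: EFin_inj; rewrite -hI hI2.
have c2 : (0 <= 6 * (J + 1) * (m + 1))%R by rewrite !mulr_ge0 ?addr_ge0.
have [d' /andP[d'0 _] hd'] := small_mul c2 e0.
have [N1 hN1] := brk_small n0 a0 an A0 d'0.
have c3 : (0 <= 6 * 2 ^+ n * @far_cst R n a * r `^ a * J)%R.
  by rewrite !mulr_ge0 ?exprn_ge0 ?far_cst_ge0 ?powR_ge0.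
have [t /andP[t0 _] ht] := small_mul c3 e0.
have [N2 hN2] := dini_tail_small (leb := leb) a0 Om_dini t0.
pose i := (N1 + N2)%N.
have Bf : mu (vball leb (2 ^+ i.+3 * r)%R) \is a fin_num by rewrite ge0_fin_numE ?Leb_ge0// (Leb_ball_fin Hleb).
pose mB := fine (mu (vball leb (2 ^+ i.+3 * r)%R)).
have mB0 : (0 <= mB)%R by rewrite fine_ge0// Leb_ge0.
have [s0 /andP[s00 s01] hs0] := small_mul mB0 e0.
exists s0 => // s s_gt0 s_le.
have s1 : (s <= 1)%R by exact: le_trans s01.
have sp := powR_ge0 s p.
have sps : (s `^ p <= s)%R by apply: (powR_le_id n0 a0 an) => //; exact: ltW.
(* If [|K| <= s / q], the radial error [brk i * |K| * J1] is at most [s / 6], because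
   [brk i <= d']. *)
pose q : R := (6 * (d' * (J + 1)))%R.
have J1' : (0 < J + 1)%R by rewrite ltr_wpDl.
have q0 : (0 < q)%R by rewrite mulr_gt0// mulr_gt0.
have s3 : (0 < s / 3)%R by rewrite divr_gt0.
have s6 : (0 < s / 6)%R by rewrite divr_gt0.
have d3 : (0 < 3 * d)%R by rewrite mulr_gt0.
have W := T_weak Hleb n0 an mOB NB0 NBP TA A0 mw hJ2 s3.
have O := far_osc_weak Hleb n0 a0 an Om_hom mOm Om_dini mOB mNB NB0 NBP i r0 mh hs hJ1 s6.
have Kq := mu_K_scale hm s_gt0 q0.
have Kd := mu_K_scale hm s_gt0 d3.
have gh : {ae mu, forall x, exists l, T_at h x l} by apply: T_at_ae => //; rewrite hJ1 ltry.
have gw : {ae mu, forall x, exists l, T_at w x l} by apply: T_at_ae => //; rewrite hJ2 ltry.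
pose Z := [set x : E | ~ (exists l, T_at h x l)] `|` [set x : E | ~ (exists l, T_at w x l)].
have Z0 : mu Z <= 0.
  by apply: le_trans (LebU _ _) _; rewrite (ae_null _).2// (ae_null _).2// adde0.
have sub : [set x | s%:E < `|T_fun leb f OB a x - (K x * I)%:E|] `<=`
   vball leb (2 ^+ i.+3 * r)%R `|`
   ([set x | far i r x /\ (s / 6)%:E < (2 ^+ n)%:E * osc a OB h x] `|`
   ([set x | (s / 3)%:E < `|T_fun leb w OB a x|] `|`
   ([set x : E | (s / q < `|K x|)%R] `|` ([set x : E | (s / (3 * d) < `|K x|)%R] `|` Z)))).
  move=> x /= hx; have [xB|xB] := leP (vnorm x) (2 ^+ i.+3 * r)%R; [by left|right].
  have xf : far (leb := leb) i r x by [].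
  have [xO|xO] := ltP (s / 6)%:E ((2 ^+ n)%:E * osc a OB h x); [by left|right].
  have [xT|xT] := ltP (s / 3)%:E `|T_fun leb w OB a x|; [by left|right].
  have [xq|xq] := ltP (s / q)%R `|K x|%R; [by left|right].
  have [xd|xd] := ltP (s / (3 * d))%R `|K x|%R; [by left|right].
  apply: contrapT => xZ.
  have [l1 L1] : exists l, T_at h x l by apply: contrapT => ?; apply: xZ; left.
  have [l2 L2] : exists l, T_at w x l by apply: contrapT => ?; apply: xZ; right.
  have L := T_at_add mh mw L1 L2.
  have fE' : (fun y => h y + w y)%R = f by apply/funext => y; rewrite fE.
  rewrite fE' in L.
  have hfin : \int[mu]_y `|h y|%:E < +oo by rewrite hJ1 ltry.
  have br := bracket (leb := leb) a0 an mOB r0 mh hs hfin xf.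
  rewrite hJ1 hI1 -/(@brk R n i) in br.
  have {br xO} := le_trans br (leeD xO (lexx _)); move: xT hx.
  rewrite (T_atE L) (T_atE L1) (T_atE L2) -!EFinM -!EFinB -EFinD !abse_EFin !(lee_fin, lte_fin) => xT hx br.
  move: xq xd; rewrite !ler_pdivlMr// => xq xd.
  have k0 := normr_ge0 (K x).
  have b1 : (@brk R n i * `|K x| * J1 <= s / 6)%R.
    rewrite ler_pdivlMr//; apply: le_trans xq; rewrite /q.
    have -> : (@brk R n i * `|K x| * J1 * 6 = `|K x| * (6 * (@brk R n i * J1)))%R by ring.
    rewrite ler_wpM2l// ler_wpM2l//; apply: ler_pM => //.
    - exact: brk_ge0.
    - by apply: hN1; exact: leq_addr.
    - by apply: le_trans J1J _; rewrite lerDl.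
  have b2 : (`|K x * I2| <= s / 3)%R.
    rewrite normrM ler_pdivlMr//; apply: le_trans xd.
    by rewrite -mulrA ler_wpM2l// mulrC ler_wpM2l.
  have e' : (l1 + l2 - K x * I = (l1 - K x * I1) + (l2 - K x * I2))%R by rewrite IE; ring.
  have := ler_normD (l1 - K x * I1)%R (l2 - K x * I2)%R; rewrite -e' => t1.
  have t2 := ler_normB l2 (K x * I2)%R.
  exact: (split_contra hx br xT t1 t2 b1 b2).
pose cO := (2 ^+ n / (s / 6) * (@far_cst R n a * r `^ a * tail_coef leb a Om i) * J1)%R.
pose cW := ((A * J2 / (s / 3)) `^ p)%R.
have tot : mu [set x | s%:E < `|T_fun leb f OB a x - (K x * I)%:E|] <=
   (mB + (cO + (cW + ((s / q) `^ (- p) * m + ((s / (3 * d)) `^ (- p) * m + 0)))))%:E.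
  rewrite !EFinD -/mB (fineK Bf).
  apply: le_trans (le_Leb sub) _; apply: le_trans (LebU _ _) _; apply: leeD => //.
  apply: le_trans (LebU _ _) _; apply: leeD; first exact: O.
  apply: le_trans (LebU _ _) _; apply: leeD; first exact: W.
  apply: le_trans (LebU _ _) _; apply: leeD; first by rewrite Kq.
  by apply: le_trans (LebU _ _) _; apply: leeD => //; rewrite Kd.
apply: le_trans (lee_wpmul2l _ tot) _; first by rewrite lee_fin.
rewrite -EFinM lee_fin addr0 !mulrDr [X in (_ + (_ + (_ + (X + _))))%R]mulrA [X in (_ + (_ + (_ + (_ + X))))%R]mulrA !(powR_ratio p s_gt0)//.
have p_1 : (s `^ p * mB <= eta / 5)%R.
  apply: le_trans e5; apply: le_trans hs0; rewrite mulrC ler_wpM2l//.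
  exact: le_trans sps s_le.
have p_2 : (s `^ p * cO <= eta / 5)%R.
  apply: le_trans e5; apply: le_trans ht; rewrite /cO.
  have -> : (s `^ p * (2 ^+ n / (s / 6) * (@far_cst R n a * r `^ a * tail_coef leb a Om i) * J1) =
     (s `^ p / s) * (6 * 2 ^+ n * @far_cst R n a * r `^ a * J1 * tail_coef leb a Om i))%R.
    by field; rewrite gt_eqF.
  have tc := tail_coef_ge0 leb a Om i; have fc := far_cst_ge0 (n := n) a; have ra := powR_ge0 r a.
  have cc : (0 <= 6 * 2 ^+ n * @far_cst R n a * r `^ a)%R by rewrite !mulr_ge0 ?exprn_ge0.
  apply: (@le_trans _ _ (6 * 2 ^+ n * @far_cst R n a * r `^ a * J1 * tail_coef leb a Om i))%R.
    rewrite ler_piMl ?(mulr_ge0 (mulr_ge0 cc J10))// ler_pdivrMr// mul1r//.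
  apply: ler_pM => //; [exact: mulr_ge0|by rewrite ler_wpM2l|by apply: hN2; exact: leq_addl].
have p_3 : (s `^ p * cW <= eta / 5)%R.
  have hc : (0 <= A * J2 / (s / 3))%R by exact: divr_ge0 (mulr_ge0 A0 J20) (ltW s3).
  rewrite /cW -(powRM p (ltW s_gt0) hc).
  have -> : (s * (A * J2 / (s / 3)) = 3 * A * J2)%R by field; rewrite gt_eqF.
  have le : (3 * A * J2 <= e)%R.
    apply: le_trans hd; apply: ler_pM => //; first by rewrite mulr_ge0.
    by rewrite -[leLHS]mulr1; apply: ler_pM; rewrite ?mulr_ge0 ?ler_wpM2l ?lerDl ?lerDr.
  apply: le_trans (le_trans le e5); apply: (powR_le_id n0 a0 an).
    by rewrite !mulr_ge0.
  exact: le_trans le e1.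
have p_4 : (q `^ p * m <= eta / 5)%R.
  have le : (q * (m + 1) <= e)%R.
    by apply: le_trans hd'; rewrite /q le_eqVlt; apply/orP; left; apply/eqP; ring.
  apply: le_trans (le_trans le e5); apply: ler_pM => //; [exact: powR_ge0| |by rewrite lerDl].
  apply: (powR_le_id n0 a0 an); first exact: ltW.
  apply: le_trans e1; apply: le_trans le; rewrite ler_pMr//; by rewrite lerDr.
have p_5 : ((3 * d) `^ p * m <= eta / 5)%R.
  have le : (3 * d * (m + 1) <= e)%R.
    apply: le_trans hd; rewrite (_ : 3 * (A + 1) * (m + 1) * d = (A + 1) * (3 * d * (m + 1)))%R; last by ring.
    by apply: ler_peMl; [rewrite mulr_ge0 ?(ltW d3) ?(ltW m1)|rewrite lerDr].
  apply: le_trans (le_trans le e5); apply: ler_pM => //; [exact: powR_ge0| |by rewrite lerDl].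
  apply: (powR_le_id n0 a0 an); first exact: ltW.
  apply: le_trans e1; apply: le_trans le; rewrite ler_pMr//; by rewrite lerDr.
exact: sum_fifths p_1 p_2 p_3 p_4 p_5.
Qed.
End approximation.

(** * Dilations *)

Section radon_nikodym_density.
Context d (T : measurableType d) (R : realType) (mu : {measure set T -> \bar R}).
Hypothesis sf : sigma_finite setT mu.

(* A copy of [mu], as a key for its sigma-finite structure. *)
Definition sf_copy (_ : sigma_finite setT mu) (A : set T) : \bar R := mu A.
Local Notation mu' := (sf_copy sf).
HB.instance Definition _ := isMeasure.Build d T R mu' (measure0 mu) (measure_ge0 mu)
  (@measure_semi_sigma_additive _ _ _ mu).
HB.instance Definition _ := @Measure_isSigmaFinite.Build d T R mu' sf.

Lemma density_of_dominated (V : {finite_measure set T -> \bar R}) : V `<< mu ->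
  exists f : T -> R, [/\ measurable_fun setT f, forall x, 0 <= f x,
    (\int[mu]_x (f x)%:E)%E = V setT &
    forall (D : set T) (g : T -> \bar R), measurable D -> measurable_fun D g -> (forall x, (0 <= g x)%E) ->
      (\int[V]_(x in D) g x = \int[mu]_(x in D) (g x * (f x)%:E))%E].
Proof.
move=> VV.
have VV' : V `<< mu' by [].
pose h := Radon_Nikodym_SigmaFinite.f V mu'.
have h0 := Radon_Nikodym_SigmaFinite.f_ge0 VV'.
have hf := Radon_Nikodym_SigmaFinite.f_fin_num VV'.
have hi := Radon_Nikodym_SigmaFinite.f_integrable VV'.
have hI := Radon_Nikodym_SigmaFinite.f_integral VV' measurableT.
have hE x : (fine (h x))%:E = h x by rewrite fineK// hf.
exists (fine \o h); split.
- by apply: measurableT_comp => //; exact: measurable_int hi.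
- by move=> x; rewrite /= fine_ge0// h0.
- by rewrite hI; apply: eq_integral => x _; rewrite hE.
- move=> D g mD mg g0.
  rewrite -(Radon_Nikodym_SigmaFinite.change_of_variables VV' g0 mD mg).
  by apply: eq_integral => x _; rewrite /= hE.
Qed.
End radon_nikodym_density.

Lemma cvge0_small (R : realType) (T : Type) (F : set_system T) (FF : Filter F) (g : T -> \bar R) :
  (forall x, 0 <= g x)%E -> (forall e : R, 0 < e -> \forall x \near F, (g x <= e%:E)%E) -> g x @[x --> F] --> 0%E.
Proof.
move=> g0 h.
have fg e x : (g x <= e%:E)%E -> g x \is a fin_num.
  by move=> ge; rewrite ge0_fin_numE// (le_lt_trans ge (ltry _)).
apply/fine_cvgP; split; first by apply: filterS (h 1 ltr01) => x; exact: fg.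
apply/cvgrPdist_le => e e0; apply: filterS (h e e0) => x gx.
by rewrite sub0r normrN ger0_norm ?fine_ge0//= -lee_fin fineK// (fg _ _ gx).
Qed.

Lemma cvg_at_right_scale (R : realType) (t : R) : 0 < t -> (e / t) @[e --> 0^'+] --> (0 : R)^'+.
Proof.
move=> t0 P [d /= d0 hP]; exists (d * t); rewrite /= ?mulr_gt0// => e /= he e0; apply: hP.
  move: he; rewrite /= !sub0r !normrN normrM normfV (gtr0_norm t0) => he.
  by rewrite ltr_pdivrMr.
by rewrite divr_gt0.
Qed.

Section dilation.
Context {R : realType} {n : nat} (leb : {measure set (n.-tuple R) -> \bar R}).
Hypothesis Hleb : is_lebesgue_borel leb.
Hypothesis n0 : (0 < n)%N.
Local Notation V := (n.-tuple R).
Local Notation E := (Rn leb).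
Local Notation mu := (lebm leb).
Variable a : R.
Hypotheses (a0 : 0 <= a) (an : a < n%:R).
Variable Om : V -> R.
Hypothesis Om_hom : forall (s : R) (x : V), 0 < s -> x != vzero -> Om (vscale s x) = Om x.
Hypothesis mOm : measurable_fun [set: E] (Om : E -> R).
Local Open Scope ereal_scope.
Let b := (n%:R - a)%R.
Let p := (n%:R / b)%R.
Let b0 : (0 < b)%R. Proof. by rewrite subr_gt0. Qed.
Let p0 : (0 < p)%R. Proof. by rewrite divr_gt0// ltr0n. Qed.
Variable W : {finite_measure set E -> \bar R}.
Variable f : E -> R.
Hypotheses (mf : measurable_fun setT f) (f0 : forall x, (0 <= f x)%R).
Hypothesis Wf : forall (D : set E) (g : E -> \bar R), measurable D -> measurable_fun D g -> (forall x, 0 <= g x) ->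
  \int[W]_(x in D) g x = \int[mu]_(x in D) (g x * (f x)%:E).

Let mkern : measurable_fun [set: E] (fun x : E => kern Om a x).
Proof.
have mp : measurable_fun setT (fun x : E => (vnorm x `^ (- b))%R).
  by apply/measurable_EFinP; exact: measurable_vnorm_powR.
have -> : (fun x : E => kern Om a x) = (fun x => Om x * vnorm x `^ (- b))%R.
  by apply/funext => x; rewrite kernE.
exact: measurable_funM mOm mp.
Qed.
Let mkernx x : measurable_fun [set: E] (fun y : E => kern Om a (vsub x y)).
Proof. exact: (measurableT_comp mkern (measurable_reflect Hleb x)). Qed.
Let dom (eps : R) (x : V) : set E := [set y : E | (eps < vnorm (vsub x y))%R].
Let mdom eps x : measurable (dom eps x).
Proof.
have h := measurable_vnorm (mvsubE (leb := leb) x).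
have -> : dom eps x = (fun y : E => vnorm (vsub x y)) @^-1` `]eps, +oo[%classic.
  by apply/seteqP; split => y; rewrite /dom /= in_itv /= andbT.
by rewrite -[_ @^-1` _]setTI; exact: h.
Qed.

(** Pushing forward by the dilation scales the truncation radius, and homogeneity of the kernel
    gives [t ^ - b]. The density formula is stated for nonnegative integrands, so the two parts of
    the kernel are transported separately. *)
Lemma Ttr_meas_dil (t e : R) z : (0 < t)%R -> Ttr_fun leb f Om a e z \is a fin_num ->
  Ttr_meas leb (dil leb W t) Om a (t * e) (vscale t z) = (t `^ (- b))%:E * Ttr_fun leb f Om a e z.
Proof.
move=> t0; rewrite /Ttr_fun -lebmE -/(dom e z) => fin.
have mt : measurable_fun [set: E] (vscale t : E -> E) by apply: (measurable_vscale_E Hleb); rewrite gt_eqF.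
pose u (y : E) : \bar R := (kern Om a (vsub z y) * f y)%:E.
have mu' : measurable_fun setT u by apply/measurable_EFinP; exact: measurable_funM (mkernx z) mf.
have iu : mu.-integrable (dom e z) u.
  exact: (finite_integrable (mdom e z) (measurable_funTS mu') fin).
rewrite -(integralZl (mdom e z) iu).
have pre : (vscale t : E -> E) @^-1` dom (t * e) (vscale t z) = dom e z.
  apply/seteqP; split => y; rewrite /dom /= -vscaleBr vnorm_scale gtr0_norm//.
    by rewrite ltr_pM2l.
  by rewrite ltr_pM2l.
pose g (y : E) : \bar R := (kern Om a (vsub (vscale t z) y))%:E.
have mg : measurable_fun setT g by apply/measurable_EFinP; exact: mkernx.
have key (h : E -> \bar R) : measurable_fun setT h -> (forall y, 0 <= h y) ->
    \int[dil leb W t]_(y in dom (t * e) (vscale t z)) h y = \int[mu]_(y in dom e z) (h (vscale t y) * (f y)%:E).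
  move=> mh h0; rewrite /dil ge0_integral_pushforward//; last exact: measurable_funTS.
  rewrite pre.
  exact: (Wf (mdom e z) (measurable_funTS (measurableT_comp mh mt)) (fun y => h0 (vscale t y))).
have gs y : g (vscale t y) * (f y)%:E = (t `^ (- b))%:E * u y.
  rewrite /g /u -vscaleBr (kern_scale a _ (Om_homT Om_hom) t0) -/b -!EFinM.
  by congr EFin; ring.
have -> : Ttr_meas leb (dil leb W t) Om a (t * e) (vscale t z) =
    \int[dil leb W t]_(y in dom (t * e) (vscale t z)) (g^\+ y) -
    \int[dil leb W t]_(y in dom (t * e) (vscale t z)) (g^\- y) by exact: integralE.
rewrite (key _ (measurable_funepos mg) (fun y => funepos_ge0 g y))
  (key _ (measurable_funeneg mg) (fun y => funeneg_ge0 g y)) [RHS]integralE.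
have fE y : 0 <= (f y)%:E by rewrite lee_fin.
congr (_ - _); apply: eq_integral => y _.
  rewrite !funeposE -gs /g -[0]/(0%:E) -EFinM -!EFin_max -EFinM.
  by rewrite maxr_pMl// mul0r.
rewrite !funenegE -gs /g -[0]/(0%:E) -EFinM -!EFinN -!EFin_max -EFinM.
by rewrite maxr_pMl// mul0r mulNr.
Qed.

(** Truncation of the dilated measure at [eps] corresponds to truncation of [f] at [eps / t], and
    [eps / t] tends to 0 from the right along with [eps]. *)
Lemma T_meas_dil (t l : R) z : (0 < t)%R ->
  (if a == 0%R then Ttr_fun leb f Om a eps z @[eps --> (0:R)^'+] --> l%:E
   else Ttr_fun leb f Om a 0 z = l%:E) ->
  T_meas leb (dil leb W t) Om a (vscale t z) = (t `^ (- b) * l)%:E.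
Proof.
move=> t0; rewrite /T_meas; case: ifP => _ h; last first.
  by have := Ttr_meas_dil (e := 0%R) (z := z) t0; rewrite mulr0 h => ->.
apply: cvg_lim => //; rewrite EFinM.
have h' : (t `^ (- b))%:E * Ttr_fun leb f Om a (eps / t) z @[eps --> (0:R)^'+] --> (t `^ (- b))%:E * l%:E.
  by apply: cvgeZl => //; exact: (cvg_comp _ _ (cvg_at_right_scale t0) h).
apply: cvg_trans h'; apply: near_eq_cvg.
have /fine_cvgP[fin _] := h.
have fin' : \forall e \near (0:R)^'+, Ttr_fun leb f Om a (e / t) z \is a fin_num := cvg_at_right_scale t0 fin.
near=> e.
have fe : Ttr_fun leb f Om a (e / t) z \is a fin_num by near: e; exact: fin'.
by rewrite -Ttr_meas_dil// mulrC divfK// gt_eqF.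
Unshelve. all: by end_near.
Qed.

End dilation.

(** * Dilated measures: the limit in measure *)

Section conclusion.
Context {R : realType} {n : nat} (leb : {measure set (n.-tuple R) -> \bar R}).
Hypothesis Hleb : is_lebesgue_borel leb.
Hypothesis n0 : (0 < n)%N.
Local Notation V := (n.-tuple R).
Local Notation E := (Rn leb).
Local Notation mu := (lebm leb).
Variable a : R.
Hypotheses (a0 : 0 <= a) (an : a < n%:R).
Variable Om : V -> R.
Hypothesis Om_hom : forall (s : R) (x : V), 0 < s -> x != vzero -> Om (vscale s x) = Om x.
Hypothesis mOm : measurable_fun [set: E] (Om : E -> R).
Hypothesis Om_dini : L1_Dini leb a Om.
Hypothesis Om_mean : a = 0%R -> sph_int leb (fun x => (Om x)%:E) = 0%E.
Variable A : R.
Hypothesis TA : T_bound leb Om a A.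
Local Open Scope ereal_scope.
Let b := (n%:R - a)%R.
Let p := (n%:R / b)%R.
Let b0 : (0 < b)%R. Proof. by rewrite subr_gt0. Qed.

Lemma T_meas_dil_cvg (W : {finite_measure set E -> \bar R}) (lam : R) : W `<< mu -> (0 < lam)%R ->
  mu [set x : E | lam%:E < `|T_meas leb (dil leb W t) Om a x - (kern Om a x)%:E * W setT|] @[t --> 0^'+] --> 0.
Proof.
move=> WW lam0.
have [f [mf f0 fI fW]] := density_of_dominated (Leb_sigma_finite Hleb) WW.
have [OB [NB [mOB mNB NB0 NBP]]] := borel_null_version Hleb mOm.
have Wfin : W setT \is a fin_num by exact: fin_num_measure.
pose I := fine (W setT); have IE : \int[mu]_x (f x)%:E = I%:E by rewrite fI /I fineK.
have JE : \int[mu]_x `|f x|%:E = I%:E by rewrite -IE; apply: eq_integral => x _; rewrite ger0_norm.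
apply: cvge0_small => [t|eta eta0]; first exact: Leb_ge0.
have lp : (0 < lam `^ p)%R by rewrite powR_gt0.
have e0 : (0 < lam `^ p * eta)%R by rewrite mulr_gt0.
have [s0 s00 hs] := T_asymptotics Hleb n0 a0 an Om_hom mOm Om_dini Om_mean mOB mNB NB0 NBP TA mf JE IE e0.
(* The value of [t] at which [lam * t ^ b] equals [s0]. *)
pose t0 : R := ((s0 / lam) `^ b^-1)%R.
have t00 : (0 < t0)%R by rewrite powR_gt0// divr_gt0.
near=> t.
have t_gt0 : (0 < t)%R by near: t; exact: nbhs_right_gt.
have t_le : (t <= t0)%R by near: t; exact: nbhs_right_le.
pose s : R := (lam * t `^ b)%R.
have tb : (0 < t `^ b)%R by rewrite powR_gt0.
have s_gt0 : (0 < s)%R by rewrite mulr_gt0.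
have s_le : (s <= s0)%R.
  rewrite /s mulrC -ler_pdivlMr//.
  have -> : (s0 / lam = t0 `^ b)%R.
    by rewrite /t0 -powRrM mulVf ?gt_eqF// powRr1// divr_ge0 ?(ltW s00) ?(ltW lam0).
  by apply: ge0_ler_powR; rewrite ?nnegrE ?(ltW b0) ?(ltW t_gt0) ?(ltW t00).
have tn : (s `^ p = lam `^ p * t ^+ n)%R.
  have bp : (b * p = n%:R)%R by rewrite /p mulrC divfK// gt_eqF.
  by rewrite /s (powRM p (ltW lam0) (ltW tb)) -powRrM bp powR_mulrn// ltW.
set S := [set x : E | _].
have fae := T_at_ae Hleb n0 a0 an Om_hom mOm Om_dini Om_mean mOB mNB NB0 NBP TA mf.
have {}fae : {ae mu, forall x, exists l, T_at a OB f x l} by apply: fae; rewrite JE ltry.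
(* Points without a genuine value of [T f], or where the kernels of [Om] and [OB] differ: a null set
   that does not depend on [t]. *)
pose Z := [set x : E | ~ (exists l, T_at a OB f x l)] `|` [set x : E | kern Om a x <> kern OB a x].
have Z0 : mu Z <= 0.
  apply: le_trans (LebU _ _) _; rewrite (ae_null _).2// add0e.
  by have := kern_ae a NB0 NBP => /= k0; rewrite [X in X <= _]k0.
have sub : (vscale t : E -> E) @^-1` S `<=` [set x | s%:E < `|T_fun leb f OB a x - (kern OB a x * I)%:E|] `|` Z.
  move=> z zS; apply: contrapT => h.
  have [l hl] : exists l, T_at a OB f z l by apply: contrapT => ?; apply: h; right; left.
  have kE : kern Om a z = kern OB a z by apply: contrapT => ?; apply: h; right; right.
  apply: h; left; rewrite /= (T_atE hl).
  have hl' : if a == 0%R then Ttr_fun leb f Om a eps z @[eps --> (0:R)^'+] --> l%:E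
             else Ttr_fun leb f Om a 0 z = l%:E.
    move: hl; rewrite /T_at; case: ifP => _; last by rewrite (Ttr_fun_version Hleb a mOB NB0 NBP _ _ mf).
    suff -> : (fun eps => Ttr_fun leb f Om a eps z) = (fun eps => Ttr_fun leb f OB a eps z) by [].
    by apply/funext => eps; rewrite (Ttr_fun_version Hleb a mOB NB0 NBP _ _ mf).
  have := T_meas_dil Hleb Om_hom mOm mf f0 fW t_gt0 hl'.
  move: zS; rewrite /S /= => + Tz; rewrite Tz (kern_scale a z (Om_homT Om_hom) t_gt0) -/b kE.
  rewrite -(fineK Wfin) -/I -EFinM -!EFinB !abse_EFin !lte_fin.
  rewrite -mulrA -mulrBr normrM (gtr0_norm (powR_gt0 _ t_gt0)) powRN.
  by rewrite ltr_pdivlMl// mulrC.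
have S_scale : (s `^ p)%:E * mu ((vscale t : E -> E) @^-1` S) <= (lam `^ p * eta)%:E.
  apply: le_trans (hs s s_gt0 s_le); apply: lee_wpmul2l; first by rewrite lee_fin powR_ge0.
  apply: le_trans (le_Leb sub) _; apply: le_trans (LebU _ _) _.
  by rewrite -[leRHS]adde0; apply: leeD.
have tn0 : (0 < t ^+ n)%R by rewrite exprn_gt0.
have t_neq : t != 0%R by rewrite gt_eqF.
have e1 : (s `^ p * (`|t| ^+ n)^-1 = lam `^ p)%R by rewrite (gtr0_norm t_gt0) tn mulfK// gt_eqF.
rewrite (Leb_vscale Hleb S t_neq) muleA -EFinM e1 EFinM in S_scale.
by move: S_scale; rewrite lee_pmul2l.
Unshelve. all: by end_near.
Qed.
End conclusion.

Theorem theorem1p8 (R : realType) (n : nat) (alpha : R) :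
  (1 <= n)%N -> 0 <= alpha -> alpha < n%:R ->
  exists C : R,
  forall leb : {measure set (n.-tuple R) -> \bar R}, is_lebesgue_borel leb ->
  forall V : {finite_measure set (Rn leb) -> \bar R}, V `<< Leb leb ->
  forall Om : n.-tuple R -> R,
    (forall (s : R) (x : n.-tuple R), 0 < s -> x != vzero ->
       Om (vscale s x) = Om x) ->
    measurable_fun [set: Rn leb] (Om : Rn leb -> R) ->
    L1_Dini leb alpha Om ->
    (alpha = 0 -> sph_int leb (fun x => (Om x)%:E) = 0%E) ->
    (T_opnorm leb Om alpha < +oo)%E ->
    let p := n%:R / (n%:R - alpha) in
    [/\ (wknorm leb p (fun x => (kern Om alpha x)%:E) < +oo)%E /\
        (wknorm leb p (fun x => (kern Om alpha x)%:E)
           <= C%:E * T_opnorm leb Om alpha)%E,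
        (sph_int leb (fun x => (`|Om x| `^ p)%:E) < +oo)%E /\
        (poweR (sph_int leb (fun x => (`|Om x| `^ p)%:E)) p^-1
           <= C%:E * T_opnorm leb Om alpha)%E &
        forall lambda : R, 0 < lambda ->
          (fun t : R => Leb leb [set x : Rn leb |
             (lambda%:E < `| T_meas leb (dil leb V t) Om alpha x
                             - (kern Om alpha x)%:E * V setT |)%E])
          @ 0^'+ --> 0%E].
Proof.
(* The constant is dictated by the bound on the sphere; the weak bound for the kernel holds with
   2. *)
move=> n0 a0 an; exists (8 * n%:R) => leb Hleb V VV Om Om_hom mOm Om_dini Om_mean Tfin p.
have n1 : (1 <= n%:R :> R) by rewrite ler1n.
have [A TA] := T_bound_exists Tfin.
have c0 : (0 < 8 * n%:R :> R) by rewrite mulr_gt0// ltr0n.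
split; [split|split|].
- exact: le_lt_trans (wknorm_kern Hleb n0 a0 an Om_hom mOm Om_dini TA) (ltry _).
- apply: (T_opnorm_le c0 Tfin) => B TB.
  apply: le_trans (wknorm_kern Hleb n0 a0 an Om_hom mOm Om_dini TB) _.
  have B0 : 0 <= B by exact: (T_bound_ge0 Hleb TB).
  by rewrite lee_fin ler_wpM2r//; move: n1; lra.
- exact: (sph_Om_pow Hleb n0 a0 an Om_hom mOm Om_dini TA).2.
- apply: (T_opnorm_le c0 Tfin) => B TB.
  exact: (sph_Om_pow Hleb n0 a0 an Om_hom mOm Om_dini TB).1.
move=> lam lam0; rewrite -lebmE in VV *.
exact: (T_meas_dil_cvg Hleb n0 a0 an Om_hom mOm Om_dini Om_mean TA VV lam0).
Qed.
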